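(* Let $\omega_1,\ldots,\omega_r$ be quadratic irrational real numbers and let $\alpha_1,\ldots,\alpha_r$ be distinct algebraic numbers with $0<|\alpha_1|,\ldots,|\alpha_r|<1$. Then $\mathfrak f_{\omega_1}(\alpha_1),\ldots,\mathfrak f_{\omega_r}(\alpha_r)$ are algebraically dependent over $\overline{\mathbb Q}$ if and only if $1,\mathfrak f_{\omega_1}(\alpha_1),\ldots,\mathfrak f_{\omega_r}(\alpha_r)$ are linearly dependent over $\overline{\mathbb Q}$.
   Context: For a real number $\omega$, the Hecke–Mahler series is $\mathfrak f_\omega(z)=\sum_{n=0}^{\infty}\lfloor n\omega\rfloor z^n$. $\overline{\mathbb Q}$ denotes the field of algebraic numbers. *)

(* Defs.v *)
From mathcomp Require Import all_boot all_order all_algebra.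
(* The notations of [mpoly] clash with those of the analysis library. *)
From mathcomp Require Import -(notations) mpoly.
From mathcomp Require Import all_classical all_reals all_analysis.
From mathcomp Require Import complex.

Set Implicit Arguments.
Unset Strict Implicit.
Unset Printing Implicit Defensive.

Import Order.TTheory GRing.Theory Num.Theory.
Import numFieldNormedType.Exports.

Local Open Scope classical_set_scope.
Local Open Scope ring_scope.
Local Open Scope complex_scope.

Definition Qbar (R : realType) : {pred R[i]} :=
  [pred z : R[i] | `[< algebraicOver (ratr : rat -> R[i]) z >]].

Definition quadratic_irrational (R : realType) (w : R) : Prop :=
  irrational w /\
  exists2 p : {poly rat}, size p = 3%N & root (map_poly (ratr : rat -> R) p) w.

(* [R[i]^o] is [R[i]] with the topology of the modulus.  [lim] is total: the
   value is the sum of the series only where the series converges, in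
   particular for `|z| < 1. *)
Definition hecke_mahler (R : realType) (w : R) (z : R[i]) : R[i] :=
  lim (series (fun n : nat =>
    ((Num.floor (n%:R * w))%:~R * z ^+ n : R[i]^o)) @ \oo).

Definition Qbar_algebraically_dependent (R : realType) (r : nat)
    (v : 'I_r -> R[i]) : Prop :=
  exists P : mpoly.mpoly r R[i],
    [/\ P \is a mpoly.mpolyOver r (@Qbar R), P != 0 & mpoly.meval v P = 0].

Definition Qbar_linearly_dependent (R : realType) (I : finType)
    (v : I -> R[i]) : Prop :=
  exists c : I -> R[i],
    [/\ forall i, c i \in @Qbar R, exists i, c i != 0
      & \sum_i c i * v i = 0].

(* Main.v *)
From HB Require Import structures.
Require Import Defs.
From mathcomp Require Import all_boot all_order all_algebra.
From mathcomp Require Import -(notations) mpoly.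
From mathcomp Require Import all_classical all_reals all_analysis.
From mathcomp Require Import complex.
From mathcomp Require Import archimedean cyclic perm separable.
From mathcomp Require Import ring lra zify.

(** Normalise each [omega] to [(a - sqrt D) / c] in [(0, 1)] and write
    [alpha i = zeta i * \prod_j beta j ^ c i j] with the [beta j] multiplicatively
    independent.  A unit [x + z * sqrt D] acts on the lattice points below the line
    of slope [omega], and the generating series of these points changes under it by
    a rational function.  Hence, moving all the quadratic fields by units of
    comparable sizes (times in a strip), the series [F k = \sum y1 ^ n * y2 ^ g] at
    the orbit point [z k] differs from the number studied, [F 0], by an algebraic
    number [A k], while [F k] is tiny.

    An algebraic relation between the [F_i 0] yields, by Siegel's lemma and the
    Liouville inequality, a polynomial in [z k] and [A k] that vanishes for all
    large times.  A polynomial in [z k] alone that vanishes on a strip is zero: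
    embed the number field into a p-adic field, where the units are analytic in the
    time, and differentiate.  Comparing a minimal relation with its translates
    makes it linear in the [A_i], and comparing the resulting power series with
    their transforms under a unit shows that a linear combination of the [F_i 0]
    is algebraic. *)

Set Implicit Arguments.
Unset Strict Implicit.
Unset Printing Implicit Defensive.

Import Order.TTheory GRing.Theory Num.Theory.
Import numFieldNormedType.Exports.

Local Open Scope ring_scope.

(** * The auxiliary polynomial *)

(** The obstacle is that several quadratic fields occur at once. Their units have incommensurable
    logarithms, so no sequence of common powers moves all the series at the same rate, and iterating
    a single transformation does not suffice. The time is therefore a vector with one entry per
    field. On a strip all exponents at the orbit point agree up to a constant factor, so that
    smallness and height are both measured by the single number [min_exp]. A strip is not stable
    under translation, hence the repeated halving of its width. The exponents of the [beta j] at the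
    orbit point are themselves exponential in the time, so vanishing is not a question about linear
    recurrences. p-adically both the powers of the units and the [beta j] raised to them can be
    differentiated, and a shortest relation is contradicted by its derivative. A linear relation
    between the [A_i] holds only along the orbit. Read on power series it says that a quotient of
    two series is invariant under a substitution that expands exponents, and such a quotient is
    constant. *)

Lemma mpoly_ring_ind n (A : nzRingType) (P : mpoly n A -> Prop) :
  (forall c, P (mpolyC n c)) -> (forall i, P (mpolyX A (mnm1 i))) ->
  (forall p q, P p -> P q -> P (p + q)) -> (forall p q, P p -> P q -> P (p * q)) ->
  forall p, P p.
Proof.
move=> PC PX PD PM p.
have PXm mu : P (mpolyX A mu).
  rewrite mpolyXE_id; apply: (big_ind P) => // [|j _]; first by rewrite -mpolyC1.
  elim: (mu j) => [|d IH]; last by rewrite exprS; exact: PM.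
  by rewrite expr0 -mpolyC1.
rewrite (mpolyE p); apply: (big_ind P) => //; first by rewrite -(mpolyC0 n).
by move=> mu _; rewrite -mul_mpolyC; exact: PM.
Qed.

Lemma meval_rmorph m (S T : comNzRingType) (f : {rmorphism S -> T}) (v : 'I_m -> S) p :
  f (meval v p) = meval (fun i => f (v i)) (map_mpoly f p).
Proof.
elim/mpoly_ring_ind: p => [c|i|p q IHp IHq|p q IHp IHq].
- by rewrite map_mpolyC !mevalC.
- by rewrite map_mpolyX !mevalXU.
- by rewrite mevalD rmorphD IHp IHq rmorphD mevalD.
- by rewrite mevalM rmorphM IHp IHq rmorphM mevalM.
Qed.

Lemma meval_mmap m k (S : comNzRingType) (h : 'I_m -> mpoly k S) (v : 'I_k -> S) p :
  meval v (mmap (@mpolyC k S) h p) = meval (fun i => meval v (h i)) p.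
Proof.
elim/mpoly_ring_ind: p => [c|i|p q IHp IHq|p q IHp IHq].
- by rewrite mmapC !mevalC.
- by rewrite mmapX mmap1U mevalXU.
- by rewrite rmorphD /= !mevalD IHp IHq.
- by rewrite rmorphM /= !mevalM IHp IHq.
Qed.

Lemma meval0_mcoeff m (S : comNzRingType) (p : mpoly m S) : meval (fun=> 0) p = mcoeff mnm0 p.
Proof.
rewrite [in RHS](mpolyE p) mevalE raddf_sum /=; apply: eq_bigr => mu _.
rewrite mcoeffZ mcoeffX; congr (_ * _); have [->|ne] := eqVneq mu mnm0.
  by rewrite big1 // => i _; rewrite mnm0E expr0.
have /existsP[i hi] : [exists i, mu i != 0%N].
  apply: contraNT ne; rewrite negb_exists => /forallP h.
  by apply/eqP/mnmP => i; move: (h i); rewrite negbK mnm0E => /eqP.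
by rewrite (bigD1 i) //= expr0n (negbTE hi) mul0r.
Qed.

(** * Absolute values and bounds for the values of polynomials *)

Section AbsoluteValue.
Context (C : fieldType) (R : realType) (nrm : C -> R).
Definition absval := [/\ forall x, 0 <= nrm x, nrm 0 = 0, nrm 1 = 1,
  (forall x y, nrm (x * y) = nrm x * nrm y) & forall x y, nrm (x + y) <= nrm x + nrm y].
Hypothesis av : absval.

Lemma av_ge0 x : 0 <= nrm x. Proof. by case: av. Qed.
Lemma av0 : nrm 0 = 0. Proof. by case: av. Qed.
Lemma av1 : nrm 1 = 1. Proof. by case: av. Qed.
Lemma avM x y : nrm (x * y) = nrm x * nrm y. Proof. by case: av. Qed.
Lemma avD x y : nrm (x + y) <= nrm x + nrm y. Proof. by case: av. Qed.
Lemma avX x n : nrm (x ^+ n) = nrm x ^+ n.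
Proof. by elim: n => [|n IH]; rewrite ?expr0 ?av1 // !exprS avM IH. Qed.
Lemma avN x : nrm (- x) = nrm x.
Proof.
suff h : nrm (-1) = 1 by rewrite -mulN1r avM h mul1r.
apply/eqP; rewrite -(@eqrXn2 _ 2) ?av_ge0 ?ler01 //.
by rewrite -avX sqrrN expr1n av1 expr1n.
Qed.
Lemma avB x y : nrm (x - y) <= nrm x + nrm y.
Proof. by rewrite -(avN y); exact: avD. Qed.
Lemma avBC x y : nrm (x - y) = nrm (y - x).
Proof. by rewrite -avN opprB. Qed.
Lemma av_eq0 x : (nrm x == 0) = (x == 0).
Proof.
apply/idP/eqP => [|->]; last by rewrite av0.
have [//|x0 h] := eqVneq x 0.
by have := av1; rewrite -(mulfV x0) avM (eqP h) mul0r => /esym/eqP; rewrite oner_eq0.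
Qed.
Lemma av_gt0 x : x != 0 -> 0 < nrm x.
Proof. by move=> x0; rewrite lt_def av_ge0 av_eq0 x0. Qed.
Lemma av_sum (I : Type) (s : seq I) (Q : pred I) (F : I -> C) :
  nrm (\sum_(i <- s | Q i) F i) <= \sum_(i <- s | Q i) nrm (F i).
Proof.
elim/big_rec2: _ => [|i y x _ h]; first by rewrite av0.
by apply: le_trans (avD _ _) _; rewrite lerD2l.
Qed.
Lemma av_prod (I : Type) (s : seq I) (Q : pred I) (F : I -> C) :
  nrm (\prod_(i <- s | Q i) F i) = \prod_(i <- s | Q i) nrm (F i).
Proof. by elim/big_rec2: _ => [|i y x _ <-]; rewrite ?av1 ?avM. Qed.

Definition L1 n (p : mpoly n C) := \sum_(mu <- msupp p) nrm (mcoeff mu p).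

Lemma L1_ge0 n (p : mpoly n C) : 0 <= L1 p.
Proof. by apply: sumr_ge0 => mu _; exact: av_ge0. Qed.

Lemma meval_small n (p : mpoly n C) (v : 'I_n -> C) t M :
  0 <= t <= 1 -> (forall i, nrm (v i) <= t) ->
  (forall mu : multinom n, (mdeg mu < M)%N -> mcoeff mu p = 0) ->
  nrm (meval v p) <= L1 p * t ^+ M.
Proof.
move=> /andP[t0 t1] hv hM; rewrite mevalE; apply: le_trans (av_sum _ _ _) _.
rewrite /L1 mulr_suml !big_seq; apply: ler_sum => mu hmu.
rewrite avM ler_wpM2l ?av_ge0 // av_prod.
apply: (@le_trans _ _ (\prod_(i < n) t ^+ mu i)).
  apply: ler_prod => i _; rewrite av_ge0 avX lerXn2r ?nnegrE ?av_ge0 ?hv //=.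
rewrite prodrXr -mdegE; apply: ler_wiXn2l => //.
by rewrite leqNgt; apply/negP => /hM /eqP; rewrite mcoeff_eq0 hmu.
Qed.

Lemma meval_bounded n (p : mpoly n C) (v : 'I_n -> C) (B : R) :
  1 <= B -> (forall i, nrm (v i) <= B) -> nrm (meval v p) <= L1 p * B ^+ msize p.
Proof.
move=> B1 hv; rewrite mevalE; apply: le_trans (av_sum _ _ _) _.
have B0 : 0 <= B by apply: le_trans B1.
rewrite /L1 mulr_suml !big_seq; apply: ler_sum => mu hmu.
rewrite avM ler_wpM2l ?av_ge0 // av_prod.
apply: (@le_trans _ _ (\prod_(i < n) B ^+ mu i)).
  apply: ler_prod => i _; rewrite av_ge0 avX lerXn2r ?nnegrE ?av_ge0 ?hv //=.
rewrite prodrXr -mdegE; apply: ler_weXn2l => //.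
by apply: ltnW; exact: msize_mdeg_lt.
Qed.

Lemma meval_lipschitz n (p : mpoly n C) (B : R) : 1 <= B -> exists2 c : R, 0 <= c &
  forall (v w : 'I_n -> C) e, (forall i, nrm (v i) <= B) -> (forall i, nrm (w i) <= B) ->
    (forall i, nrm (v i - w i) <= e) -> 0 <= e -> nrm (meval v p - meval w p) <= c * e.
Proof.
move=> B1; pose S p := exists2 c : R, 0 <= c &
  forall (v w : 'I_n -> C) e, (forall i, nrm (v i) <= B) -> (forall i, nrm (w i) <= B) ->
    (forall i, nrm (v i - w i) <= e) -> 0 <= e -> nrm (meval v p - meval w p) <= c * e.
have B0 : 0 <= B by apply: le_trans B1.
have SD p1 p2 : S p1 -> S p2 -> S (p1 + p2).
  move=> [c1 c10 h1] [c2 c20 h2]; exists (c1 + c2); first exact: addr_ge0.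
  move=> v w e hv hw hvw e0; rewrite !mevalD opprD addrACA mulrDl.
  by apply: le_trans (avD _ _) _; apply: lerD; [exact: h1|exact: h2].
have SM p1 p2 : S p1 -> S p2 -> S (p1 * p2).
  move=> [c1 c10 h1] [c2 c20 h2].
  exists (c1 * (L1 p2 * B ^+ msize p2) + L1 p1 * B ^+ msize p1 * c2).
    by rewrite addr_ge0 // !mulr_ge0 ?L1_ge0 ?exprn_ge0.
  move=> v w e hv hw hvw e0; rewrite !mevalM.
  have -> : meval v p1 * meval v p2 - meval w p1 * meval w p2 =
    (meval v p1 - meval w p1) * meval v p2 + meval w p1 * (meval v p2 - meval w p2) by ring.
  apply: le_trans (avD _ _) _; rewrite !avM mulrDl; apply: lerD.
    rewrite mulrAC; apply: ler_pM; rewrite ?av_ge0 ?h1 ?meval_bounded //.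
  rewrite -[X in _ <= X]mulrA; apply: ler_pM; rewrite ?av_ge0 ?h2 ?meval_bounded //.
have SC c : S (mpolyC n c).
  by exists 0 => // v w e _ _ _ _; rewrite !mevalC subrr av0 mul0r.
have SU j : S (mpolyX C (mnm1 j)).
  by exists 1 => // v w e _ _ h _; rewrite !mevalXU mul1r.
have SX mu : S (mpolyX C mu).
  rewrite mpolyXE_id; apply: (big_ind S) => // [|j _]; first by rewrite -mpolyC1; exact: SC.
  elim: (mu j) => [|d IH]; last by rewrite exprS; apply: SM.
  by rewrite expr0 -mpolyC1; exact: SC.
rewrite -/(S p) (mpolyE p); apply: (big_ind S) => //.
  by rewrite -(mpolyC0 n); exact: SC.
by move=> mu _; rewrite -mul_mpolyC; exact: SM.
Qed.
End AbsoluteValue.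

(** The form of Siegel's lemma needed here: the auxiliary polynomial is fixed before the time tends
    to infinity, so the size of its coefficients does not matter and a dimension count is enough. *)
Lemma exists_kernel_vector (K : fieldType) (T1 T2 : finType) (a : T1 -> T2 -> K) :
  (#|T2| < #|T1|)%N -> exists2 v : T1 -> K, (exists t, v t != 0) &
    forall s, \sum_t v t * a t s = 0.
Proof.
move=> h; pose A : 'M[K]_(#|T1|, #|T2|) := \matrix_(i, j) a (enum_val i) (enum_val j).
have : kermx A != 0.
  rewrite -mxrank_eq0 mxrank_ker -lt0n subn_gt0.
  exact: leq_ltn_trans (rank_leq_col A) h.
case/rowV0Pn => u /sub_kermxP uA u0.
exists (fun t => u ord0 (enum_rank t)).
  apply/existsP; apply: contraNT u0; rewrite negb_exists => /forallP u0.
  by apply/eqP/rowP => j; rewrite mxE; move: (u0 (enum_val j)); rewrite negbK enum_valK => /eqP.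
move=> s; have := congr1 (fun M : 'rV_ _ => M ord0 (enum_rank s)) uA; rewrite !mxE => uAs.
apply: etrans uAs.
rewrite (reindex (@enum_val _ T1)) /=; last by exists enum_rank => x _; rewrite ?enum_valK ?enum_rankK.
by apply: eq_bigr => i _; rewrite enum_valK mxE enum_rankK.
Qed.

(** A polynomial with nonzero constant term is invertible as a power series over the fraction field,
    so dividing by it does not lower the order of vanishing. By induction on the degree, all terms
    of the coefficient at [e] of the product vanish except the one with the constant term of [p]. *)
Lemma low_coeff_factor n (D : idomainType) (p q : mpoly n D) M : mcoeff mnm0 p != 0 ->
  (forall e : multinom n, (mdeg e < M)%N -> mcoeff e (p * q) = 0) ->
  forall e : multinom n, (mdeg e < M)%N -> mcoeff e q = 0.
Proof.
move=> p0 hpq e; have [d] := ubnP (mdeg e); elim: d e => // d IH e; rewrite ltnS => hd he.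
have := hpq e he; rewrite mcoeffM.
rewrite (bigD1 (BMultinom (bm0_proof n (mdeg e)), BMultinom (ltnSn (mdeg e)))) /=; last first.
  by rewrite /= add0m.
rewrite big1 => [|[a b] /= /andP[/eqP ab ne]]; last first.
  suff -> : mcoeff b q = 0 by rewrite mulr0.
  have db : (mdeg b < mdeg e)%N.
    have dd : mdeg e = (mdeg a + mdeg b)%N by rewrite {1}ab mdegD.
    suff : mdeg a != 0%N by move: dd; lia.
    rewrite mdeg_eq0; apply: contraNneq ne => a0; rewrite xpair_eqE !bmeqP /= a0 eqxx /=.
    by rewrite [X in _ == X]ab a0 add0m.
  by apply: IH; [exact: leq_trans db hd | exact: ltn_trans db he].
by rewrite addr0 => /eqP; rewrite mulf_eq0 (negbTE p0) => /eqP.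
Qed.

(** Isolates the first nonzero coefficient: after division by [p ^+ j0] the sum is congruent to
    [Q j0] modulo [p], so smallness of [p] and of the sum is passed on to [Q j0], which involves no
    [p]. *)
Lemma geometric_factor (W : comNzRingType) (p : W) (Q : nat -> W) N :
  (exists2 j, (j < N)%N & Q j != 0) -> exists j0 G, [/\ (j0 < N)%N, Q j0 != 0 &
    \sum_(j < N) Q j * p ^+ j = p ^+ j0 * (Q j0 + p * G)].
Proof.
elim: N Q => [|N IH] Q [j jN Qj]; first by [].
rewrite big_ord_recl expr0 mulr1 /=.
under eq_bigr do rewrite /bump /= add1n exprS mulrCA.
rewrite -mulr_sumr; have [Q0|Q0] := eqVneq (Q 0) 0; last first.
  by exists 0, (\sum_(i < N) Q i.+1 * p ^+ i); rewrite expr0 mul1r.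
case: (IH (fun j => Q j.+1)) => [|j0 [G [j0N Qj0 ->]]].
  by case: j jN Qj => [|j] jN Qj; [rewrite Q0 eqxx in Qj | exists j].
by exists j0.+1, G; split=> //; rewrite Q0 add0r exprS mulrA.
Qed.

(** * Siegel's construction against the Liouville inequality *)

Section StepC.
Context (K C : fieldType) (R : realType) (nrm : C -> R) (av : absval nrm).
Context (iota : {rmorphism K -> C}).
Context (I : Type) (n r : nat) (E : I -> nat) (z : I -> 'I_n -> K) (A : I -> 'I_r -> K).
Context (x : 'I_r -> C) (rho : R) (tau : nat -> 'I_r -> mpoly n K).

Notation W := (mpoly n (mpoly r K)).
Definition evalZY (k : I) (w : W) : K := meval (z k) (map_mpoly (meval (A k)) w).
Definition boxed d (w : W) := forall e mu, mcoeff mu (mcoeff e w) != 0 ->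
  (forall i, e i < d)%N /\ (forall i, mu i < d)%N.

Hypothesis rho01 : 0 < rho < 1.
Hypothesis Hz : forall k i, nrm (iota (z k i)) <= rho ^+ E k.
Hypothesis Htau0 : forall M i, mcoeff mnm0 (tau M i) = 0.
Hypothesis Htau : forall M, exists c, forall k i, (0 < E k)%N ->
  nrm (x i - iota (A k i) - iota (meval (z k) (tau M i))) <= c * rho ^+ (M * E k).
(** The rate [kap] precedes the polynomial; only the constant [c] may depend on its coefficients.
    This order allows the vanishing rate to be chosen before the degree [d]. *)
Hypothesis HL : exists2 kap : R, 0 < kap & forall d w, boxed d w ->
  exists2 c : R, 0 < c & forall k, evalZY k w = 0 \/ c * kap ^+ (d * E k) <= nrm (iota (evalZY k w)).

Lemma evalZYD k : {morph evalZY k : u v / u + v}.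
Proof. by move=> u v; rewrite /evalZY rmorphD mevalD. Qed.
Lemma evalZYM k : {morph evalZY k : u v / u * v}.
Proof. by move=> u v; rewrite /evalZY rmorphM mevalM. Qed.
Lemma evalZY_C k p : evalZY k (mpolyC n p) = meval (A k) p.
Proof. by rewrite /evalZY map_mpolyC mevalC. Qed.

(* [P (Y + tau M)] *)
Definition shifted (P : mpoly r K) M : W := mmap (@mpolyC n _ \o @mpolyC r K)
  (fun i => mpolyC n (mpolyX K (mnm1 i)) + map_mpoly (@mpolyC r K) (tau M i)) P.

Lemma shiftedC c M : shifted (mpolyC r c) M = mpolyC n (mpolyC r c).
Proof. by rewrite /shifted mmapC. Qed.
Lemma shiftedX i M : shifted (mpolyX K (mnm1 i)) M =
  mpolyC n (mpolyX K (mnm1 i)) + map_mpoly (@mpolyC r K) (tau M i).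
Proof. by rewrite /shifted mmapX mmap1U. Qed.
Lemma shiftedD p q M : shifted (p + q) M = shifted p M + shifted q M.
Proof. by rewrite /shifted rmorphD. Qed.
Lemma shiftedM p q M : shifted (p * q) M = shifted p M * shifted q M.
Proof. by rewrite /shifted rmorphM. Qed.

Lemma evalZY_shifted P M k :
  evalZY k (shifted P M) = meval (fun i => A k i + meval (z k) (tau M i)) P.
Proof.
elim/mpoly_ring_ind: P => [c|i|p q IHp IHq|p q IHp IHq].
- by rewrite shiftedC evalZY_C !mevalC.
- rewrite shiftedX evalZYD evalZY_C !mevalXU.
  congr (_ + _); rewrite /evalZY; congr (meval _ _); apply/mpolyP => e.
  by rewrite !mcoeff_map_mpoly /= mevalC.
- by rewrite shiftedD (evalZYD k (shifted p M)) [RHS]mevalD; congr (_ + _).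
- by rewrite shiftedM (evalZYM k (shifted p M)) [RHS]mevalM; congr (_ * _).
Qed.

(** The series [tau M] have no constant term, so setting [z = 0] gives back [P]. This provides the
    nonzero constant term required by [low_coeff_factor]. *)
Lemma mcoeff0_shifted P M : mcoeff mnm0 (shifted P M) = P.
Proof.
rewrite -meval0_mcoeff; elim/mpoly_ring_ind: P => [c|i|p q IHp IHq|p q IHp IHq].
- by rewrite shiftedC mevalC.
- rewrite shiftedX mevalD mevalC.
  by rewrite (meval0_mcoeff (map_mpoly _ _)) mcoeff_map_mpoly Htau0 /= mpolyC0 addr0.
- by rewrite shiftedD mevalD; congr (_ + _).
- by rewrite shiftedM mevalM; congr (_ * _).
Qed.

Definition ydeg d (w : W) := forall e mu, mcoeff mu (mcoeff e w) != 0 -> forall i, (mu i <= d)%N.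

Lemma ydegW d d' w : (d <= d')%N -> ydeg d w -> ydeg d' w.
Proof. by move=> le h e mu /h hi i; apply: leq_trans le. Qed.
Lemma ydegD d u v : ydeg d u -> ydeg d v -> ydeg d (u + v).
Proof.
move=> hu hv e mu; rewrite !mcoeffD => h i.
have [h1|h1] := eqVneq (mcoeff mu (mcoeff e u)) 0; last exact: (hu e).
by rewrite h1 add0r in h; exact: (hv e).
Qed.
Lemma sum_neq0_ex (V : zmodType) (J : finType) (Q : pred J) (F : J -> V) :
  \sum_(j | Q j) F j != 0 -> exists2 j, Q j & F j != 0.
Proof.
move=> h; have [/existsP[j /andP[]]|] := boolP [exists j, Q j && (F j != 0)]; first by exists j.
rewrite negb_exists => /forallP h'; move: h; rewrite big1 ?eqxx // => j Qj.
by move: (h' j); rewrite Qj /= negbK => /eqP.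
Qed.
Lemma ydegM d d' u v : ydeg d u -> ydeg d' v -> ydeg (d + d') (u * v).
Proof.
move=> hu hv e mu; rewrite mcoeffM raddf_sum /= => /sum_neq0_ex[[a b] /= _].
rewrite mcoeffM => /sum_neq0_ex[[a' b'] /= /eqP ab] h i.
have -> : mu i = (a' i + b' i)%N by rewrite {1}ab mnmDE.
apply: leq_add; first by apply: (hu a); apply: contraNneq h => ->; rewrite mul0r.
by apply: (hv b); apply: contraNneq h => ->; rewrite mulr0.
Qed.
Lemma ydeg_C d p : (forall mu, mcoeff mu p != 0 -> forall i, (mu i <= d)%N) -> ydeg d (mpolyC n p).
Proof.
move=> h e mu; rewrite mcoeffC; have [_|_] := eqVneq e mnm0; rewrite ?mulr1; first exact: h.
by rewrite mulr0 mcoeff0 eqxx.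
Qed.
Lemma ydeg_map p : ydeg 0 (map_mpoly (@mpolyC r K) p).
Proof.
move=> e mu; rewrite mcoeff_map_mpoly mcoeffC; have [-> _ i|_] := eqVneq mu mnm0.
  by rewrite mnm0E.
by rewrite mulr0 eqxx.
Qed.
Lemma ydeg1 d : ydeg d 1.
Proof.
rewrite -mpolyC1; apply: ydeg_C => mu; rewrite mcoeff1; have [-> _ i|_] := eqVneq mu mnm0.
  by rewrite mnm0E.
by rewrite eqxx.
Qed.
Lemma ydegX d u j : ydeg d u -> ydeg (j * d) (u ^+ j).
Proof.
by move=> h; elim: j => [|j IH]; rewrite ?expr0 ?mul0n ?exprS ?mulSn; [exact: ydeg1|exact: ydegM].
Qed.
(** No [Y] occurs in [tau M], so the degree in [Y] is bounded uniformly in [M]; the count of linear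
    conditions below relies on this uniformity. *)
Lemma ydeg_shifted P : exists d, forall M, ydeg d (shifted P M).
Proof.
elim/mpoly_ring_ind: P => [c|i|p q [d1 h1] [d2 h2]|p q [d1 h1] [d2 h2]].
- exists 0%N => M; rewrite shiftedC; apply: ydeg_C => mu.
  by rewrite mcoeffC; have [-> _ i|_] := eqVneq mu mnm0; rewrite ?mnm0E // mulr0 eqxx.
- exists 1%N => M; rewrite shiftedX; apply: ydegD.
    apply: ydeg_C => mu; rewrite mcoeffX; have [<- _ j|_] := eqVneq (mnm1 i) mu; last by rewrite eqxx.
    by rewrite mnm1E; case: (i == j).
  by apply: (@ydegW 0%N 1%N) => //; exact: ydeg_map.
- exists (maxn d1 d2) => M; rewrite shiftedD.
  by apply: ydegD; [exact: ydegW (leq_maxl _ _) (h1 M)|exact: ydegW (leq_maxr _ _) (h2 M)].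
- exists (d1 + d2)%N => M; rewrite shiftedM.
  exact: ydegM.
Qed.

Lemma iota_bounded : exists2 B : R, 1 <= B & forall k, (0 < E k)%N ->
  (forall i, nrm (iota (A k i)) <= B) /\ (forall i, nrm (x i) <= B).
Proof.
have /andP[r0 r1] := rho01.
have [c hc] := Htau 1.
pose B := \sum_i (nrm (x i) + L1 nrm (map_mpoly iota (tau 1%N i))) + `|c| + 1.
have n0 i : 0 <= nrm (x i) + L1 nrm (map_mpoly iota (tau 1%N i)).
  by rewrite addr_ge0 ?(av_ge0 av) // L1_ge0.
have Bi i : nrm (x i) + L1 nrm (map_mpoly iota (tau 1%N i)) + `|c| <= B.
  have h : nrm (x i) + L1 nrm (map_mpoly iota (tau 1%N i)) <=
      \sum_i (nrm (x i) + L1 nrm (map_mpoly iota (tau 1%N i))).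
    by rewrite [leRHS](bigD1 i) //= lerDl sumr_ge0.
  by rewrite /B; have := normr_ge0 c; lra.
exists B; first by rewrite /B lerDr addr_ge0 // sumr_ge0.
move=> k Ek; split=> i; apply: le_trans (Bi i); last by rewrite -addrA lerDl addr_ge0 ?L1_ge0.
have -> : iota (A k i) = x i - iota (meval (z k) (tau 1%N i))
    - (x i - iota (A k i) - iota (meval (z k) (tau 1%N i))) by ring.
apply: le_trans (avB av _ _) _; apply: lerD; last first.
  apply: le_trans (hc k i Ek) _; apply: le_trans (ler_norm _) _.
  by rewrite normrM ler_piMr // ger0_norm ?exprn_ge0 ?exprn_ile1 // ltW.
apply: le_trans (avB av _ _) _; rewrite lerD2l meval_rmorph.
apply: le_trans (meval_small av (t := 1) (M := 0) _ _ _) _; rewrite ?lexx ?ler01 //.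
  by move=> j; apply: le_trans (Hz k j) _; rewrite exprn_ile1 // ltW.
by rewrite expr1n mulr1.
Qed.

Lemma evalZY_bounded w : exists2 c : R, 0 <= c & forall k, (0 < E k)%N ->
  nrm (iota (evalZY k w)) <= c.
Proof.
have /andP[r0 r1] := rho01.
have [B B1 hB] := iota_bounded.
elim/mpoly_ring_ind: w => [p|i|p q [c1 c10 h1] [c2 c20 h2]|p q [c1 c10 h1] [c2 c20 h2]].
- exists (L1 nrm (map_mpoly iota p) * B ^+ msize (map_mpoly iota p)).
    by rewrite mulr_ge0 ?L1_ge0 // exprn_ge0 // (le_trans _ B1).
  move=> k Ek; rewrite evalZY_C meval_rmorph; apply: meval_bounded => // i.
  by case: (hB k Ek).
- exists 1 => // k Ek; rewrite /evalZY map_mpolyX mevalXU; apply: le_trans (Hz k i) _.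
  by rewrite exprn_ile1 // ltW.
- exists (c1 + c2); first exact: addr_ge0.
  move=> k Ek; rewrite evalZYD rmorphD; apply: le_trans (avD av _ _) _.
  by apply: lerD; [exact: h1|exact: h2].
- exists (c1 * c2); first exact: mulr_ge0.
  move=> k Ek; rewrite evalZYM rmorphM (avM av); apply: ler_pM; rewrite ?(av_ge0 av) ?h1 ?h2 //.
Qed.

Lemma evalZY_small w M : (forall e : multinom n, (mdeg e < M)%N -> mcoeff e w = 0) ->
  exists2 c : R, 0 <= c & forall k, (0 < E k)%N ->
    nrm (iota (evalZY k w)) <= c * rho ^+ (M * E k).
Proof.
have /andP[r0 r1] := rho01.
move=> hM.
have /choice[c hc] : forall e : multinom n, exists c, 0 <= c /\ forall k, (0 < E k)%N ->
    nrm (iota (meval (A k) (mcoeff e w))) <= c.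
  move=> e; have [c c0 h] := evalZY_bounded (mpolyC n (mcoeff e w)).
  by exists c; split=> // k /h; rewrite evalZY_C.
exists (\sum_(e <- msupp w) c e); first by apply: sumr_ge0 => e _; case: (hc e).
move=> k Ek.
have -> : evalZY k w = \sum_(e <- msupp w) meval (A k) (mcoeff e w) * \prod_i z k i ^+ e i.
  have e0 : evalZY k 0 = 0 by rewrite -[0 in LHS](mpolyC0 n) evalZY_C meval0.
  rewrite {1}(mpolyE w) (big_morph (evalZY k) (evalZYD k) e0); apply: eq_bigr => e _.
  rewrite -mul_mpolyC (evalZYM k (mpolyC n _)) evalZY_C; congr (_ * _).
  by rewrite /evalZY map_mpolyX mevalX.
rewrite rmorph_sum /=; apply: le_trans (av_sum av _ _ _) _.
rewrite mulr_suml !big_seq; apply: ler_sum => e he.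
rewrite rmorphM (avM av); apply: ler_pM; rewrite ?(av_ge0 av) //; first by case: (hc e) => _; exact.
rewrite rmorph_prod (av_prod av).
apply: (@le_trans _ _ (\prod_(i < n) (rho ^+ E k) ^+ e i)).
  apply: ler_prod => i _; rewrite (av_ge0 av) rmorphXn (avX av) lerXn2r ?nnegrE ?(av_ge0 av) ?Hz //=.
  by rewrite exprn_ge0 // ltW.
rewrite prodrXr -mdegE -exprM mulnC; apply: ler_wiXn2l; rewrite ?ltW // leq_mul2r.
by rewrite leqNgt orbC; apply/orP; left; apply/negP => /hM /eqP; rewrite mcoeff_eq0 he.
Qed.

(** [P] vanishes at [x] and is Lipschitz on bounded sets, so its value at [A k + tau M (z k)]
    inherits the error of that approximation to [x]. *)
Lemma shifted_small P M : meval x (map_mpoly iota P) = 0 ->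
  exists2 c : R, 0 <= c & forall k, (0 < E k)%N ->
    nrm (iota (evalZY k (shifted P M))) <= c * rho ^+ (M * E k).
Proof.
have /andP[r0 r1] := rho01.
move=> Px; have [B B1 hB] := iota_bounded.
have [c hc] := Htau M.
pose b := \sum_i L1 nrm (map_mpoly iota (tau M i)).
have b0 : 0 <= b by apply: sumr_ge0 => i _; exact: L1_ge0.
have [l l0 hl] := meval_lipschitz av (map_mpoly iota P) (B := B + b) (ler_wpDr b0 B1).
exists (l * `|c|); first by rewrite mulr_ge0.
move=> k Ek; rewrite evalZY_shifted meval_rmorph -[X in nrm X]subr0 -Px -mulrA.
have [hA hx] := hB k Ek.
apply: hl.
- move=> i; rewrite rmorphD; apply: le_trans (avD av _ _) _; apply: lerD => //.
  rewrite meval_rmorph; apply: le_trans (meval_small av (t := 1) (M := 0) _ _ _) _; rewrite ?lexx ?ler01 //.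
    by move=> j; apply: le_trans (Hz k j) _; rewrite exprn_ile1 // ltW.
  rewrite expr1n mulr1 /b (bigD1 i) //= lerDl; apply: sumr_ge0 => j _; exact: L1_ge0.
- by move=> i; apply: le_trans (hx i) _; rewrite lerDl.
- move=> i; rewrite rmorphD (avBC av) opprD addrA; apply: le_trans (hc k i Ek) _.
  by apply: ler_wpM2r; rewrite ?exprn_ge0 ?ler_norm // ltW.
- by rewrite mulr_ge0 // exprn_ge0 // ltW.
Qed.

(** A combination of the first [d] powers of [p = P (Y + tau M)], with coefficients of degree less
    than [d], vanishes to an order [M] far beyond [d]. At late times [p] and the combination are
    tiny, hence so is the first coefficient [Q j0]; the Liouville inequality forces it to vanish. *)
Theorem exists_vanishing_polynomial P : P != 0 -> meval x (map_mpoly iota P) = 0 ->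
  exists w : W, w != 0 /\ exists E0, forall k, (E0 <= E k)%N -> evalZY k w = 0.
Proof.
move=> P0 Px; have /andP[r0 r1] := rho01.
have [kap kap0 hL] := HL.
have [dP hdP] := ydeg_shifted P.
(* The ratio [t] between the order [M] and the degree [d] is taken so large that
   [rho ^+ (t * d * E)] beats the Liouville bound [kap ^+ (d * E)] by a factor [2 ^ (d * E)]. *)
have [t ht] : exists t, rho ^+ t <= kap / 2%:R.
  have kap2 : 0 < kap / 2%:R by rewrite divr_gt0.
  have := @cvg_expr R rho; rewrite ger0_norm ?ltW // => /(_ r1) /cvgrPdist_le /(_ _ kap2) [t _ h].
  exists t; have := h t (leqnn t); rewrite sub0r normrN ger0_norm //.
  by rewrite exprn_ge0 // ltW.
(* There are [d * d ^ n * d ^ r] unknowns and [(d * t) ^ n * (d * dP.+1) ^ r] conditions; all powers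
   of [d] cancel but one. *)
have [d d0 dlt] : exists2 d, (0 < d)%N & (t ^ n * dP.+1 ^ r < d)%N.
  by exists (t ^ n * dP.+1 ^ r).+1.
have [M ME] : exists M, M = (d * t)%N by exists (d * t)%N.
have [p [p0 pY [c2 c20 h2]]] : exists p : W, [/\ mcoeff mnm0 p = P, ydeg dP p &
    exists2 c : R, 0 <= c & forall k, (0 < E k)%N ->
      nrm (iota (evalZY k p)) <= c * rho ^+ (M * E k)].
  by exists (shifted P M); split; [exact: mcoeff0_shifted|exact: hdP|exact: shifted_small].
(* [T1] indexes the unknowns by the power of [p], the exponents of [z] and those of [Y]; [T2]
   indexes the coefficients to be killed, namely a box containing all exponents of [z] of degree
   less than [M]. *)
pose T1 := ('I_d * ({ffun 'I_n -> 'I_d} * {ffun 'I_r -> 'I_d}))%type.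
pose T2 := ({ffun 'I_n -> 'I_M} * {ffun 'I_r -> 'I_(d * dP.+1)})%type.
pose me (q : nat) (f : {ffun 'I_n -> 'I_q}) : multinom n := Multinom [tuple (f i : nat) | i < n].
pose mm (q : nat) (f : {ffun 'I_r -> 'I_q}) : multinom r := Multinom [tuple (f i : nat) | i < r].
have meE q (f : {ffun 'I_n -> 'I_q}) i : me q f i = f i by rewrite /me mnmE.
have mmE q (f : {ffun 'I_r -> 'I_q}) i : mm q f i = f i by rewrite /mm mnmE.
pose mono (t : {ffun 'I_n -> 'I_d} * {ffun 'I_r -> 'I_d}) : W :=
  mpolyC n (mpolyX K (mm _ t.2)) * mpolyX _ (me _ t.1).
have mcoeff_mono t0 e mu : mcoeff mu (mcoeff e (mono t0)) = ((me _ t0.1 == e) && (mm _ t0.2 == mu))%:R.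
  rewrite /mono mul_mpolyC mcoeffZ mcoeffX; case: eqP => _; last by rewrite mulr0 mcoeff0.
  by rewrite mulr1 mcoeffX.
pose a (u : T1) (s : T2) := mcoeff (mm _ s.2) (mcoeff (me _ s.1) (mono u.2 * p ^+ u.1)).
have card : (#|{: T2}| < #|{: T1}|)%N.
  rewrite !card_prod !card_ffun !card_ord.
  rewrite ME !expnMn mulnACA [X in (_ < X)%N]mulnC ltn_pmul2l; last by rewrite muln_gt0 !expn_gt0 d0.
  exact: dlt.
have [v [u0 vu0] hv] := exists_kernel_vector a card.
have injm t0 t1 : me d t0.1 == me d t1.1 -> mm d t0.2 == mm d t1.2 -> t0 = t1.
  move: t0 t1 => [f1 f2] [g1 g2] /= /eqP e1 /eqP e2; congr pair; apply/ffunP => i; apply: val_inj => /=.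
    by have := congr1 (fun q : multinom n => q i) e1; rewrite !meE.
  by have := congr1 (fun q : multinom r => q i) e2; rewrite !mmE.
clearbody mono.
pose Q (j : nat) : W := if insub j is Some j' then
  \sum_(t0 : {ffun 'I_n -> 'I_d} * {ffun 'I_r -> 'I_d}) mpolyC n (mpolyC r (v (j', t0))) * mono t0 else 0.
have QE (j : 'I_d) : Q j = \sum_t0 mpolyC n (mpolyC r (v (j, t0))) * mono t0.
  by rewrite /Q valK.
have mcoeffCC c (w : W) e mu : mcoeff mu (mcoeff e (mpolyC n (mpolyC r c) * w)) = c * mcoeff mu (mcoeff e w).
  by rewrite mul_mpolyC mcoeffZ mul_mpolyC mcoeffZ.
have Qu0 : Q u0.1 != 0.
  apply: contra_neq vu0 => /(congr1 (fun w : W => mcoeff (mm _ u0.2.2) (mcoeff (me _ u0.2.1) w))).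
  rewrite QE !raddf_sum /= !mcoeff0 (bigD1 u0.2) //= mcoeffCC mcoeff_mono !eqxx mulr1 -surjective_pairing.
  rewrite big1 ?addr0 // => t0 ne; rewrite mcoeffCC mcoeff_mono.
  case: andP => [[e1 e2]|]; last by rewrite mulr0.
  by rewrite (injm _ _ e1 e2) eqxx in ne.
have [j0 [G [j0d Qj0 sumE]]] : exists j0 G, [/\ (j0 < d)%N, Q j0 != 0 &
    \sum_(j < d) Q j * p ^+ j = p ^+ j0 * (Q j0 + p * G)].
  by apply: geometric_factor; exists u0.1.
have bQ : boxed d (Q j0).
  move=> e mu; rewrite (QE (Ordinal j0d)) !raddf_sum /= => /sum_neq0_ex[t0 _].
  rewrite mcoeffCC mcoeff_mono; case: andP => [[/eqP <- /eqP <-]|]; last by rewrite mulr0 eqxx.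
  by split=> i; rewrite ?meE ?mmE ltn_ord.
have sum0 e : (mdeg e < M)%N -> mcoeff e (\sum_(j < d) Q j * p ^+ j) = 0.
  move=> he; apply/mpolyP => mu; rewrite mcoeff0.
  have E1 : \sum_(j < d) Q j * p ^+ j =
      \sum_(u : T1) mpolyC n (mpolyC r (v u)) * (mono u.2 * p ^+ u.1).
    transitivity (\sum_(j < d) \sum_t0 mpolyC n (mpolyC r (v (j, t0))) * (mono t0 * p ^+ j)).
      by apply: eq_bigr => j _; rewrite QE mulr_suml; apply: eq_bigr => t0 _; rewrite mulrA.
    by rewrite pair_bigA; apply: eq_bigr => -[j t0] _.
  have yd (u : T1) : ydeg (d.-1 * dP.+1) (mono u.2 * p ^+ u.1).
    apply: (@ydegW (d.-1 + u.1 * dP)%N).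
      rewrite mulnS leq_add2l leq_mul2r; apply/orP; right.
      by rewrite -ltnS prednK.
    apply: ydegM; last by apply: ydegX; exact: pY.
    move=> e' mu'; rewrite mcoeff_mono; case: andP => [[_ /eqP <-]|]; last by rewrite eqxx.
    by move=> _ i; rewrite mmE -ltnS prednK.
  rewrite E1 !raddf_sum /=.
  have [/forallP hmu|] := boolP [forall i : 'I_r, (mu i < d * dP.+1)%N]; last first.
    rewrite negb_forall => /existsP[i hi]; rewrite big1 // => u _; rewrite mcoeffCC.
    have [->|/(yd u e mu)/(_ i)] := eqVneq (mcoeff mu (mcoeff e (mono u.2 * p ^+ u.1))) 0.
      by rewrite mulr0.
    move=> h; move: hi; rewrite (leq_ltn_trans h) //.
    by rewrite ltn_pmul2r // prednK.
  have heM i : (e i < M)%N.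
    by apply: leq_ltn_trans he; rewrite mdegE (bigD1 i) //= leq_addr.
  pose s : T2 := ([ffun i => Ordinal (heM i)], [ffun i => Ordinal (hmu i)]).
  have eE : me _ s.1 = e by apply/mnmP => i; rewrite meE ffunE.
  have muE : mm _ s.2 = mu by apply/mnmP => i; rewrite mmE ffunE.
  rewrite -[RHS](hv s); apply: eq_bigr => u _.
  by rewrite mcoeffCC /a eE muE.
have low e : (mdeg e < M)%N -> mcoeff e (Q j0 + p * G) = 0.
  apply: (low_coeff_factor (p := p ^+ j0)); last by move=> e' he'; rewrite -sumE; exact: sum0.
  by rewrite -meval0_mcoeff rmorphXn /= meval0_mcoeff p0 expf_neq0.
have [c1 c10 h1] := evalZY_small low.
have [c3 c30 h3] := evalZY_bounded G.
have [c c0 hc] := hL d _ bQ.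
exists (Q j0); split=> //.
pose B := (c1 + c2 * c3) / c.
have B0 : 0 <= B by rewrite divr_ge0 ?addr_ge0 ?mulr_ge0 // ltW.
exists (Num.truncn B).+1 => k hk.
have Ek : (0 < E k)%N by apply: leq_trans hk.
case: (hc k) => // hck; exfalso.
(* [Q j0] is the difference of [Q j0 + p * G], which vanishes to order [M] in [z], and of [p * G],
   where [p] is small at the orbit point. *)
have up : nrm (iota (evalZY k (Q j0))) <= (c1 + c2 * c3) * rho ^+ (M * E k).
  have -> : evalZY k (Q j0) = evalZY k (Q j0 + p * G) - evalZY k p * evalZY k G.
    by rewrite evalZYD evalZYM addrK.
  rewrite rmorphB rmorphM; apply: le_trans (avB av _ _) _.
  rewrite mulrDl; apply: lerD; first exact: h1.
  by rewrite (avM av) mulrAC; apply: ler_pM; rewrite ?(av_ge0 av) ?h2 ?h3.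
have := le_trans hck up.
have -> : (M * E k)%N = (t * (d * E k))%N by rewrite ME (mulnC d t) mulnA.
rewrite (exprM rho t) => h4.
have h5 : c * kap ^+ (d * E k) <= (c1 + c2 * c3) * (kap / 2%:R) ^+ (d * E k).
  apply: le_trans h4 _; apply: ler_wpM2l; first by rewrite addr_ge0 // mulr_ge0.
  by apply: lerXn2r => //; rewrite nnegrE ?exprn_ge0 ?divr_ge0 // ltW.
have h6 : 2%:R ^+ (d * E k) <= B.
  rewrite /B ler_pdivlMr // mulrC -(ler_pM2r (exprn_gt0 (d * E k) kap0)).
  have := ler_wpM2r (exprn_ge0 (d * E k) (ler0n R 2)) h5.
  by rewrite -[X in _ <= X]mulrA -exprMn divfK ?pnatr_eq0 // mulrAC.
have h7 : (E k)%:R <= B.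
  apply: le_trans h6; rewrite -natrX ler_nat; apply: ltnW; apply: leq_trans (ltn_expl _ (ltnSn 1)) _.
  by rewrite leq_exp2l // leq_pmull.
have := truncnS_gt B; rewrite ltNge => /negP; apply.
by apply: le_trans h7; rewrite ler_nat.
Qed.
End StepC.

(** * The p-adic integers, limits along an ultrafilter, derivatives along shifts by powers of p *)

(* The primality proof is a parameter of the type so that the ring structures, which need it,
   can be inferred. *)
Record padic p (p_pr : prime p) := Padic {
  pseq :> nat -> int; _ : forall n, pseq n = (pseq n.+1 %% (p ^ n)%N)%Z }.
Arguments pseq : simpl never.

Section Padic.
Context (p : nat) (p_pr : prime p).

Notation P n := ((p ^ n)%N : int).
Local Notation padic := (padic p_pr).

Lemma P_gt0 n : 0 < P n. Proof. by rewrite ltz_nat expn_gt0 prime_gt0. Qed.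
Lemma P_neq0 n : P n != 0. Proof. by rewrite gt_eqF ?P_gt0. Qed.

Lemma padicP (x y : padic) : (forall n, x n = y n) -> x = y.
Proof.
case: x y => [x hx] [y hy] h.
have e : x = y by apply/funext => n; exact: h.
by rewrite {h}; subst y; congr Padic; exact: Prop_irrelevance.
Qed.

Lemma pseq_coh (x : padic) n : x n = (x n.+1 %% P n)%Z.
Proof. by case: x. Qed.

Lemma pseq_mod (x : padic) n : (x n %% P n)%Z = x n.
Proof. by rewrite pseq_coh modz_mod. Qed.

Lemma dvdP n k : (n <= k)%N -> (P n %| P k)%Z.
Proof. by move=> h; rewrite /dvdz /=; exact: dvdn_exp2l. Qed.

Lemma modP_mod n k (x : int) : (n <= k)%N -> modz (modz x (P k)) (P n) = modz x (P n).
Proof.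
move=> h; apply/eqP; rewrite eqz_mod_dvd; apply: dvdz_trans (dvdP h) _.
by rewrite -eqz_mod_dvd modz_mod.
Qed.

Lemma pseq_le (x : padic) n k : (n <= k)%N -> (x k %% P n)%Z = x n.
Proof.
move/subnK <-; elim: (k - n)%N => [|d IH]; first exact: pseq_mod.
by rewrite -IH [in RHS]pseq_coh modP_mod // leq_addl.
Qed.

Definition coherent (f : nat -> int) := forall n, (f n.+1 = f n %[mod P n])%Z.

Lemma mkpadic_subproof f : coherent f -> forall n, modz (f n) (P n) = modz (modz (f n.+1) (P n.+1)) (P n).
Proof. by move=> hf n; rewrite modP_mod. Qed.

Definition mkpadic f (hf : coherent f) : padic := Padic p_pr (mkpadic_subproof hf).

Lemma mkpadicE f (hf : coherent f) n : mkpadic hf n = (f n %% P n)%Z.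
Proof. by []. Qed.

Lemma coh_cst c : coherent (fun=> c). Proof. by []. Qed.
Lemma coh_add (x y : padic) : coherent (fun n => x n + y n).
Proof. by move=> n; rewrite -modzDm -!pseq_coh. Qed.
Lemma coh_opp (x : padic) : coherent (fun n => - x n).
Proof. by move=> n; rewrite -modzNm -pseq_coh. Qed.
Lemma coh_mul (x y : padic) : coherent (fun n => x n * y n).
Proof. by move=> n; rewrite -modzMm -!pseq_coh. Qed.

Definition padd x y := mkpadic (coh_add x y).
Definition popp x := mkpadic (coh_opp x).
Definition pmul x y := mkpadic (coh_mul x y).
Definition pcst c := mkpadic (coh_cst c).

HB.instance Definition _ := gen_eqMixin padic.
HB.instance Definition _ := gen_choiceMixin padic.

Lemma paddA : associative padd.
Proof. by move=> x y z; apply: padicP => n; rewrite !mkpadicE modzDml modzDmr addrA. Qed.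
Lemma paddC : commutative padd.
Proof. by move=> x y; apply: padicP => n; rewrite !mkpadicE addrC. Qed.
Lemma padd0 : left_id (pcst 0) padd.
Proof. by move=> x; apply: padicP => n; rewrite !mkpadicE modzDml add0r pseq_mod. Qed.
Lemma paddN : left_inverse (pcst 0) popp padd.
Proof. by move=> x; apply: padicP => n; rewrite !mkpadicE modzDml addNr. Qed.
HB.instance Definition _ := GRing.isZmodule.Build padic paddA paddC padd0 paddN.

Lemma pmulA : associative pmul.
Proof. by move=> x y z; apply: padicP => n; rewrite !mkpadicE modzMml modzMmr mulrA. Qed.
Lemma pmulC : commutative pmul.
Proof. by move=> x y; apply: padicP => n; rewrite !mkpadicE mulrC. Qed.
Lemma pmul1 : left_id (pcst 1) pmul.
Proof. by move=> x; apply: padicP => n; rewrite !mkpadicE modzMml mul1r pseq_mod. Qed.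
Lemma pmulD : left_distributive pmul padd.
Proof. by move=> x y z; apply: padicP => n; rewrite !mkpadicE modzMml modzDm mulrDl. Qed.
Lemma pone_neq0 : pcst 1 != 0 :> padic.
Proof.
apply/eqP => /(congr1 (fun x : padic => x 1%N)); rewrite !mkpadicE.
by rewrite !modz_small // ?ltz_nat expn1 ?prime_gt1 ?prime_gt0.
Qed.
HB.instance Definition _ := GRing.Zmodule_isComNzRing.Build padic pmulA pmulC pmul1 pmulD pone_neq0.

Lemma pseqD (x y : padic) n : (x + y) n = ((x n + y n) %% P n)%Z. Proof. by []. Qed.
Lemma pseqN (x : padic) n : (- x) n = ((- x n) %% P n)%Z. Proof. by []. Qed.
Lemma pseqM (x y : padic) n : (x * y) n = ((x n * y n) %% P n)%Z. Proof. by []. Qed.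
Lemma pseq0 n : (0 : padic) n = 0. Proof. by rewrite mkpadicE mod0z. Qed.
Lemma pseq1 n : (1 : padic) n = (1 %% P n)%Z. Proof. by []. Qed.
Lemma pseq_nat k n : (k%:R : padic) n = (k%:Z %% P n)%Z.
Proof.
elim: k => [|k IH]; first by rewrite pseq0 mod0z.
by rewrite -addn1 natrD pseqD IH pseq1 modzDm PoszD.
Qed.
Lemma pseq_int (k : int) n : (k%:~R : padic) n = (k %% P n)%Z.
Proof.
case: k => k; first by rewrite -pmulrn pseq_nat.
by rewrite NegzE mulrNz pseqN -pmulrn pseq_nat modzNm.
Qed.
Lemma pseqX (x : padic) k n : (x ^+ k) n = (x n ^+ k %% P n)%Z.
Proof.
elim: k => [|k IH]; first by rewrite !expr0.
by rewrite exprS pseqM IH modzMmr -exprS.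
Qed.

Lemma padic_neq0 (x : padic) : x != 0 -> exists n, x n != 0.
Proof.
move=> x0; apply: contrapT => h; move/eqP: x0; apply; apply: padicP => n.
by rewrite pseq0; apply/eqP; apply: contrapT => /negP h'; apply: h; exists n.
Qed.

(** Once a residue is nonzero, the valuation of all later approximations stays below [n]. Valuations
    of nonzero elements are thus finite and additive, which excludes zero divisors. *)
Lemma padic_logn (x : padic) n k : x n != 0 -> (n <= k)%N -> x k != 0 /\ (logn p `|x k| < n)%N.
Proof.
move=> xn h; have xk : ~~ (P n %| x k)%Z.
  by apply: contra xn => /dvdz_mod0P; rewrite pseq_le // => ->.
have xk0 : x k != 0 by apply: contraNneq xk => ->; rewrite dvdz0.
split=> //; rewrite ltnNge; apply: contra xk => h'.
by rewrite dvdzE /= pfactor_dvdn // absz_gt0.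
Qed.

Lemma padic_mul_eq0 (x y : padic) : x * y = 0 -> (x == 0) || (y == 0).
Proof.
move=> xy; apply: contrapT => /negP; rewrite negb_or => /andP[/padic_neq0[n xn] /padic_neq0[k yk]].
have [x0 xl] := padic_logn xn (leq_addr k n).
have [y0 yl] := padic_logn yk (leq_addl n k).
have := congr1 (fun x : padic => x (n + k)%N) xy; rewrite pseqM pseq0 => /dvdz_mod0P; rewrite dvdzE abszM /=.
rewrite pfactor_dvdn ?muln_gt0 ?absz_gt0 ?x0 ?y0 // lognM ?absz_gt0 //.
by rewrite leqNgt; apply/negP/negPn; rewrite (leq_trans (n := n + k)%N) // -addSn leq_add // ltnW.
Qed.

Definition padic_unit : pred padic := [pred x | `[< exists y, y * x = 1 >]].
Definition padic_inv (x : padic) : padic :=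
  if pselect (exists y, y * x = 1) is left h then sval (cid h) else x.
Lemma padic_mulVx : {in padic_unit, left_inverse 1 padic_inv *%R}.
Proof.
move=> x /asboolP h; rewrite /padic_inv; case: pselect => // h'.
exact: (svalP (cid h')).
Qed.
Lemma padic_unitPl (x y : padic) : y * x = 1 -> padic_unit x.
Proof. by move=> h; apply/asboolP; exists y. Qed.
Lemma padic_invr_out : {in [predC padic_unit], padic_inv =1 id}.
Proof.
move=> x; rewrite inE /= => /asboolP h; rewrite /padic_inv; case: pselect => //.
Qed.
HB.instance Definition _ := GRing.ComNzRing_hasMulInverse.Build padic
  padic_mulVx padic_unitPl padic_invr_out.
HB.instance Definition _ := GRing.ComUnitRing_isIntegral.Build padic padic_mul_eq0.

Lemma padic_int_eq0 (k : int) : (k%:~R : padic) = 0 -> k = 0.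
Proof.
move=> h; apply/eqP; rewrite -absz_eq0; apply: contrapT => /negP; rewrite -lt0n => k0.
have := congr1 (fun x : padic => x `|k|%N) h; rewrite pseq_int pseq0 => /dvdz_mod0P.
rewrite /dvdz /= => /(dvdn_leq k0); rewrite leqNgt => /negP; apply.
by rewrite ltn_expl // prime_gt1.
Qed.

Lemma padic_divp (x : padic) n : x n = 0 -> exists y, x = (p ^ n)%:R * y.
Proof.
move=> xn.
have hx k : (P n %| x (n + k)%N)%Z by apply/dvdz_mod0P; rewrite pseq_le ?leq_addr.
have coh : coherent (fun k => (x (n + k)%N %/ P n)%Z).
  move=> k; apply/eqP; rewrite eqz_mod_dvd -(dvdz_mul2l (P_neq0 n)) mulrBr.
  rewrite ![P n * _]mulrC !divzK // -PoszM -expnD -eqz_mod_dvd addnS (addnC k).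
  by rewrite -pseq_coh pseq_mod.
exists (mkpadic coh); apply: padicP => k; rewrite pseqM pseq_nat mkpadicE modzMml.
have -> : x k = (x (n + k)%N %% P k)%Z by rewrite pseq_le ?leq_addl.
rewrite -{1}(divzK (hx k)) mulrC; apply/eqP; rewrite eqz_mod_dvd -mulrBr.
by apply: dvdz_mull; rewrite -eqz_mod_dvd modz_mod.
Qed.

Lemma padic_pdvd (y : padic) n : ((p ^ n)%:R * y) n = 0.
Proof. by rewrite pseqM pseq_nat modzz mul0r mod0z. Qed.

(* Limits of arbitrary sequences along a fixed nonprincipal ultrafilter. *)
Local Open Scope classical_set_scope.

Lemma exists_ultra : exists U : set_system nat, UltraFilter U /\ \oo `<=` U.
Proof. by apply: ultraFilterLemma. Qed.

Definition ultra_nat : set_system nat := sval (cid exists_ultra).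
Lemma ultra_nat_ultra : UltraFilter ultra_nat.
Proof. by rewrite /ultra_nat; case: (cid _) => U []. Qed.
Lemma ultra_nat_oo : \oo `<=` ultra_nat.
Proof. by rewrite /ultra_nat; case: (cid _) => U []. Qed.
#[local] Existing Instance ultra_nat_ultra.

Lemma ultra_natI A B : ultra_nat A -> ultra_nat B -> ultra_nat (A `&` B).
Proof. exact: filterI. Qed.
Lemma ultra_natW (A B : set nat) : A `<=` B -> ultra_nat A -> ultra_nat B.
Proof. exact: filterS. Qed.
Lemma ultra_nat_ex A : ultra_nat A -> exists n, A n.
Proof. exact: filter_ex. Qed.

Lemma ultra_nat0 (A : set nat) : ~ ultra_nat A -> ultra_nat (~` A).
Proof. by move=> h; have [] := in_ultra_setVsetC A ultra_nat_ultra. Qed.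

(** If no level set belonged to the ultrafilter, removing the values one by one would put every set
    where [g n] is at least [r] into it, including the empty one at [r = N]. *)
Lemma ultra_bounded (g : nat -> nat) N : (forall n, (g n < N)%N) ->
  exists r, ultra_nat [set n | g n = r].
Proof.
move=> hg; apply: contrapT => no.
have h r : ultra_nat [set n | (r <= g n)%N].
  elim: r => [|r IH]; first by apply: ultra_natW (filterT (F := ultra_nat)).
  apply: ultra_natW (ultra_natI IH (ultra_nat0 (A := [set n | g n = r]) _)).
    by move=> n /= [h1 h2]; rewrite ltn_neqAle h1 andbT; apply/eqP => e; apply: h2.
  by move=> h; apply: no; exists r.
by have [n /=] := ultra_nat_ex (h N); rewrite leqNgt hg.
Qed.

Lemma pseq_ge0 (x : padic) n : 0 <= x n.
Proof. by rewrite -pseq_mod modz_ge0 // P_neq0. Qed.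
Lemma pseq_lt (x : padic) n : x n < P n.
Proof. by rewrite -pseq_mod ltz_pmod // P_gt0. Qed.

Lemma ulim_subproof (s : nat -> padic) c : exists r : int, ultra_nat [set n | s n c = r].
Proof.
have [n|r hr] := @ultra_bounded (fun n => `|s n c|%N) (p ^ c).
  by rewrite -ltz_nat gez0_abs ?pseq_ge0 //; exact: pseq_lt.
exists r%:Z; apply: ultra_natW hr => n /= <-.
by rewrite gez0_abs // pseq_ge0.
Qed.

Definition ulim_seq (s : nat -> padic) c : int := sval (cid (ulim_subproof s c)).
Lemma ulim_seqP (s : nat -> padic) c : ultra_nat [set n | s n c = ulim_seq s c].
Proof. exact: svalP (cid (ulim_subproof s c)). Qed.

Lemma ulim_coh s : coherent (ulim_seq s).
Proof.
move=> c; have [n /= [<- <-]] := ultra_nat_ex (ultra_natI (ulim_seqP s c) (ulim_seqP s c.+1)).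
by rewrite -pseq_coh pseq_mod.
Qed.

Definition ulim s := mkpadic (@ulim_coh s).

Lemma ulimP (s : nat -> padic) c : ultra_nat [set n | s n c = ulim s c].
Proof.
have h := ulim_seqP s c; have [n /= hn] := ultra_nat_ex h.
by rewrite [ulim s c]mkpadicE -hn pseq_mod hn.
Qed.

Lemma ulim_eq (s : nat -> padic) (x : padic) : (forall c, ultra_nat [set n | s n c = x c]) -> ulim s = x.
Proof.
move=> h; apply: padicP => c.
by have [n /= [<- <-]] := ultra_nat_ex (ultra_natI (ulimP s c) (h c)).
Qed.

Lemma ulimD s t : ulim (fun n => s n + t n) = ulim s + ulim t.
Proof.
apply: ulim_eq => c; apply: ultra_natW (ultra_natI (ulimP s c) (ulimP t c)) => n /= [h1 h2].
by rewrite !pseqD h1 h2.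
Qed.
Lemma ulimM s t : ulim (fun n => s n * t n) = ulim s * ulim t.
Proof.
apply: ulim_eq => c; apply: ultra_natW (ultra_natI (ulimP s c) (ulimP t c)) => n /= [h1 h2].
by rewrite !pseqM h1 h2.
Qed.
Lemma ulim_cst x : ulim (fun=> x) = x.
Proof. by apply: ulim_eq => c; apply: ultra_natW (filterT (F := ultra_nat)). Qed.
Lemma ulim_small s : ulim (fun n => (p ^ n)%:R * s n) = 0.
Proof.
apply: ulim_eq => c; apply: (@ultra_natW [set n | (c <= n)%N]).
  by move=> n /= cn; rewrite -(pseq_le _ cn) padic_pdvd mod0z pseq0.
by apply: ultra_nat_oo; exists c.
Qed.

(* [der F a b]: along the sequence [F n], a function with value [a] has derivative [b], the
   increment of the variable being [p ^ n]. *)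
Definition der (F : nat -> padic) (a b : padic) :=
  exists2 y, (forall n, F n = a + (p ^ n)%:R * y n) & ulim y = b.

Lemma pX_neq0 n : (p ^ n)%:R != 0 :> padic.
Proof.
apply/eqP => h; have := @padic_int_eq0 (p ^ n)%:Z; rewrite -pmulrn => /(_ h)/eqP.
by rewrite (negbTE (P_neq0 n)).
Qed.

Lemma der_inj F a b b' : der F a b -> der F a b' -> b = b'.
Proof.
move=> [y hy <-] [y' hy' <-]; congr ulim; apply/funext => n.
by apply: (mulfI (pX_neq0 n)); apply: (addrI a); rewrite -hy -hy'.
Qed.
Lemma der_cst x : der (fun=> x) x 0.
Proof.
exists (fun=> 0); last by rewrite ulim_cst.
by move=> n; rewrite mulr0 addr0.
Qed.
Lemma derD F G a b a' b' : der F a b -> der G a' b' -> der (fun n => F n + G n) (a + a') (b + b').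
Proof.
move=> [y hy <-] [y' hy' <-]; exists (fun n => y n + y' n); last exact: ulimD.
by move=> n; rewrite hy hy' mulrDr addrACA.
Qed.
Lemma derM F G a b a' b' : der F a b -> der G a' b' ->
  der (fun n => F n * G n) (a * a') (b * a' + a * b').
Proof.
move=> [y hy <-] [y' hy' <-].
exists (fun n => y n * a' + a * y' n + (p ^ n)%:R * (y n * y' n)).
  by move=> n; rewrite hy hy'; ring.
by rewrite ulimD ulim_small addr0 ulimD !ulimM !ulim_cst.
Qed.

Lemma der_sum (I : Type) (r : seq I) (F : I -> nat -> padic) a b :
  (forall i, der (F i) (a i) (b i)) ->
  der (fun n => \sum_(i <- r) F i n) (\sum_(i <- r) a i) (\sum_(i <- r) b i).
Proof.
move=> h; elim: r => [|i r IH].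
  rewrite !big_nil; under [fun n => _]eq_fun do rewrite big_nil; exact: der_cst.
rewrite !big_cons; under [fun n => _]eq_fun do rewrite big_cons; exact: derD.
Qed.

(* Products are described by their logarithmic derivatives. *)
Lemma der_logM F G a b a' b' : der F a (a * b) -> der G a' (a' * b') ->
  der (fun n => F n * G n) (a * a') (a * a' * (b + b')).
Proof.
move=> h1 h2; have := derM h1 h2.
by rewrite (_ : a * b * a' + a * (a' * b') = a * a' * (b + b')) //; ring.
Qed.
Lemma der_logX F a b k : der F a (a * b) -> der (fun n => F n ^+ k) (a ^+ k) (a ^+ k * (b *+ k)).
Proof.
move=> h; elim: k => [|k IH].
  under [fun n => _]eq_fun do rewrite expr0; rewrite expr0 mulr0n mulr0; exact: der_cst.
under [fun n => _]eq_fun do rewrite exprS; rewrite exprS mulrS; exact: der_logM.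
Qed.
Lemma der_log_prod (I : Type) (r : seq I) (F : I -> nat -> padic) a b :
  (forall i, der (F i) (a i) (a i * b i)) ->
  der (fun n => \prod_(i <- r) F i n) (\prod_(i <- r) a i)
    (\prod_(i <- r) a i * \sum_(i <- r) b i).
Proof.
move=> h; elim: r => [|i r IH].
  rewrite !big_nil mulr0; under [fun n => _]eq_fun do rewrite big_nil; exact: der_cst.
rewrite !big_cons; under [fun n => _]eq_fun do rewrite big_cons; exact: der_logM.
Qed.

Hypothesis p_odd : (2 < p)%N.

Lemma expr1D_sq (A : comNzRingType) (t : A) k : exists r, (1 + t) ^+ k = 1 + t *+ k + t ^+ 2 * r.
Proof.
elim: k => [|k [r IH]]; first by exists 0; rewrite expr0 mulr0n mulr0 !addr0.
exists (k%:R + r + t * r); rewrite exprS IH !mulrS -mulr_natr; ring.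
Qed.

(** The binomial coefficients strictly between the ends are divisible by [p]; the terms of degree 2
    to [p - 1] are collected in [r]. *)
Lemma expr1D_p (A : comNzRingType) (t : A) :
  exists r, (1 + t) ^+ p = 1 + t *+ p + t ^+ 2 * r *+ p + t ^+ p.
Proof.
case: (p) p_pr p_odd => [|[|q]] // q_pr _.
exists (\sum_(i < q) t ^+ i *+ ('C(q.+2, i.+2) %/ q.+2)).
rewrite exprDn big_ord_recl big_ord_recl big_ord_recr.
rewrite !lift0 !expr1n !mul1r [ord0 : nat]/= [ord_max : nat]/= expr0 bin0 mulr1n expr1 bin1 binn mulr1n.
rewrite [LHS]addrA [LHS]addrA mulr_sumr -sumrMnl; congr (_ + _ + _); apply: eq_bigr => i _.
rewrite !lift0 expr1n mul1r mulrnAr -mulrnA divnK; last first.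
  by apply: prime_dvd_bin => //; rewrite !ltnS; exact: (ltn_ord i).
by rewrite -exprD add2n.
Qed.

Lemma pseq1_1 : (1 : padic) 1%N = 1.
Proof. by rewrite pseq1 expn1 modz_small // ltz_nat prime_gt1. Qed.

(** A [p]-th power raises the depth of a one-unit by exactly one and keeps the leading digit [w]
    modulo [p]. Oddness is needed for the last binomial term: [m * p] must be at least [m + 2],
    already for [m = 1]. *)
Lemma exp_p_step m (w : padic) : (0 < m)%N -> exists w' : padic,
  (1 + (p ^ m)%:R * w) ^+ p = 1 + (p ^ m.+1)%:R * w' /\ w' 1%N = w 1%N.
Proof.
case: m => // m _; have [r ->] := expr1D_p ((p ^ m.+1)%:R * w).
have [e he] : exists e, (m.+1 * p = m.+3 + e)%N.
  by exists (m.+1 * p - m.+3)%N; rewrite subnKC //; move: p_odd; nia.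
pose q : padic := p%:R; pose a := q ^+ m.
have q1 : (p ^ m.+1)%:R = q * a :> padic by rewrite natrX exprS.
have q2 : (p ^ m.+2)%:R = q * q * a :> padic by rewrite natrX !exprS mulrA.
have qp : ((p ^ m.+1)%:R * w) ^+ p = q * q * q * a * (q ^+ e * w ^+ p).
  by rewrite exprMn natrX -exprM he exprD !exprS !mulrA.
exists (w + (p ^ 1)%:R * (a * w ^+ 2 * r + q ^+ e * w ^+ p)); split; last first.
  by rewrite pseqD padic_pdvd addr0 pseq_mod.
rewrite qp q1 q2 expn1 -/q -[X in 1 + X + _ + _]mulr_natr -[X in 1 + _ + X + _]mulr_natr -/q.
ring.
Qed.

Lemma exp_pX m (w : padic) n : (0 < m)%N -> exists w' : padic,
  (1 + (p ^ m)%:R * w) ^+ (p ^ n) = 1 + (p ^ (m + n))%:R * w' /\ w' 1%N = w 1%N.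
Proof.
move=> m0; elim: n => [|n [w' [IH1 IH2]]]; first by exists w; rewrite addn0 expr1.
have [w'' [h1 h2]] := exp_p_step w' (leq_trans m0 (leq_addr n m)).
by exists w''; rewrite expnSr exprM IH1 h1 addnS h2.
Qed.

Definition one_unit (x : padic) := x 1%N = 1.

Lemma one_unitE x : one_unit x -> exists w, x = 1 + (p ^ 1)%:R * w.
Proof.
move=> h; have [|w hw] := @padic_divp (x - 1) 1%N.
  by rewrite pseqD pseqN pseq1_1 h modzDmr subrr mod0z.
by exists w; rewrite -hw addrC subrK.
Qed.

Lemma one_unit_der x : one_unit x -> exists b, der (fun n => x ^+ (p ^ n)) 1 b.
Proof.
move=> /one_unitE[w ->]; have /choice[w' hw'] := fun n => @exp_pX 1 w n (ltnSn 0).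
exists (ulim (fun n => (p ^ 1)%:R * w' n)); exists (fun n => (p ^ 1)%:R * w' n) => // n.
by case: (hw' n) => -> _; rewrite expnD natrM -mulrA mulrCA.
Qed.

(** The p-adic logarithm, as the limit of [(x ^+ (p ^ n) - 1) / p ^ n]; the default 0 is only
    reached where that quotient makes no sense. *)
Definition lam x : padic := if pselect (exists b, der (fun n => x ^+ (p ^ n)) 1 b) is left h
  then sval (cid h) else 0.
Lemma lamP x : one_unit x -> der (fun n => x ^+ (p ^ n)) 1 (lam x).
Proof.
move=> /one_unit_der h; rewrite /lam; case: pselect => // h'; exact: svalP (cid h').
Qed.

Lemma der_exp x (c : nat -> nat) : one_unit x ->
  der (fun n => x ^+ (p ^ n * c n)) 1 (lam x * ulim (fun n => (c n)%:R)).
Proof.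
move=> /lamP[y hy <-].
have /choice[r hr] := fun n => @expr1D_sq padic ((p ^ n)%:R * y n) (c n).
exists (fun n => y n * (c n)%:R + (p ^ n)%:R * (y n ^+ 2 * r n)).
  by move=> n; rewrite exprM hy hr -mulr_natr; ring.
by rewrite ulimD ulim_small addr0 ulimM.
Qed.

Lemma one_unitM x y : one_unit x -> one_unit y -> one_unit (x * y).
Proof. by rewrite /one_unit pseqM => -> ->; rewrite mulr1 -pseq1 pseq1_1. Qed.

Lemma lamM x y : one_unit x -> one_unit y -> lam (x * y) = lam x + lam y.
Proof.
move=> hx hy; apply: der_inj (lamP (one_unitM hx hy)) _.
under [fun n => _]eq_fun do rewrite exprMn.
by have := derM (lamP hx) (lamP hy); rewrite !mulr1 !mul1r.
Qed.

(** If [x = 1 + p ^ a.+1 * v] with [v] nonzero modulo [p], then [x ^+ (p ^ n)] is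
    [1 + p ^ (a.+1 + n) * w'] with [w'] congruent to [v] modulo [p] for every [n], so the limit
    defining the logarithm cannot be zero. *)
Lemma lam_eq0 x : one_unit x -> lam x = 0 -> x = 1.
Proof.
move=> hx l0; apply: contrapT => x1.
have [w xE] := one_unitE hx.
have [n wn] : exists n, w n != 0 by apply: padic_neq0; apply/eqP => w0; apply: x1; rewrite xE w0 mulr0 addr0.
pose q := fun n => w n != 0; have exq : exists n, q n by exists n.
case: (ex_minnP exq) => -[|a]; first by rewrite /q -(pseq_mod w 0) expn0 modz1 eqxx.
move=> wa minw.
have wa0 : w a = 0 by apply/eqP; apply: contrapT => /negP /minw; rewrite ltnn.
have [v wE] := padic_divp wa0.
have v1 : v 1%N != 0.
  apply: contraNneq wa => /padic_divp[u vE].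
  by rewrite /q wE vE mulrA -natrM -expnD addn1 padic_pdvd.
have xE' : x = 1 + (p ^ a.+1)%:R * v by rewrite xE wE mulrA -natrM -expnD add1n.
have /choice[w' hw'] := fun n => @exp_pX a.+1 v n (ltn0Sn a).
have d : der (fun n => x ^+ (p ^ n)) 1 ((p ^ a.+1)%:R * ulim w').
  exists (fun n => (p ^ a.+1)%:R * w' n); last by rewrite ulimM ulim_cst.
  by move=> k; case: (hw' k) => h _; rewrite xE' h expnD natrM -mulrA mulrCA.
have := der_inj d (lamP hx); rewrite l0 => /eqP; rewrite mulf_eq0 (negbTE (pX_neq0 _)) /= => /eqP u0.
have [k /=] := ultra_nat_ex (ulimP w' 1%N); rewrite u0 pseq0 => h.
by case: (hw' k) => _; rewrite h => e; rewrite -e eqxx in v1.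
Qed.
End Padic.

(** * Solutions of the Pell equation *)

Section Pell.
Context (D X Z : nat).

Fixpoint pell k : nat * nat :=
  if k is k'.+1 then ((pell k').1 * X + D * (pell k').2 * Z, (pell k').1 * Z + (pell k').2 * X)%N
  else (1, 0)%N.
Definition pellx k := (pell k).1.
Definition pelly k := (pell k).2.

Lemma pellD j k : (pellx (j + k) = pellx j * pellx k + D * pelly j * pelly k)%N /\
  (pelly (j + k) = pellx j * pelly k + pelly j * pellx k)%N.
Proof.
elim: j => [|j [IHx IHy]]; rewrite /pellx /pelly /= -/(pellx _) -/(pelly _).
  by rewrite muln0 mul1n mul0n !addn0 !mul1n.
rewrite -!/(pellx _) -!/(pelly _) IHx IHy; split; ring.
Qed.

Lemma pell1 : pellx 1 = X /\ pelly 1 = Z.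
Proof. by rewrite /pellx /pelly /= !mul1n !muln0 mul0n !addn0. Qed.

(** The [K]-th power of the unit [X + Z * sqrt D] is congruent to 1 modulo [Q], written without
    subtraction. *)
Definition unit_mod Q K := exists a c, pellx K = (1 + Q * a)%N /\ pelly K = (Q * c)%N.

Lemma unit_mod_mul Q K j : unit_mod Q K -> unit_mod Q (j * K).
Proof.
move=> [a [c [hx hy]]]; elim: j => [|j [a' [c' [IHx IHy]]]].
  by exists 0%N, 0%N; rewrite !muln0.
rewrite /unit_mod mulSn; have [-> ->] := pellD K (j * K); rewrite hx hy IHx IHy.
exists (a + a' + Q * a * a' + D * c * c' * Q)%N, (c + c' + Q * a * c' + c * Q * a')%N.
by split; ring.
Qed.

Lemma unit_modD Q K k : unit_mod Q K -> exists c d,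
  pellx (k + K) = (pellx k + Q * c)%N /\ pelly (k + K) = (pelly k + Q * d)%N.
Proof.
move=> [a [c [hx hy]]]; have [-> ->] := pellD k K; rewrite hx hy.
by exists (pellx k * a + D * pelly k * c)%N, (pellx k * c + pelly k * a)%N; split; ring.
Qed.

(** Modulo the square of [Q], powers of a unit congruent to 1 are linear in the exponent; for the
    exponent [p] the linear term is divisible by [p * Q], and so is the square of [Q] because [p]
    divides [Q]. *)
Lemma pell_lift p Q K : (p %| Q)%N -> unit_mod Q K -> unit_mod (p * Q) (p * K).
Proof.
move=> /dvdnP[s sQ] [a [c [xE yE]]].
have h j : exists u v, (pellx (j * K) = 1 + j * Q * a + Q * Q * u)%N /\ (pelly (j * K) = j * Q * c + Q * Q * v)%N.
  elim: j => [|j [u [v [hu hv]]]]; first by exists 0%N, 0%N; rewrite !mul0n !muln0.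
  rewrite mulSn; have [-> ->] := pellD K (j * K); rewrite xE yE hu hv.
  exists (u + j * a * a + Q * a * u + D * c * (j * c + Q * v))%N.
  exists (v + Q * a * v + a * j * c + c * j * a + Q * c * u)%N.
  by split; ring.
rewrite /unit_mod; have [u [v [-> ->]]] := h p.
exists (a + s * u)%N, (c + s * v)%N; split; rewrite {3}sQ; ring.
Qed.

Hypothesis Pell : (X ^ 2 = D * Z ^ 2 + 1)%N.

Lemma pell_norm k : (pellx k ^ 2 = D * pelly k ^ 2 + 1)%N.
Proof.
elim: k => [|k]; first by rewrite /= muln0.
rewrite /pellx /pelly /= -/(pellx k) -/(pelly k); move: (pellx k) (pelly k) => x y IH.
transitivity (x ^ 2 * X ^ 2 + 2 * (D * x * X * y * Z) + D * y ^ 2 * (D * Z ^ 2))%N; first by ring.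
transitivity (D * (x ^ 2 * Z ^ 2 + 2 * (x * X * y * Z) + y ^ 2 * X ^ 2) + 1)%N; last by ring.
by rewrite IH Pell; ring.
Qed.

Lemma pellx_gt0 k : (0 < pellx k)%N.
Proof. by have := pell_norm k; case: (pellx k) => //; rewrite addn1. Qed.

(** Two powers of the unit agree modulo [q] by the pigeonhole principle, and their quotient is
    congruent to 1 because norms are 1. *)
Lemma pell_period q : (0 < q)%N -> exists2 M, (0 < M)%N & unit_mod q M.
Proof.
case: q => // q _.
pose f (i : 'I_(q.+1 * q.+1).+1) : 'I_q.+1 * 'I_q.+1 := (inord (pellx i %% q.+1), inord (pelly i %% q.+1)).
have [t [t' tt' e]] : exists t : 'I_(q.+1 * q.+1).+1, exists2 t' : 'I_(q.+1 * q.+1).+1, (t < t')%N & f t = f t'.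
  apply: contrapT => no.
  have inj : injective f.
    move=> t t' e; apply: val_inj; apply/eqP; rewrite eqn_leq; apply/andP; split;
      rewrite leqNgt; apply/negP => h; apply: no.
      by exists t', t.
    by exists t, t'.
  by have := leq_card _ inj; rewrite card_prod !card_ord ltnn.
have ex : pellx t = pellx t' %[mod q.+1].
  by have := congr1 (fun u => nat_of_ord u.1) e; rewrite !inordK // ltn_mod.
have ey : pelly t = pelly t' %[mod q.+1].
  by have := congr1 (fun u => nat_of_ord u.2) e; rewrite !inordK // ltn_mod.
have nt : (pellx t * pellx t = D * (pelly t * pelly t) + 1)%N by exact: pell_norm.
have := pellD t (t' - t); rewrite subnKC ?(ltnW tt') // => -[xe ye].
have px0 := pellx_gt0 (t' - t).
exists (t' - t)%N; first by rewrite subn_gt0.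
rewrite /unit_mod; move: (pellx t) (pelly t) (pellx t') (pelly t') (pellx (t' - t)) (pelly (t' - t)) ex ey xe ye nt px0.
move=> a b a' b' x y ex ey xe ye nt px0.
(* multiply by the inverse [(a, -b)] of [(a, b)] *)
have h1 : (x + D * (b * b') = a * a')%N.
  rewrite xe ye; transitivity ((D * (b * b) + 1) * x + D * a * b * y)%N; first by ring.
  by rewrite -nt; ring.
have h2 : (y + b * a' = a * b')%N.
  rewrite xe ye; transitivity ((D * (b * b) + 1) * y + a * b * x)%N; first by ring.
  by rewrite -nt; ring.
have h3 : (x + D * (b * b') = 1 + D * (b * b') %[mod q.+1])%N.
  rewrite h1 -modnMmr -ex modnMmr nt [in RHS]addnC; apply/eqP; rewrite eqn_modDr; apply/eqP.
  by rewrite !mulnA -[LHS]modnMmr ey modnMmr.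
have h4 : (y + b * a' = 0 + b * a' %[mod q.+1])%N.
  by rewrite h2 add0n -modnMmr -ey modnMmr -[in RHS]modnMmr -ex modnMmr mulnC.
move/eqP: h3; rewrite eqn_modDr eqn_mod_dvd // => /dvdnP[u hu].
move/eqP: h4; rewrite eqn_modDr mod0n => /dvdnP[v hv].
exists u, v; split; last by rewrite hv mulnC.
by rewrite mulnC -hu subnKC.
Qed.

Section Ring.
Context (A : comNzRingType) (d : A).
Hypothesis d2 : d ^+ 2 = D%:R.

Lemma pell_exp k : (X%:R + Z%:R * d) ^+ k = (pellx k)%:R + (pelly k)%:R * d.
Proof.
elim: k => [|k IH]; first by rewrite expr0 mul0r addr0.
rewrite exprSr IH /pellx /pelly /= -/(pellx k) -/(pelly k) !natrD !natrM -d2; ring.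
Qed.

Lemma pell_expN k : (X%:R - Z%:R * d) ^+ k = (pellx k)%:R - (pelly k)%:R * d.
Proof.
elim: k => [|k IH]; first by rewrite expr0 mul0r subr0.
rewrite exprSr IH /pellx /pelly /= -/(pellx k) -/(pelly k) !natrD !natrM -d2; ring.
Qed.

Lemma pell_inv : (X%:R + Z%:R * d) * (X%:R - Z%:R * d) = 1.
Proof.
have := congr1 (fun n => n%:R : A) Pell; rewrite natrD natrM !natrX -d2 => e.
rewrite (_ : _ * _ = X%:R ^+ 2 - d ^+ 2 * Z%:R ^+ 2); last by ring.
by rewrite e addrAC subrr add0r.
Qed.
End Ring.
End Pell.

(** * Strips of times *)

Section Strips.
Context (R : realType) (m : nat) (w : 'I_m -> R).
Hypothesis w_gt0 : forall l, 0 < w l.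

(** With [w l] the logarithm of a unit, this says that the powers of the units at time [k] agree up
    to a factor [exp B]. *)
Definition strip (B : R) (k : 'I_m -> nat) :=
  forall l l', `|(k l)%:R * w l - (k l')%:R * w l'| < B.

Lemma strip_mono B B' k : B <= B' -> strip B k -> strip B' k.
Proof. by move=> h hk l l'; exact: lt_le_trans (hk l l') h. Qed.

Lemma strip_add B B' k P : strip B k -> strip B' P -> strip (B + B') (fun l => k l + P l)%N.
Proof.
move=> hk hP l l'; rewrite !natrD.
rewrite (_ : _ - _ = ((k l)%:R * w l - (k l')%:R * w l') + ((P l)%:R * w l - (P l')%:R * w l')); last by ring.
by apply: le_lt_trans (ler_normD _ _) _; exact: ltrD.
Qed.

Lemma strip_sub B k P : strip B k -> strip B (fun l => k l + P l)%N -> strip (B + B) P.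
Proof.
move=> hk hP l l'.
rewrite (_ : _ - _ = ((k l + P l)%:R * w l - (k l' + P l')%:R * w l') - ((k l)%:R * w l - (k l')%:R * w l')); last first.
  by rewrite !natrD; ring.
by apply: le_lt_trans (ler_normB _ _) _; exact: ltrD.
Qed.

Lemma strip_scale B k M : (0 < M)%N -> strip (B / M%:R) k -> strip B (fun l => M * k l)%N.
Proof.
move=> M0 hk l l'; rewrite !natrM -!mulrA -mulrBr normrM normr_nat mulrC -ltr_pdivlMr ?ltr0n //.
Qed.

(* Dirichlet: the residues of multiples of a large [T] modulo the weights lie in finitely many
   small boxes. *)
Lemma strip_far B (N : nat) : 0 < B -> exists P, strip B P /\ forall l, (N <= P l)%N.
Proof.
move=> B0.
have [n hn] : exists n : nat, forall l, w l < (n.+1)%:R * (B / 2).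
  have [n hn] : exists n : nat, (\sum_l w l) / (B / 2) < n%:R.
    by exists (Num.bound (\sum_l w l / (B / 2))); rewrite mulr_suml; apply: archi_boundP;
      apply: sumr_ge0 => l _; rewrite ltW // divr_gt0 // divr_gt0.
  exists n => l; rewrite -ltr_pdivrMr ?divr_gt0 //; apply: le_lt_trans (lt_trans hn _); last by rewrite ltr_nat.
  rewrite ler_pM2r ?invr_gt0 ?divr_gt0 // (bigD1 l) //= lerDl sumr_ge0 // => i _; exact: ltW.
have [T hT] : exists T : R, 0 < T /\ forall l, N%:R * w l + B <= T.
  exists (N%:R * (\sum_l w l) + B); split=> [|l].
    by rewrite ltr_wpDl // mulr_ge0 // sumr_ge0 // => l _; exact: ltW.
  rewrite lerD2r ler_wpM2l // (bigD1 l) //= lerDl sumr_ge0 // => i _; exact: ltW.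
pose q (t : nat) l := Num.truncn (t%:R * T / w l).
pose rs (t : nat) l := t%:R * T - (q t l)%:R * w l.
have Tpos := hT.1.
have hq t l : 0 <= rs t l < w l.
  have h0 : 0 <= t%:R * T / w l.
    by apply: divr_ge0; [apply: mulr_ge0; [exact: ler0n | exact: ltW] | exact: ltW].
  have /andP[h1 h2] := Num.Theory.truncn_itv h0.
  rewrite subr_ge0 -ler_pdivlMr // h1 /= ltrBlDr -{1}(mul1r (w l)) -mulrDl.
  by rewrite -ltr_pdivrMr // addrC natr1.
pose box (t : 'I_(#|{ffun 'I_m -> 'I_n.+1}|).+1) : {ffun 'I_m -> 'I_n.+1} :=
  [ffun l => inord (Num.truncn (rs t l / (B / 2)))].
have [t [t' tt' eb]] : exists t : 'I_(#|{ffun 'I_m -> 'I_n.+1}|).+1, exists2 t' : 'I_(#|{ffun 'I_m -> 'I_n.+1}|).+1, (t < t')%N & box t = box t'.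
  apply: contrapT => no.
  have inj : injective box.
    move=> t t' e; apply: val_inj; apply/eqP; rewrite eqn_leq; apply/andP; split;
      rewrite leqNgt; apply/negP => h; apply: no.
      by exists t', t.
    by exists t, t'.
  have := leq_card _ inj; by rewrite card_ord ltnn.
have B20 : 0 < B / 2 by rewrite divr_gt0.
have close l : `|rs t l - rs t' l| < B / 2.
  have := congr1 (fun f : {ffun 'I_m -> 'I_n.+1} => nat_of_ord (f l)) eb; rewrite !ffunE.
  have tr s : 0 <= rs s l / (B / 2) by rewrite divr_ge0 ?(ltW B20) //; case/andP: (hq s l).
  have sm s : (Num.truncn (rs s l / (B / 2)) < n.+1)%N.
    rewrite -(ltr_nat R); have /andP[h1 _] := Num.Theory.truncn_itv (tr s).
    apply: le_lt_trans h1 _; rewrite ltr_pdivrMr //; apply: lt_trans (hn l); by case/andP: (hq s l).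
  rewrite !inordK // => e.
  have /andP[a1 a2] := Num.Theory.truncn_itv (tr t).
  have /andP[b1 b2] := Num.Theory.truncn_itv (tr t').
  rewrite e in a1 a2; rewrite ler_pdivlMr // in a1; rewrite ler_pdivlMr // in b1.
  rewrite ltr_pdivrMr // -natr1 mulrDl mul1r in a2; rewrite ltr_pdivrMr // -natr1 mulrDl mul1r in b2.
  by rewrite ltr_norml; apply/andP; split; lra.
pose P l := (q t' l - q t l)%N.
have qle l : (q t l <= q t' l)%N.
  apply: Num.Theory.le_truncn; rewrite ler_pM2r ?invr_gt0 // ler_pM2r // ler_nat; exact: ltnW.
have PE l : (P l)%:R * w l = (t'%:R - t%:R) * T + (rs t l - rs t' l).
  by rewrite natrB // /rs; ring.
exists P; split=> [l l'|l].
  rewrite !PE; have := close l; have := close l'; rewrite !ltr_norml => /andP[? ?] /andP[? ?].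
  by apply/andP; split; lra.
rewrite -(ler_nat R) -(ler_pM2r (w_gt0 l)) PE.
have h1 : T <= (t'%:R - t%:R) * T.
  by rewrite ler_peMl ?(ltW Tpos) // -natrB ?(ltnW tt') // ler1n subn_gt0.
have := hT.2 l; have := close l; rewrite ltr_norml => /andP[? ?] ?; lra.
Qed.

(* Almost closed times span a space whose dimension stabilises, so that a fixed time is a rational
   combination of arbitrarily almost closed ones; rounding the coefficients keeps the
   divisibility of a component under control. *)
Lemma strip_lowval p l : prime p -> exists c, forall B, 0 < B ->
  exists P, [/\ strip B P, (0 < P l)%N & (logn p (P l) <= c)%N].
Proof.
move=> p_pr.
(* [F j] says that arbitrarily narrow strips contain [j] linearly independent times; the largest
   such [j] is the stable dimension. *)
pose F j := forall B, 0 < B -> exists b : 'I_j -> 'I_m -> nat,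
  (forall i, strip B (b i)) /\ row_free (\matrix_(i < j, l' < m) ((b i l')%:R : rat)).
have F0 : F 0%N.
  move=> B _; exists (fun _ _ => 0%N); split=> [[]//|]; by rewrite /row_free -leqn0 rank_leq_row.
have Fm : ~ F m.+1.
  move=> /(_ 1 ltr01)[b [_ h]]; move: (rank_leq_col (\matrix_(i < m.+1, l' < m) ((b i l')%:R : rat))).
  by rewrite (eqP h) ltnn.
have [j Fj Fj1] : exists2 j, F j & ~ F j.+1.
  apply: contrapT => no; apply: Fm; elim: m.+1 => // n IH; apply: contrapT => h; apply: no; by exists n.
have [e0 e00 he0] : exists2 e0, 0 < e0 & forall b : 'I_j.+1 -> 'I_m -> nat, (forall i, strip e0 (b i)) ->
    ~~ row_free (\matrix_(i < j.+1, l' < m) ((b i l')%:R : rat)).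
  apply: contrapT => no; apply: Fj1 => B B0; apply: contrapT => no'; apply: no; exists B => // b hb.
  by apply/negP => hf; apply: no'; exists b.
have [Q [Qs Ql]] := strip_far 1 e00.
exists (logn p (Q l)) => B B0.
(* Division by [j.+1] leaves room for a combination of [j] of these times with coefficients in
   [[0, 1)]. *)
pose e := Num.min e0 (B / (j.+1)%:R).
have e_0 : 0 < e by rewrite lt_min e00 divr_gt0.
have [b [bs bf]] := Fj e e_0.
pose M := \matrix_(i < j, l' < m) ((b i l')%:R : rat).
pose v : 'rV[rat]_m := \row_l' (Q l')%:R.
have /submxP[x vx] : (v <= M)%MS.
  pose b' (i : 'I_j.+1) := if unlift ord0 i is Some i' then b i' else Q.
  have := he0 b' _; set M1 := \matrix_(_, _) _.
  have eM : M1 = @col_mx rat 1 j m v M.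
    apply/matrixP => i l'; rewrite !mxE /b'; case: splitP => i' e'.
      rewrite ord1 in e'; have -> : i = ord0 by apply: ord_inj.
      by rewrite unlift_none mxE.
    have -> : i = lift ord0 i' by apply: ord_inj; rewrite lift0; exact: e'.
    by rewrite liftK mxE.
  move=> h; apply: contrapT => /negP vM; have /negP[] : ~~ row_free M1.
    apply: h => i; rewrite /b'; case: unliftP => [i' _|_] //.
    by apply: strip_mono (bs i'); rewrite ge_min lexx.
  have -> : row_free M1 = (\rank (v + M)%MS == j.+1) by rewrite eM /row_free (addsmxE v M).
  have [v0|v0] := eqVneq v 0; first by rewrite v0 sub0mx in vM.
  rewrite mxrank_disjoint_sum ?(eqP bf) ?rank_rV ?v0 //.
  apply/eqP; rewrite -mxrank_eq0 -leqn0 leqNgt; apply: contra vM => r1.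
  apply: submx_trans (capmxSr v M).
  rewrite -(mxrank_leqif_sup (capmxSl v M)) eqn_leq mxrankS ?capmxSl //=.
  by rewrite rank_rV v0.
have Qe l' : (Q l')%:R = \sum_i x 0 i * (b i l')%:R :> rat.
  by have := congr1 (fun A : 'rV_m => A 0 l') vx; rewrite !mxE => ->; apply: eq_bigr => i _; rewrite mxE.
pose y i := Num.floor (x 0 i).
pose u l' : int := (Q l')%:Z - \sum_i y i * (b i l')%:Z.
pose fr i : rat := x 0 i - (y i)%:~R.
have fr_itv i : 0 <= fr i < 1.
  have /andP[h1 h2] := Num.Theory.floor_itv (x 0 i); rewrite subr_ge0 h1 /= ltrBlDl.
  by rewrite intrD in h2.
have uE l' : (u l')%:~R = \sum_i fr i * (b i l')%:R :> rat.
  rewrite rmorphB /= rmorph_sum /= -pmulrn Qe -sumrB; apply: eq_bigr => i _.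
  by rewrite rmorphM /= -pmulrn mulrBl.
have u0 l' : 0 <= u l'.
  rewrite -(ler0z rat) uE; apply: sumr_ge0 => i _; rewrite mulr_ge0 //; by case/andP: (fr_itv i).
pose P l' := `|u l'|%N.
have PE l' : (P l')%:R = \sum_i ratr (fr i) * (b i l')%:R :> R.
  rewrite pmulrn gez0_abs //.
  have := congr1 (ratr : rat -> R) (uE l'); rewrite ratr_int => ->.
  by rewrite rmorph_sum; apply: eq_bigr => i _; rewrite rmorphM /= ratr_nat.
have eB : e * (j.+1)%:R <= B by rewrite -ler_pdivlMr // ge_min lexx orbT.
have Ps : strip B P.
  move=> l1 l2; rewrite !PE !mulr_suml -sumrB.
  apply: le_lt_trans (ler_norm_sum _ _ _) _; apply: lt_le_trans eB.
  apply: (@le_lt_trans _ _ (\sum_(i < j) e)); last first.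
    by rewrite sumr_const card_ord -[X in X < _]mulr_natr ltr_pM2l // ltr_nat.
  apply: ler_sum => i _; rewrite -[ratr _ * _ * w l1]mulrA -[ratr _ * _ * w l2]mulrA -mulrBr normrM.
  have /andP[f0 f1] := fr_itv i.
  have g0 : 0 <= ratr (fr i) :> R by rewrite ler0q.
  have g1 : ratr (fr i) <= 1 :> R by rewrite -[leRHS](ratr_nat R 1) ler_rat ltW.
  by rewrite ger0_norm // -[leRHS]mul1r ler_pM // ltW // bs.
have [P1|P1] := boolP ((0 < P l)%N && (logn p (P l) <= logn p (Q l))%N).
  by case/andP: P1 => P1 P2; exists P.
have bsB i : strip B (b i).
  apply: strip_mono (bs i); apply: le_trans eB; by rewrite ler_peMr ?(ltW e_0) // (ler_nat R 1).
(* Otherwise the remainder [P] and all the [b i] would be divisible at [l] by a power of [p] that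
   exceeds the valuation of [Q l], although [Q] is an integral combination of them. *)
apply: contrapT => no.
pose c := (logn p (Q l)).+1.
have div i : (p ^ c %| b i l)%N.
  have [->|b0] := posnP (b i l); first by rewrite dvdn0.
  rewrite pfactor_dvdn // ltnNge; apply/negP => h; apply: no; by exists (b i).
have divP : (p ^ c %| P l)%N.
  have [->|b0] := posnP (P l); first by rewrite dvdn0.
  by rewrite pfactor_dvdn // ltnNge; apply: contra P1 => h; rewrite b0.
have : (p ^ c %| Q l)%N.
  have /eqP : (Q l)%:Z = u l + \sum_i y i * (b i l)%:Z by rewrite /u subrK.
  rewrite -(gez0_abs (u0 l)) -/(P l) => /eqP e'.
  suff : ((p ^ c)%N%:Z %| (Q l)%:Z)%Z by [].
  rewrite e'; apply: rpredD; first exact: divP.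
  by apply: rpred_sum => i _; apply: dvdz_mull; exact: div.
by rewrite pfactor_dvdn // ltnn.
Qed.
End Strips.

(** * Low monomials and the Euler operator *)

Section Monomials.
Context (A : idomainType) (m : nat).
Implicit Types (p q : mpoly m A) (e : multinom m).

Lemma mcoeffM_supp p q e : mcoeff e (p * q) =
  \sum_(a <- msupp p) \sum_(b <- msupp q) mcoeff a p * mcoeff b q * (mnm_add a b == e)%:R.
Proof.
rewrite [in LHS](mpolyE p) [in LHS](mpolyE q) mulr_suml raddf_sum; apply: eq_bigr => a _ /=.
rewrite mulr_sumr raddf_sum; apply: eq_bigr => b _ /=.
by rewrite -scalerAl -scalerAr mcoeffZ mcoeffZ -mpolyXD mcoeffX mulrA.
Qed.

Lemma mcoeffX_neq0 (a b : multinom m) : mcoeff a (mpolyX A b) != 0 -> a = b.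
Proof. by rewrite mcoeffX; case: (eqVneq b a) => [->//|_]; rewrite mulr0n eqxx. Qed.

Lemma mcoeffM_neq0 p q e : mcoeff e (p * q) != 0 ->
  exists a b, [/\ mcoeff a p != 0, mcoeff b q != 0 & e = mnm_add a b].
Proof.
move=> h; apply: contrapT => no; move/eqP: h; apply; rewrite mcoeffM_supp.
rewrite big_seq big1 // => a ha; rewrite big_seq big1 // => b hb.
case: eqP => [e'|_]; last by rewrite mulr0.
by case: no; exists a, b; rewrite -!mcoeff_msupp.
Qed.

Lemma seq_min (s : seq (multinom m)) : s != [::] -> exists2 x, x \in s & forall y, y \in s -> (x <= y)%O.
Proof.
elim: s => // a [|b s] IH _.
  by exists a; rewrite ?mem_head // => y; rewrite inE => /eqP ->.
have [//|x xs hx] := IH; have [ax|xa] := leP a x.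
  exists a; rewrite ?mem_head // => y; rewrite inE => /orP[/eqP -> //|/hx]; exact: le_trans.
exists x; first by rewrite inE xs orbT.
by move=> y; rewrite inE => /orP[/eqP ->|/hx //]; exact: ltW.
Qed.

Lemma low_monomial p : p != 0 -> exists mu, mcoeff mu p != 0 /\ forall e, mcoeff e p != 0 -> (mu <= e)%O.
Proof.
move=> p0; have [|x xs hx] := @seq_min (msupp p); first by rewrite msupp_eq0.
by exists x; split=> [|e]; rewrite -mcoeff_msupp //; exact: hx.
Qed.

Lemma low_monomialM p q mu nu : (forall e, mcoeff e p != 0 -> (mu <= e)%O) ->
  (forall e, mcoeff e q != 0 -> (nu <= e)%O) ->
  mcoeff (mnm_add mu nu) (p * q) = mcoeff mu p * mcoeff nu q /\
  forall e, mcoeff e (p * q) != 0 -> (mnm_add mu nu <= e)%O.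
Proof.
move=> hp hq; split; last first.
  by move=> e /mcoeffM_neq0[a [b [ha hb ->]]]; apply: lem_add; [exact: hp | exact: hq].
have big_pick (r : mpoly m A) nu' (f : multinom m -> A) : (forall b, b != nu' -> mcoeff b r != 0 -> f b = 0) ->
    (mcoeff nu' r = 0 -> f nu' = 0) -> \sum_(b <- msupp r) f b = f nu'.
  move=> h1 h2; have [h|h] := boolP (nu' \in msupp r).
    rewrite (bigD1_seq nu') ?msupp_uniq //= big_seq_cond big1 ?addr0 // => b /andP[hb bn].
    by apply: h1; rewrite // -mcoeff_msupp.
  rewrite h2; last by apply/eqP; move: h; rewrite mcoeff_msupp negbK.
  rewrite big_seq big1 // => b hb; apply: h1; last by rewrite -mcoeff_msupp.
  by apply: contraNneq h => <-.
rewrite mcoeffM_supp (big_pick p mu).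
- rewrite (big_pick q nu) ?eqxx ?mulr1 // => [b bn hb|->]; last by rewrite mulr0 ?mul0r.
  case: eqP => [e|_]; last by rewrite mulr0.
  by case/eqP: bn; move/eqP: e; rewrite eqm_add2l => /eqP.
- move=> a an ha; rewrite big_seq big1 // => b; rewrite mcoeff_msupp => hb.
  case: eqP => [e|_]; last by rewrite mulr0.
  have : (mnm_add mu nu < mnm_add a b)%O.
    by apply: ltmc_le_add; [rewrite lt_neqAle eq_sym an hp | exact: hq].
  by rewrite e ltxx.
- by move=> ->; rewrite big1 // => b _; rewrite !mul0r.
Qed.
End Monomials.

(** * The Euler operator as derivation in the time *)

Section Euler.
Context (A : idomainType) (m : nat) (phi : 'I_m -> A).
Implicit Types (p q : mpoly m A) (e mu : multinom m).

Definition weight mu : A := \sum_l phi l *+ mu l.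
(** Differentiation in the time: if the variable [l] stands for a unit power with logarithmic
    derivative [phi l], the monomial [mu] has logarithmic derivative [weight mu]. *)
Definition euler q : mpoly m A := \sum_(mu <- msupp q) (mcoeff mu q * weight mu) *: mpolyX A mu.

Lemma euler_supp q e : mcoeff e (euler q) != 0 -> mcoeff e q != 0.
Proof.
rewrite raddf_sum /=; apply: contraNneq => h; rewrite big_seq big1 // => a ha.
rewrite mcoeffZ mcoeffX; case: eqP => [ae|_]; last by rewrite mulr0.
by rewrite ae h !mul0r.
Qed.

(* [euler] preserves degrees, so only the factor of [q * q0] reaches the extreme degrees. *)
Lemma euler_lead c kap (Lin B q q0 : mpoly m A) :
  (forall e, mcoeff e Lin != 0 -> mdeg e = 1%N) ->
  (forall e, mcoeff e B != 0 -> (mdeg e < mdeg kap)%N) ->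
  q != 0 -> q0 != 0 ->
  c *: (mpolyX A kap * (q0 * euler q - q * euler q0)) + (Lin * mpolyX A kap - B) * (q * q0) = 0 ->
  Lin = 0 /\ B = 0.
Proof.
move=> hL hB qn q0n; set W := q0 * _ - _; set T := Lin * _ - _ => hT.
have WT M : mcoeff M (T * (q * q0)) != 0 -> exists a b,
    [/\ mcoeff a q != 0, mcoeff b q0 != 0 & M = mnm_add kap (mnm_add a b)].
  move=> h; have : mcoeff M (mpolyX A kap * W) != 0.
    apply: contraNneq h => h; have := congr1 (mcoeff M) hT.
    by rewrite mcoeffD mcoeffZ h mulr0 add0r mcoeff0 => ->.
  move=> /mcoeffM_neq0[a [b [ha hb ->]]].
  rewrite (mcoeffX_neq0 ha).
  have : mcoeff b (q0 * euler q) != 0 \/ mcoeff b (q * euler q0) != 0.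
    have [e1|] := eqVneq (mcoeff b (q0 * euler q)) 0; last by left.
    by right; apply: contraNneq hb; rewrite /W mcoeffB e1 => ->; rewrite subr0.
  case=> /mcoeffM_neq0[x [y [hx /euler_supp hy ->]]]; last by exists x, y.
  by exists y, x; split=> //; rewrite [mnm_add x y]addmC.
have coefL e : mcoeff (mnm_add e kap) (Lin * mpolyX A kap) = mcoeff e Lin.
  by rewrite addmC mcoeffMX.
have T0 (e : multinom m) : mcoeff e T != 0 -> (mdeg e <= (mdeg kap).+1)%N.
  rewrite mcoeffB; have [->|hb] := eqVneq (mcoeff e B) 0; last by move=> _; apply: ltnW; apply: ltnW; exact: hB.
  rewrite subr0 => /mcoeffM_neq0[a [b [/hL ha hb ->]]]; rewrite mdegD ha add1n.
  by rewrite (mcoeffX_neq0 hb).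
split.
- apply: contrapT => /eqP Ln.
  have Te : mcoeff (mnm_add (mlead Lin) kap) T != 0.
    rewrite mcoeffB coefL (_ : mcoeff _ B = 0) ?subr0 ?mleadc_eq0 //.
    by apply: contrapT => /eqP /hB; rewrite mdegD ltnNge leq_addl.
  have Tn : T != 0 by apply: contraNneq Te => ->; rewrite mcoeff0.
  have Td : (mdeg kap < mdeg (mlead T))%N.
    have /lemc_mdeg : (mnm_add (mlead Lin) kap <= mlead T)%O.
      by apply: msupp_le_mlead; rewrite mcoeff_msupp.
    by rewrite mdegD hL ?mleadc_eq0.
  have qq : q * q0 != 0 by rewrite mulf_neq0.
  have : mcoeff (mlead (T * (q * q0))) (T * (q * q0)) != 0 by rewrite mleadc_eq0 mulf_neq0.
  move/WT => [a [b [ha hb]]]; rewrite mleadM // mleadM // => /(congr1 (@mdeg _)).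
  rewrite !mdegD.
  have /lemc_mdeg : (a <= mlead q)%O by apply: msupp_le_mlead; rewrite mcoeff_msupp.
  have /lemc_mdeg : (b <= mlead q0)%O by apply: msupp_le_mlead; rewrite mcoeff_msupp.
  by move: Td; clear; lia.
- apply: contrapT => /eqP Bn.
  have [nu [Bnu Bmin]] := low_monomial Bn.
  have nud : (mdeg nu < mdeg kap)%N by exact: hB.
  have [mu [qmu qmin]] := low_monomial qn.
  have [mu0 [q0mu q0min]] := low_monomial q0n.
  have Lnu e : (mdeg e <= mdeg kap)%N -> mcoeff e (Lin * mpolyX A kap) = 0.
    move=> he; apply: contrapT => /eqP /mcoeffM_neq0[a [b [/hL ha hb ee]]].
    have bk := mcoeffX_neq0 hb.
    by move: he; rewrite ee mdegD ha bk ltnn.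
  have Tnu : mcoeff nu T != 0 by rewrite mcoeffB Lnu ?sub0r ?oppr_eq0 //; exact: ltnW nud.
  have Tmin e : mcoeff e T != 0 -> (nu <= e)%O.
    rewrite mcoeffB => h; have [de|de] := leqP (mdeg e) (mdeg kap).
      by apply: Bmin; move: h; rewrite Lnu // sub0r oppr_eq0.
    rewrite leNgt; apply/negP => /ltW /lemc_mdeg; move: nud de; clear; lia.
  have [e1 m1] := low_monomialM qmin q0min.
  have [e2 m2] := low_monomialM Tmin m1.
  have : mcoeff (mnm_add nu (mnm_add mu mu0)) (T * (q * q0)) != 0.
    by rewrite e2 e1 !mulf_neq0.
  move/WT => [a [b [ha hb]]] => /(congr1 (@mdeg _)); rewrite !mdegD.
  have /lemc_mdeg := qmin _ ha; have /lemc_mdeg := q0min _ hb.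
  by move: nud; clear; lia.
Qed.
End Euler.

(** * Density of the orbits in the p-adic integers *)

Section Density.
Context (p : nat) (p_pr : prime p) (p_odd : (2 < p)%N).
Notation ZZ := (padic p_pr).
Context (R : realType) (m s n : nat) (w : 'I_m -> R) (w_gt0 : forall l, 0 < w l).
Context (bl : 'I_n -> 'I_m) (jj : 'I_n -> 'I_s) (isx : 'I_n -> bool).
Hypothesis var_inj : forall i i', bl i = bl i' -> jj i = jj i' -> isx i = isx i' -> i = i'.
Context (D X Z : 'I_m -> nat).
Hypothesis Pell : forall l, (X l ^ 2 = D l * Z l ^ 2 + 1)%N.
Context (b b' : 'I_s -> ZZ) (dl th : 'I_m -> ZZ).
Hypothesis bK : forall j, b j * b' j = 1.
Hypothesis dl2 : forall l, dl l ^+ 2 = (D l)%:R.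
Hypothesis dlK : forall l, th l * dl l = 1.
Notation kap l := ((X l)%:R + (Z l)%:R * dl l : ZZ).
Notation kab l := ((X l)%:R - (Z l)%:R * dl l : ZZ).
Hypothesis b_indep : forall u v : 'I_s -> nat, \prod_j b j ^+ u j = \prod_j b j ^+ v j -> u =1 v.
Hypothesis kap_indep : forall u v : 'I_m -> nat,
  \prod_l kap l ^+ u l = \prod_l kap l ^+ v l -> u =1 v.

Definition zexp (k : 'I_m -> nat) i :=
  if isx i then pellx (D (bl i)) (X (bl i)) (Z (bl i)) (k (bl i))
  else pelly (D (bl i)) (X (bl i)) (Z (bl i)) (k (bl i)).
Definition zval k i : ZZ := b (jj i) ^+ zexp k i.
Definition kval (k : 'I_m -> nat) l : ZZ := kap l ^+ k l.
Definition kadd (k P : 'I_m -> nat) l := (k l + P l)%N.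

Lemma kapK l : kap l * kab l = 1. Proof. exact: (pell_inv (Pell l) (dl2 l)). Qed.
Lemma kap_neq0 l : kap l != 0.
Proof. by apply/eqP => h; have := kapK l; rewrite h mul0r => /eqP; rewrite eq_sym oner_eq0. Qed.
Lemma b_neq0 j : b j != 0.
Proof. by apply/eqP => h; have := bK j; rewrite h mul0r => /eqP; rewrite eq_sym oner_eq0. Qed.
Lemma natZp_neq0 k : (0 < k)%N -> k%:R != 0 :> ZZ.
Proof.
by move=> k0; apply/eqP => h; have := @padic_int_eq0 p p_pr k%:Z; rewrite -pmulrn => /(_ h)/eqP; lia.
Qed.

Definition evanish (F : ('I_m -> nat) -> ZZ) := exists B : R, 0 < B /\ exists k0 : 'I_m -> nat,
  forall k, strip w B k -> (forall l, k0 l <= k l)%N -> F k = 0.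

Definition mon (e : multinom n) k := \prod_i zval k i ^+ e i.
Definition kmon (mu : multinom m) k := \prod_l kval k l ^+ mu l.

Lemma kmonD mu k P : kmon mu (kadd k P) = kmon mu k * kmon mu P.
Proof. by rewrite -big_split; apply: eq_bigr => l _; rewrite /kval exprD exprMn. Qed.
Lemma kmon_neq0 mu k : kmon mu k != 0.
Proof. by apply/prodf_neq0 => l _; rewrite !expf_neq0 ?kap_neq0. Qed.
Lemma mon_neq0 e k : mon e k != 0.
Proof. by apply/prodf_neq0 => i _; rewrite !expf_neq0 ?b_neq0. Qed.

(* Artin's independence of characters, for the shifts along a strip. *)
Lemma kmon_indep (S : seq (multinom m)) (c : multinom m -> ZZ) : uniq S ->
  evanish (fun k => \sum_(mu <- S) c mu * kmon mu k) -> forall mu, mu \in S -> c mu = 0.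
Proof.
elim: S c => // mu0 S IH c /= /andP[mu0S uS] [B [B0 [k0 hF]]].
(* On the half strip both [k] and [k + P] stay in the strip of width [B], since [P] is itself taken
   in the half strip. *)
have B20 : 0 < B / 2 by rewrite divr_gt0.
have [P [Ps P1]] := strip_far w_gt0 1 B20.
have hS mu : mu \in S -> c mu = 0.
  move=> muS; have h : kmon mu P - kmon mu0 P != 0.
    rewrite subr_eq0; apply: contraNneq mu0S => e.
    suff -> : mu0 = mu by [].
    apply/mnmP => l; apply/eqP; rewrite -(eqn_pmul2l (P1 l)); apply/eqP.
    have := @kap_indep (fun l => P l * mu l)%N (fun l => P l * mu0 l)%N.
    move=> /(_ _ l) ->//; rewrite /kmon /kval in e.
    by under eq_bigr do rewrite exprM; under [in RHS]eq_bigr do rewrite exprM.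
  apply/eqP; rewrite -(mulIr_eq0 _ (mulIf h)); apply/eqP.
  apply: (IH (fun mu => c mu * (kmon mu P - kmon mu0 P)) uS) => //.
  exists (B / 2); split=> //; exists k0 => k ks kk.
  have BB : B / 2 <= B by lra.
  have := hF k (strip_mono BB ks) kk; rewrite big_cons => h1.
  have : \sum_(mu <- mu0 :: S) c mu * kmon mu (kadd k P) = 0.
    apply: hF; first by rewrite (_ : B = B / 2 + B / 2); [exact: strip_add | field].
    by move=> l; rewrite (leq_trans (kk l)) // leq_addr.
  rewrite big_cons kmonD => h2.
  rewrite (_ : \sum_(mu1 <- S) _ = \sum_(j <- S) c j * kmon j (kadd k P) - kmon mu0 P * \sum_(j <- S) c j * kmon j k); last first.
    by rewrite mulr_sumr -sumrB; apply: eq_bigr => j _; rewrite kmonD; ring.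
  move: h1 h2; set S1 := \sum_(_ <- _) _; set S2 := \sum_(_ <- _) _ => h1 h2.
  rewrite (_ : _ - _ = (c mu0 * (kmon mu0 k * kmon mu0 P) + S2) - kmon mu0 P * (c mu0 * kmon mu0 k + S1)); last by ring.
  by rewrite h1 h2 mulr0 subr0.
move=> mu; rewrite inE => /orP[/eqP -> {mu}|]; last exact: hS.
pose N := (\max_l k0 l)%N; have [k [ks kN]] := strip_far w_gt0 N B0.
have := hF k ks _; rewrite big_cons big_seq big1 ?addr0 => [h|mu /hS ->]; last by rewrite mul0r.
have /eqP := h (fun l => leq_trans (leq_bigmax l) (kN l)).
by rewrite mulf_eq0 (negbTE (kmon_neq0 _ _)) orbF => /eqP.
Qed.

Lemma kval_indep (q : mpoly m ZZ) : evanish (fun k => meval (kval k) q) -> q = 0.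
Proof.
move=> h; apply/mpolyP => mu; rewrite mcoeff0; have [hm|] := boolP (mu \in msupp q); last first.
  by rewrite mcoeff_msupp negbK => /eqP.
apply: (kmon_indep (c := fun mu => mcoeff mu q) (msupp_uniq q) _ hm).
case: h => B [B0 [k0 hk]]; exists B; split=> //; exists k0 => k ks kk.
by have := hk k ks kk; rewrite mevalE.
Qed.

Lemma one_unit1D x : one_unit (1 + (p%:R : ZZ) * x).
Proof. have h : ((p%:R : ZZ) * x) 1%N = 0 by have := padic_pdvd x 1%N; rewrite expn1.
by rewrite /one_unit pseqD h addr0 pseq_mod pseq1_1. Qed.

Lemma lam1 : lam (1 : ZZ) = 0.
Proof.
have h : one_unit (1 : ZZ) by rewrite /one_unit pseq1_1.
apply: der_inj (lamP p_odd h) _; under [fun n => _]eq_fun do rewrite expr1n; exact: der_cst.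
Qed.

Lemma lam_prod (I : Type) (r : seq I) (F : I -> ZZ) : (forall i, one_unit (F i)) ->
  one_unit (\prod_(i <- r) F i) /\ lam (\prod_(i <- r) F i) = \sum_(i <- r) lam (F i).
Proof.
move=> h; elim: r => [|i r [IH1 IH2]]; first by rewrite !big_nil lam1 /one_unit pseq1_1.
by rewrite !big_cons lamM // IH2; split=> //; apply: one_unitM.
Qed.

Lemma lamX (x : ZZ) k : one_unit x -> one_unit (x ^+ k) /\ lam (x ^+ k) = lam x *+ k.
Proof.
move=> h; elim: k => [|k [IH1 IH2]]; first by rewrite expr0 lam1 /one_unit pseq1_1.
by rewrite exprS lamM // IH2 mulrS; split=> //; apply: one_unitM.
Qed.

Lemma lam_inj (x y y' : ZZ) : one_unit x -> one_unit y -> y * y' = 1 -> lam x = lam y -> x = y.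
Proof.
move=> hx hy yy e.
have hy' : one_unit y'.
  have := congr1 (fun t : ZZ => t 1%N) yy; by rewrite pseqM hy mul1r pseq_mod pseq1_1.
have xy : x * y' = 1.
  apply: (lam_eq0 p_odd); first exact: one_unitM.
  by rewrite lamM // e -lamM // yy lam1.
by rewrite -[x]mulr1 -yy mulrA (mulrAC x) xy mul1r.
Qed.

(** By Fermat's theorem; the logarithm only accepts one-units, which is why exponents are shifted by
    multiples of [p - 1] below. *)
Lemma b_one_unit j : one_unit (b j ^+ p.-1).
Proof.
have e := congr1 (fun t : ZZ => t 1%N) (bK j).
rewrite pseqM pseq1_1 expn1 in e.
have nz : (`|b j 1%N| %% p != 0)%N.
  apply/eqP => h; have : (p %| b j 1%N)%Z by rewrite dvdzE /= /dvdn h.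
  move=> /dvdz_mod0P => h'; have := pseq_mod (b j) 1%N; rewrite expn1 h' => h''; move: e; by rewrite -h'' mul0r mod0z.
rewrite /one_unit pseqX expn1 -[b j 1%N]gez0_abs ?pseq_ge0 // -[X in X ^+ _]natz -natrX natz modz_nat.
have cp : coprime `|b j 1%N| p by rewrite coprime_sym prime_coprime // /dvdn.
have := Euler_exp_totient cp; rewrite totient_prime // => ->.
by rewrite modn_small // prime_gt1.
Qed.

Notation q0 := (p * p.-1)%N.

(** The shifts are [p ^ t * M0 * W t]. The factor [M0] makes all units congruent to 1 modulo
    [p * (p - 1)], the power of [p] makes the shift tend to zero, and [strip_lowval] supplies [W t]
    in an ever narrower strip with bounded valuation at [l0]. That bound survives in the limit, so
    the direction [phi] is nonzero at [l0]. *)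
Lemma shift_sequence B l0 : 0 < B -> exists P : nat -> 'I_m -> nat, exists phi : 'I_m -> ZZ,
  [/\ forall t, strip w B (P t), phi l0 != 0,
    forall k l, der (fun t => kval (kadd k (P t)) l) (kval k l) (kval k l * phi l),
    forall k l, der (fun t => kab l ^+ (k l + P t l)) (kab l ^+ k l) (kab l ^+ k l * - phi l)
  & forall k l t, exists c d,
     pellx (D l) (X l) (Z l) (k l + P t l) = (pellx (D l) (X l) (Z l) (k l) + p ^ t * (p.-1 * c))%N /\
     pelly (D l) (X l) (Z l) (k l + P t l) = (pelly (D l) (X l) (Z l) (k l) + p ^ t * (p.-1 * d))%N].
Proof.
move=> B0.
have q0_gt0 : (0 < q0)%N by rewrite muln_gt0 prime_gt0 //= -subn1 subn_gt0 prime_gt1.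
have /choice[M hM] : forall l, exists M, (0 < M)%N /\ unit_mod (D l) (X l) (Z l) q0 M.
  by move=> l; have [M M0 hM] := pell_period (Pell l) q0_gt0; exists M.
pose M0 := (\prod_l M l)%N.
have M00 : (0 < M0)%N by rewrite prodn_gt0 // => l; case: (hM l).
have hM0 l : unit_mod (D l) (X l) (Z l) q0 M0.
  rewrite /M0 (bigD1 l) //= [X in unit_mod _ _ _ _ X]mulnC; apply: unit_mod_mul; exact: (hM l).2.
have hMt t l : unit_mod (D l) (X l) (Z l) (p ^ t * q0) (p ^ t * M0).
  elim: t => [|t IH]; first by rewrite !mul1n.
  by rewrite expnS -!mulnA; apply: pell_lift => //; rewrite mulnCA dvdn_mulr.
have [c hc] := strip_lowval w_gt0 l0 p_pr.
have /choice[W hW] : forall t, exists W, [/\ strip w (B / (p ^ t * M0)%:R) W, (0 < W l0)%N & (logn p (W l0) <= c)%N].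
  by move=> t; apply: hc; rewrite divr_gt0 // ltr0n muln_gt0 expn_gt0 prime_gt0.
pose P t l := (p ^ t * M0 * W t l)%N.
pose phi l := lam (kap l ^+ M0) * ulim (fun t => (W t l)%:R).
have onek l : one_unit (kap l ^+ M0).
  rewrite (pell_exp _ _ (dl2 l)); have [a [d [-> ->]]] := hM0 l.
  rewrite natrD !natrM -addrA -!(mulrA p%:R) -mulrDr; exact: one_unit1D.
have onekb l : one_unit (kab l ^+ M0).
  rewrite (pell_expN _ _ (dl2 l)); have [a [d [-> ->]]] := hM0 l.
  rewrite natrD !natrM -addrA -!(mulrA p%:R) -mulrBr; exact: one_unit1D.
have lamN l : lam (kab l ^+ M0) = - lam (kap l ^+ M0).
  apply/eqP; rewrite -addr_eq0 -(lamM p_odd) // -exprMn mulrC kapK expr1n; apply/eqP; exact: lam1.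
have dershift (x : ZZ) k l : one_unit (x ^+ M0) -> der (fun t => x ^+ (k + P t l)) (x ^+ k)
    (x ^+ k * (lam (x ^+ M0) * ulim (fun t => (W t l)%:R))).
  move=> h; have := derM (der_cst (x ^+ k)) (der_exp p_odd (fun t => W t l) h).
  rewrite mul0r add0r mulr1; congr (der _ _ _); apply/funext => t.
  by rewrite exprD /P; congr (_ * _); rewrite -exprM; congr (_ ^+ _); ring.
exists P, phi; split.
- move=> t; have := strip_scale (M := p ^ t * M0) _ (_ : strip w (B / _) (W t)); apply.
    by rewrite muln_gt0 expn_gt0 prime_gt0.
  by case: (hW t).
- rewrite mulf_neq0 //.
    apply/eqP => /(lam_eq0 p_odd (onek l0)) e.
    have := @kap_indep (fun l => M0 * (l == l0))%N (fun=> 0%N).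
    have -> : \prod_l kap l ^+ (M0 * (l == l0)) = 1.
      rewrite (bigD1 l0) //= eqxx muln1 e mul1r big1 // => l /negbTE ->; by rewrite muln0 expr0.
    rewrite big1 => [|l _]; last by rewrite expr0.
    by move=> /(_ erefl l0); rewrite eqxx muln1 => h; rewrite h in M00.
  apply/eqP => e; have [t /=] := ultra_nat_ex (ulimP (fun t => (W t l0)%:R : ZZ) c.+1).
  rewrite e pseq0 pseq_nat => /dvdz_mod0P; have [_ W1 W2] := hW t.
  by rewrite dvdzE /= pfactor_dvdn // ltnNge W2.
- by move=> k l; apply: dershift.
- move=> k l; have -> : - phi l = lam (kab l ^+ M0) * ulim (fun t => (W t l)%:R) by rewrite lamN mulNr.
  exact: dershift.
- move=> k l t; have h := unit_mod_mul (W t l) (hMt t l).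
  have [a [d [e1 e2]]] := unit_modD (k l) h.
  exists (p * a)%N, (p * d)%N; have -> : P t l = (W t l * (p ^ t * M0))%N by rewrite /P mulnC.
  by rewrite e1 e2; split; ring.
Qed.

(* [2 (p - 1)] times the derivative of the exponents of [b] along a shift sequence. *)
Definition cu i : ZZ := if isx i then 1 else th (bl i).
Definition cv i : ZZ := if isx i then 1 else - th (bl i).
Definition lb i : ZZ := lam (b (jj i) ^+ p.-1).

(** The exponents are half the sum of [kap ^+ k] and its inverse, respectively half their difference
    divided by [dl]; the inverse has the opposite logarithmic derivative, which turns the plus
    between the two terms into a minus. The factor [2 * (p - 1)] avoids division in the p-adic
    integers. *)
Lemma zval_der (P : nat -> 'I_m -> nat) (phi : 'I_m -> ZZ) k i :
  (forall k l, der (fun t => kval (kadd k (P t)) l) (kval k l) (kval k l * phi l)) ->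
  (forall k l, der (fun t => kab l ^+ (k l + P t l)) (kab l ^+ k l) (kab l ^+ k l * - phi l)) ->
  (forall k l t, exists c d,
     pellx (D l) (X l) (Z l) (k l + P t l) = (pellx (D l) (X l) (Z l) (k l) + p ^ t * (p.-1 * c))%N /\
     pelly (D l) (X l) (Z l) (k l + P t l) = (pelly (D l) (X l) (Z l) (k l) + p ^ t * (p.-1 * d))%N) ->
  exists C, der (fun t => zval (kadd k (P t)) i) (zval k i) (zval k i * (lb i * C)) /\
    2%:R * (p.-1)%:R * C = phi (bl i) * (cu i * kval k (bl i) - cv i * kab (bl i) ^+ k (bl i)).
Proof.
move=> h1 h2 h3.
have /choice[c hc] : forall t, exists c, zexp (kadd k (P t)) i = (zexp k i + p ^ t * (p.-1 * c))%N.
  move=> t; have [c [d [e1 e2]]] := h3 k (bl i) t; rewrite /zexp /kadd; case: (isx i).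
    by exists c.
  by exists d.
exists (ulim (fun t => (c t)%:R)); split.
  have := derM (der_cst (zval k i)) (der_exp p_odd c (b_one_unit (jj i))).
  rewrite mul0r add0r mulr1; congr (der _ _ _); apply/funext => t.
  by rewrite {2}/zval hc exprD -exprM mulnCA.
pose f (e : nat) : ZZ := 2%:R * e%:R.
have E k' : f (zexp k' i) = cu i * kval k' (bl i) + cv i * kab (bl i) ^+ k' (bl i).
  rewrite /f /cu /cv /kval (pell_exp _ _ (dl2 _)) (pell_expN _ _ (dl2 _)) /zexp; case: (isx i); first by ring.
  set e := pelly _ _ _ _; transitivity ((th (bl i) * dl (bl i)) * (2 * e%:R)); last by ring.
  by rewrite dlK mul1r.
(* Twice the exponent is differentiated in two ways, from its integral increments and from its
   expression by the units; uniqueness of derivatives gives the formula for [C]. *)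
have d1 : der (fun t => f (zexp (kadd k (P t)) i)) (f (zexp k i)) (2%:R * (p.-1)%:R * ulim (fun t => (c t)%:R)).
  exists (fun t => 2%:R * (p.-1)%:R * (c t)%:R); last by rewrite ulimM ulim_cst.
  by move=> t; rewrite /f hc natrD !natrM; ring.
have d2 : der (fun t => f (zexp (kadd k (P t)) i)) (f (zexp k i))
    (cu i * (kval k (bl i) * phi (bl i)) + cv i * (kab (bl i) ^+ k (bl i) * - phi (bl i))).
  rewrite E; under [fun t => _]eq_fun do rewrite E.
  have := derD (derM (der_cst (cu i)) (h1 k (bl i))) (derM (der_cst (cv i)) (h2 k (bl i))).
  by rewrite !mul0r !add0r.
by rewrite (der_inj d1 d2); ring.
Qed.

Definition ones (T : pred 'I_m) : multinom m := Multinom [tuple (T l : nat) | l < m].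
Lemma onesE T l : ones T l = T l. Proof. by rewrite multinomE tnth_mktuple. Qed.
Lemma mdeg_ones T : mdeg (ones T) = #|T|.
Proof.
by rewrite mdegE -sum1_card [RHS]big_mkcond; apply: eq_bigr => l _; rewrite onesE; have -> : (l \in T) = T l by []; case: (T l).
Qed.
Lemma meval_ones (v : 'I_m -> ZZ) T : meval v (mpolyX ZZ (ones T)) = \prod_(l | T l) v l.
Proof.
rewrite mevalX; rewrite [RHS]big_mkcond; apply: eq_bigr => l _; rewrite onesE.
by case: (T l); rewrite ?expr1 ?expr0.
Qed.

(** * Differentiating an exponential relation along a shift *)

Section Derivation.
Context (phi : 'I_m -> ZZ).
(** The logarithmic derivative of [mon e] is, up to [c0], a combination of the [kap l ^+ k l] minus
    one of their inverses. After multiplication by the product [U] of all variables the first part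
    becomes [lin e] times that product and the second the polynomial [cst e]; [dcoef] is the
    resulting coefficient of [mon e] in the derived relation. *)
Definition lin (e : multinom n) : mpoly m ZZ :=
  \sum_i (lb i * phi (bl i) * cu i *+ e i) *: mpolyX ZZ (mnm1 (bl i)).
Definition cst (e : multinom n) : mpoly m ZZ :=
  \sum_i (lb i * phi (bl i) * cv i *+ e i) *: mpolyX ZZ (ones (predC1 (bl i))).
Notation U := (ones predT).
Notation c0 := (2%:R * (p.-1)%:R : ZZ).
Definition dcoef (e : multinom n) (q : mpoly m ZZ) :=
  c0 *: (mpolyX ZZ U * euler phi q) + (lin e * mpolyX ZZ U - cst e) * q.

Lemma lin_supp e mu : mcoeff mu (lin e) != 0 -> mdeg mu = 1%N.
Proof.
move=> h; apply: contrapT => h'; move/eqP: h; apply; rewrite raddf_sum big1 // => i _ /=.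
rewrite mcoeffZ mcoeffX; case: eqP => [e'|_]; last by rewrite mulr0.
by case: h'; rewrite -e' mdeg1.
Qed.

Lemma cst_supp e mu : mcoeff mu (cst e) != 0 -> (mdeg mu < mdeg U)%N.
Proof.
move=> h; apply: contrapT => h'; move/eqP: h; apply; rewrite raddf_sum big1 // => i _ /=.
rewrite mcoeffZ mcoeffX; case: eqP => [e'|_]; last by rewrite mulr0.
by case: h'; rewrite -e' !mdeg_ones cardC1 -[#|xpredT|]/#|'I_m| card_ord; case: (m) (bl i) => [[]|].
Qed.

Lemma mcoeff_lin e l : mcoeff (mnm1 l) (lin e) = phi l * \sum_(i | bl i == l) lb i * cu i *+ e i.
Proof.
rewrite raddf_sum mulr_sumr [RHS]big_mkcond; apply: eq_bigr => i _ /=.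
rewrite mcoeffZ mcoeffX eq_mnm1; case: eqP => [->|_]; last by rewrite mulr0.
by rewrite mulr1 -mulrnAr; ring.
Qed.

Lemma mcoeff_cst e l : mcoeff (ones (predC1 l)) (cst e) = phi l * \sum_(i | bl i == l) lb i * cv i *+ e i.
Proof.
rewrite raddf_sum mulr_sumr [RHS]big_mkcond; apply: eq_bigr => i _ /=.
rewrite mcoeffZ mcoeffX.
have -> : (ones (predC1 (bl i)) == ones (predC1 l)) = (bl i == l).
  apply/eqP/eqP => [h|-> //]; have := congr1 (fun u : multinom m => u l) h.
  by rewrite !onesE /= eqxx eq_sym; case: eqP.
case: eqP => [->|_]; last by rewrite mulr0.
by rewrite mulr1 -mulrnAr; ring.
Qed.

Context (P : nat -> 'I_m -> nat).
Hypothesis h1 : forall k l, der (fun t => kval (kadd k (P t)) l) (kval k l) (kval k l * phi l).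
Hypothesis h2 : forall k l, der (fun t => kab l ^+ (k l + P t l)) (kab l ^+ k l) (kab l ^+ k l * - phi l).
Hypothesis h3 : forall k l t, exists c d,
     pellx (D l) (X l) (Z l) (k l + P t l) = (pellx (D l) (X l) (Z l) (k l) + p ^ t * (p.-1 * c))%N /\
     pelly (D l) (X l) (Z l) (k l + P t l) = (pelly (D l) (X l) (Z l) (k l) + p ^ t * (p.-1 * d))%N.

Lemma meval_der k (q : mpoly m ZZ) :
  der (fun t => meval (kval (kadd k (P t))) q) (meval (kval k) q) (meval (kval k) (euler phi q)).
Proof.
have -> : meval (kval k) (euler phi q) = \sum_(mu <- msupp q) mcoeff mu q * (kmon mu k * weight phi mu).
  rewrite raddf_sum; apply: eq_bigr => mu _ /=; rewrite mevalZ mevalX /kmon; ring.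
rewrite mevalE; under [fun t => _]eq_fun do rewrite mevalE.
apply: der_sum => mu; have := derM (der_cst (mcoeff mu q)) (der_log_prod (index_enum 'I_m)
  (fun l => der_logX (mu l) (h1 k l))).
by rewrite mul0r add0r.
Qed.

Lemma mon_der k : exists C : 'I_n -> ZZ, (forall i, c0 * C i = phi (bl i) *
     (cu i * kval k (bl i) - cv i * kab (bl i) ^+ k (bl i))) /\
  forall e, der (fun t => mon e (kadd k (P t))) (mon e k) (mon e k * \sum_i (lb i * C i) *+ e i).
Proof.
have /choice[C hC] := fun i => zval_der k i h1 h2 h3.
exists C; split=> [i|e]; first by case: (hC i).
exact: (der_log_prod (index_enum 'I_n) (fun i => der_logX (e i) (hC i).1)).
Qed.

(** The relation holds at [k] and at all [k + P t], so its derivative is that of the zero sequence;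
    it is then multiplied by [c0 * \prod_l kval k l]. *)
Lemma dcoef_vanish (S : seq (multinom n)) (Q : multinom n -> mpoly m ZZ) (B : R) k0 k :
  (forall k, strip w B k -> (forall l, k0 l <= k l)%N -> \sum_(e <- S) meval (kval k) (Q e) * mon e k = 0) ->
  0 < B -> (forall t, strip w (B / 2) (P t)) -> strip w (B / 2) k -> (forall l, k0 l <= k l)%N ->
  \sum_(e <- S) meval (kval k) (dcoef e (Q e)) * mon e k = 0.
Proof.
move=> hF B0 Ps ks kk.
have [C [C1 C2]] := mon_der k.
have F0 t : \sum_(e <- S) meval (kval (kadd k (P t))) (Q e) * mon e (kadd k (P t)) = 0.
  apply: hF; first by rewrite (_ : B = B / 2 + B / 2); [exact: strip_add | field].
  by move=> l; rewrite (leq_trans (kk l)) // leq_addr.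
have Fk : \sum_(e <- S) meval (kval k) (Q e) * mon e k = 0.
  by apply: hF => //; apply: strip_mono ks; lra.
have := der_sum S (fun e => derM (meval_der k (Q e)) (C2 e)).
rewrite Fk; under [fun t => _]eq_fun do rewrite F0.
move=> /(der_inj (der_cst 0))/(congr1 (fun x => c0 * \prod_l kval k l * x)).
rewrite mulr0 mulr_sumr => /esym e; rewrite -[RHS]e; apply: eq_bigr => e' _.
rewrite /dcoef mevalD mevalZ !mevalM meval_ones mevalB mevalM meval_ones.
have -> : meval (kval k) (lin e') * \prod_l kval k l - meval (kval k) (cst e') =
    c0 * \prod_l kval k l * \sum_i (lb i * C i) *+ e' i.
  have -> : meval (kval k) (lin e') = \sum_i meval (kval k) ((lb i * phi (bl i) * cu i *+ e' i) *: mpolyX ZZ (mnm1 (bl i))).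
    by rewrite /lin raddf_sum.
  have -> : meval (kval k) (cst e') = \sum_i meval (kval k) ((lb i * phi (bl i) * cv i *+ e' i) *: mpolyX ZZ (ones (predC1 (bl i)))).
    by rewrite /cst raddf_sum.
  rewrite mulr_suml -sumrB mulr_sumr; apply: eq_bigr => i _ /=.
  rewrite !mevalZ meval_ones mevalXU.
  have -> : \prod_(l | predC1 (bl i) l) kval k l = kab (bl i) ^+ k (bl i) * \prod_l kval k l.
    rewrite [in RHS](bigD1 (bl i)) //= mulrA {2}/kval -exprMn [kab _ * _]mulrC kapK expr1n mul1r.
    by [].
  have mn (x : ZZ) : x *+ e' i = x * (e' i)%:R by rewrite mulr_natr.
  rewrite (mn (lb i * C i)) (mn (lb i * phi (bl i) * cu i)) (mn (lb i * phi (bl i) * cv i)).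
  transitivity (lb i * (phi (bl i) * (cu i * kval k (bl i) - cv i * kab (bl i) ^+ k (bl i))) * (e' i)%:R * \prod_l kval k l); first by ring.
  by rewrite -C1; ring.
by ring.
Qed.
End Derivation.

Lemma th_neq0 l : th l != 0.
Proof. by apply/eqP => h; have := dlK l; rewrite h mul0r => /eqP; rewrite eq_sym oner_eq0. Qed.

(** [cu] and [cv] agree on the first sort of variables and are opposite on the second, so the sum
    and the difference of the hypotheses separate the sorts. Injectivity of the logarithm then gives
    an equality of monomials in the [b j], which are independent. *)
Lemma exponents_determined (e e' : multinom n) l :
  \sum_(i | bl i == l) lb i * cu i *+ e i = \sum_(i | bl i == l) lb i * cu i *+ e' i ->
  \sum_(i | bl i == l) lb i * cv i *+ e i = \sum_(i | bl i == l) lb i * cv i *+ e' i ->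
  forall i, bl i = l -> e i = e' i.
Proof.
move=> hu hv.
pose sg (x : bool) (e : multinom n) : ZZ := \sum_(i | (bl i == l) && (isx i == x)) lb i *+ e i.
have split_s (t : ZZ) (c : 'I_n -> ZZ) (u : multinom n) : (forall i, bl i = l -> c i = if isx i then 1 else t) ->
    \sum_(i | bl i == l) lb i * c i *+ u i = sg true u + t * sg false u.
  move=> hc; rewrite (bigID isx) /= /sg mulr_sumr; congr (_ + _); apply: eq_big => [i|i /andP[/eqP il hi]].
  - by rewrite eqb_id.
  - by rewrite hc // hi mulr1.
  - by rewrite eqbF_neg.
  - by rewrite hc // (negbTE hi) mulrC mulrnAr.
have two : 2%:R != 0 :> ZZ by exact: natZp_neq0.
rewrite !(split_s (th l)) in hu; try by move=> i <-.
rewrite !(split_s (- th l)) in hv; try by move=> i <-.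
have hs x : sg x e = sg x e'.
  case: x.
    apply: (mulfI two); transitivity ((sg true e + th l * sg false e) + (sg true e + - th l * sg false e)); first by ring.
    by rewrite hu hv; ring.
  apply: (mulfI two); apply: (mulfI (th_neq0 l)).
  transitivity ((sg true e + th l * sg false e) - (sg true e + - th l * sg false e)); first by ring.
  by rewrite hu hv; ring.
move=> i0 il.
pose M (u : multinom n) : ZZ := \prod_(i | (bl i == l) && (isx i == isx i0)) (b (jj i) ^+ p.-1) ^+ u i.
pose M' (u : multinom n) : ZZ := \prod_(i | (bl i == l) && (isx i == isx i0)) (b' (jj i) ^+ p.-1) ^+ u i.
have MK u : M u * M' u = 1.
  by rewrite -big_split big1 // => i _ /=; rewrite -!exprMn bK !expr1n.
have M1 u : one_unit (M u) /\ lam (M u) = sg (isx i0) u.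
  rewrite /M /sg -big_filter -[in RHS]big_filter.
  have [H1 H2] := lam_prod [seq i <- index_enum 'I_n | (bl i == l) && (isx i == isx i0)]
    (fun i => (lamX (u i) (b_one_unit (jj i))).1).
  split=> //; rewrite H2; apply: eq_bigr => i _; exact: (lamX _ (b_one_unit _)).2.
have Meq : M e = M e'.
  by apply: (lam_inj (M1 e).1 (M1 e').1 (MK e')); rewrite (M1 e).2 (M1 e').2.
have MJ u : M u = \prod_j b j ^+ (\sum_(i | (bl i == l) && (isx i == isx i0) && (jj i == j)) p.-1 * u i)%N.
  rewrite /M (partition_big jj predT) //=; apply: eq_bigr => j _.
  by rewrite -prodrXr; apply: eq_bigr => i /andP[_ /eqP <-]; rewrite exprM.
rewrite !MJ in Meq; have := b_indep Meq (jj i0).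
have sing (u : multinom n) : (\sum_(i | (bl i == l) && (isx i == isx i0) && (jj i == jj i0)) p.-1 * u i = p.-1 * u i0)%N.
  rewrite (big_pred1 i0) // => i; apply/idP/eqP => [/andP[/andP[/eqP h1 /eqP h2] /eqP h3]|->].
    by apply: var_inj; rewrite // il.
  by rewrite il !eqxx.
by rewrite !sing => /eqP; rewrite eqn_pmul2l => [/eqP//|]; rewrite -subn1 subn_gt0 prime_gt1.
Qed.

(** Induction on the number of monomials. Eliminating [e0] between the relation and its derivative
    gives a shorter relation [r]. The vanishing of [r e1] relates the logarithmic derivatives of
    [Q e0] and [Q e1], and by [euler_lead] it forces [e0] and [e1] to agree in the field [bl l],
    against the choice of [l]. Coefficients [Q] must be allowed to depend on the unit powers, as
    differentiation creates such dependence. *)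
Theorem coeff_vanish (S : seq (multinom n)) (Q : multinom n -> mpoly m ZZ) : uniq S ->
  evanish (fun k => \sum_(e <- S) meval (kval k) (Q e) * mon e k) -> forall e, e \in S -> Q e = 0.
Proof.
have [N] := ubnP (size S); elim: N S Q => // N IH S Q; rewrite ltnS => sS uS hS.
have [[e0 e0S Q0]|all] := pselect (exists2 e0, e0 \in S & Q e0 = 0).
  move=> e eS; have [->//|ne] := eqVneq e e0.
  have hN : (size (rem e0 S) < N)%N.
    by rewrite size_rem //; move: sS; case: (S) e0S => //.
  apply: (IH (rem e0 S) Q hN (rem_uniq _ uS)); last by rewrite mem_rem_uniq // inE ne.
  case: hS => B [B0 [k0 hk]]; exists B; split=> //; exists k0 => k ks kk.
  by have := hk k ks kk; rewrite (big_rem e0) //= Q0 rmorph0 mul0r add0r.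
have Qn e : e \in S -> Q e != 0 by move=> eS; apply/eqP => h; apply: all; exists e.
case: S sS uS hS all Qn => // e0 [|e1 S] sS uS [B [B0 [k0 hk]]] all Qn.
  move=> e; rewrite inE => /eqP ->; apply: kval_indep; exists B; split=> //; exists k0 => k ks kk.
  have /eqP := hk k ks kk; rewrite big_seq1 mulf_eq0 (negbTE (mon_neq0 _ _)) orbF => /eqP //.
have [l ne] : exists i, e0 i != e1 i.
  apply: contrapT => h; have e01 : e0 = e1.
    by apply/mnmP => i; apply/eqP; apply: contrapT => /negP h'; apply: h; exists i.
  by move: uS; rewrite /= e01 mem_head.
have B20 : 0 < B / 2 by rewrite divr_gt0.
have [P [phi [Ps phi0 h1 h2 h3]]] := shift_sequence (bl l) B20.
pose r e := Q e0 * dcoef phi e (Q e) - dcoef phi e0 (Q e0) * Q e.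
have r0 : r e1 = 0.
  apply: (IH (e1 :: S) r); rewrite ?mem_head //; first by case/andP: uS.
  exists (B / 2); split=> //; exists k0 => k ks kk.
  have := dcoef_vanish h1 h2 h3 hk B0 Ps ks kk; rewrite big_cons => H1.
  have BB : B / 2 <= B by lra.
  have := hk k (strip_mono BB ks) kk; rewrite big_cons => H2.
  transitivity (meval (kval k) (Q e0) * (meval (kval k) (dcoef phi e0 (Q e0)) * mon e0 k +
      \sum_(e <- e1 :: S) meval (kval k) (dcoef phi e (Q e)) * mon e k)
    - meval (kval k) (dcoef phi e0 (Q e0)) * (meval (kval k) (Q e0) * mon e0 k +
      \sum_(e <- e1 :: S) meval (kval k) (Q e) * mon e k)); last by rewrite H1 H2 !mulr0 subr0.
  rewrite !mulrDr opprD addrACA [X in _ = X + _](_ : _ = 0) ?add0r; last by ring.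
  rewrite !mulr_sumr -sumrB; apply: eq_bigr => e _; rewrite /r mevalB !mevalM; ring.
have [] := @euler_lead _ _ phi (2%:R * (p.-1)%:R) (ones predT) (lin phi e1 - lin phi e0)
  (cst phi e1 - cst phi e0) (Q e1) (Q e0).
- move=> mu; rewrite mcoeffB; have [->|h] := eqVneq (mcoeff mu (lin phi e1)) 0; last by move=> _; exact: lin_supp h.
  by rewrite sub0r oppr_eq0; exact: lin_supp.
- move=> mu; rewrite mcoeffB; have [->|h] := eqVneq (mcoeff mu (cst phi e1)) 0; last by move=> _; exact: cst_supp h.
  by rewrite sub0r oppr_eq0; exact: cst_supp.
- by apply: Qn; rewrite inE mem_head orbT.
- by apply: Qn; rewrite mem_head.
- rewrite -[RHS]r0 /r /dcoef -!mul_mpolyC; set x1 := mpolyC _ _; set x2 := euler _ _; set x3 := euler _ _; ring.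
move=> hl hc; case/eqP: ne.
apply/esym; apply: (@exponents_determined e1 e0 (bl l)) => //.
  have /eqP := congr1 (mcoeff (mnm1 (bl l))) hl; rewrite mcoeffB mcoeff0 !mcoeff_lin -mulrBr mulf_eq0.
  by rewrite (negbTE phi0) subr_eq0 => /eqP.
have /eqP := congr1 (mcoeff (ones (predC1 (bl l)))) hc; rewrite mcoeffB mcoeff0 !mcoeff_cst -mulrBr mulf_eq0.
by rewrite (negbTE phi0) subr_eq0 => /eqP.
Qed.

Theorem zval_dense (q : mpoly n ZZ) : evanish (fun k => meval (zval k) q) -> q = 0.
Proof.
move=> [B [B0 [k0 hk]]]; apply/mpolyP => e; rewrite mcoeff0.
have [he|] := boolP (e \in msupp q); last by rewrite mcoeff_msupp negbK => /eqP.
have h := @coeff_vanish (msupp q) (fun e => mpolyC m (mcoeff e q)) (msupp_uniq q) _ e he.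
suff /h/eqP : evanish (fun k => \sum_(e <- msupp q) meval (kval k) (mpolyC m (mcoeff e q)) * mon e k).
  by rewrite mpolyC_eq0 => /eqP.
exists B; split=> //; exists k0 => k ks kk; have := hk k ks kk; rewrite mevalE => h0; rewrite -[RHS]h0.
by apply: eq_bigr => e' _; rewrite mevalC.
Qed.
End Density.

(** * Embeddings of a number field into p-adic fields *)

Section IntegerPolynomials.
Implicit Types (f g : {poly int}).

Lemma int_nonroot f N : f != 0 -> exists2 t : nat, (N < t)%N & f.[t%:Z] != 0.
Proof.
move=> f0; apply: contrapT => no.
pose rs := [seq (i%:Z : int) | i <- iota N.+1 (size f)].
have : (size rs < size f)%N.
  apply: max_poly_roots => //.
    apply/allP => _ /mapP[i hi ->]; apply/rootP; apply/eqP; apply: contrapT => /negP h; apply: no.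
    by exists i => //; move: hi; rewrite mem_iota; lia.
  by rewrite map_inj_uniq ?iota_uniq // => i j [].
by rewrite size_map size_iota ltnn.
Qed.

(** Euclid's argument: at multiples [u] of [f.[0] * M] the value is [f.[0]] times a number congruent
    to 1 modulo [M], whose prime divisors do not divide [M]. *)
Lemma prime_divides_value f M : (1 < size f)%N -> (0 < M)%N ->
  exists p, [/\ prime p, ~~ (p %| M)%N & exists t, (p %| f.[t])%Z].
Proof.
move=> sf M0.
have [a0|a0] := eqVneq f.[0] 0.
  have [p Mp p_pr] := prime_above M; exists p; split=> //; last by exists 0; rewrite a0 dvdz0.
  by rewrite gtnNdvd.
(* If [q] does not vanish at [u], the cofactor [h] of [f.[0]] is none of 0, 1 and -1, so it has a
   prime divisor. *)
pose q := f * (f - f.[0]%:P) * (f + f.[0]%:P).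
have nz c : f - c%:P != 0.
  by apply: contraTneq sf => /eqP; rewrite subr_eq0 => /eqP ->; rewrite -leqNgt size_polyC leq_b1.
have q0 : q != 0.
  apply: mulf_neq0; last by have := nz (- f.[0]); rewrite polyCN opprK.
  by apply: mulf_neq0; [have := nz 0; rewrite polyC0 subr0 | exact: nz].
have lin0 : (size (f.[0] * M%:Z *: 'X) > 1)%N.
  by rewrite size_scale ?size_polyX // mulf_neq0 //; lia.
have [|t _] := @int_nonroot (q \Po (f.[0] * M%:Z *: 'X)) 0.
  by rewrite comp_poly_eq0.
rewrite horner_comp hornerZ hornerX !hornerM !hornerD hornerN !hornerC; set u := _ * t%:Z.
have [g fE] : exists g, f = f.[0]%:P + 'X * g.
  have /factor_theorem[g hg] : root (f - f.[0]%:P) 0 by rewrite /root hornerD hornerN hornerC subrr.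
  by exists g; rewrite -[LHS](subrK f.[0]%:P) hg subr0 addrC mulrC.
have fu : f.[u] = f.[0] * (1 + M%:Z * (t%:Z * g.[u])).
  rewrite {1}fE hornerD hornerC hornerM hornerX /u; ring.
set h := 1 + _ in fu; rewrite fu => hne.
have [p p_pr ph] : exists2 p, prime p & (p %| `|h|)%N.
  exists (pdiv `|h|); last exact: pdiv_dvd.
  apply: pdiv_prime; case: (ltnP 1 `|h|) => // h1; case/negP: hne.
  have : h \in [:: 0; 1; -1] by move: h1; rewrite !inE; clear; lia.
  rewrite !inE => /or3P[] /eqP ->; apply/eqP; ring.
exists p; split=> //; last by exists u; rewrite fu dvdz_mull.
apply/negP => pM; have : (p %| h)%Z by [].
rewrite rpredDr; last by apply: dvdz_mulr.
by rewrite dvdzE /= dvdn1 => /eqP p1; rewrite p1 in p_pr.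
Qed.

Lemma poly_taylor1 f (x h : int) : exists r, f.[x + h] = f.[x] + h * f^`().[x] + h ^+ 2 * r.
Proof.
elim/poly_ind: f => [|f c [r IH]]; first by exists 0; rewrite deriv0 !horner0 !mulr0 !addr0.
exists (x * r + f^`().[x] + h * r).
by rewrite !hornerMXaddC IH derivMXaddC hornerD hornerMX; ring.
Qed.

(* Hensel's lemma, without coherence: a limit along an ultrafilter will do. *)
Lemma hensel_step (p : nat) f u v (e t : int) n : prime p -> u * f + v * f^`() = e%:P -> ~~ (p %| e)%Z ->
  (p %| f.[t])%Z -> exists t', ((p ^ n)%N %| f.[t'])%Z /\ (p %| f.[t'])%Z.
Proof.
move=> p_pr bez pe pt; elim: n => [|n [t' [IH1 IH2]]]; first by exists t; rewrite expn0 dvd1z.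
case: n IH1 => [|n] IH1; first by exists t'; rewrite expn1.
have cop : coprimez f^`().[t'] p.
  rewrite coprimez_sym /coprimez /gcdz -[_ == _]/(coprime p _) prime_coprime //.
  apply: contra pe => h; have := congr1 (fun q => q.[t']) bez.
  rewrite hornerD !hornerM hornerC => <-; apply: rpredD; apply: dvdz_mull => //.
have /coprimezP[[a b] /= ab] := cop.
have /dvdzP[c hc] := IH1.
(* Newton's correction, with [a] an inverse of the derivative modulo [p]. *)
exists (t' + (p ^ n.+1)%N%:Z * (- c * a)).
have [r ->] := poly_taylor1 f t' ((p ^ n.+1)%N%:Z * (- c * a)).
suff h : ((p ^ n.+2)%N %| f.[t'] + (p ^ n.+1)%N%:Z * (- c * a) * f^`().[t'] + ((p ^ n.+1)%N%:Z * (- c * a)) ^+ 2 * r)%Z.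
  split=> //; apply: dvdz_trans h; rewrite expnS PoszM; exact: dvdz_mulr.
rewrite hc; apply/dvdzP; exists (c * b + (p ^ n)%N%:Z * (c * a) ^+ 2 * r).
have -> : c * (p ^ n.+1)%N%:Z = c * (p ^ n.+1)%N%:Z * (a * f^`().[t'] + b * p%:Z) by rewrite ab mulr1.
by rewrite !expnS !PoszM; ring.
Qed.
End IntegerPolynomials.

Lemma fracB (F : fieldType) (a b c d : F) : c != 0 -> d != 0 -> (d * a - c * b) / (c * d) = a / c - b / d.
Proof. by move=> c0 d0; field; rewrite c0 d0. Qed.

(** * Places of a number field *)

Section NumberField.
Context (K : fieldType) (g0 : K) (f u v : {poly int}) (e : int).
Notation "p ^i" := (map_poly intr p) (at level 2).
Notation ev P := ((map_poly intr P).[g0]).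
Hypothesis charK : forall k : int, k%:~R = 0 :> K -> k = 0.
Hypothesis f_root : ev f = 0.
Hypothesis f_gen : forall y : K, exists d P, d != 0 /\ d%:~R * y = ev P.
Hypothesis f_min : forall P, ev P = 0 -> exists c g, c != 0 /\ c *: P = g * f.
Hypothesis f_sep : u * f + v * f^`() = e%:P.
Hypothesis e0 : e != 0.

Lemma nf_size : (1 < size f)%N.
Proof.
rewrite ltnNge; apply/negP => /size1_polyC fE; move: f_root; rewrite fE map_polyC hornerC => /charK h.
by move: f_sep; rewrite fE h polyC0 deriv0 !mulr0 addr0 => /eqP; rewrite eq_sym polyC_eq0 (negbTE e0).
Qed.

Section Place.
Context (p : nat) (p_pr : prime p).
Notation ZZ := (padic p_pr).

Lemma padic_intI : forall k : int, k%:~R = 0 :> ZZ -> k = 0. Proof. exact: padic_int_eq0. Qed.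

Lemma ulim_horner (P : {poly int}) (t : nat -> ZZ) :
  ulim (fun n => (map_poly intr P).[t n]) = (map_poly intr P).[ulim t].
Proof.
elim/poly_ind: P => [|P c IH].
  rewrite map_poly0 horner0; under [fun n => _]eq_fun do rewrite horner0; exact: ulim_cst.
rewrite rmorphD rmorphM /= map_polyX map_polyC hornerMXaddC.
under [fun n => _]eq_fun do rewrite hornerMXaddC.
by rewrite ulimD ulimM IH ulim_cst.
Qed.

Lemma padic_int_unit (d : int) : ~~ (p %| d)%Z -> exists t : ZZ, d%:~R * t = 1.
Proof.
move=> pd.
have /choice[a ha] : forall n, exists a, ((p ^ n)%N %| d * a - 1)%Z.
  move=> n; have : coprimez d (p ^ n)%N.
    rewrite coprimez_sym /coprimez /gcdz -[_ == _]/(coprime (p ^ n) _) coprimeXl // prime_coprime //.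
  move=> /coprimezP[[a b] /= ab]; exists a; rewrite -ab; apply/dvdzP; exists (- b); ring.
exists (ulim (fun n => (a n)%:~R)); rewrite -[d%:~R](ulim_cst (d%:~R : ZZ)) -ulimM; apply: ulim_eq => c.
apply: (@ultra_natW [set n | (c <= n)%N]%classic); last by apply: ultra_nat_oo; exists c.
move=> n /= cn; rewrite -rmorphM /= pseq_int pseq1; apply/eqP; rewrite eqz_mod_dvd.
exact: dvdz_trans (dvdP _ cn) (ha n).
Qed.

Hypothesis pe : ~~ (p %| e)%Z.
Context (t : int) (pt : (p %| f.[t])%Z).

Lemma padic_root : exists r : ZZ, (map_poly intr f).[r] = 0.
Proof.
have /choice[s hs] := fun n => hensel_step n p_pr f_sep pe pt.
exists (ulim (fun n => (s n)%:~R)); rewrite -ulim_horner; apply: ulim_eq => c.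
apply: (@ultra_natW [set n | (c <= n)%N]%classic); last by apply: ultra_nat_oo; exists c.
move=> n /= cn; rewrite horner_map /= pseq_int pseq0; apply/dvdz_mod0P.
exact: dvdz_trans (dvdP _ cn) (hs n).1.
Qed.

Definition proot : ZZ := sval (cid padic_root).
Lemma prootP : (map_poly intr f).[proot] = 0. Proof. exact: svalP (cid padic_root). Qed.
Notation pev P := ((map_poly intr P).[proot]).
Notation F := {fraction ZZ}.

Definition repr (y : K) : int * {poly int} :=
  (sval (cid (f_gen y)), sval (cid (svalP (cid (f_gen y))))).
Lemma reprP y : (repr y).1 != 0 /\ (repr y).1%:~R * y = ev (repr y).2.
Proof. exact: svalP (cid (svalP (cid (f_gen y)))). Qed.

(** An element written [P (g0) / d] is sent to the same expression at a p-adic root of [f]. Two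
    representatives differ by a multiple of [f] up to an integer factor, so the value does not
    depend on the choice; the target is the fraction field because [p] may divide [d]. *)
Definition place (y : K) : F := tofrac (pev (repr y).2) / tofrac ((repr y).1%:~R).

Lemma placeE y d P : d != 0 -> d%:~R * y = ev P -> place y = tofrac (pev P) / tofrac d%:~R.
Proof.
move=> d0 dP; rewrite /place; have [r0 rP] := reprP y.
move: (repr y).1 (repr y).2 r0 rP => d' P' d'0 dP'.
have nz (k : int) : k != 0 -> tofrac (k%:~R : ZZ) != 0.
  by move=> k0; rewrite tofrac_eq0; apply: contraNneq k0 => /padic_intI ->.
apply/eqP; rewrite eqr_div ?nz // -!tofracM tofrac_eq; apply/eqP.
have /f_min[c [g [c0 cg]]] : ev (d *: P' - d' *: P) = 0.
  rewrite rmorphB /= hornerD hornerN !map_polyZ !hornerZ -dP -dP' /=; ring.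
have := congr1 (fun q => pev q) cg; rewrite rmorphM hornerM prootP mulr0 map_polyZ rmorphB /= !map_polyZ.
rewrite hornerZ hornerD hornerN !hornerZ => /eqP; rewrite mulf_eq0 => /orP[/eqP /padic_intI /eqP|].
  by rewrite (negbTE c0).
by rewrite subr_eq0 => /eqP; rewrite ![_ * d%:~R]mulrC ![_ * d'%:~R]mulrC.
Qed.

Lemma place_rmorph : [/\ {morph place : x y / x - y}, {morph place : x y / x * y} & place 1 = 1].
Proof.
have nz (k : int) : k != 0 -> tofrac (k%:~R : ZZ) != 0.
  by move=> k0; rewrite tofrac_eq0; apply: contraNneq k0 => /padic_intI ->.
split=> [x y|x y|].
- have [x0 xP] := reprP x; have [y0 yP] := reprP y.
  rewrite (placeE x0 xP) (placeE y0 yP).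
  rewrite (@placeE _ ((repr x).1 * (repr y).1) ((repr y).1 *: (repr x).2 - (repr x).1 *: (repr y).2)) ?mulf_neq0 //.
    rewrite rmorphB /= hornerD hornerN !map_polyZ !hornerZ /= rmorphM /= tofracB !tofracM.
    exact: fracB (nz _ x0) (nz _ y0).
  rewrite rmorphB /= hornerD hornerN !map_polyZ !hornerZ -xP -yP /= rmorphM /=; ring.
- have [x0 xP] := reprP x; have [y0 yP] := reprP y.
  rewrite (placeE x0 xP) (placeE y0 yP).
  rewrite (@placeE _ ((repr x).1 * (repr y).1) ((repr x).2 * (repr y).2)) ?mulf_neq0 //.
    rewrite intrM [map_poly _ _]rmorphM /= hornerM !tofracM.
    by rewrite mulf_div.
  rewrite intrM [map_poly _ _]rmorphM /= hornerM -xP -yP; ring.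
- rewrite (@placeE _ 1 1) ?oner_eq0 //; last by rewrite mulr1 [map_poly _ _]rmorph1 -polyC1 hornerC.
  by rewrite [map_poly _ _]rmorph1 -polyC1 hornerC divff // tofrac_eq0 oner_eq0.
Qed.

HB.instance Definition _ := GRing.isZmodMorphism.Build K F place (let: And3 h _ _ := place_rmorph in h).
HB.instance Definition _ := GRing.isMonoidMorphism.Build K F place
  (let: And3 _ h1 h2 := place_rmorph in (h2, h1)).
End Place.

(** The prime avoids three things: the divisors of the factorial of [B], so that it exceeds [B]; the
    resultant-like number [e], so that Hensel's lemma applies; and the chosen denominators of the
    elements of [s], so that these become integral. *)
Theorem exists_place (s : seq K) B : exists p (p_pr : prime p) (phi : {rmorphism K -> {fraction padic p_pr}}),
  (B < p)%N /\ forall y, y \in s -> exists t, phi y = tofrac t.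
Proof.
pose d y := (repr y).1.
have d0 y : (0 < `|d y|)%N by rewrite absz_gt0; case: (reprP y).
pose M := (B`! * `|e| * \prod_(y <- s) `|d y|)%N.
have M0 : (0 < M)%N by rewrite !muln_gt0 fact_gt0 absz_gt0 e0 prodn_gt0.
have [p [p_pr pM [t pt]]] := prime_divides_value nf_size M0.
have pe : ~~ (p %| e)%Z by apply: contra pM => h; rewrite /M -mulnA mulnCA dvdn_mulr.
exists p, p_pr, (place p_pr pe pt); split.
  rewrite ltnNge; apply: contra pM => pB; rewrite /M -mulnA dvdn_mulr // dvdn_fact // prime_gt0 //.
move=> y ys; have [|z hz] := @padic_int_unit p p_pr (d y).
  by apply: contra pM => h; rewrite /M (big_rem y) //= mulnCA dvdn_mulr.
exists ((map_poly intr (repr y).2).[proot p_pr pe pt] * z).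
rewrite /= /place tofracM; congr (_ * _).
have := congr1 (@tofrac _) hz; rewrite tofracM tofrac1 => h.
by rewrite -[LHS]mulr1 -h mulKf //; apply: contra_eq_neq h => ->; rewrite mul0r eq_sym oner_eq0.
Qed.
End NumberField.

(** * Heights and the Liouville inequality *)

Lemma leq_expl a b k : (a <= b)%N -> (a ^ k <= b ^ k)%N.
Proof. by case: k => // k h; rewrite leq_exp2r. Qed.

Lemma size_absurd a b c : (1 < a)%N -> (0 < b)%N -> (c <= a.-1)%N -> c = (b + a).-1 -> False.
Proof. lia. Qed.

Lemma absz_sgz (x : int) : `|x|%N%:Z = sgz x * x.
Proof. by case: sgzP; lia. Qed.

Section Liouville.
Context (K : fieldType) (g0 : K) (f : {poly int}).
Notation ev P := ((map_poly intr P).[g0]).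
Hypothesis charK : forall k : int, k%:~R = 0 :> K -> k = 0.
Hypothesis f_root : ev f = 0.
Hypothesis f_gen : forall y : K, exists d P, d != 0 /\ d%:~R * y = ev P.
Hypothesis f_min : forall P, ev P = 0 -> exists c g, c != 0 /\ c *: P = g * f.
Hypothesis f_size : (1 < size f)%N.
Notation D := (size f).-1.

Definition coords (y : K) (N : 'I_D -> int) := y = \sum_j (N j)%:~R * g0 ^+ j.

Lemma coords_inj y N N' : coords y N -> coords y N' -> N =1 N'.
Proof.
move=> -> h; pose P := \poly_(j < D) (if insub j is Some j' then N j' - N' j' else 0).
have Pj (j : 'I_D) : P`_j = N j - N' j by rewrite coef_poly ltn_ord valK.
have P0 : ev P = 0.
  rewrite (@horner_coef_wide _ D); last by rewrite (leq_trans (size_poly _ _)) ?size_poly.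
  transitivity (\sum_j (N j)%:~R * g0 ^+ j - \sum_j (N' j)%:~R * g0 ^+ j); last by rewrite -h subrr.
  by rewrite -sumrB; apply: eq_bigr => j _; rewrite coef_map /= Pj rmorphB mulrBl.
have [c [g [c0 cg]]] := f_min P0.
have PE : P = 0.
  apply: contrapT => /eqP Pn; have : size (c *: P) = size (g * f) by rewrite cg.
  have f0 : f != 0 by rewrite -size_poly_gt0 ltnW.
  have g0' : g != 0 by apply: contraNneq Pn => g0'; move/eqP: cg; rewrite g0' mul0r scale_poly_eq0 (negbTE c0).
  rewrite size_scale // size_mul //.
  have : (size P <= D)%N by rewrite size_poly.
  have : (0 < size g)%N by rewrite size_poly_gt0.
  by move=> h1 h2 h3; exact: size_absurd f_size h1 h2 h3.
by move=> j; apply/eqP; rewrite -subr_eq0 -Pj PE coef0.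
Qed.

(** Multiplication by [b * y] has an integral matrix with entries at most [H] in the powers of [g0].
    This notion replaces heights: it behaves well under sums, products and, through the adjugate
    matrix, inverses. *)
Definition sz (b H : nat) (y : K) := exists N : 'I_D -> 'I_D -> int,
  (forall i j, (`|N i j| <= H)%N) /\ forall i : 'I_D, coords (b%:R * y * g0 ^+ i) (N i).

Lemma sz_leq b H H' y : (H <= H')%N -> sz b H y -> sz b H' y.
Proof. by move=> h [N [h1 h2]]; exists N; split=> // i j; exact: leq_trans (h1 i j) h. Qed.

Lemma sz_scale c b H y : sz b H y -> sz (c * b) (c * H) y.
Proof.
move=> [N [h1 h2]]; exists (fun i j => c%:Z * N i j); split=> [i j|i].
  by rewrite abszM leq_mul2l h1 orbT.
rewrite /coords natrM -!mulrA mulrA [_ * (_ * _)](_ : _ = c%:R * (b%:R * y * g0 ^+ i)); last by ring.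
rewrite h2 mulr_sumr; apply: eq_bigr => j _; by rewrite intrM -pmulrn mulrA.
Qed.

Lemma sz1 : sz 1 1 1.
Proof.
exists (fun i j => (i == j)%:Z); split=> [i j|i]; first by case: eqP.
rewrite /coords !mul1r (bigD1 i) //= eqxx mul1r big1 ?addr0 // => j /negbTE ji.
by rewrite eq_sym ji mul0r.
Qed.

Lemma szD b H H' y y' : sz b H y -> sz b H' y' -> sz b (H + H') (y + y').
Proof.
move=> [N [h1 h2]] [N' [h1' h2']]; exists (fun i j => N i j + N' i j); split=> [i j|i].
  by move: (h1 i j) (h1' i j); clear; lia.
rewrite /coords mulrDr mulrDl h2 h2' -big_split; apply: eq_bigr => j _ /=.
by rewrite rmorphD mulrDl.
Qed.

Lemma absz_sum (I : Type) (s : seq I) (F : I -> int) : (`|(\sum_(i <- s) F i)%R| <= \sum_(i <- s) `|F i|)%N.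
Proof. by elim/big_ind2: _ => //= x m y n; lia. Qed.

Lemma szM b b' H H' y y' : sz b H y -> sz b' H' y' -> sz (b * b') (D * (H * H')) (y * y').
Proof.
move=> [N [h1 h2]] [N' [h1' h2']]; exists (fun i k => \sum_j N i j * N' j k); split=> [i k|i].
  apply: leq_trans (absz_sum _ _) _.
  apply: (@leq_trans (\sum_(j < D) H * H')%N); last by rewrite sum_nat_const card_ord.
  by apply: leq_sum => j _; rewrite abszM leq_mul.
rewrite /coords natrM (_ : _ * _ * _ * _ = (b'%:R * y') * (b%:R * y * g0 ^+ i)); last by ring.
rewrite h2 mulr_sumr.
transitivity (\sum_j \sum_k (N i j * N' j k)%:~R * g0 ^+ k).
  apply: eq_bigr => j _; rewrite mulrCA h2' mulr_sumr; apply: eq_bigr => k _.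
  by rewrite intrM mulrA.
by rewrite exchange_big; apply: eq_bigr => k _; rewrite -mulr_suml -rmorph_sum.
Qed.

Lemma szX b H y k : sz b H y -> sz (b ^ k) ((D * H) ^ k) (y ^+ k).
Proof.
by move=> h; elim: k => [|k IH]; [exact: sz1 | rewrite exprS !expnS -mulnA; exact: szM].
Qed.

Lemma sz_prod (I : Type) (s : seq I) (b : I -> nat) H (y : I -> K) : (forall i, sz (b i) H (y i)) ->
  sz (\prod_(i <- s) b i) ((D * H) ^ size s) (\prod_(i <- s) y i).
Proof.
move=> h; elim: s => [|i s IH]; first by rewrite !big_nil; exact: sz1.
by rewrite !big_cons /= expnS -mulnA; exact: szM.
Qed.

Lemma sz_sum (I : eqType) (s : seq I) b H (y : I -> K) : (forall i, i \in s -> sz b H (y i)) ->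
  sz b (size s * H) (\sum_(i <- s) y i).
Proof.
elim: s => [|i s IH] h.
  rewrite big_nil; exists (fun _ _ => 0); split=> // i; rewrite /coords mulr0 mul0r big1 // => j _; by rewrite mul0r.
rewrite big_cons /= mulSn; apply: szD; first by apply: h; rewrite mem_head.
by apply: IH => j hj; apply: h; rewrite inE hj orbT.
Qed.

Lemma sz_exists y : exists b H, [/\ (0 < b)%N, (0 < H)%N & sz b H y].
Proof.
have [d [P [d0 dP]]] := f_gen y.
have f0 : f != 0 by rewrite -size_poly_gt0 ltnW.
have /choice[a ha] : forall i : 'I_D, exists aN : int * ('I_D -> int), aN.1 != 0 /\ coords (aN.1%:~R * y * g0 ^+ i) aN.2.
  move=> i; pose k := scalp (P * 'X^i) f; pose rr := (P * 'X^i) %% f.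
  (* Pseudo-division by [f] costs a power of its leading coefficient, which joins the
     denominator. *)
  exists (lead_coef f ^+ k * d, fun j : 'I_D => rr`_j); split; first by rewrite mulf_neq0 // expf_neq0 // lead_coef_eq0.
  have := Pdiv.Idomain.divp_eq (P * 'X^i) f; rewrite -/k -/rr => /(congr1 (fun q => ev q)).
  rewrite map_polyZ rmorphD /= !rmorphM /= hornerZ hornerD !hornerM f_root mulr0 add0r -dP map_polyXn hornerXn.
  move=> e; rewrite /coords -!mulrA mulrA; rewrite -!mulrA in e.
  rewrite -!mulrA e (@horner_coef_wide _ D); last first.
    rewrite (leq_trans (size_poly _ _)) // -ltnS prednK ?(ltnW f_size) //; exact: ltn_modpN0.
  by apply: eq_bigr => j _; rewrite coef_map.
pose b := (\prod_i `|(a i).1|)%N.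
have b0 : (0 < b)%N by rewrite prodn_gt0 // => i; rewrite absz_gt0; case: (ha i).
pose c i := sgz (a i).1 * (\prod_(i' | i' != i) `|(a i').1|)%N%:Z.
have bc i : b%:Z = c i * (a i).1.
  by rewrite /b (bigD1 i) //= PoszM absz_sgz /c; ring.
exists b, (\sum_i \sum_j `|(c i * (a i).2 j)%R|).+1%N; split=> //.
exists (fun i j => c i * (a i).2 j); split=> [i j|i].
  by rewrite leqW // (bigD1 i) //= (bigD1 j) //= -addnA leq_addr.
rewrite /coords pmulrn (bc i) intrM -!mulrA [(a i).1%:~R * _]mulrA (ha i).2 mulr_sumr.
by apply: eq_bigr => j _; rewrite intrM mulrA.
Qed.

Lemma sz_common (s : seq K) : exists b H, [/\ (0 < b)%N, (0 < H)%N & forall y, y \in s -> sz b H y].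
Proof.
elim: s => [|x s [b [H [b0 H0 IH]]]]; first by exists 1%N, 1%N.
have [b' [H' [b0' H0' h]]] := sz_exists x.
exists (b * b')%N, (b' * H + b * H')%N; split; rewrite ?muln_gt0 ?addn_gt0 ?muln_gt0 ?b0 ?b0' ?H0 //.
move=> y; rewrite inE => /orP[/eqP ->|/IH hy].
  by apply: sz_leq (sz_scale b h); rewrite leq_addl.
by rewrite mulnC; apply: sz_leq (sz_scale b' hy); rewrite leq_addr.
Qed.

Lemma det_bound n (A : 'M[int]_n) H : (forall i j, (`|A i j| <= H)%N) -> (`|\det A| <= n`! * H ^ n)%N.
Proof.
move=> hA; rewrite /determinant; apply: leq_trans (absz_sum _ _) _.
apply: (@leq_trans (\sum_(s : 'S_n) H ^ n)%N); last by rewrite sum_nat_const card_Sn.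
apply: leq_sum => s _; rewrite abszM absz_sign mul1n.
rewrite (_ : `|_|%N = (\prod_i `|A i (s i)|)%N); last by apply: (big_morph absz abszM).
apply: (@leq_trans (\prod_(i < n) H)%N); last by rewrite prod_nat_const card_ord.
by apply: leq_prod => i _.
Qed.

Lemma adj_bound n (A : 'M[int]_n) H i j : (forall i j, (`|A i j| <= H)%N) ->
  (`|\adj A i j| <= n.-1`! * H ^ n.-1)%N.
Proof.
move=> hA; rewrite mxE /cofactor abszM absz_sign mul1n.
by apply: det_bound => i' j'; rewrite !mxE.
Qed.

(** The powers of [g0] form an eigenvector of the multiplication matrix for the eigenvalue [b * y];
    applying the adjugate gives the identity. The determinant is nonzero because the matrix
    belonging to the inverse of [y] multiplies it to a nonzero scalar. *)
Lemma sz_det b H y : (0 < b)%N -> sz b H y -> y != 0 -> exists N : 'M[int]_D,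
  [/\ forall i j : 'I_D, (`|N i j| <= H)%N, \det N != 0 &
      forall i : 'I_D, (\det N)%:~R * g0 ^+ i = b%:R * y * \sum_j (\adj N i j)%:~R * g0 ^+ j].
Proof.
move=> b0 [N [h1 h2]] y0; pose M : 'M[int]_D := \matrix_(i, j) N i j.
have E (i : 'I_D) : (\det M)%:~R * g0 ^+ i = b%:R * y * \sum_j (\adj M i j)%:~R * g0 ^+ j.
  rewrite mulr_sumr; under eq_bigr do rewrite mulrCA h2 mulr_sumr.
  rewrite exchange_big /=.
  transitivity (\sum_k ((\adj M *m M) i k)%:~R * g0 ^+ k).
    rewrite mul_adj_mx (bigD1 i) //= big1 => [|k ki]; last by rewrite mxE eq_sym (negbTE ki) mul0r.
    by rewrite mxE eqxx addr0 mulr1n.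
  apply: eq_bigr => k _; rewrite mxE rmorph_sum mulr_suml; apply: eq_bigr => j _.
  by rewrite /= intrM [M j k]mxE mulrA.
exists M; split=> // [i j|]; first by rewrite mxE.
have [b' [H' [b0' _ [N' [_ h2']]]]] := sz_exists y^-1.
have NN : M *m (\matrix_(i, j) N' i j) = (b * b')%:Z%:M.
  apply/matrixP => i k; rewrite [LHS]mxE.
  apply: (@coords_inj ((b * b')%:R * g0 ^+ i) (fun k => \sum_j M i j * (\matrix_(i, j) N' i j) j k) (fun k => (b * b')%:Z%:M i k)).
    rewrite /coords natrM (_ : _ * _ * _ = (b'%:R * y^-1) * (b%:R * y * g0 ^+ i)); last by field.
    rewrite h2 mulr_sumr.
    transitivity (\sum_j \sum_k (N i j * N' j k)%:~R * g0 ^+ k).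
      apply: eq_bigr => j _; rewrite mulrCA h2' mulr_sumr; apply: eq_bigr => k' _.
      by rewrite intrM mulrA.
    rewrite exchange_big; apply: eq_bigr => k' _; rewrite -mulr_suml -rmorph_sum /=; congr (_%:~R * _).
    by apply: eq_bigr => j _; rewrite !mxE.
  rewrite /coords (bigD1 i) //= big1 => [|k' ki]; last by rewrite mxE eq_sym (negbTE ki) mul0r.
  by rewrite mxE eqxx addr0 mulr1n -pmulrn.
apply/eqP => dM; have := congr1 determinant NN; rewrite det_mulmx dM mul0r det_scalar => /eqP.
by rewrite eq_sym expf_eq0 => /andP[_]; rewrite eqz_nat muln_eq0; move: b0 b0'; clear; lia.
Qed.

(** The identity of [sz_det] read backwards: the determinant is a denominator of the inverse, and
    [b] times the adjugate its matrix. *)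
Lemma sz_inv b H y : (0 < b)%N -> sz b H y -> y != 0 ->
  exists b', [/\ (0 < b')%N, (b' <= D`! * H ^ D)%N & sz b' (b * (D.-1`! * H ^ D.-1)) y^-1].
Proof.
move=> b0 h y0; have [N [h1 h2 h3]] := sz_det b0 h y0.
exists `|\det N|%N; split; [by rewrite absz_gt0 | exact: det_bound |].
exists (fun i j => sgz (\det N) * (b%:Z * \adj N i j)); split=> [i j|i].
  rewrite !abszM (_ : `|sgz _|%N = 1%N) ?mul1n ?leq_mul2l ?adj_bound ?orbT //.
  by move: h2; case: sgzP.
rewrite /coords pmulrn absz_sgz intrM.
rewrite (_ : _ * _ * _ * _ = (sgz (\det N))%:~R * (y^-1 * ((\det N)%:~R * g0 ^+ i))); last by ring.
rewrite h3 -!mulrA [y^-1 * _]mulrCA mulKf // !mulr_sumr; apply: eq_bigr => j _.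
by rewrite !intrM -pmulrn !mulrA.
Qed.

Context (C : fieldType) (R : realType) (nrm : C -> R) (av : absval nrm) (iota : {rmorphism K -> C}).
Hypothesis nrm_int : forall k : int, nrm k%:~R = (`|k|%N)%:R.

(** A nonzero integer has absolute value at least 1. Here it is a determinant, equal to [b * y]
    times a combination of powers of [g0] with adjugate entries, which are of order [H ^ D.-1]. *)
Lemma liouville : exists2 V : R, 0 < V & forall b H y, (0 < b)%N -> sz b H y -> y != 0 ->
  1 <= nrm (iota y) * b%:R * H%:R ^+ D.-1 * V.
Proof.
pose V0 := 1 + \sum_(j < D) nrm (iota g0) ^+ j.
have V00 : 0 < V0 by rewrite ltr_pwDl // sumr_ge0 // => j _; rewrite exprn_ge0 ?(av_ge0 av).
exists ((D.-1`!)%:R * V0); first by rewrite mulr_gt0 // ltr0n fact_gt0.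
move=> b H y b0 h y0; have [N [h1 h2 h3]] := sz_det b0 h y0.
have D0 : (0 < D)%N by move: f_size; clear; lia.
have := congr1 (fun t => nrm (iota t)) (h3 (Ordinal D0)).
rewrite expr0 mulr1 rmorph_int nrm_int !rmorphM rmorph_nat !(avM av) => e.
have : 1 <= (`|\det N|%N)%:R :> R by rewrite ler1n absz_gt0.
move/le_trans; apply; rewrite e -[b%:R in leLHS]/(b%:Z%:~R) nrm_int absz_nat [nrm _ * b%:R]mulrC -!mulrA.
apply: ler_wpM2l => //; apply: ler_wpM2l; first exact: av_ge0 av _.
rewrite rmorph_sum /=; apply: le_trans (av_sum av _ _ _) _.
rewrite /V0 mulrDr mulr1 [leRHS]mulrDr ; apply: (@le_trans _ _ (H%:R ^+ D.-1 * ((D.-1)`!%:R * \sum_(j < D) nrm (iota g0) ^+ j))); last first.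
  by rewrite lerDr mulr_ge0.
rewrite mulrA mulr_sumr; apply: ler_sum => j _.
rewrite rmorphM rmorph_int rmorphXn (avM av) nrm_int (avX av) ler_wpM2r ?exprn_ge0 ?(av_ge0 av) //.
by rewrite -natrX -natrM ler_nat mulnC adj_bound.
Qed.

Context (I : Type) (n r : nat) (E : I -> nat) (z : I -> 'I_n -> K) (A : I -> 'I_r -> K) (b0 H0 : nat).
Hypothesis b00 : (0 < b0)%N.
Hypothesis H00 : (0 < H0)%N.
Hypothesis hz : forall k i, exists b, [/\ (0 < b)%N, (b <= b0 ^ E k)%N & sz b (H0 ^ E k) (z k i)].
Hypothesis hA : forall k i, exists b, [/\ (0 < b)%N, (b <= b0 ^ E k)%N & sz b (H0 ^ E k) (A k i)].

Lemma evalZYE k w : evalZY z A k w = \sum_(e <- msupp w) \sum_(mu <- msupp (mcoeff e w))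
  mcoeff mu (mcoeff e w) * ((\prod_i A k i ^+ mu i) * \prod_i z k i ^+ e i).
Proof.
rewrite /evalZY.
transitivity (meval (z k) (\sum_(e <- msupp w) map_mpoly (meval (A k)) (mcoeff e w *: mpolyX _ e))).
  by rewrite -raddf_sum -mpolyE.
rewrite raddf_sum; apply: eq_bigr => e _ /=.
have -> : map_mpoly (meval (A k)) (mcoeff e w *: mpolyX _ e) = meval (A k) (mcoeff e w) *: mpolyX _ e.
  apply/mpolyP => e'; rewrite mcoeff_map_mpoly !mcoeffZ !mcoeffX /= mevalM; congr (_ * _).
  by case: eqP => _; rewrite ?meval1 ?meval0.
rewrite mevalZ mevalX [in LHS](mevalE (A k)) mulr_suml; apply: eq_bigr => mu _; by rewrite mulrA.
Qed.

(** The denominator is [b i ^ d] whatever the exponent [e i] is, so that different monomials can be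
    added. *)
Lemma sz_monomial (B : nat) H d q (b : 'I_q -> nat) (y : 'I_q -> K) (e : 'I_q -> nat) :
  (0 < H)%N -> (forall i, (0 < b i <= B)%N) -> (forall i, sz (b i) H (y i)) -> (forall i, e i < d)%N ->
  sz (\prod_i b i ^ d) ((D * (D ^ d * (B * H) ^ d)) ^ q) (\prod_i y i ^+ e i).
Proof.
move=> H1 hb hy he; have D0 : (0 < D)%N by move: f_size; clear; lia.
have sq : size (index_enum 'I_q) = q by rewrite -sum1_size sum_nat_const card_ord muln1.
have := @sz_prod _ (index_enum 'I_q) (fun i => b i ^ d)%N (D ^ d * (B * H) ^ d)%N
  (fun i => y i ^+ e i); rewrite sq; apply => i; have /andP[b1 b2] := hb i.
have ed : (e i <= d)%N by exact: ltnW.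
have := sz_scale (b i ^ (d - e i)) (szX (e i) (hy i)); rewrite -expnD subnK //.
apply: sz_leq; rewrite expnMn mulnCA leq_mul ?leq_pexp2l //.
apply: (@leq_trans (B ^ (d - e i) * (B * H) ^ e i)%N).
  by rewrite leq_mul ?leq_expl // leq_pmull // (leq_trans b1).
by rewrite -[in leqRHS](subnK ed) expnD leq_mul2r; apply/orP; right; rewrite leq_expl // leq_pmulr.
Qed.

Theorem exists_liouville_rate : exists2 kap : R, 0 < kap & forall d w, boxed d w ->
  exists2 c : R, 0 < c & forall k, evalZY z A k w = 0 \/ c * kap ^+ (d * E k) <= nrm (iota (evalZY z A k w)).
Proof.
have [V V0 hV] := liouville.
pose Q := (b0 * H0)%N; have Q0 : (0 < Q)%N by rewrite muln_gt0 b00.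
(* In [kinv] the first factor bounds the denominators and the second the entries, raised to the
   power [D.-1] of the Liouville inequality. Both are exponential in [d * E k] and independent of
   [w]. *)
pose q := (r + n)%N; pose kinv : nat := (b0 ^ q * (Q ^ q) ^ D.-1)%N.
have k0 : (0 < kinv)%N by rewrite muln_gt0 !expn_gt0 b00 Q0 // orbT.
exists (kinv%:R^-1); first by rewrite invr_gt0 ltr0n.
move=> d w hw.
pose cs := flatten [seq [seq mcoeff mu (mcoeff e w) | mu <- msupp (mcoeff e w)] | e <- msupp w].
have [bw [Hw [bw0 Hw0 hcs]]] := sz_common cs.
pose N1 := (\sum_(e <- msupp w) size (msupp (mcoeff e w)))%N.
pose C1 := (size (msupp w) * (N1 * (D * (Hw * (D * (D * D ^ d) ^ q))))).+1%N.
exists (bw%:R * C1%:R ^+ D.-1 * V)^-1.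
  by rewrite invr_gt0 !mulr_gt0 ?exprn_gt0 ?ltr0n.
move=> k; have [->|ne] := eqVneq (evalZY z A k w) 0; [by left | right].
have /choice[bz hbz] := hz k; have /choice[bA hbA] := hA k.
pose B := (b0 ^ E k)%N; pose H := (H0 ^ E k)%N; pose X := (D * (D ^ d * (B * H) ^ d))%N.
pose T := (\prod_i bA i ^ d * \prod_i bz i ^ d)%N.
have H1 : (0 < H)%N by rewrite expn_gt0 H00.
have szmon e mu : e \in msupp w -> mu \in msupp (mcoeff e w) ->
    sz (bw * T) (D * (Hw * (D * (X ^ r * X ^ n)))) (mcoeff mu (mcoeff e w) * ((\prod_i A k i ^+ mu i) * \prod_i z k i ^+ e i)).
  move=> he hmu; have [h1 h2] : (forall i, e i < d)%N /\ (forall i, mu i < d)%N.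
    by apply: hw; rewrite -mcoeff_msupp.
  apply: szM; first by apply: hcs; apply/flatten_mapP; exists e => //; apply/mapP; exists mu.
  by apply: szM; apply: sz_monomial => // i; [case: (hbA i) => -> -> | case: (hbA i) | case: (hbz i) => -> -> | case: (hbz i)].
have szw : sz (bw * T) (size (msupp w) * (N1 * (D * (Hw * (D * (X ^ r * X ^ n)))))) (evalZY z A k w).
  rewrite evalZYE; apply: sz_sum => e he.
  apply: sz_leq (sz_sum _); last by move=> mu hmu; exact: szmon.
  by rewrite leq_mul2r /N1 (big_rem e) //= leq_addr orbT.
have XE : (D * (X ^ r * X ^ n) = D * (D * D ^ d) ^ q * (Q ^ q) ^ (d * E k))%N.
  have -> : X = (D * D ^ d * Q ^ (E k * d))%N by rewrite /X /B /H -[in LHS](expnMn b0 H0) -/Q expnM mulnA.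
  rewrite -expnD -/q expnMn mulnA; congr (_ * _)%N; rewrite -!expnM; congr (_ ^ _)%N; ring.
have Hle : (size (msupp w) * (N1 * (D * (Hw * (D * (X ^ r * X ^ n))))) <= C1 * (Q ^ q) ^ (d * E k))%N.
  by rewrite XE /C1 mulSn !mulnA leq_addl.
have Tle : (bw * T <= bw * (b0 ^ q) ^ (d * E k))%N.
  rewrite leq_mul2l; apply/orP; right.
  have h m (b : 'I_m -> nat) : (forall i, b i <= B)%N -> (\prod_i b i ^ d <= (b0 ^ m) ^ (d * E k))%N.
    move=> hb; apply: (@leq_trans (\prod_(i < m) B ^ d)%N).
      by apply: leq_prod => i _; rewrite leq_expl.
    by rewrite prod_nat_const card_ord /B -!expnM (_ : E k * (d * m) = m * (d * E k))%N //; ring.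
  by rewrite /q expnD expnMn leq_mul // h // => i; [case: (hbA i) | case: (hbz i)].
have T0 : (0 < bw * T)%N.
  rewrite !muln_gt0 bw0 !prodn_gt0 // => i; rewrite expn_gt0.
    by case: (hbz i) => ->.
  by case: (hbA i) => ->.
have := hV _ _ _ T0 (sz_leq Hle szw) ne; set y := nrm _ => h.
have y0 : 0 <= y by exact: av_ge0 av _.
have c0 : 0 < bw%:R * C1%:R ^+ D.-1 * V * kinv%:R ^+ (d * E k).
  by rewrite !mulr_gt0 ?exprn_gt0 ?ltr0n.
rewrite exprVn -invfM -div1r ler_pdivrMr //; apply: le_trans h _.
pose Y : R := y * V * C1%:R ^+ D.-1 * (((Q ^ q) ^ (d * E k))%:R) ^+ D.-1.
have Y0 : 0 <= Y by rewrite !mulr_ge0 ?exprn_ge0 // ltW.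
have -> : y * (bw * T)%:R * (C1 * (Q ^ q) ^ (d * E k))%:R ^+ D.-1 * V = Y * (bw * T)%:R.
  by rewrite /Y [(C1 * _)%:R]natrM exprMn; ring.
have -> : y * (bw%:R * C1%:R ^+ D.-1 * V * kinv%:R ^+ (d * E k)) = Y * (bw * (b0 ^ q) ^ (d * E k))%:R.
  have -> : kinv%:R ^+ (d * E k) = ((b0 ^ q) ^ (d * E k))%:R * ((Q ^ q) ^ (d * E k))%:R ^+ D.-1 :> R.
    rewrite -!natrX -natrM /kinv expnMn; congr ((_ * _)%:R); by rewrite -!expnM; congr (_ ^ _)%N; ring.
  by rewrite /Y [(bw * _)%:R]natrM; ring.
by rewrite ler_wpM2l // ler_nat.
Qed.
End Liouville.

(** * Number fields inside a field of characteristic zero *)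

Section Subfield.
Context (C : numFieldType).
Notation evp P g := ((map_poly intr P).[g]).

(** Minimality concerns the degree only; without a primitivity condition, divisibility by [mpol]
    holds up to a nonzero integer factor. *)
Record min_int_poly := MinIntPoly {
  mroot : C; mpol : {poly int};
  mpol_neq0 : mpol != 0; mpol_root : evp mpol mroot = 0;
  mpol_min : forall P, P != 0 -> evp P mroot = 0 -> (size mpol <= size P)%N }.

Lemma intrC_eq0 (k : int) : k%:~R = 0 :> C -> k = 0.
Proof. by move=> /eqP; rewrite intr_eq0 => /eqP. Qed.

Context (A : min_int_poly).
Notation g := (mroot A).
Notation f := (mpol A).
Notation ev P := (evp P g).

Lemma evM P Q : ev (P * Q) = ev P * ev Q. Proof. by rewrite rmorphM hornerM. Qed.
Lemma evD P Q : ev (P + Q) = ev P + ev Q. Proof. by rewrite rmorphD hornerD. Qed.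
Lemma evB P Q : ev (P - Q) = ev P - ev Q. Proof. by rewrite rmorphB hornerD hornerN. Qed.
Lemma evC c : ev c%:P = c%:~R. Proof. by rewrite map_polyC hornerC. Qed.
Lemma evZ c P : ev (c *: P) = c%:~R * ev P. Proof. by rewrite map_polyZ hornerZ. Qed.

Lemma mpol_dvd P : ev P = 0 -> exists c q, c != 0 /\ c *: P = q * f.
Proof.
move=> h; exists (lead_coef f ^+ scalp P f), (P %/ f); split.
  by rewrite expf_neq0 // lead_coef_eq0 mpol_neq0.
rewrite Pdiv.Idomain.divp_eq; apply/eqP; rewrite -subr_eq0 addrC addrA addNr add0r.
apply: contrapT => /negP r0.
have r1 : ev (P %% f) = 0.
  have := congr1 (fun q => ev q) (Pdiv.Idomain.divp_eq P f).
  by rewrite evZ h mulr0 evD evM mpol_root mulr0 add0r.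
by have := mpol_min r0 r1; rewrite leqNgt ltn_modp mpol_neq0.
Qed.

(** A common divisor of [P] and [f] does not vanish at [g], so the cofactor in [f] does and has at
    least the degree of [f]; the divisor is therefore constant. *)
Lemma mpol_bezout P : ev P != 0 -> exists u v e, e != 0 /\ u * P + v * f = e%:P.
Proof.
move=> hP.
have /Bezout_coprimepP[[u v] /=] : coprimep P f.
  apply/coprimepP => d /Pdiv.Idomain.dvdpP[[c1 q1] /= c10 e1] /Pdiv.Idomain.dvdpP[[c2 q2] /= c20 e2].
  have dg : ev d != 0.
    apply: contraNneq hP => dg; have := congr1 (fun q => ev q) e1; rewrite evZ evM dg mulr0 => /eqP.
    by rewrite mulf_eq0 intr_eq0 (negbTE c10).
  have q20 : q2 != 0.
    by apply: contraNneq (mpol_neq0 A) => q20; move/eqP: e2; rewrite q20 mul0r scale_poly_eq0 (negbTE c20).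
  have d0 : d != 0 by apply: contraNneq dg => ->; rewrite map_poly0 horner0.
  have q2g : ev q2 = 0.
    have := congr1 (fun q => ev q) e2; rewrite evZ evM mpol_root mulr0 => /eqP.
    by rewrite eq_sym mulf_eq0 (negbTE dg) orbF => /eqP.
  have := congr1 (fun q : {poly int} => size q) e2; rewrite size_scale // size_mul // => sz.
  have := mpol_min q20 q2g; rewrite sz -size_poly_eq1.
  rewrite -size_poly_gt0 in d0; rewrite -size_poly_gt0 in q20.
  by move: (size d) (size q2) d0 q20 => x y; clear; lia.
rewrite -size_poly_eq1 => /size_poly1P[e e0 he].
by exists u, v, e.
Qed.

Lemma mpol_size : (1 < size f)%N.
Proof.
rewrite ltnNge; apply/negP => /size1_polyC fE; have := mpol_root A; rewrite fE evC => /intrC_eq0 h.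
by have := mpol_neq0 A; rewrite fE h polyC0 eqxx.
Qed.

Lemma mpol_sep : exists u v e, e != 0 /\ u * f + v * f^`() = e%:P.
Proof.
have sf : (size f^`() < size f)%N by rewrite lt_size_deriv // mpol_neq0.
have f'0 : f^`() != 0.
  apply/eqP => h; have /eqP := congr1 (fun q : {poly int} => q`_((size f).-2)) h.
  rewrite coef_deriv coef0 prednK; last by move: mpol_size; clear; lia.
  by rewrite mulrn_eq0 -lead_coefE lead_coef_eq0 (negbTE (mpol_neq0 A)) orbF; move: mpol_size; clear; lia.
have [|v [u [e [e0 h]]]] := @mpol_bezout f^`().
  by apply/eqP => h; have := mpol_min f'0 h; rewrite leqNgt sf.
by exists u, v, e; rewrite addrC.
Qed.

Definition nfpred : {pred C} := [pred y : C | `[< exists d P, d != 0 /\ d%:~R * y = ev P >]].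
Lemma nfpredP y : reflect (exists d P, d != 0 /\ d%:~R * y = ev P) (y \in nfpred).
Proof. exact: asboolP. Qed.

Lemma nfpred_divring : GRing.divring_closed nfpred.
Proof.
split.
- by apply/nfpredP; exists 1, 1%:P; rewrite evC mulr1.
- move=> x y /nfpredP[d [P [d0 e]]] /nfpredP[d' [P' [d'0 e']]]; apply/nfpredP.
  exists (d * d'), (d' *: P - d *: P'); rewrite mulf_neq0 // evB !evZ -e -e' intrM; split=> //; ring.
- move=> x y /nfpredP[d [P [d0 e]]] /nfpredP[d' [P' [d'0 e']]]; apply/nfpredP.
  have [->|y0] := eqVneq y 0; first by exists 1, 0; rewrite invr0 !mulr0 map_poly0 horner0.
  have [|u [v [k [k0 h]]]] := @mpol_bezout P'; first by rewrite -e' mulf_neq0 ?intr_eq0.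
  exists (d * k), (P * (d' *: u)); rewrite mulf_neq0 //; split=> //.
  have := congr1 (fun q => ev q) h; rewrite evD !evM mpol_root mulr0 addr0 evC evZ => h'.
  by rewrite -e intrM -h' -e'; field.
Qed.

HB.instance Definition _ := GRing.isDivringClosed.Build C nfpred nfpred_divring.

Record nfield := NField { nfval :> C; _ : nfval \in nfpred }.
HB.instance Definition _ := [isSub for nfval].
HB.instance Definition _ := [Choice of nfield by <:].
HB.instance Definition _ := [SubChoice_isSubIntegralDomain of nfield by <:].
HB.instance Definition _ := [SubIntegralDomain_isSubField of nfield by <:].

Lemma nfield_gen_in : g \in nfpred.
Proof. by apply/nfpredP; exists 1, 'X; rewrite map_polyX hornerX mul1r. Qed.
Definition nfield_gen : nfield := NField nfield_gen_in.
End Subfield.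

(** * Finitely many algebraic numbers in one number field *)

Section Existence.
Context (C : numFieldType).
Notation evq P g := ((map_poly (ratr : rat -> C) P).[g]).

Lemma rat_poly_int (P : {poly rat}) : exists d (Q : {poly int}), d != 0 /\
  forall z : C, d%:~R * evq P z = (map_poly intr Q).[z].
Proof.
have [Q [a a0 ->]] := rat_poly_scale P; exists a, Q; split=> // z.
rewrite map_polyZ hornerZ /= fmorphV rmorph_int mulrA mulfV ?intr_eq0 // mul1r -map_poly_comp.
by congr (_.[z]); apply: eq_map_poly => k /=; rewrite ratr_int.
Qed.

Lemma rat_PET (s : seq C) : (forall x, x \in s -> algebraicOver (ratr : rat -> C) x) ->
  exists g, algebraicOver (ratr : rat -> C) g /\ forall x, x \in s -> exists P, x = evq P g.
Proof.
elim: s => [|x s IH] hs.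
  exists 0; split=> //; exists 'X; first by rewrite polyX_eq0.
  by rewrite map_polyX /root hornerX.
have [|g [galg hg]] := IH; first by move=> y ys; apply: hs; rewrite inE ys orbT.
have [p p0 px] := hs x (mem_head _ _); have [q q0 qg] := galg.
have [n [[Px hPx] [Pg hPg]]] := pchar0_PET p0 px q0 qg (pchar_num _).
exists (g *+ n - x); split.
  apply: algebraic_sub; last exact: hs (mem_head _ _).
  by rewrite -mulr_natr -(ratr_nat C n); apply: algebraic_mul => //; exact: algebraic_id.
move=> y; rewrite inE => /orP[/eqP ->|/hg [P ->]]; first by exists Px.
by exists (P \Po Pg); rewrite map_comp_poly horner_comp hPg.
Qed.

Lemma exists_min_int_poly (g : C) : algebraicOver (ratr : rat -> C) g -> exists A : min_int_poly C, mroot A = g.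
Proof.
move=> [p p0 pg]; have [d [Q [d0 hQ]]] := rat_poly_int p.
pose T n := `[< exists P : {poly int}, [/\ P != 0, (map_poly intr P).[g] = 0 & size P = n] >].
have exT : exists n, T n.
  exists (size Q); apply/asboolP; exists Q; split=> //.
    apply: contraNneq p0 => Q0; have [q [a a0 pE]] := rat_poly_scale p.
    have h0 z : evq p z = 0.
      apply/eqP; have := hQ z; rewrite Q0 map_poly0 horner0 => /eqP.
      by rewrite mulf_eq0 intr_eq0 (negbTE d0).
    apply: contrapT => /negP p0.
    have pC0 : map_poly (ratr : rat -> C) p != 0 by rewrite map_poly_eq0.
    pose rs := [seq (i%:R : C) | i <- iota 0 (size (map_poly (ratr : rat -> C) p))].
    have : (size rs < size (map_poly (ratr : rat -> C) p))%N.
      apply: max_poly_roots => //; first by apply/allP => x _; rewrite /root h0.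
      by rewrite map_inj_uniq ?iota_uniq // => i j /eqP; rewrite eqr_nat => /eqP.
    by rewrite size_map size_iota ltnn.
  by rewrite -hQ (eqP pg) mulr0.
case: (ex_minnP exT) => n /asboolP[P [P0 Pg Pn]] minn.
have hmin P' : P' != 0 -> (map_poly intr P').[g] = 0 -> (size P <= size P')%N.
  by move=> h1 h2; rewrite Pn; apply: minn; apply/asboolP; exists P'.
by exists (MinIntPoly P0 Pg hmin).
Qed.

Theorem exists_nfield (s : seq C) : (forall x, x \in s -> algebraicOver (ratr : rat -> C) x) ->
  exists A : min_int_poly C, forall x, x \in s -> exists y : nfield A, val y = x.
Proof.
move=> /rat_PET[g [/exists_min_int_poly[A gA] hg]]; exists A => x /hg[P xE].
have xin : x \in nfpred A.
  apply/nfpredP; have [d [Q [d0 hQ]]] := rat_poly_int P; exists d, Q; split=> //.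
  by rewrite xE hQ gA.
by exists (NField xin).
Qed.
End Existence.

(** * From algebraic to linear relations along the orbits *)

Section StepB.
Context (K : fieldType) (charK : forall n, (n.+1)%:R != 0 :> K).
Context (R : realFieldType) (m r : nat).

Notation time := ('I_m -> nat).
Definition tadd m (k P : 'I_m -> nat) : 'I_m -> nat := fun l => (k l + P l)%N.
Definition later m (k0 k : 'I_m -> nat) := forall l, (k0 l <= k l)%N.
Definition vanish (St : R -> time -> Prop) (f : time -> K) :=
  exists B : R, 0 < B /\ exists k0, forall k, St B k -> later k0 k -> f k = 0.

Context (St : R -> time -> Prop).
Hypothesis St_mono : forall B B' k, B <= B' -> St B k -> St B' k.
Hypothesis St_sub : forall B k0 P, St B k0 -> St B (tadd k0 P) -> St (B + B) P.
Hypothesis St_add : forall B B' k P, St B k -> St B' P -> St (B + B') (tadd k P).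

(** [Zc] stands for the functions of the time that are polynomials in the orbit point. The
    hypothesis [Zc0] is the density theorem: such a function vanishes identically as soon as it
    vanishes at the late times of a strip. *)
Context (Zc : (time -> K) -> Prop).
Hypothesis ZcC : forall c, Zc (fun=> c).
Hypothesis ZcD : forall f g, Zc f -> Zc g -> Zc (fun k => f k + g k).
Hypothesis ZcM : forall f g, Zc f -> Zc g -> Zc (fun k => f k * g k).
Hypothesis Zc_shift : forall P f, Zc f -> Zc (fun k => f (tadd k P)).
Hypothesis Zc0 : forall f, Zc f -> vanish St f -> forall k, f k = 0.
Context (A : time -> 'I_r -> K).
Hypothesis hA : forall P i, exists N D, [/\ Zc N, Zc D, (forall k, D k != 0) &
  forall k, D k * (A (tadd k P) i - A k i) = N k].

Notation MP := (mpoly r K).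
Definition coefZ (F : time -> MP) := forall mu, Zc (fun k => mcoeff mu (F k)).
Definition translate (a : 'I_r -> K) : MP -> MP :=
  mmap (@mpolyC r K) (fun i => mpolyX K (mnm1 i) + mpolyC r (a i)).

Lemma Zc_sum (I : Type) (s : seq I) (Q : pred I) (f : I -> time -> K) :
  (forall i, Zc (f i)) -> Zc (fun k => \sum_(i <- s | Q i) f i k).
Proof.
move=> hf; elim: s => [|i s IH].
  by rewrite (_ : (fun k => _) = fun=> 0) //; apply/funext=> k; rewrite big_nil.
case Qi: (Q i).
  rewrite (_ : (fun k => _) = fun k => f i k + \sum_(j <- s | Q j) f j k); first exact: ZcD.
  by apply/funext=> k; rewrite big_cons Qi.
rewrite (_ : (fun k => _) = fun k => \sum_(j <- s | Q j) f j k) //.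
by apply/funext=> k; rewrite big_cons Qi.
Qed.

Lemma ZcX f d : Zc f -> Zc (fun k => f k ^+ d).
Proof.
move=> hf; elim: d => [|d IH].
  by rewrite (_ : (fun k => _) = fun=> 1) //; apply/funext=> k; rewrite expr0.
rewrite (_ : (fun k => _) = fun k => f k * f k ^+ d); first exact: ZcM.
by apply/funext=> k; rewrite exprS.
Qed.

Lemma coefZD F G : coefZ F -> coefZ G -> coefZ (fun k => F k + G k).
Proof.
move=> hF hG mu; rewrite (_ : (fun k => _) = fun k => mcoeff mu (F k) + mcoeff mu (G k)).
  exact: ZcD.
by apply/funext=> k; rewrite mcoeffD.
Qed.

Lemma coefZ_C f : Zc f -> coefZ (fun k => mpolyC r (f k)).
Proof.
move=> hf mu; rewrite (_ : (fun k => _) = fun k => f k * (mu == mnm0)%:R).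
  by apply: ZcM.
by apply/funext=> k; rewrite mcoeffC eq_sym.
Qed.

Lemma coefZ_cst p : coefZ (fun=> p).
Proof. by move=> mu; exact: ZcC. Qed.

Lemma coefZM F G : coefZ F -> coefZ G -> coefZ (fun k => F k * G k).
Proof.
move=> hF hG mu.
under [fun k => _]eq_fun do rewrite mcoeffM.
by apply: Zc_sum => i; exact: ZcM.
Qed.

Lemma coefZ_sum (I : Type) (s : seq I) (F : I -> time -> MP) :
  (forall i, coefZ (F i)) -> coefZ (fun k => \sum_(i <- s) F i k).
Proof.
move=> hF mu; under [fun k => _]eq_fun do rewrite raddf_sum /=.
by apply: Zc_sum => i; exact: hF.
Qed.

Lemma coefZX F d : coefZ F -> coefZ (fun k => F k ^+ d).
Proof.
move=> hF; elim: d => [|d IH].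
  under [fun k => _]eq_fun do rewrite expr0; exact: coefZ_cst.
under [fun k => _]eq_fun do rewrite exprS; exact: coefZM.
Qed.

Lemma coefZ_prod (I : Type) (s : seq I) (F : I -> time -> MP) :
  (forall i, coefZ (F i)) -> coefZ (fun k => \prod_(i <- s) F i k).
Proof.
move=> hF; elim: s => [|i s IH].
  under [fun k => _]eq_fun do rewrite big_nil; exact: coefZ_cst.
under [fun k => _]eq_fun do rewrite big_cons; exact: coefZM.
Qed.

Lemma coefZZ f F : Zc f -> coefZ F -> coefZ (fun k => f k *: F k).
Proof.
move=> hf hF; under [fun k => _]eq_fun do rewrite -mul_mpolyC.
by apply: coefZM => //; exact: coefZ_C.
Qed.

Lemma translateX a mu :
  translate a (mpolyX K mu) = \prod_i (mpolyX K (mnm1 i) + mpolyC r (a i)) ^+ mu i.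
Proof. by rewrite /translate mmapX. Qed.

Lemma lead_XD i c : mlead (mpolyX K (mnm1 i) + mpolyC r c) = mnm1 i.
Proof.
rewrite mleadDl ?mleadXm // mleadC.
by apply: lt_mdeg_ltmc; rewrite mdeg0 mdeg1.
Qed.

Lemma XD_neq0 i c : mpolyX K (mnm1 i) + mpolyC r c != 0.
Proof.
apply/eqP => /(congr1 (mcoeff (mnm1 i))).
rewrite mcoeffD mcoeffX eqxx mcoeffC mcoeff0 mnm1_eq0 mulr0 addr0.
by move/eqP; rewrite oner_eq0.
Qed.

Lemma mlead_translateX a mu : mlead (translate a (mpolyX K mu)) = mu.
Proof.
rewrite translateX mlead_prod //; last by move=> i _ _; rewrite expf_neq0 ?XD_neq0.
rewrite {2}(multinomUE_id mu); apply: eq_bigr => i _.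
by rewrite mleadX ?XD_neq0 // lead_XD.
Qed.

Lemma mleadc_translateX a mu : mcoeff mu (translate a (mpolyX K mu)) = 1.
Proof.
rewrite -{1}(mlead_translateX a mu) translateX.
have h i : mcoeff (mlead ((mpolyX K (mnm1 i) + mpolyC r (a i)) ^+ mu i))
   ((mpolyX K (mnm1 i) + mpolyC r (a i)) ^+ mu i) = 1.
  rewrite mleadX ?XD_neq0 // mleadcX lead_XD mcoeffD mcoeffX eqxx mcoeffC mnm1_eq0.
  by rewrite mulr0 addr0 expr1n.
rewrite mlead_prod; last by move=> i _ _; rewrite expf_neq0 ?XD_neq0.
by rewrite mleadc_prod big1.
Qed.

Lemma translateE a p :
  translate a p = \sum_(mu <- msupp p) mcoeff mu p *: translate a (mpolyX K mu).
Proof.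
rewrite {1}(mpolyE p) /translate raddf_sum; apply: eq_bigr => mu _.
by rewrite /= mmapZ mul_mpolyC.
Qed.

Lemma translatewE a p d : (msize p <= d)%N ->
  translate a p = \sum_(mu : bmultinom r d) mcoeff mu p *: translate a (mpolyX K mu).
Proof.
move=> hd; rewrite {1}(mpolywE hd) /translate raddf_sum; apply: eq_bigr => mu _.
by rewrite /= mmapZ mul_mpolyC.
Qed.

Lemma translate_gt a p (mu0 : multinom r) : (forall nu, (mu0 < nu :> multinom r)%O -> mcoeff nu p = 0) ->
  (forall nu, (mu0 < nu :> multinom r)%O -> mcoeff nu (translate a p) = 0) /\
  mcoeff mu0 (translate a p) = mcoeff mu0 p.
Proof.
move=> hp.
have sp (mu : multinom r) : mu \in msupp p -> (mu <= mu0)%O.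
  by rewrite mcoeff_msupp => h; rewrite leNgt; apply: contra h => /hp ->.
have lt_tr (mu nu : multinom r) : (mu < nu)%O -> mcoeff nu (translate a (mpolyX K mu)) = 0.
  by move=> h; apply: mcoeff_gt_mlead; rewrite mlead_translateX.
split=> [nu hnu|].
  rewrite translateE raddf_sum /= big1_seq // => mu /= /sp hmu.
  by rewrite mcoeffZ lt_tr ?mulr0 //; exact: le_lt_trans hmu hnu.
rewrite translateE raddf_sum /=.
have [h0|h0] := boolP (mu0 \in msupp p).
  rewrite (bigD1_seq mu0) //= mcoeffZ mleadc_translateX mulr1.
  rewrite big_seq_cond big1 ?addr0 // => mu /andP[/sp hmu ne].
  by rewrite mcoeffZ lt_tr ?mulr0 // lt_neqAle ne.
rewrite (memN_msupp_eq0 h0) big1_seq // => mu /= hmu.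
rewrite mcoeffZ lt_tr ?mulr0 // lt_neqAle (sp _ hmu) andbT.
by apply: contraNneq h0 => <-.
Qed.

Lemma mderiv_translate a i p : mderiv i (translate a p) = translate a (mderiv i p).
Proof.
pose S (p : MP) := mderiv i (translate a p) = translate a (mderiv i p).
have SD p1 p2 : S p1 -> S p2 -> S (p1 + p2).
  by rewrite /S /translate mderivD !rmorphD /= mderivD => -> ->.
have SM p1 p2 : S p1 -> S p2 -> S (p1 * p2).
  by rewrite /S /translate mderivM !(rmorphM,rmorphD) /= mderivM => -> ->.
have SC c : S (mpolyC r c).
  by rewrite /S /translate mmapC !mderivC rmorph0.
have SU j : S (mpolyX K (mnm1 j)).
  rewrite /S /translate mmapX mmap1U mderivD mderivC addr0.
  rewrite mderivX mnm1E; case: eqP => [->|_]; last by rewrite !scale0r rmorph0.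
  rewrite !scale1r mmapX.
  have -> : mnm_sub (mnm1 i) (mnm1 i) = mnm0 :> multinom r.
    by apply/mnmP => k; rewrite mnmBE subnn mnm0E.
  by rewrite mmap11 mpolyX0.
have S1 : S 1 by rewrite -mpolyC1; exact: SC.
have SX mu : S (mpolyX K mu).
  rewrite mpolyXE_id; apply: (big_ind S) => // j _.
  by elim: (mu j) => [|d IH]; rewrite ?expr0 // exprS; apply: SM.
rewrite -/(S p) (mpolyE p); apply: (big_ind S) => //.
  by rewrite -(mpolyC0 r); exact: SC.
by move=> mu _; rewrite -mul_mpolyC; exact: SM.
Qed.

Lemma mnm_neq0_ex (mu : multinom r) : mu != mnm0 -> exists i, mu i != 0%N.
Proof.
move=> h; apply/existsP; apply: contraNT h; rewrite negb_exists => /forallP h.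
by apply/eqP/mnmP => i; move: (h i); rewrite negbK mnm0E => /eqP.
Qed.

Lemma meval_0 (p : MP) : meval (fun=> 0) p = mcoeff mnm0 p.
Proof.
have h (mu : multinom r) : mu != mnm0 -> mcoeff mu p * \prod_(i < r) 0 ^+ mu i = 0.
  by move/mnm_neq0_ex => [i hi]; rewrite (bigD1 i) //= expr0n (negbTE hi) mul0r mulr0.
rewrite mevalE; have [h0|h0] := boolP (mnm0 \in msupp p); last first.
  rewrite (memN_msupp_eq0 h0) big1_seq // => mu /= hmu; apply: h.
  by apply: contraNneq h0 => <-.
rewrite (bigD1_seq mnm0) //= big1 ?mulr1 => [|i _]; last by rewrite mnm0E expr0.
by rewrite big1 ?addr0 // => mu; exact: h.
Qed.

Lemma meval_translate a p : meval (fun i => - a i) (translate a p) = mcoeff mnm0 p.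
Proof.
rewrite translateE raddf_sum /= -meval_0 mevalE; apply: eq_bigr => mu _.
rewrite mevalZ translateX rmorph_prod /=; congr (_ * _).
apply: eq_bigr => i _; rewrite rmorphXn /= mevalD mevalXU mevalC.
by rewrite addrC subrr.
Qed.

(* Differentiating until the degree is one turns the equality of [F k] and a translate of
   [F k0] into a linear relation. *)
Lemma linear_relation_of_translate d k0 (B : R) (F : time -> MP) f (mu0 : multinom r) :
  coefZ F -> Zc f -> f k0 != 0 -> mdeg mu0 = d.+1 ->
  (forall nu, (d.+1 < mdeg nu)%N -> mcoeff nu (F k0) = 0) -> mcoeff mu0 (F k0) != 0 ->
  (forall k, St B k -> later k0 k ->
     f k0 *: translate (fun i => A k i - A k0 i) (F k) = f k *: F k0) ->
  exists c : 'I_r -> K, (exists i, c i != 0) /\ exists q p, [/\ Zc q, Zc p, q k0 != 0 &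
    forall k, St B k -> later k0 k -> q k * \sum_i c i * A k i = p k].
Proof.
elim: d F mu0 => [|d IH] F mu0 hF hf f0 dmu0 hdeg hmu0 htr; last first.
  have /mnm_neq0_ex[i hi] : mu0 != mnm0 by rewrite -mdeg_eq0 dmu0.
  have hU : mnm_add (mnm_sub mu0 (mnm1 i)) (mnm1 i) = mu0.
    by apply: submK; rewrite lep1mP.
  apply: (IH (fun k => mderiv i (F k)) (mnm_sub mu0 (mnm1 i))) => //.
  - move=> mu; under [fun k => _]eq_fun do rewrite mcoeff_mderiv -mulr_natr.
    by apply: ZcM => //; exact: hF.
  - by apply/eqP; rewrite -eqSS -addn1 -(mdeg1 i) -mdegD hU dmu0.
  - move=> nu hnu; rewrite mcoeff_mderiv hdeg ?mul0rn //.
    by rewrite mdegD mdeg1 addn1 ltnS.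
  - rewrite mcoeff_mderiv hU -mulr_natr mulf_neq0 //.
  - by move=> k hk1 hk2; rewrite -mderiv_translate -!mderivZ htr.
have /mdeg1P[i0 /eqP hi0] : mdeg mu0 == 1%N by rewrite dmu0.
exists (fun i => mcoeff (mnm1 i) (F k0)); split; first by exists i0; rewrite -hi0.
have ev a : meval a (F k0) = mcoeff mnm0 (F k0) + \sum_i mcoeff (mnm1 i) (F k0) * a i.
  suff {1}-> : F k0 = mpolyC r (mcoeff mnm0 (F k0)) +
     \sum_i mcoeff (mnm1 i) (F k0) *: mpolyX K (mnm1 i).
    rewrite mevalD mevalC raddf_sum /=; congr (_ + _).
    by apply: eq_bigr => i _; rewrite mevalZ mevalXU.
  apply/mpolyP => nu; rewrite mcoeffD mcoeffC raddf_sum /=.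
  have [dn|dn] := ltnP 1 (mdeg nu).
    rewrite hdeg // big1 => [|i _].
      by rewrite (_ : (nu == mnm0) = false) ?mulr0 ?addr0 //; apply/eqP => h; rewrite h mdeg0 in dn.
    rewrite mcoeffZ mcoeffX (_ : (_ == nu) = false) ?mulr0 //.
    by apply/eqP => h; rewrite -h mdeg1 in dn.
  move: dn; rewrite leq_eqVlt => /orP[/mdeg1P[j /eqP ->]|].
    rewrite mnm1_eq0 mulr0 add0r (bigD1 j) //= mcoeffZ mcoeffX eqxx mulr1.
    rewrite big1 ?addr0 // => i hi; rewrite mcoeffZ mcoeffX eq_mnm1 (negbTE hi) mulr0 //.
  rewrite ltnS leqn0 mdeg_eq0 => /eqP ->; rewrite eqxx mulr1 big1 ?addr0 // => i _.
  by rewrite mcoeffZ mcoeffX mnm1_eq0 mulr0.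
exists f, (fun k => f k * (mcoeff mnm0 (F k0) + \sum_i mcoeff (mnm1 i) (F k0) * A k0 i)
   + (- f k0) * mcoeff mnm0 (F k)); split=> //.
  by apply: ZcD; apply: ZcM => //; exact: hF.
(* At minus the translation vector the translated polynomial takes its constant coefficient as
   value, which lies in [Zc]; the other side is affine in [A k - A k0]. *)
move=> k hk1 hk2; have := congr1 (meval (fun i => - (A k i - A k0 i))) (htr k hk1 hk2).
rewrite !mevalZ meval_translate ev => h.
rewrite mulNr h -mulrBr; congr (_ * _).
rewrite opprD addrACA subrr add0r -sumrB; apply: eq_bigr => i _.
by rewrite opprB mulrBr opprB addrC subrK.
Qed.

Lemma meval_translateE x a p : meval x (translate a p) = meval (fun i => x i + a i) p.
Proof.
rewrite translateE raddf_sum /= mevalE; apply: eq_bigr => mu _.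
rewrite mevalZ translateX rmorph_prod /=; congr (_ * _).
by apply: eq_bigr => i _; rewrite rmorphXn /= mevalD mevalXU mevalC.
Qed.

Lemma exists_max_monomial (F : time -> MP) d : (forall k, (msize (F k) <= d)%N) ->
  (exists k, F k != 0) -> exists mu0, (exists k, mcoeff mu0 (F k) != 0) /\
    forall k (nu : multinom r), (mu0 < nu)%O -> mcoeff nu (F k) = 0.
Proof.
move=> hd [k hk].
have bnd k' (mu : multinom r) : mcoeff mu (F k') != 0 -> (mdeg mu < d)%N.
  by rewrite -mcoeff_msupp => /msize_mdeg_lt /leq_trans; exact.
have [mu hmu] : exists mu, mcoeff mu (F k) != 0.
  by exists (mlead (F k)); rewrite mleadc_eq0.
pose i0 := BMultinom (bnd _ _ hmu).
pose Q := [pred i : bmultinom r d | `[< exists k', mcoeff i (F k') != 0 >]].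
have Qi0 : Q i0 by apply/asboolP; exists k.
case: (@Order.TotalTheory.arg_maxP _ _ _ i0 Q (fun i => bmnm i) Qi0) => i /asboolP Qi hi.
exists i; split => // k' nu hnu; apply/eqP; apply: contraTT hnu => h.
have Qn : Q (BMultinom (bnd _ _ h)) by apply/asboolP; exists k'.
by rewrite -leNgt; exact: (hi _ Qn).
Qed.

Lemma msize_of_gt (p : MP) (mu0 : multinom r) :
  (forall nu : multinom r, (mu0 < nu)%O -> mcoeff nu p = 0) -> (msize p <= (mdeg mu0).+1)%N.
Proof.
move=> h; have [->|p0] := eqVneq p 0; first by rewrite msize0.
rewrite -mlead_deg // ltnS; apply: lemc_mdeg; rewrite leNgt.
by apply/negP => /h /eqP; rewrite mleadc_eq0 (negbTE p0).
Qed.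

Lemma Zc_prod (I : Type) (s : seq I) (Q : pred I) (f : I -> time -> K) :
  (forall i, Zc (f i)) -> Zc (fun k => \prod_(i <- s | Q i) f i k).
Proof.
move=> hf; elim: s => [|i s IH].
  by under [fun k => _]eq_fun do rewrite big_nil.
case Qi: (Q i); last by under [fun k => _]eq_fun do rewrite big_cons Qi.
by under [fun k => _]eq_fun do rewrite big_cons Qi; exact: ZcM.
Qed.

Lemma common_increment P : exists N D, [/\ forall i, Zc (N i), Zc D, (forall k, D k != 0) &
  forall k i, D k * (A (tadd k P) i - A k i) = N i k].
Proof.
have /choice[N0 /choice[D0 h0]] := hA P.
exists (fun i k => N0 i k * \prod_(j | j != i) D0 j k), (fun k => \prod_i D0 i k); split => //.
- move=> i; apply: ZcM; first by case: (h0 i).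
  by apply: Zc_prod => j; case: (h0 j).
- by apply: Zc_prod => j; case: (h0 j).
- by move=> k; apply/prodf_neq0 => i _; case: (h0 i).
- by move=> k i; rewrite (bigD1 i) //= mulrAC; case: (h0 i) => _ _ _ ->.
Qed.

(** The translation vector has entries [N i / D], so the power [D ^+ d], with [d] bounding the
    degree, clears all denominators. *)
Lemma coefZ_translate (F : time -> MP) (N : 'I_r -> time -> K) (D : time -> K) a d :
  coefZ F -> (forall k, (msize (F k) <= d)%N) -> (forall i, Zc (N i)) -> Zc D ->
  (forall k i, D k * a k i = N i k) ->
  coefZ (fun k => D k ^+ d *: translate (a k) (F k)).
Proof.
move=> hF hd hN hD ha.
have E k : D k ^+ d *: translate (a k) (F k) = \sum_(mu : bmultinom r d)
   (D k ^+ (d - mdeg mu) * mcoeff mu (F k)) *: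
     \prod_i (mpolyC r (D k) * mpolyX K (mnm1 i) + mpolyC r (N i k)) ^+ mu i.
  rewrite (translatewE _ (hd k)) scaler_sumr; apply: eq_bigr => mu _.
  have -> : \prod_i (mpolyC r (D k) * mpolyX K (mnm1 i) + mpolyC r (N i k)) ^+ mu i =
      D k ^+ mdeg mu *: translate (a k) (mpolyX K mu).
    rewrite translateX -mul_mpolyC mdegE rmorphXn /= -prodrXr -big_split /=.
    apply: eq_bigr => i _; rewrite -exprMn; congr (_ ^+ _).
    by rewrite mulrDr -ha rmorphM.
  by rewrite !scalerA mulrAC -exprD subnK // ltnW // bmdeg.
rewrite (funext E); apply: coefZ_sum => mu; apply: coefZZ.
  by apply: ZcM; [exact: ZcX | exact: hF].
apply: coefZ_prod => i; apply: coefZX; apply: coefZD; last exact: coefZ_C.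
by apply: coefZM; [exact: coefZ_C | exact: coefZ_cst].
Qed.

(** Well-founded induction on the largest monomial [mu0] occurring at any time. Cross-multiplying
    [F k] with the translate of [F (k + P)] cancels [mu0]. Either the result is nonzero for some
    [P], and it is a smaller relation, or [F] is proportional to its translates, which
    [linear_relation_of_translate] exploits. *)
Theorem linear_relation_of_algebraic (F : time -> MP) d :
  coefZ F -> (forall k, (msize (F k) <= d)%N) -> (exists k, F k != 0) ->
  vanish St (fun k => meval (A k) (F k)) ->
  exists c : 'I_r -> K, (exists i, c i != 0) /\ exists q p, [/\ Zc q, Zc p,
    exists k, q k != 0 &
    exists B : R, 0 < B /\ exists k0, forall k, St B k -> later k0 k ->
      q k * \sum_i c i * A k i = p k].
Proof.
move=> hF hd hne [B [B0 [k1 hv]]].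
have [mu0 [hmu0 hgt]] := exists_max_monomial hd hne.
elim/(@well_founded_ind _ _ (@ltom_wf r)): mu0 F B B0 k1 hv hF {hd hne} hmu0 hgt => mu0 IH F B B0 k1 hv hF hmu0 hgt.
pose f0 k := mcoeff mu0 (F k).
have hf0 : Zc f0 by exact: hF.
have hd k : (msize (F k) <= (mdeg mu0).+1)%N by apply: msize_of_gt; exact: hgt.
(* Two halvings: the difference of two times of the quarter strip is a shift in the half strip, and
   a time of the half strip plus such a shift stays in the strip of width [B]. *)
have B2 : 0 < B / 2%:R by rewrite divr_gt0.
have B4 : 0 < B / 2%:R / 2%:R by rewrite divr_gt0.
have le2 : B / 2%:R <= B by lra.
have le4 : B / 2%:R / 2%:R <= B by lra.
have [[P [hP [kG hG]]]|noG] := pselect (exists P, St (B / 2%:R) P /\ exists k,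
   f0 (tadd k P) *: F k != f0 k *: translate (fun i => A (tadd k P) i - A k i) (F (tadd k P))).
  have [N [D [hN hD D0 hND]]] := common_increment P.
  (* Both terms vanish at [A k], because the translate there takes the value of [F (k + P)] at
     [A (k + P)]; the power of [D] makes the coefficients polynomial again. *)
  pose G k := D k ^+ (mdeg mu0).+1 *: (f0 (tadd k P) *: F k
     - f0 k *: translate (fun i => A (tadd k P) i - A k i) (F (tadd k P))).
  have cG : coefZ G.
    have -> : G = fun k => f0 (tadd k P) *: (D k ^+ (mdeg mu0).+1 *: F k) +
        ((-1) * f0 k) *: (D k ^+ (mdeg mu0).+1 *:
           translate (fun i => A (tadd k P) i - A k i) (F (tadd k P))).
      apply/funext => k; rewrite /G scalerBr !scalerA mulN1r mulNr scaleNr.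
      by congr (_ *: _ - _ *: _); rewrite mulrC.
    apply: coefZD; first by apply: coefZZ; [exact: Zc_shift | apply: coefZZ => //; exact: ZcX].
    apply: coefZZ; first by apply: ZcM.
    apply: (@coefZ_translate (fun k => F (tadd k P)) N D) => // mu; exact: (Zc_shift P (hF mu)).
  have G_gt k (nu : multinom r) : (mu0 <= nu)%O -> mcoeff nu (G k) = 0.
    move=> hnu; rewrite /G mcoeffZ mcoeffB !mcoeffZ.
    have [t1 t2] := translate_gt (fun i => A (tadd k P) i - A k i) (hgt (tadd k P)).
    move: hnu; rewrite le_eqVlt => /orP[/eqP <-|hnu].
      by rewrite t2 /f0 [X in X - _]mulrC subrr mulr0.
    by rewrite hgt // t1 // !mulr0 subrr mulr0.
  have [mu1 [hmu1 hgt1]] : exists mu1, (exists k, mcoeff mu1 (G k) != 0) /\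
    forall k (nu : multinom r), (mu1 < nu)%O -> mcoeff nu (G k) = 0.
    apply: (@exists_max_monomial _ (mdeg mu0).+1).
      by move=> k; apply: msize_of_gt => nu /ltW; exact: G_gt.
    by exists kG; rewrite /G scaler_eq0 expf_eq0 (negbTE (D0 _)) andbF /= subr_eq0.
  apply: (IH mu1 _ G (B / 2%:R) B2 k1) => //.
    case: hmu1 => k; rewrite ltNge; apply: contra => h; apply/eqP; exact: G_gt.
  move=> k hk lk; rewrite /G mevalZ mevalB !mevalZ meval_translateE.
  rewrite hv ?mulr0 //; last exact: St_mono hk.
  rewrite (meval_eq (v2 := A (tadd k P))); last by move=> i; rewrite addrC subrK.
  rewrite hv ?mulr0 ?subrr ?mulr0 //; last first.
    by move=> l; apply: leq_trans (lk l) (leq_addr _ _).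
  by rewrite (splitr B); exact: St_add.
have [k0 [hk0 lk0 fk0]] : exists k0, [/\ St (B / 2%:R / 2%:R) k0, later k1 k0 & f0 k0 != 0].
  apply: contrapT => h; case: hmu0 => k; rewrite -/(f0 k) (Zc0 hf0) ?eqxx //.
  exists (B / 2%:R / 2%:R); split=> //; exists k1 => k' h1 h2; apply/eqP.
  by apply: contrapT => /negP h3; apply: h; exists k'.
have tr k : St (B / 2%:R / 2%:R) k -> later k0 k ->
    f0 k0 *: translate (fun i => A k i - A k0 i) (F k) = f0 k *: F k0.
  move=> hk lk; pose P : time := fun l => (k l - k0 l)%N.
  have kE : tadd k0 P = k by apply/funext => l; rewrite /tadd /P subnKC.
  have hP : St (B / 2%:R) P.
    by rewrite (splitr (B / 2%:R)); apply: (St_sub hk0); rewrite kE.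
  apply/eqP; rewrite eq_sym; apply: contrapT => /negP h; apply: noG; exists P; split=> //.
  by exists k0; rewrite kE.
case dE : (mdeg mu0) => [|d0].
  have F0 : F k0 = mpolyC r (f0 k0).
    have m0 : mu0 = mnm0 by apply/eqP; rewrite -mdeg_eq0 dE.
    apply/mpolyP => nu; rewrite mcoeffC; have [->|ne] := eqVneq nu mnm0.
      by rewrite mulr1 /f0 m0.
    by rewrite mulr0 hgt // m0 lt_neqAle eq_sym ne le0m.
  have := hv k0 (St_mono le4 hk0) lk0; rewrite F0 mevalC => /eqP.
  by rewrite (negbTE fk0).
have [c [hc [q [p [hq hp q0 hqp]]]]] := @linear_relation_of_translate d0 k0 _ F f0 mu0 hF hf0 fk0 dE
  (fun nu hnu => hgt k0 nu (lt_mdeg_ltmc (eq_ind_r (fun x => x < _)%N hnu dE))) fk0 tr.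
exists c; split=> //; exists q, p; split=> //; first by exists k0.
by exists (B / 2%:R / 2%:R); split=> //; exists k0.
Qed.

End StepB.

(** * Multiplicative bases *)

Lemma sqr_ge0_int (x : int) : 0 <= x * x.
Proof. by rewrite -expr2 sqr_ge0. Qed.

Section Basis.
Context (C : fieldType) (R : realType) (nrm : C -> R) (av : absval nrm).
Hypothesis roots : forall (x : C) n, (0 < n)%N -> exists y, y ^+ n = x.
Context (alg : C -> Prop).
Hypothesis algM : forall x y, alg x -> alg y -> alg (x * y).
Hypothesis algV : forall x, alg x -> alg x^-1.
Hypothesis algX : forall x n, (0 < n)%N -> alg (x ^+ n) -> alg x.

Definition good x := [/\ alg x, 0 < nrm x & nrm x < 1].
Notation L x := (- ln (nrm x)).

Lemma good_neq0 x : good x -> x != 0.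
Proof. by case=> _ h _; apply: contraTneq h => ->; rewrite (av0 av) ltxx. Qed.
Lemma L_gt0 x : good x -> 0 < L x.
Proof. by case=> _ h1 h2; rewrite oppr_gt0 ln_lt0 // h1. Qed.
Lemma nrm1 : nrm 1 = 1. Proof. exact: av1 av. Qed.
Lemma nrmV x : x != 0 -> nrm x^-1 = (nrm x)^-1.
Proof.
move=> x0; have := avM av x x^-1; rewrite mulfV // nrm1 => h.
have n0 : nrm x != 0 by apply/eqP => e; move: h; rewrite e mul0r => /eqP; rewrite oner_eq0.
by apply: (mulfI n0); rewrite -h mulfV.
Qed.

(** The exponents are natural numbers, since the monomials have to be polynomials in variables that
    are small along the orbit. Elimination in the multiplicative group is therefore not enough:
    every substitution must keep absolute values below 1 and exponents nonnegative. *)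
Definition spans s t (b : 'I_s -> C) (g : 'I_t -> C) := exists N (zt : 'I_s -> C) (c : 'I_s -> 'I_t -> nat),
  (0 < N)%N /\ forall i, zt i ^+ N = 1 /\ b i = zt i * \prod_j g j ^+ c i j.

Lemma spans_trans s t u (b : 'I_s -> C) (g : 'I_t -> C) (h : 'I_u -> C) : spans b g -> spans g h -> spans b h.
Proof.
move=> [N [zt [c [N0 hb]]]] [N' [zt' [c' [N0' hg]]]].
exists (N * N')%N, (fun i => zt i * \prod_j zt' j ^+ c i j), (fun i k => \sum_j c' j k * c i j)%N.
rewrite muln_gt0 N0 N0'; split=> // i; split.
  rewrite exprMn exprM (hb i).1 expr1n mul1r -prodrXl big1 // => j _.
  by rewrite exprAC mulnC exprM (hg j).1 !expr1n.
rewrite (hb i).2 -mulrA; congr (_ * _).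
under eq_bigr do rewrite (hg _).2 exprMn.
rewrite big_split; congr (_ * _).
under eq_bigr do rewrite -prodrXl.
rewrite exchange_big; apply: eq_bigr => k _ /=.
by rewrite -prodrXr; apply: eq_bigr => j _; rewrite exprM.
Qed.

Lemma spans_mono s (b b' : 'I_s -> C) (c : 'I_s -> 'I_s -> nat) :
  (forall i, b i = \prod_j b' j ^+ c i j) -> spans b b'.
Proof. by move=> h; exists 1%N, (fun=> 1), c; split=> // i; rewrite expr1 mul1r. Qed.

Definition relation s (b : 'I_s -> C) (M : 'I_s -> int) := \prod_i b i ^ M i = 1.

Lemma relation_L s (b : 'I_s -> C) M : (forall i, good (b i)) -> relation b M ->
  \sum_i (M i)%:~R * L (b i) = 0.
Proof.
move=> hb h.
have nz i : 0 < nrm (b i) by case: (hb i).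
have lnz (x : R) k : 0 < x -> ln (x ^ k) = k%:~R * ln x.
  move=> x0; case: k => k; first by rewrite -exprnP lnXn // -pmulrn mulr_natl.
  by rewrite NegzE -exprnN lnV ?posrE ?exprn_gt0 // lnXn // mulrNz mulNr -pmulrn mulr_natl.
have nrmz (x : C) k : x != 0 -> nrm (x ^ k) = nrm x ^ k.
  move=> x0; case: k => k; first by rewrite -!exprnP (avX av).
  by rewrite NegzE -!exprnN nrmV ?expf_neq0 // (avX av).
have := congr1 (fun x => ln (nrm x)) h; rewrite /= nrm1 ln1 (av_prod av).
have -> : \prod_i nrm (b i ^ M i) = \prod_i nrm (b i) ^ M i.
  by apply: eq_bigr => i _; rewrite nrmz // good_neq0.
have -> : ln (\prod_i nrm (b i) ^ M i) = \sum_i (M i)%:~R * ln (nrm (b i)).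
  have [-> _] : ln (\prod_i nrm (b i) ^ M i) = \sum_i (M i)%:~R * ln (nrm (b i)) /\ 0 < \prod_i nrm (b i) ^ M i.
    elim/big_rec2: _ => [|i y x _ [e x0]]; first by rewrite ln1.
    by rewrite lnM ?posrE ?exprz_gt0 // e lnz ?mulr_gt0 ?exprz_gt0.
  by [].
by move=> e; under eq_bigr do rewrite mulrN; rewrite sumrN e oppr0.
Qed.

(* An elementary substitution [b i = b' i * b' j ^ a], [b j = b' j ^ e]. *)
Lemma substitution s (b : 'I_s -> C) M i j a e : (forall l, good (b l)) -> relation b M -> i != j ->
  (0 < e)%N -> a%:R * L (b j) < e%:R * L (b i) ->
  exists b' M', [/\ forall l, good (b' l), relation b' M', spans b b' &
    [/\ M' i = M i, M' j = e%:Z * M j + a%:Z * M i, (forall l, l != i -> l != j -> M' l = M l /\ b' l = b l),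
        L (b' j) = L (b j) / e%:R & L (b' i) = L (b i) - a%:R / e%:R * L (b j)]].
Proof.
move=> hb hM ij e0 hL; have [d de] := roots (b j) e0.
have ji : (j == i) = false by rewrite eq_sym (negbTE ij).
have bi0 := good_neq0 (hb i); have bj0 := good_neq0 (hb j).
have d0 : d != 0 by apply: contraNneq bj0 => d0; rewrite -de d0 expr0n -(negbK (e == 0%N)) -lt0n e0.
(* The new [b' j] is an [e]-th root of [b j], and the hypothesis on [L] says that [b' i] still has
   absolute value less than 1. *)
pose b' l := if l == i then b i * d ^- a else if l == j then d else b l.
pose M' l := if l == j then e%:Z * M j + a%:Z * M i else M l.
have [aj nj0 nj1] := hb j; have [ai ni0 ni1] := hb i.
have dn0 : 0 < nrm d by rewrite lt_neqAle (av_ge0 av) andbT eq_sym (av_eq0 av).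
have eR : e%:R != 0 :> R by rewrite pnatr_eq0 -lt0n.
have Ld : L d = L (b j) / e%:R.
  by rewrite -de (avX av) lnXn // -[ln _ *+ e]mulr_natr -mulNr mulfK.
have L' : L (b i * d ^- a) = L (b i) - a%:R / e%:R * L (b j).
  rewrite (avM av) nrmV ?expf_neq0 // (avX av) lnM ?posrE ?invr_gt0 ?exprn_gt0 // lnV ?posrE ?exprn_gt0 // lnXn //.
  rewrite opprB addrC -[ln (nrm d) *+ a]mulr_natl -[ln (nrm d)]opprK Ld; field => //.
have bi0' : b i * d ^- a != 0 by rewrite mulf_neq0 // invr_neq0 // expf_neq0.
have gd : good d.
  split=> //; first by apply: (algX e0); rewrite de.
  by rewrite ltNge; apply/negP => /ln_ge0; rewrite leNgt -oppr_gt0 Ld divr_gt0 ?L_gt0 ?ltr0n.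
have gbi : good (b i * d ^- a).
  have nn : 0 < nrm (b i * d ^- a) by rewrite lt_neqAle (av_ge0 av) andbT eq_sym (av_eq0 av).
  split=> //.
    have algXn n : alg (d ^+ n.+1) by elim: n => [|n IH]; [rewrite expr1; case: gd | rewrite exprS; apply: algM => //; case: gd].
    by apply: algM => //; apply: algV; case: (a) => [|n]; [rewrite expr0 -(mulfV d0); apply: algM; [|apply: algV]; case: gd | exact: algXn].
  rewrite ltNge; apply/negP => /ln_ge0; rewrite leNgt -oppr_gt0 L' subr_gt0 mulrAC ltr_pdivrMr ?ltr0n //.
  by rewrite [_ * e%:R]mulrC hL.
exists b', M'; split.
- by move=> l; rewrite /b'; case: eqP => // _; case: eqP.
- rewrite /relation (bigD1 i) //= (bigD1 j) ?ji //= /b' /M' !eqxx ji (negbTE ij).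
  move: hM; rewrite /relation (bigD1 i) //= (bigD1 j) ?ji //= => hM'; rewrite -[RHS]hM'.
  rewrite [in RHS]mulrA [in LHS]mulrA; congr (_ * _).
    rewrite expfzDr // exprzMl ?unitfE ?invr_neq0 ?expf_neq0 // -de.
    rewrite -mulrA; congr (_ * _); rewrite (exprnN d a) (exprnP d e) !exprz_exp -!expfzDr //.
    congr (d ^ _); ring.
  by apply: eq_bigr => l /andP[/negbTE -> /negbTE ->].
- apply: (@spans_mono _ _ _ (fun l l' => if l == i then (l' == i) + a * (l' == j) else if l == j then e * (l' == j) else (l' == l))%N).
  move=> l; have one (k : 'I_s) n : \prod_l' b' l' ^+ (n * (l' == k)) = b' k ^+ n.
    by rewrite (bigD1 k) //= eqxx muln1 big1 ?mulr1 // => l' /negbTE ->; rewrite muln0 expr0.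
  have one1 (k : 'I_s) : \prod_l' b' l' ^+ (l' == k) = b' k.
    by have := one k 1%N; under eq_bigr do rewrite mul1n.
  case: (eqVneq l i) => [->|li].
    under eq_bigr do rewrite exprD; rewrite big_split /= one one1 /b' !eqxx ji -mulrA mulVf ?mulr1 //.
    by rewrite expf_neq0.
  case: (eqVneq l j) => [->|lj]; first by rewrite one /b' ji eqxx de.
  by rewrite one1 /b' (negbTE li) (negbTE lj).
- rewrite /M' /b' !eqxx (negbTE ij) ji; split=> // l /negbTE -> /negbTE ->; by [].
Qed.

(** The numbers [L (b i)] are positive and their combination with coefficients [M i] is zero. *)
Lemma relation_signs s (b : 'I_s -> C) M l : (forall i, good (b i)) -> relation b M -> M l != 0 ->
  exists i j, M i > 0 /\ M j < 0.
Proof.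
move=> hb hM Ml; have h := relation_L hb hM.
have pos (S : 'I_s -> int) : S l != 0 -> (forall i, 0 <= S i) -> 0 < \sum_i (S i)%:~R * L (b i).
  move=> Sl S0; rewrite (bigD1 l) //= ltr_pwDl //.
    by rewrite mulr_gt0 ?L_gt0 // ltr0z lt_neqAle eq_sym Sl S0.
  by apply: sumr_ge0 => i _; apply: mulr_ge0; [rewrite ler0z | exact: ltW (L_gt0 (hb i))].
have [[i hi]|no] := pselect (exists i, M i > 0); have [[j hj]|no'] := pselect (exists j, M j < 0).
- by exists i, j.
- have H := pos M Ml; rewrite h ltxx in H; suff : false by []; apply: H => i'.
  by rewrite leNgt; apply/negP => h'; apply: no'; exists i'.
- have := pos (fun i => - M i); rewrite oppr_eq0 => /(_ Ml).
  under eq_bigr do rewrite rmorphN /= mulNr; rewrite sumrN h oppr0 ltxx => H; suff : false by []; apply: H => i'.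
  by rewrite oppr_ge0 leNgt; apply/negP => h'; apply: no; exists i'.
- exfalso; case/eqP: Ml; apply/eqP; rewrite eq_le; apply/andP; split; rewrite leNgt; apply/negP => h'.
    by apply: no; exists l.
  by apply: no'; exists l.
Qed.

Notation w b M i := (`|M i|%:R * L (b i) : R).

(* Cancels the exponent of the lighter of two terms of opposite signs. *)
Lemma cancel_term s (b : 'I_s -> C) M i j : (forall l, good (b l)) -> relation b M -> M i * M j < 0 ->
  w b M j < w b M i -> exists (b' : 'I_s -> C) (M' : 'I_s -> int), [/\ forall l, good (b' l), relation b' M', spans b b',
    (exists l, M' l != 0) & (#|[pred l | M' l != 0]| < #|[pred l | M l != 0]|)%N].
Proof.
move=> hb hM hij hw.
have Mi0 : M i != 0 by apply: contraTneq hij => ->; rewrite mul0r ltxx.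
have Mj0 : M j != 0 by apply: contraTneq hij => ->; rewrite mulr0 ltxx.
have ij : i != j by apply: contraTneq hij => ->; rewrite -leNgt sqr_ge0_int.
have [|b' [M' [h1 h2 h3 [e1 e2 e3 _ _]]]] := @substitution s b M i j `|M j| `|M i| hb hM ij _ hw.
  by rewrite absz_gt0.
exists b', M'; split=> //; first by exists i; rewrite e1.
have Mj' : M' j = 0.
  by rewrite e2; move: hij; clear; case: (ltrgt0P (M i)) => h1; case: (ltrgt0P (M j)) => h2; rewrite ?h1 ?h2; nia.
rewrite [X in (_ < X)%N](cardD1 j) inE Mj0 add1n ltnS; apply/subset_leq_card/fintype.subsetP => l.
rewrite !inE => hl; have lj : l != j by apply: contraNneq hl => ->; rewrite Mj'.
rewrite lj /=; have [->|li] := eqVneq l i; first by rewrite Mi0.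
by have [<- _] := e3 l li lj.
Qed.

(** With only two terms the relation reads [b i ^+ |M i| = b j ^+ |M j|]. If [d] is a root of [b j]
    of order [|M i|], then [b i] is a power of [d] up to a root of unity, and [d] replaces both. *)
Lemma merge_pair s (b : 'I_s.+1 -> C) M i j : (forall l, good (b l)) -> relation b M -> M i * M j < 0 ->
  (forall l, M l != 0 -> l = i \/ l = j) -> exists g : 'I_s -> C, (forall l, good (g l)) /\ spans b g.
Proof.
move=> hb hM hij hl.
have Mi0 : M i != 0 by apply: contraTneq hij => ->; rewrite mul0r ltxx.
have Mj0 : M j != 0 by apply: contraTneq hij => ->; rewrite mulr0 ltxx.
have ij : i != j by apply: contraTneq hij => ->; rewrite -leNgt sqr_ge0_int.
have ji : j != i by rewrite eq_sym.
have bi0 := good_neq0 (hb i); have bj0 := good_neq0 (hb j).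
have rel : b i ^+ `|M i| = b j ^+ `|M j|.
  have : b i ^ M i * b j ^ M j = 1.
    move: hM; rewrite /relation (bigD1 i) //= (bigD1 j) //= big1 ?mulr1 // => l /andP[li lj].
    have [->|/hl[] e] := eqVneq (M l) 0; first by rewrite expr0z.
      by rewrite e eqxx in li.
    by rewrite e eqxx in lj.
  have z (x : C) k : x != 0 -> x ^+ k = 1 / x ^ (- k%:Z) by move=> x0; rewrite -exprnN invrK mul1r.
  move: hij; case: (ltrgt0P (M i)) => [si|si|->]; last by rewrite mul0r ltxx.
    case: (ltrgt0P (M j)) => [sj|sj|->]; last by rewrite mulr0 ltxx.
      by rewrite ltNge => /negP h; exfalso; apply: h; apply: ltW; rewrite mulr_gt0.
    move=> _ h; rewrite (z (b j)) // -h (_ : - `|M j|%N%:Z = M j); last by move: sj; clear; lia.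
    rewrite mulfK ?expfz_neq0 //; rewrite (_ : M i = `|M i|%N) ?absz_nat //; by move: si; clear; lia.
  case: (ltrgt0P (M j)) => [sj|sj|->]; last by rewrite mulr0 ltxx.
    move=> _ h; rewrite (z (b i)) // -h (_ : - `|M i|%N%:Z = M i); last by move: si; clear; lia.
    rewrite mulrAC divff ?expfz_neq0 // mul1r; rewrite (_ : M j = `|M j|%N) ?absz_nat //; by move: sj; clear; lia.
  by rewrite ltNge => /negP h; exfalso; apply: h; apply: ltW; rewrite nmulr_rgt0.
have [d de] : exists d, d ^+ `|M i| = b j by apply: roots; rewrite absz_gt0.
have gd : good d.
  have [aj nj0 nj1] := hb j; have e0 : (0 < `|M i|)%N by rewrite absz_gt0.
  have d0 : d != 0 by apply: contraNneq bj0 => d0; rewrite -de d0 expr0n -(negbK (_ == 0%N)) -lt0n e0.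
  split; [by apply: (algX e0); rewrite de | exact: av_gt0 |].
  by rewrite ltNge; apply/negP => h; move: nj1; rewrite -de (avX av) ltNge exprn_ege1.
pose g (l : 'I_s) := if lift i l == j then d else b (lift i l).
exists g; split; first by move=> l; rewrite /g; case: ifP.
have zN : (b i / d ^+ `|M j|) ^+ `|M i| = 1.
  by rewrite exprMn rel exprVn -exprM mulnC exprM de divff // expf_neq0.
have d0 := good_neq0 gd.
exists `|M i|%N, (fun l => if l == i then b i / d ^+ `|M j| else 1),
  (fun l t => if l == i then `|M j| * (lift i t == j) else if l == j then `|M i| * (lift i t == j) else (lift i t == l))%N.
rewrite absz_gt0; split=> // l.
have [t0 jt0] : exists t, j = lift i t by case: (unliftP i j) => [t ->|e]; [exists t | rewrite e eqxx in ji].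
have prd n : \prod_t g t ^+ (n * (lift i t == j)) = d ^+ n.
  rewrite (bigD1 t0) //= -jt0 eqxx muln1 /g -jt0 eqxx big1 ?mulr1 // => t tt0.
  by rewrite jt0 (inj_eq lift_inj) (negbTE tt0) muln0 expr0.
have [->|li] := eqVneq l i.
  split; first exact: zN.
  by rewrite prd divfK // expf_neq0.
split; first by rewrite expr1n.
rewrite mul1r; have [->|lj] := eqVneq l j; first by rewrite prd de.
have [t lt'] : exists t, l = lift i t by case: (unliftP i l) => [t ->|e]; [exists t | rewrite e eqxx in li].
rewrite (bigD1 t) //= -lt' eqxx expr1 /g -lt' (negbTE lj) big1 ?mulr1 // => t' tt'.
by rewrite lt' (inj_eq lift_inj) (negbTE tt') expr0.
Qed.

(** Induction on the number of terms. A pair of opposite signs and different weights loses its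
    lighter term. If all such pairs balance, a third term allows the balance to be broken; if there
    is no third term, the pair is merged. *)
Lemma reduce_relation s (b : 'I_s.+1 -> C) M l : (forall i, good (b i)) -> relation b M -> M l != 0 ->
  exists g : 'I_s -> C, (forall i, good (g i)) /\ spans b g.
Proof.
have [N] := ubnP #|[pred l | M l != 0]|; elim: N b M l => // N IH b M l; rewrite ltnS => cM hb hM Ml.
have step : (exists (b' : 'I_s.+1 -> C) (M' : 'I_s.+1 -> int), [/\ forall l, good (b' l), relation b' M', spans b b',
    (exists l, M' l != 0) & (#|[pred l | M' l != 0%R]| < #|[pred l | M l != 0%R]|)%N]) ->
    exists g : 'I_s -> C, (forall i, good (g i)) /\ spans b g.
  move=> [b' [M' [h1 h2 h3 [l' h4] h5]]]; have [g [g1 g2]] := IH b' M' l' (leq_trans h5 cM) h1 h2 h4.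
  by exists g; split=> //; exact: spans_trans h3 g2.
have [[i [j [hij hw]]]|no] := pselect (exists i j, M i * M j < 0 /\ w b M j < w b M i).
  by apply: step; exact: cancel_term hij hw.
have eqw i j : M i * M j < 0 -> w b M i = w b M j.
  move=> hij; apply/eqP; rewrite eq_le !leNgt; apply/andP; split; apply/negP => h; apply: no.
    by exists i, j.
  by exists j, i; rewrite mulrC.
have [i0 [j0 [hi0 hj0]]] := relation_signs hb hM Ml.
have hij0 : M i0 * M j0 < 0 by rewrite pmulr_rlt0.
have [[l0 [Ml0 li lj]]|two] := pselect (exists l, [/\ M l != 0, l <> i0 & l <> j0]); last first.
  apply: (merge_pair hb hM hij0) => l' hl'; apply: contrapT => h; apply: two; exists l'; split=> // e; apply: h; by [left|right].
(* a third term, of the sign of [i] *)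
have [i [j [hij [il lneqj lij]]]] : exists i j, M i * M j < 0 /\ [/\ l0 <> i, l0 <> j & M l0 * M j < 0].
  case: (ltrgt0P (M l0)) Ml0 => // sl _.
    by exists i0, j0; split=> //; split=> //; rewrite pmulr_rlt0.
  by exists j0, i0; rewrite mulrC; split=> //; split=> //; rewrite nmulr_rlt0.
have Mi0 : M i != 0 by apply: contraTneq hij => ->; rewrite mul0r ltxx.
have Mj0 : M j != 0 by apply: contraTneq hij => ->; rewrite mulr0 ltxx.
have ij : i != j by apply: contraTneq hij => ->; rewrite -leNgt sqr_ge0_int.
have wj0 : 0 < w b M j by rewrite mulr_gt0 ?L_gt0 // ltr0n absz_gt0.
(* The choice [e = 2 * |M i|] changes the exponent of [j] to [|M i| * M j] and divides [L] by
   [2 * |M i|], so the weight of [j] is halved. The third term [l0] then outweighs [j] and cancels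
   it. *)
have [||b' [M' [h1 h2 h3 [e1 e2 e3 e4 _]]]] := @substitution s.+1 b M i j `|M j| (2 * `|M i|) hb hM ij.
- by rewrite muln_gt0 absz_gt0.
- by rewrite natrM -mulrA (eqw _ _ hij) ltr_pMl // ltr1n.
have [f1 f2] := e3 l0 (introN eqP il) (introN eqP lneqj).
have Mj' : M' j = `|M i|%N%:Z * M j.
  by rewrite e2; move: hij; clear; rewrite PoszM; case: (ltrgt0P (M i)) => h1; case: (ltrgt0P (M j)) => h2; rewrite ?h1 ?h2; nia.
have Mi1 : (0 < `|M i|)%N by rewrite absz_gt0.
have wj' : w b' M' j = w b M j / 2.
  by rewrite e4 Mj' abszM absz_nat !natrM; field; rewrite pnatr_eq0 -lt0n Mi1.
have lij' : M' l0 * M' j < 0.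
  by rewrite f1 Mj' mulrCA pmulr_rlt0 // ltz_nat.
have hw : w b' M' j < w b' M' l0.
  by rewrite wj' f1 f2 (eqw _ _ lij) ltr_pdivrMr // ltr_pMr // ltr1n.
apply: step; have [b2 [M2 [k1 k2 k3 k4 k5]]] := cancel_term h1 h2 lij' hw.
exists b2, M2; split=> //; first exact: spans_trans h3 k3.
apply: leq_trans k5 _; apply/subset_leq_card/fintype.subsetP => l'; rewrite !inE.
have [->|l'j] := eqVneq l' j; first by rewrite Mj0.
have [->|l'i] := eqVneq l' i; first by rewrite Mi0.
by have [-> _] := e3 l' l'i l'j.
Qed.

Theorem multiplicative_basis r (b : 'I_r -> C) : (forall i, good (b i)) ->
  exists s (g : 'I_s -> C), [/\ forall i, good (g i), spans b g &
    forall u v : 'I_s -> nat, \prod_j g j ^+ u j = \prod_j g j ^+ v j -> u =1 v].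
Proof.
elim: r b => [|r IH] b hb.
  exists 0%N, b; split=> //; last by move=> u v _ [].
  by apply: (@spans_mono _ _ _ (fun _ _ => 0%N)) => -[].
have [h|no] := pselect (forall u v : 'I_r.+1 -> nat, \prod_j b j ^+ u j = \prod_j b j ^+ v j -> u =1 v).
  exists r.+1, b; split=> //; apply: (@spans_mono _ _ _ (fun i j => j == i)) => i.
  by rewrite (bigD1 i) //= eqxx expr1 big1 ?mulr1 // => j /negbTE ->.
have [u [v [uv [l uvl]]]] : exists u v : 'I_r.+1 -> nat, \prod_j b j ^+ u j = \prod_j b j ^+ v j /\ exists l, u l != v l.
  apply: contrapT => h; apply: no => u v uv l; apply/eqP; apply: contrapT => /negP hl; apply: h.
  by exists u, v; split=> //; exists l.
have rel : relation b (fun i => (u i)%:Z - (v i)%:Z).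
  rewrite /relation; have -> : \prod_i b i ^ ((u i)%:Z - (v i)%:Z) = \prod_i b i ^+ u i / \prod_i b i ^+ v i.
    by rewrite -prodf_div; apply: eq_bigr => i _; rewrite expfzDr ?good_neq0 // -exprnN.
  by rewrite uv divff //; apply/prodf_neq0 => i _; rewrite expf_neq0 // good_neq0.
have [|g [hg bg]] := reduce_relation (l := l) hb rel; first by rewrite subr_eq0 eqz_nat.
have [s [g' [h1 h2 h3]]] := IH g hg.
by exists s, g'; split=> //; exact: spans_trans bg h2.
Qed.
End Basis.

(** * Lattice points below a quadratic irrational line *)

Section Cone.
Context (a c D x z : nat).
Hypothesis D_gt0 : (0 < D)%N.
Hypothesis aD : (D < a ^ 2)%N.
Hypothesis acD : ((a - c) ^ 2 < D)%N.
Hypothesis Pell : (x ^ 2 = D * z ^ 2 + 1)%N.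
Hypothesis z0 : (0 < z)%N.
Hypothesis c0 : (0 < c)%N.
Hypothesis cz : (c %| z)%N.

(* The point [(n, m)] lies strictly between the first axis and the line of slope
   [(a - sqrt D) / c]. *)
Definition below (a c D n m : nat) := (0 < m)%N && (D * n ^ 2 < (n * a - m * c) ^ 2)%N.

(** With [g = n * a - m * c] a lattice point is the number [g + n * sqrt D], and the unit
    [x + z * sqrt D] acts by multiplication. The point [(1, 0)] of the axis, where [g = a], goes to
    [(coneN, coneM)] with [g = coneG]. The image of the region below the line is thus bounded by the
    ray through this point, and the cone under the ray is what the unit omits. *)
Definition coneN := (x + z * a)%N.
Definition coneM := (z %/ c * (a ^ 2 - D))%N.
Definition coneG := (a * x + D * z)%N.
Definition ceil m := ((m * coneN + coneM.-1) %/ coneM)%N.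

Lemma x_gt0 : (0 < x)%N. Proof. by move: Pell; case: (x) => // h; rewrite exp0n // addn1 in h. Qed.
Lemma coneN_gt0 : (0 < coneN)%N. Proof. by rewrite addn_gt0 x_gt0. Qed.
Lemma coneM_gt0 : (0 < coneM)%N.
Proof. by rewrite muln_gt0 divn_gt0 // dvdn_leq // subn_gt0. Qed.

Lemma coneG_eq : (coneN * a = coneM * c + coneG)%N.
Proof.
rewrite /coneM mulnAC divnK // mulnBr /coneG /coneN.
have : (z * D <= z * a ^ 2)%N by rewrite leq_mul2l ltnW ?orbT.
have -> : (z * a ^ 2 = z * a * a)%N by rewrite -mulnA.
rewrite mulnDl [(x * a)%N]mulnC [(D * z)%N]mulnC; lia.
Qed.

Lemma coneG_sq : (D * coneN ^ 2 < coneG ^ 2)%N.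
Proof.
have : (coneG ^ 2 + D * x ^ 2 + D * (a ^ 2 * z ^ 2) = D * coneN ^ 2 + a ^ 2 * x ^ 2 + D * z ^ 2 * D)%N.
  by rewrite /coneG /coneN; ring.
rewrite Pell; move: (coneG ^ 2)%N (coneN ^ 2)%N => G N; nia.
Qed.

Lemma leq_ceil m n : (ceil m <= n)%N = (m * coneN <= n * coneM)%N.
Proof.
have M0 := coneM_gt0; rewrite -ltnS ltn_divLR // mulSn.
by apply/idP/idP; move: M0; case: (coneM) => // k _ /=; lia.
Qed.

(** The boundary ray lies below the irrational line by [coneG_sq], which expresses that the unit
    preserves the norm; everything under the ray follows. *)
Lemma cone_below n m : (0 < m)%N -> (ceil m <= n)%N -> [/\ below a c D n m, (m * c <= n * a)%N & (m < n)%N].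
Proof.
move=> m0; rewrite leq_ceil => h.
have N0 := coneN_gt0; have M0 := coneM_gt0; have G := coneG_eq; have G2 := coneG_sq.
have n0 : (0 < n)%N by move: h; case: (n) => //; rewrite mul0n leqn0 muln_eq0; lia.
have key : (n * coneG + m * c * coneN <= n * a * coneN)%N.
  have : (n * (coneN * a) = n * coneM * c + n * coneG)%N by rewrite G; ring.
  have : (m * coneN * c <= n * coneM * c)%N by rewrite leq_mul2r h orbT.
  rewrite (mulnAC m) -(mulnA n a) (mulnC a); lia.
have mcna : (m * c <= n * a)%N.
  rewrite -(leq_pmul2r N0); apply: leq_trans key; exact: leq_addl.
have gle : (n * coneG <= (n * a - m * c) * coneN)%N by rewrite mulnBl leq_subRL ?leq_mul2r ?mcna ?orbT // addnC.
have bl : (D * n ^ 2 < (n * a - m * c) ^ 2)%N.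
  have N20 : (0 < coneN ^ 2)%N by rewrite expn_gt0 N0.
  rewrite -(ltn_pmul2r N20) -expnMn; apply: (@leq_trans ((n * coneG) ^ 2)%N); last by rewrite leq_exp2r.
  by rewrite expnMn mulnAC mulnC ltn_pmul2l ?expn_gt0 ?n0.
split=> //; first by rewrite /below m0.
rewrite -(ltn_pmul2r N0); apply: leq_ltn_trans h _; rewrite ltn_pmul2l //.
rewrite -(ltn_pmul2r c0) -(ltn_add2r coneG) -G.
case: (leqP a c) => ac.
  apply: (@leq_ltn_trans (coneN * c)%N); first by rewrite leq_mul2l ac orbT.
  by rewrite -[X in (X < _)%N]addn0 ltn_add2l /coneG addn_gt0 !muln_gt0 D_gt0 z0 orbT.
have : (coneN * (a - c) < coneG)%N.
  rewrite -ltn_sqr expnMn; apply: leq_ltn_trans G2; rewrite mulnC leq_mul2r ltnW ?orbT //.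
by rewrite mulnBr ltn_subLR // leq_mul2l ltnW ?orbT.
Qed.

Lemma belowP n m : below a c D n m -> exists g, [/\ (0 < m)%N, (n * a = m * c + g)%N, (n * a - m * c = g)%N & (D * n ^ 2 < g ^ 2)%N].
Proof.
move=> /andP[m0 h]; exists (n * a - m * c)%N; split=> //.
by rewrite subnKC //; move: h; case: (leqP (m * c) (n * a)) => // h; rewrite (eqP (ltnW h : (_ - _ == 0)%N)).
Qed.

Lemma below_lt n m : below a c D n m -> (m < n)%N.
Proof.
move=> /belowP[g [m0 e _ h]]; rewrite ltnNge; apply/negP => nm; move: h; rewrite ltnNge => /negP; apply.
have gle : (g <= n * (a - c))%N.
  have : (n * c <= m * c)%N by rewrite leq_mul2r nm orbT.
  by rewrite mulnBr; move: e; clear; lia.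
apply: (@leq_trans ((n * (a - c)) ^ 2)%N); first by rewrite leq_sqr.
by rewrite expnMn mulnC leq_mul2r ltnW ?orbT.
Qed.

Definition shiftm n m g := (x * m + z %/ c * (g * a - D * n))%N.

Lemma shiftm_eq n m g : (n * a = m * c + g)%N -> (D * n ^ 2 < g ^ 2)%N ->
  ((x * n + z * g) * a = shiftm n m g * c + (D * z * n + x * g))%N.
Proof.
move=> e h.
have ga : (D * n <= g * a)%N.
  rewrite -leq_sqr; apply: ltnW; apply: (@leq_ltn_trans (D * (D * n ^ 2))%N).
    by rewrite expnMn mulnA.
  have : (D * (D * n ^ 2) <= D * g ^ 2)%N by rewrite leq_mul2l ltnW ?orbT.
  move/leq_ltn_trans; apply; rewrite expnMn mulnC ltn_pmul2l // expn_gt0.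
  by case: (g) h => //; rewrite ltn0.
rewrite /shiftm mulnDl mulnDl -[(z %/ c * _ * c)%N]mulnAC divnK // mulnBr.
have : (z * (D * n) <= z * (g * a))%N by rewrite leq_mul2l ga orbT.
have -> : (D * z * n = z * (D * n))%N by ring.
rewrite -mulnA e -(mulnA z g a) -(mulnA x m c); move: (z * (g * a))%N (z * (D * n))%N => u v uv.
by rewrite mulnDr; lia.
Qed.

Lemma shift_norm n g : ((D * z * n + x * g) ^ 2 + D * n ^ 2 = D * (x * n + z * g) ^ 2 + g ^ 2)%N.
Proof.
have -> : ((D * z * n + x * g) ^ 2 + D * n ^ 2 = x ^ 2 * g ^ 2 + D * n ^ 2 * (D * z ^ 2 + 1) + 2 * (D * z * n * x * g))%N by ring.
transitivity (x ^ 2 * (D * n ^ 2) + (D * z ^ 2 + 1) * g ^ 2 + 2 * (D * z * n * x * g))%N; last by ring.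
by rewrite -Pell; ring.
Qed.

(** The axis goes to the boundary ray, and a point strictly above the axis goes strictly above that
    ray: hence the strict inequality with [ceil]. *)
Lemma shift_below n m g : (0 < m)%N -> (n * a = m * c + g)%N -> (D * n ^ 2 < g ^ 2)%N ->
  let n' := (x * n + z * g)%N in let m' := shiftm n m g in
  [/\ below a c D n' m', (n' * a - m' * c = D * z * n + x * g)%N & (n' < ceil m')%N].
Proof.
move=> m0 e h n' m'; have e' := shiftm_eq e h; rewrite -/n' -/m' in e'.
have eg : (n' * a - m' * c = D * z * n + x * g)%N by rewrite e' addnC addnK.
split=> //.
  rewrite /below eg /m' /shiftm addn_gt0 muln_gt0 x_gt0 m0 /=.
  by have := shift_norm n g; rewrite -/n'; move: h; clear; lia.
rewrite ltnNge leq_ceil -ltnNge -(ltn_pmul2r c0).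
have G := coneG_eq.
have k1 : (m' * coneN * c + (D * z * n + x * g) * coneN = n' * a * coneN)%N by rewrite e'; ring.
have k2 : (n' * a * coneN = n' * coneM * c + n' * coneG)%N by rewrite -mulnA [(a * _)%N]mulnC G; ring.
have k3 : (n' * coneG = (D * z * n + x * g) * coneN + m * c)%N.
  apply/eqP; rewrite -(eqn_add2r g) -[X in _ == X]addnA -e; apply/eqP.
  rewrite /n' /coneG /coneN.
  transitivity ((x ^ 2 * (a * n) + D * z ^ 2 * g + g) + z * g * a * x + D * z * x * n)%N; first by ring.
  transitivity ((D * z ^ 2 + 1) * (n * a) + x ^ 2 * g + z * g * a * x + D * z * x * n)%N; last by ring.
  transitivity (x ^ 2 * (a * n) + (D * z ^ 2 + 1) * g + z * g * a * x + D * z * x * n)%N; first by ring.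
  by rewrite -Pell; ring.
have : (0 < m * c)%N by rewrite muln_gt0 m0.
move: k1 k2 k3; clear; lia.
Qed.

(** The inverse unit [x - z * sqrt D] is applied, which requires the positivity of two differences;
    lying above the ray is exactly the condition that the preimage has [m] positive. *)
Lemma unshift_below n' m' g' : (n' * a = m' * c + g')%N -> (D * n' ^ 2 < g' ^ 2)%N -> (n' < ceil m')%N ->
  exists n m g, [/\ (0 < m)%N, (n * a = m * c + g)%N, (D * n ^ 2 < g ^ 2)%N & (n' = x * n + z * g)%N /\ m' = shiftm n m g].
Proof.
move=> e h; rewrite ltnNge leq_ceil -ltnNge => hc.
have G := coneG_eq.
pose m := (m' * coneN - n' * coneM)%N.
have mE : (m' * coneN = n' * coneM + m)%N by rewrite subnKC // ltnW.
have m0 : (0 < m)%N by rewrite subn_gt0.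
have k : (n' * coneG = g' * coneN + m * c)%N.
  have k1 : (n' * a * coneN = m' * coneN * c + g' * coneN)%N by rewrite e; ring.
  have k2 : (n' * a * coneN = n' * coneM * c + n' * coneG)%N by rewrite -mulnA [(a * _)%N]mulnC G; ring.
  by move: k1; rewrite mE mulnDl; move: k2; clear; lia.
have hx : (D * z * n' < x * g')%N.
  have e2 : ((x * g') ^ 2 = x ^ 2 * g' ^ 2)%N by ring.
  rewrite -ltn_sqr e2 Pell (_ : (D * z * n') ^ 2 = D * z ^ 2 * (D * n' ^ 2))%N; last by ring.
  apply: (@leq_ltn_trans (D * z ^ 2 * g' ^ 2)%N); first by rewrite leq_mul2l ltnW ?orbT.
  rewrite mulnDl mul1n -[X in (X < _)%N]addn0 ltn_add2l; exact: leq_ltn_trans h.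
have hz : (z * g' < x * n')%N.
  rewrite ltnNge; apply/negP => h'.
  have : (a * (x * n') <= a * (z * g'))%N by rewrite leq_mul2l h' orbT.
  have : (0 < m * c)%N by rewrite muln_gt0 m0.
  have : (a * (x * n') + D * z * n' = a * (z * g') + x * g' + m * c)%N.
    by move: k; rewrite /coneG /coneN => k; transitivity (n' * (a * x + D * z))%N; [ring | rewrite k; ring].
  by move: hx; clear; lia.
pose n := (x * n' - z * g')%N; pose g := (x * g' - D * z * n')%N.
have nE : (x * n' = z * g' + n)%N by rewrite subnKC // ltnW.
have gE : (x * g' = D * z * n' + g)%N by rewrite subnKC // ltnW.
have eng : (n * a = m * c + g)%N.
  apply/eqP; rewrite -(eqn_add2r (a * (z * g') + D * z * n')); apply/eqP.
  transitivity (a * (z * g' + n) + D * z * n')%N; first by ring.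
  transitivity (m * c + a * (z * g') + (D * z * n' + g))%N; last by ring.
  rewrite -nE -gE; transitivity (n' * coneG)%N; first by rewrite /coneG; ring.
  by rewrite k /coneN; ring.
have n'E : (n' = x * n + z * g)%N.
  apply/eqP; rewrite -(eqn_add2r (x * (z * g') + z * (D * z * n'))); apply/eqP.
  transitivity (x * (z * g') + (D * z ^ 2 + 1) * n')%N; first by ring.
  transitivity (x * (z * g' + n) + z * (D * z * n' + g))%N; last by ring.
  by rewrite -nE -gE -Pell; ring.
have g'E : (g' = D * z * n + x * g)%N.
  apply/eqP; rewrite -(eqn_add2r (D * z * (z * g') + x * (D * z * n'))); apply/eqP.
  transitivity (x * (D * z * n') + (D * z ^ 2 + 1) * g')%N; first by ring.
  transitivity (D * z * (z * g' + n) + x * (D * z * n' + g))%N; last by ring.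
  by rewrite -nE -gE -Pell; ring.
have hng : (D * n ^ 2 < g ^ 2)%N.
  by have := shift_norm n g; rewrite -n'E -g'E; move: h; clear; lia.
exists n, m, g; split=> //; split=> //.
have := shiftm_eq eng hng; rewrite -n'E -g'E e => /eqP; rewrite eqn_add2r eqn_pmul2r // => /eqP //.
Qed.

Lemma shift_inj n g n2 g2 : (x * n + z * g = x * n2 + z * g2)%N -> (D * z * n + x * g = D * z * n2 + x * g2)%N ->
  n = n2.
Proof.
move=> e1 e2.
have h u v : (x * (x * u + z * v) = u + z * (D * z * u + x * v))%N.
  by transitivity ((x ^ 2) * u + x * z * v)%N; [ring | rewrite Pell; ring].
have := h n g; rewrite e1 e2 h => /eqP; rewrite eqn_add2r => /eqP //.
Qed.

Section Ring.
Context (W : comNzRingType).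

Definition term (y1 y2 : W) n m := y1 ^+ n * y2 ^+ (n * a - m * c).
Definition tau M (y1 y2 : W) := \sum_(n < M) \sum_(m < M | below a c D n m) term y1 y2 n m.
Definition cone_num (y1 y2 : W) := \sum_(m < coneM) term y1 y2 (ceil m.+1) m.+1.
Definition cone_den (y1 y2 : W) := (1 - y1 * y2 ^+ a) * (1 - y1 ^+ coneN * y2 ^+ coneG).

Context (y1 y2 : W) (M : nat).
Notation Y := (term y1 y2).

(** A signed sum of at most [k] monomials in which the exponent of [y1] is at least [M]. The same
    statement yields order of vanishing [M] when [y1] is a polynomial without constant term, and a
    bound [k * t ^+ M] when [y1] is a number of absolute value at most [t]. *)
Definition small k (h : W) := exists s : seq (bool * nat * nat),
  [/\ all (fun t => M <= t.1.2)%N s, (size s <= k)%N &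
      h = \sum_(t <- s) (-1) ^+ t.1.1 * (y1 ^+ t.1.2 * y2 ^+ t.2)].

Lemma small_leq k k' h : (k <= k')%N -> small k h -> small k' h.
Proof. by move=> kk [s [h1 h2 h3]]; exists s; split=> //; exact: leq_trans kk. Qed.
Lemma small0 k : small k 0. Proof. by exists [::]; rewrite big_nil. Qed.
Lemma smallD k k' h h' : small k h -> small k' h' -> small (k + k') (h + h').
Proof.
move=> [s [h1 h2 ->]] [s' [h1' h2' ->]]; exists (s ++ s').
by rewrite all_cat h1 h1' size_cat leq_add // big_cat.
Qed.
Lemma smallN k h : small k h -> small k (- h).
Proof.
move=> [s [h1 h2 ->]]; exists [seq (~~ t.1.1, t.1.2, t.2) | t <- s]; rewrite all_map size_map big_map -sumrN.
by split=> //; apply: eq_bigr => t _ /=; case: (t.1.1); rewrite ?expr0 ?expr1 ?mulN1r ?mul1r ?opprK.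
Qed.
Lemma smallM n g k h : small k h -> small k (y1 ^+ n * y2 ^+ g * h).
Proof.
move=> [s [h1 h2 ->]]; exists [seq (t.1.1, n + t.1.2, g + t.2)%N | t <- s]; rewrite all_map size_map big_map mulr_sumr.
split=> //; first by apply: sub_all h1 => t /= ht; rewrite (leq_trans ht) // leq_addl.
by apply: eq_bigr => t _ /=; rewrite !exprD; ring.
Qed.
Lemma small1 n g : (M <= n)%N -> small 1 (y1 ^+ n * y2 ^+ g).
Proof. by move=> h; exists [:: (false, n, g)]; rewrite /= h big_seq1 expr0 mul1r. Qed.
Lemma small_sum (I : Type) (r : seq I) (P : pred I) F k : (forall i, P i -> small k (F i)) ->
  small (size r * k) (\sum_(i <- r | P i) F i).
Proof.
move=> h; elim: r => [|i r IH]; first by rewrite big_nil; exact: small0.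
rewrite big_cons /= mulSn; case: ifP => [/h hi|_]; first exact: smallD.
by apply: small_leq IH; rewrite leq_addl.
Qed.
Lemma small_sum_ord n (P : pred 'I_n) F k : (forall i, P i -> small k (F i)) ->
  small (n * k) (\sum_(i < n | P i) F i).
Proof.
move=> h; have := small_sum (index_enum 'I_n) h.
by rewrite -sum1_size sum_nat_const card_ord muln1.
Qed.
Lemma small_den n g k h : small k h -> small (k + k) ((1 - y1 ^+ n * y2 ^+ g) * h).
Proof. by move=> hs; rewrite mulrBl mul1r; apply: smallD => //; apply: smallN; exact: smallM. Qed.

(** A row of the cone is a geometric progression: a unit step along the axis multiplies the term by
    [y1 * y2 ^+ a]. *)
Lemma row_telescope m : (0 < m)%N ->
  (1 - y1 * y2 ^+ a) * \sum_(n < M | (ceil m <= n)%N) Y n m =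
  if (ceil m <= M)%N then Y (ceil m) m - Y M m else 0.
Proof.
move=> m0; elim: (M) => [|N IH].
  by rewrite big_ord0 mulr0; case: ifP => //; rewrite leqn0 => /eqP ->; rewrite subrr.
rewrite [in LHS]big_mkcond big_ord_recr -big_mkcond /= mulrDr IH.
have [h|h] := leqP (ceil m) N.
  have [_ h2 _] := cone_below m0 h; rewrite (leqW h) /term mulSn -addnBA // exprD exprS; ring.
rewrite mulr0 addr0; case: ifP => // h'.
by rewrite (_ : ceil m = N.+1) ?subrr //; apply/eqP; rewrite eqn_leq h'.
Qed.

Lemma ceil_shift m : ceil (m + coneM) = (ceil m + coneN)%N.
Proof.
by rewrite /ceil mulnDl addnAC [(coneM * _)%N]mulnC addnC divnMDl ?coneM_gt0 // addnC.
Qed.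

Lemma ceil_geq m : (m <= ceil m)%N.
Proof. by case: m => // m; have [_ _] := @cone_below (ceil m.+1) m.+1 isT (leqnn _); exact: ltnW. Qed.

(** The left ends of the rows are periodic along the boundary ray, so the second factor of
    [cone_den] telescopes them to the [coneM] terms of [cone_num]. *)
Lemma term_shift m : (0 < m)%N -> Y (ceil (m + coneM)) (m + coneM) = y1 ^+ coneN * y2 ^+ coneG * Y (ceil m) m.
Proof.
move=> m0; have [_ h _] := cone_below m0 (leqnn _); rewrite ceil_shift /term exprD.
have -> : ((ceil m + coneN) * a - (m + coneM) * c = coneG + (ceil m * a - m * c))%N.
  by rewrite (mulnDl (ceil m)) (mulnDl m) coneG_eq; move: h; clear; lia.
by rewrite exprD; ring.
Qed.

Definition inner := \sum_(n < M) \sum_(m < M | (0 < m)%N && (ceil m <= n)%N) Y n m.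
Definition outer := \sum_(n < M) \sum_(m < M | below a c D n m && (n < ceil m)%N) Y n m.

Lemma tau_split : tau M y1 y2 = inner + outer.
Proof.
rewrite -big_split; apply: eq_bigr => n _ /=; rewrite (bigID (fun m : 'I_M => (ceil m <= n)%N)) /=.
congr (_ + _); apply: eq_bigl => m; last by rewrite -ltnNge.
apply/andP/andP => [[/andP[m0 _] h]|[m0 h]]; split=> //.
by have [] := cone_below m0 h.
Qed.

Lemma inner_num : (0 < M)%N -> small (2 * M + coneM) (cone_den y1 y2 * inner - cone_num y1 y2).
Proof.
move=> M0; pose g m := Y (ceil m) m.
have e1 : inner = \sum_(m < M | (0 < m)%N) \sum_(n < M | (ceil m <= n)%N) Y n m.
  rewrite /inner (exchange_big_dep (fun m : 'I_M => (0 < m)%N)) /=; last by move=> n m _ /andP[].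
  by apply: eq_bigr => m m0; apply: eq_bigl => n; rewrite m0.
(* the rows telescope to the lower boundary of the cone *)
have h1 : small M ((1 - y1 * y2 ^+ a) * inner - \sum_(1 <= m < M) g m).
  have -> : \sum_(1 <= m < M) g m = \sum_(m < M | (0 < m)%N) g m.
    rewrite (big_addn 0) subn1 big_mkord -(prednK M0) [RHS]big_mkcond big_ord_recl /= add0r.
    by apply: eq_bigr => i _; rewrite addn1.
  rewrite e1 mulr_sumr -sumrB -[X in small X]muln1; apply: small_sum_ord => m m0.
  rewrite row_telescope //; case: leqP => h.
    by rewrite /g addrAC subrr add0r; apply: smallN; exact: small1.
  by rewrite sub0r; apply: smallN; apply: small1; exact: ltnW.
have h2 : small coneM ((1 - y1 ^+ coneN * y2 ^+ coneG) * (\sum_(1 <= m < M) g m) - cone_num y1 y2).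
  have -> : cone_num y1 y2 = \sum_(1 <= m < coneM.+1) g m.
    by rewrite (big_addn 0) subn1 big_mkord; apply: eq_bigr => i _; rewrite addn1.
  have -> : (1 - y1 ^+ coneN * y2 ^+ coneG) * (\sum_(1 <= m < M) g m) =
      \sum_(1 <= m < M) g m - \sum_(1 + coneM <= m < M + coneM) g m.
    rewrite [X in _ = _ - X](big_addn 1) addnK mulrBl mul1r mulr_sumr; congr (_ - _).
    by apply: eq_big_nat => m /andP[m0 _]; rewrite /g term_shift.
  have -> : \sum_(1 <= m < M) g m = \sum_(1 <= m < M + coneM) g m - \sum_(M <= m < M + coneM) g m.
    by rewrite [\sum_(1 <= m < M + coneM) _](@big_cat_nat _ _ _ M) ?leq_addr //= addrK.
  rewrite [\sum_(1 <= m < M + coneM) _](@big_cat_nat _ _ _ (1 + coneM)) ?leq_add2r ?leq_addr //=.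
  rewrite add1n (_ : _ - _ - _ - _ = - \sum_(M <= m < M + coneM) g m); last by ring.
  apply: smallN; rewrite -[X in \sum_(X <= _ < _) _](add0n M) big_addn addnC addnK big_mkord -[X in small X]muln1.
  apply: small_sum_ord => m _; apply: small1; apply: leq_trans (ceil_geq _); exact: leq_addl.
rewrite /cone_den [(1 - y1 * _) * _]mulrC -mulrA.
set A := (1 - y1 * _) * inner in h1 *; set B := \sum_(1 <= m < M) g m in h1 h2.
rewrite (_ : _ - _ = (1 - y1 ^+ coneN * y2 ^+ coneG) * (A - B) + ((1 - y1 ^+ coneN * y2 ^+ coneG) * B - cone_num y1 y2)); last by ring.
by rewrite mul2n -addnn; apply: smallD h2; exact: small_den.
Qed.

(** The unit maps the points below the line bijectively onto those outside the cone. The truncation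
    to [n] and [m] less than [M] is not respected, but only images with first coordinate at least
    [M] are lost. *)
Lemma outer_shift : small (M * M) (tau M (y1 ^+ x * y2 ^+ (D * z)) (y1 ^+ z * y2 ^+ x) - outer).
Proof.
pose N (p : 'I_M * 'I_M) := (x * p.1 + z * (p.1 * a - p.2 * c))%N.
pose M' (p : 'I_M * 'I_M) := shiftm p.1 p.2 (p.1 * a - p.2 * c).
pose F (p : 'I_M * 'I_M) := term (y1 ^+ x * y2 ^+ (D * z)) (y1 ^+ z * y2 ^+ x) p.1 p.2.
have FE p : F p = y1 ^+ N p * y2 ^+ (D * z * p.1 + x * (p.1 * a - p.2 * c)).
  by rewrite /F /term !exprMn -!exprM /N !exprD; ring.
have -> : tau M (y1 ^+ x * y2 ^+ (D * z)) (y1 ^+ z * y2 ^+ x) = \sum_(p : 'I_M * 'I_M | below a c D p.1 p.2) F p.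
  by rewrite /tau pair_big_dep.
rewrite (bigID (fun p => (N p < M)%N)) /=.
pose P1 := [set p : 'I_M * 'I_M | below a c D p.1 p.2 && (N p < M)%N]%SET.
pose h (p : 'I_M * 'I_M) : 'I_M * 'I_M := (insubd p.1 (N p), insubd p.2 (M' p)).
have hP p : p \in P1 -> [/\ (h p).1 = N p :> nat, (h p).2 = M' p :> nat,
    below a c D (N p) (M' p), (N p * a - M' p * c = D * z * p.1 + x * (p.1 * a - p.2 * c))%N & (N p < ceil (M' p))%N].
  rewrite inE => /andP[/belowP[g [m0 e1 e2 e3]] hN].
  have := shift_below m0 e1 e3; rewrite /N /M' e2 => -[b1 b2 b3]; split=> //.
    by rewrite /= val_insubd; rewrite /N e2 in hN *; rewrite hN.
  rewrite /= val_insubd /M' e2 ifT //; apply: leq_trans (hN); rewrite /N e2 ltnS.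
  have [g' [m0' e1' _ _]] := belowP b1.
  exact: ltnW (below_lt b1).
have -> : \sum_(p : 'I_M * 'I_M | below a c D p.1 p.2 && (N p < M)%N) F p = outer.
  have -> : outer = \sum_(q : 'I_M * 'I_M | q \in [set h p | p in P1]%SET) Y q.1 q.2.
    rewrite /outer pair_big_dep /=; apply: eq_bigl => q; apply/idP/imsetP => [/andP[/belowP[g [m0 e1 e2 e3]] hq]|[p pP1 ->]].
      have [n [m [g0 [k1 k2 k3 [k4 k5]]]]] := unshift_below e1 e3 hq.
      have x1 := x_gt0.
      have nM : (n < M)%N.
        by apply: leq_ltn_trans (ltn_ord q.1); rewrite k4; apply: leq_trans (leq_addr _ _); rewrite leq_pmull.
      have bnm : below a c D n m by rewrite /below k1 k2 addnC addnK.
      have mM : (m < M)%N by apply: ltn_trans nM; exact: below_lt bnm.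
      have gE : (n * a - m * c)%N = g0 by rewrite k2 addnC addnK.
      exists (Ordinal nM, Ordinal mM).
        by rewrite inE /N /= gE -k4 bnm ltn_ord.
      apply/eqP; rewrite [q]surjective_pairing xpair_eqE; apply/andP; split; apply/eqP; apply: ord_inj; rewrite val_insubd /N /M' /= gE.
        by rewrite -k4 ltn_ord.
      by rewrite -k5 ltn_ord.
    by have [-> -> -> _ ->] := hP p pP1.
  rewrite big_imset /=.
    rewrite [RHS](eq_bigl (fun p : 'I_M * 'I_M => below a c D p.1 p.2 && (N p < M)%N)) => [|p]; last by rewrite inE.
    apply: eq_bigr => p hp; have [|-> -> _ eg _] := hP p; first by rewrite inE.
    by rewrite FE /term eg.
  move=> p q hp hq epq; have [p1 p2 _ p4 _] := hP p hp; have [q1 q2 _ q4 _] := hP q hq.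
  have eN : N p = N q by rewrite -p1 -q1 epq.
  have eM : M' p = M' q by rewrite -p2 -q2 epq.
  have e1 : p.1 = q.1 by apply: ord_inj; apply: (shift_inj eN); rewrite -p4 -q4 eN eM.
  move: hp hq; rewrite !inE => /andP[/belowP[g [_ k1 k1' _]] _] /andP[/belowP[g' [_ k2 k2' _]] _].
  have z1 : g = g'.
    have := eN; rewrite /N k1' k2' e1 => /eqP; rewrite eqn_add2l eqn_pmul2l // => /eqP //.
  have e2 : p.2 = q.2.
    apply: ord_inj; apply/eqP; rewrite -(eqn_pmul2r c0) -(eqn_add2r g) -k1 e1 k2 z1 //.
  by rewrite [p]surjective_pairing [q]surjective_pairing e1 e2.
rewrite addrC addrK.
have := @small_sum _ (index_enum ('I_M * 'I_M)%type) (fun p : 'I_M * 'I_M => below a c D p.1 p.2 && ~~ (N p < M)%N) F 1.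
rewrite -sum1_size sum_nat_const card_prod card_ord !muln1; apply => p /andP[_ h2].
by rewrite FE; apply: small1; rewrite leqNgt.
Qed.

(* The generating series of the points below the irrational line transforms, up to a rational
   function, into itself under the unit. *)
Theorem cone_identity : (0 < M)%N -> small (8 * M ^ 2 + coneM)
  (cone_den y1 y2 * (tau M y1 y2 - tau M (y1 ^+ x * y2 ^+ (D * z)) (y1 ^+ z * y2 ^+ x)) - cone_num y1 y2).
Proof.
move=> M0; set t' := tau M (_ * _) _; rewrite tau_split.
have h : small (4 * (M * M)) (cone_den y1 y2 * (outer - t')).
  rewrite /cone_den -mulrA -[y1 * _]/(y1 ^+ 1 * _) (_ : 4 * (M * M) = (M * M + M * M) + (M * M + M * M))%N; last by lia.
  by do 2!apply: small_den; rewrite -opprB; apply: smallN; exact: outer_shift.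
rewrite (_ : _ - _ = cone_den y1 y2 * (outer - t') + (cone_den y1 y2 * inner - cone_num y1 y2)); last by ring.
apply: small_leq (smallD h (inner_num M0)); rewrite addnA leq_add2r; nia.
Qed.
End Ring.
End Cone.

(** * Proportional power series *)

Section Lex.
Context (R : realType) (T : Type) (E : Type) (r : T -> E -> R).
Hypothesis r_min : forall t (S : E -> Prop), (exists e, S e) -> exists e, S e /\ forall f, S f -> r t e <= r t f.

Fixpoint lexle (s : seq T) (e f : E) : Prop :=
  if s is t :: s' then r t e <= r t f /\ (r t e = r t f -> lexle s' e f) else True.

Lemma lex_min (s : seq T) (S : E -> Prop) : (exists e, S e) -> exists e, S e /\ forall f, S f -> lexle s e f.
Proof.
elim: s S => [|t s IH] S hS; first by have [e he] := hS; exists e.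
have [e0 [Se0 he0]] := r_min t hS.
have [|e [[Se re] he]] := IH (fun e => S e /\ r t e = r t e0); first by exists e0.
exists e; split=> // f Sf; split; first by rewrite re; exact: he0.
by move=> ef; apply: he; split=> //; rewrite -ef.
Qed.
End Lex.

(** * Quotients of series invariant under an expanding substitution *)

Section Formal.
Context (K : fieldType) (R : realType) (n : nat) (T : Type) (s : seq T) (r : T -> multinom n -> R) (eps : T -> R).
Context (te : multinom n -> multinom n).
Hypothesis rD : forall t e f, r t (mnm_add e f) = r t e + r t f.
Hypothesis r_te : forall t e, r t (te e) = eps t * r t e.
Hypothesis eps_gt1 : forall t, 1 < eps t.
Hypothesis r_min : forall t (S : multinom n -> Prop), (exists e, S e) -> exists e, S e /\ forall f, S f -> r t e <= r t f.
Hypothesis r_inj : forall e f, (forall t, List.In t s -> r t e = r t f) -> e = f.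
Hypothesis te_deg : forall e, (mdeg e <= mdeg (te e))%N.
Context (th : mpoly n K -> mpoly n K).
Hypothesis th_coef : forall p e, mcoeff (te e) (th p) = mcoeff e p.
Hypothesis th_supp : forall p g, mcoeff g (th p) != 0 -> exists f, g = te f.
Context (q : mpoly n K) (v : multinom n -> K) (V : nat -> mpoly n K).
Hypothesis q0 : q != 0.
Hypothesis hV : forall M e, (mdeg e < M)%N -> mcoeff e (V M) = v e.
Hypothesis hqV : forall M e, (mdeg e < M)%N -> mcoeff e (q * th (V M) - th q * V M) = 0.
Hypothesis thB : forall p p', th (p - p') = th p - th p'.
Hypothesis thZ : forall c p, th (c *: p) = c *: th p.

Notation lex := (lexle r s).

(** One linear form at a time: minimality in [E1] gives that [(eps - 1) * r e0] is at most
    [(eps - 1) * r f0], and [E2] gives the converse. Equality propagates to all four minima, so the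
    lexicographic comparison can pass to the next form. *)
Lemma lex_cancel (e0 f0 e f e' f' : multinom n) : lex e0 e -> lex f0 f -> lex e0 e' -> lex f0 f' ->
  mnm_add e0 (te f0) = mnm_add (te e) f -> mnm_add (te e0) f0 = mnm_add e' (te f') -> e0 = f0.
Proof.
move=> h1 h2 h3 h4 E1 E2; apply: r_inj.
elim: (s) h1 h2 h3 h4 => // t l IH [a1 b1] [a2 b2] [a3 b3] [a4 b4] t'.
have g := eps_gt1 t; have g0 : 0 < eps t by apply: lt_trans g; exact: ltr01.
have := congr1 (r t) E1; have := congr1 (r t) E2; rewrite !rD !r_te => {}E2' {}E1'.
have m1 : eps t * r t e0 <= eps t * r t e by rewrite ler_pM2l.
have m2 : eps t * r t f0 <= eps t * r t f' by rewrite ler_pM2l.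
have k1 : eps t * r t e0 = eps t * r t e by lra.
have k2 : eps t * r t f0 = eps t * r t f' by lra.
have gn : eps t != 0 by rewrite gt_eqF.
have {k1}k1 := mulfI gn k1; have {k2}k2 := mulfI gn k2.
have k3 : r t f0 = r t f by lra.
have k4 : r t e0 = r t e' by lra.
have k5 : r t e0 = r t f0.
  have e1 : eps t - 1 != 0 by rewrite subr_eq0 gt_eqF.
  apply: (mulfI e1); rewrite !mulrBl !mul1r; lra.
by move=> /= [<-//|]; exact: IH (b1 k1) (b2 k3) (b3 k4) (b4 k2) t'.
Qed.

Lemma lex_refl_anti e0 f0 e f : lex e0 e -> lex f0 f -> mnm_add e0 (te f0) = mnm_add e (te f) -> e0 = e /\ f0 = f.
Proof.
move=> h1 h2 E1; suff h : forall t, List.In t s -> r t e0 = r t e /\ r t f0 = r t f.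
  by split; apply: r_inj => t /h[].
elim: (s) h1 h2 => // t l IH [a1 b1] [a2 b2] t'.
have g := eps_gt1 t; have g0 : 0 < eps t by apply: lt_trans g; exact: ltr01.
have := congr1 (r t) E1; rewrite !rD !r_te => E1'.
have m2 : eps t * r t f0 <= eps t * r t f by rewrite ler_pM2l.
have k1 : r t e0 = r t e by lra.
have k2 : eps t * r t f0 = eps t * r t f by lra.
have gn : eps t != 0 by rewrite gt_eqF.
have {k2}k2 := mulfI gn k2.
by move=> /= [<-//|]; exact: IH (b1 k1) (b2 k2) t'.
Qed.

Lemma lex_refl_anti' e0 f0 e f : lex e0 e -> lex f0 f -> mnm_add (te e0) f0 = mnm_add (te e) f -> e0 = e /\ f0 = f.
Proof.
by move=> h1 h2; rewrite addmC [RHS]addmC => /(lex_refl_anti h2 h1)[].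
Qed.

Lemma mcoeffM_unique (p p' : mpoly n K) a b :
  (forall a' b', mcoeff a' p != 0 -> mcoeff b' p' != 0 -> mnm_add a b = mnm_add a' b' -> a = a' /\ b = b') ->
  mcoeff (mnm_add a b) (p * p') = mcoeff a p * mcoeff b p'.
Proof.
move=> h; rewrite mcoeffM_supp.
have pick (P : mpoly n K) x (f : multinom n -> K) : (forall y, y != x -> mcoeff y P != 0 -> f y = 0) ->
    (mcoeff x P = 0 -> f x = 0) -> \sum_(y <- msupp P) f y = f x.
  move=> h1 h2; have [hx|hx] := boolP (x \in msupp P).
    rewrite (bigD1_seq x) ?msupp_uniq //= big_seq_cond big1 ?addr0 // => y /andP[hy yx].
    by apply: h1; rewrite // -mcoeff_msupp.
  rewrite h2; last by apply/eqP; move: hx; rewrite mcoeff_msupp negbK.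
  rewrite big_seq big1 // => y hy; apply: h1; last by rewrite -mcoeff_msupp.
  by apply: contraNneq hx => <-.
rewrite (pick p a).
- rewrite (pick p' b) ?eqxx ?mulr1 // => [y yb hy|->]; last by rewrite mulr0 ?mul0r.
  case: eqP => [e|_]; last by rewrite mulr0.
  by case/eqP: yb; move/eqP: e; rewrite eqm_add2l => /eqP.
- move=> y ya hy; rewrite big_seq big1 // => y' ; rewrite mcoeff_msupp => hy'.
  case: eqP => [e|_]; last by rewrite mulr0.
  by have [e1 _] := h y y' hy hy' (esym e); rewrite e1 eqxx in ya.
- by move=> ->; rewrite big1 // => y _; rewrite !mul0r.
Qed.

(** The hypotheses say that the quotient of the series [v] by [q] is invariant under [th]. Let [L]
    match the coefficients at the lexicographic minimum [e0] of [q], and let [f0] be the minimum of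
    [v - L * q]. The lowest terms of the two sides are at [e0 + te f0] and [te e0 + f0]; since [te]
    expands every form, this forces [e0 = f0], where [v - L * q] has coefficient zero. *)
Theorem proportional : exists L, forall e, v e = L * mcoeff e q.
Proof.
have [|e0 [qe0 he0]] := @lex_min R T (multinom n) r r_min s (fun e => mcoeff e q != 0).
  by exists (mlead q); rewrite mleadc_eq0.
pose L := v e0 / mcoeff e0 q; exists L.
apply: contrapT => /existsNP[e1 he1].
pose v' e := v e - L * mcoeff e q.
have [|f0 [vf0 hf0]] := @lex_min R T (multinom n) r r_min s (fun e => v' e != 0).
  by exists e1; rewrite subr_eq0; apply/eqP.
pose M := (mdeg (mnm_add e0 (te f0)) + mdeg (mnm_add (te e0) f0)).+1.
pose V' := V M - L *: q.
have V'E e : (mdeg e < M)%N -> mcoeff e V' = v' e by move=> h; rewrite mcoeffB mcoeffZ hV.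
have hqV' e : (mdeg e < M)%N -> mcoeff e (q * th V') = mcoeff e (th q * V').
  move=> h; apply/eqP; rewrite -subr_eq0 -mcoeffB; have /eqP := hqV h; congr (_ == 0); congr (mcoeff e _).
  by rewrite /V' thB thZ -!mul_mpolyC; ring.
have d1 : (mdeg (mnm_add e0 (te f0)) < M)%N by rewrite ltnS leq_addr.
have d2 : (mdeg (mnm_add (te e0) f0) < M)%N by rewrite ltnS leq_addl.
have dlt (a b g : multinom n) : mnm_add a b = g -> (mdeg g < M)%N -> (mdeg a < M)%N /\ (mdeg b < M)%N.
  by move=> <-; rewrite mdegD => h; split; apply: leq_ltn_trans h; rewrite ?leq_addr ?leq_addl.
have tlt a : (mdeg (te a) < M)%N -> (mdeg a < M)%N by exact: leq_ltn_trans.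
have n1 : mcoeff (mnm_add e0 (te f0)) (q * th V') != 0.
  rewrite mcoeffM_unique => [|a b ha hb E1].
    rewrite th_coef mulf_neq0 // V'E //; apply: tlt; by have [] := dlt _ _ _ erefl d1.
  have [f fE] := th_supp hb; rewrite fE in hb E1 *; rewrite th_coef in hb.
  have [_ hf] := dlt _ _ _ (esym E1) d1; rewrite (V'E _ (tlt _ hf)) in hb.
  by have [-> ->] := lex_refl_anti (he0 _ ha) (hf0 _ hb) E1.
have n2 : mcoeff (mnm_add (te e0) f0) (th q * V') != 0.
  rewrite mcoeffM_unique => [|a b ha hb E1].
    by rewrite th_coef mulf_neq0 // V'E //; have [] := dlt _ _ _ erefl d2.
  have [e eE] := th_supp ha; rewrite eE in ha E1 *; rewrite th_coef in ha.
  have [_ hf] := dlt _ _ _ (esym E1) d2; rewrite (V'E _ hf) in hb.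
  by have [-> ->] := lex_refl_anti' (he0 _ ha) (hf0 _ hb) E1.
rewrite hqV' // in n1; rewrite -hqV' // in n2.
have [a [b [ha hb E1]]] := mcoeffM_neq0 n1; have [a' [b' [ha' hb' E2]]] := mcoeffM_neq0 n2.
have [e eE] := th_supp ha; rewrite eE th_coef in ha; rewrite eE in E1.
have [f fE] := th_supp hb'; rewrite fE th_coef in hb'; rewrite fE in E2.
have [_ lb] := dlt _ _ _ (esym E1) d1; rewrite (V'E _ lb) in hb.
have [_ lf] := dlt _ _ _ (esym E2) d2; rewrite (V'E _ (tlt _ lf)) in hb'.
have e0f0 := lex_cancel (he0 _ ha) (hf0 _ hb) (he0 _ ha') (hf0 _ hb') E1 E2.
by move: vf0; rewrite -e0f0 /v' /L divfK // subrr eqxx.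
Qed.
End Formal.

(** * Estimates *)

Section Low.
Context (n : nat) (A : comNzRingType) (M : nat).
Implicit Types p q : mpoly n A.
Definition low p := forall e : multinom n, (mdeg e < M)%N -> mcoeff e p = 0.

Lemma low0 : low 0. Proof. by move=> e _; rewrite mcoeff0. Qed.
Lemma lowD p q : low p -> low q -> low (p + q).
Proof. by move=> hp hq e he; rewrite mcoeffD hp ?hq ?addr0. Qed.
Lemma lowN p : low p -> low (- p).
Proof. by move=> hp e he; rewrite mcoeffN hp ?oppr0. Qed.
Lemma lowMl p q : low p -> low (p * q).
Proof.
move=> hp e he; rewrite mcoeffM; apply: big1 => -[a b] /= /eqP ab.
rewrite hp ?mul0r //; apply: leq_ltn_trans he.
by rewrite [in leqRHS](_ : mdeg e = (mdeg a + mdeg b)%N) ?leq_addr // {1}ab mdegD.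
Qed.
Lemma lowMr p q : low q -> low (p * q).
Proof. by rewrite mulrC; exact: lowMl. Qed.
Lemma low_sum (I : Type) (s : seq I) (P : pred I) F : (forall i, P i -> low (F i)) -> low (\sum_(i <- s | P i) F i).
Proof. by move=> h; apply: (big_ind low) => //; [exact: low0 | exact: lowD]. Qed.
Lemma low_mono M' p : (M' <= M)%N -> low p -> forall e : multinom n, (mdeg e < M')%N -> mcoeff e p = 0.
Proof. by move=> h hp e he; apply: hp; exact: leq_trans h. Qed.
Lemma lowZX c (e : multinom n) : (M <= mdeg e)%N -> low (c *: mpolyX A e).
Proof.
move=> h g hg; rewrite mcoeffZ mcoeffX; case: eqP => [eg|_]; last by rewrite mulr0.
by move: hg; rewrite -eg ltnNge h.
Qed.
End Low.

Lemma lowM n (A : comNzRingType) M1 M2 (p q : mpoly n A) : low M1 p -> low M2 q -> low (M1 + M2) (p * q).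
Proof.
move=> hp hq e he; rewrite mcoeffM; apply: big1 => -[a b] /= /eqP ab.
have [h|h] := ltnP (mdeg a) M1; first by rewrite hp ?mul0r.
rewrite hq ?mulr0 //; have : mdeg e = (mdeg a + mdeg b)%N by rewrite {1}ab mdegD.
by move: he h; clear; lia.
Qed.
Lemma lowX n (A : comNzRingType) k (p : mpoly n A) : low 1 p -> low k (p ^+ k).
Proof.
by move=> h; elim: k => [|k IH]; [move=> e | rewrite exprS; exact: (@lowM _ _ 1 k)].
Qed.
Lemma low_small n (A : comNzRingType) (y1 y2 : mpoly n A) M k h : low 1 y1 -> small y1 y2 M k h -> low M h.
Proof.
move=> h1 [s [sM _ ->]]; rewrite big_seq; apply: low_sum => t ts; apply: lowMr; apply: lowMl => e he.
by apply: (lowX h1) (leq_trans he _); move/allP: sM => /(_ _ ts).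
Qed.

Section Rows.
Context (a c D : nat) (acD : ((a - c) ^ 2 < D)%N) (W : comNzRingType).
Definition trow (y1 y2 : W) n := \sum_(m < n | below a c D n m) term a c y1 y2 n m.

Lemma tau_rows M (y1 y2 : W) : tau a c D M y1 y2 = \sum_(0 <= n < M) trow y1 y2 n.
Proof.
rewrite big_mkord; apply: eq_bigr => n _; rewrite /trow.
rewrite (big_ord_widen_cond _ _ _ (ltnW (ltn_ord n))); apply: eq_bigl => m.
by apply/idP/andP => [h|[]] //; split=> //; exact: (below_lt acD).
Qed.

Lemma tau_sub M M' (y1 y2 : W) : (M <= M')%N ->
  tau a c D M' y1 y2 - tau a c D M y1 y2 = \sum_(M <= n < M') trow y1 y2 n.
Proof. by move=> h; rewrite !tau_rows (big_cat_nat (leq0n M) h) /= addrAC subrr add0r. Qed.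
End Rows.

Lemma low_trow n (A : comNzRingType) a c D (y1 y2 : mpoly n A) k : low 1 y1 -> low k (trow a c D y1 y2 k).
Proof. by move=> h; apply: low_sum => m _; apply: lowMl; exact: lowX. Qed.
Lemma low_tau_sub n (A : comNzRingType) a c D (acD : ((a - c) ^ 2 < D)%N) (y1 y2 : mpoly n A) M M' : (M <= M')%N ->
  low 1 y1 -> low M (tau a c D M' y1 y2 - tau a c D M y1 y2).
Proof.
move=> hM h; rewrite (tau_sub acD) // big_nat; apply: low_sum => k /andP[Mk _].
exact: low_mono Mk (low_trow _ _ _ _ h).
Qed.
Lemma low_tau n (A : comNzRingType) a c D (acD : ((a - c) ^ 2 < D)%N) (y1 y2 : mpoly n A) M :
  low 1 y1 -> low 1 (tau a c D M y1 y2).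
Proof.
move=> h; rewrite (tau_rows acD); apply: low_sum => -[_|k _]; first by rewrite /trow big_ord0; exact: low0.
exact: low_mono (ltn0Sn k) (low_trow _ _ _ _ h).
Qed.

Section Estimates.
Context (R : realType).

Lemma arith_geom_sum (r : R) J : 0 <= r < 1 -> \sum_(j < J) j.+1%:R * r ^+ j <= (1 - r)^-2.
Proof.
move=> /andP[r0 r1].
have E : (1 - r) ^+ 2 * \sum_(j < J) j.+1%:R * r ^+ j = 1 - J.+1%:R * r ^+ J + J%:R * r ^+ J.+1.
  elim: J => [|J IH]; first by rewrite big_ord0 expr0; ring.
  by rewrite big_ord_recr /= mulrDr IH !exprS -!natr1; ring.
have p : 0 < (1 - r) ^+ 2 by rewrite exprn_gt0 // subr_gt0.
rewrite -(ler_pM2l p) divff ?gt_eqF // E.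
have : J%:R * r ^+ J.+1 <= J.+1%:R * r ^+ J.
  apply: ler_pM => //; rewrite ?exprn_ge0 ?ler_nat // exprS ler_piMl ?exprn_ge0 // ltW //.
lra.
Qed.

Lemma geom_tail (rho t : R) M M' : 0 <= t <= rho -> rho < 1 ->
  \sum_(M <= n < M') n%:R * t ^+ n <= M.+1%:R * (1 - rho)^-2 * t ^+ M.
Proof.
move=> /andP[t0 tr] r1.
have tt : 0 <= t < 1 by rewrite t0 (le_lt_trans tr).
rewrite -{1}[M]add0n big_addn big_mkord.
apply: (@le_trans _ _ (\sum_(i < M' - M) M.+1%:R * t ^+ M * (i.+1%:R * t ^+ i))).
  apply: ler_sum => i _; rewrite exprD.
  have -> : M.+1%:R * t ^+ M * (i.+1%:R * t ^+ i) = M.+1%:R * i.+1%:R * (t ^+ i * t ^+ M) by ring.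
  apply: ler_wpM2r; first by rewrite mulr_ge0 ?exprn_ge0.
  by rewrite -natrM ler_nat; clear; nia.
rewrite -mulr_sumr mulrAC; apply: ler_wpM2r; first exact: exprn_ge0.
apply: ler_wpM2l => //; apply: le_trans (arith_geom_sum _ tt) _.
have p : 0 < 1 - rho by rewrite subr_gt0.
have p' : 0 < 1 - t by lra.
rewrite lef_pV2 ?posrE ?exprn_gt0 //; apply: lerXn2r; rewrite ?nnegrE ?(ltW p) ?(ltW p') //; lra.
Qed.

Lemma expr_to0 (r e : R) : 0 <= r < 1 -> 0 < e -> exists M0, forall M, (M0 <= M)%N -> r ^+ M <= e.
Proof.
move=> /andP[r0 r1] e0.
have := @cvg_expr R r; rewrite ger0_norm // => /(_ r1) /cvgrPdist_le /(_ _ e0) [t _ h].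
by exists t => M hM; have := h M hM; rewrite sub0r normrN ger0_norm // exprn_ge0.
Qed.

Lemma quad_geom_to0 (r e : R) (A B : nat) : 0 <= r < 1 -> 0 < e ->
  exists M0, forall M, (M0 <= M)%N -> (A * M ^ 2 + B)%:R * r ^+ M <= e.
Proof.
move=> /andP[r0 r1] e0.
(* A fourth root of [r] leaves two factors [s ^+ M] to absorb the square of [M] and two more, of
   which one tends to zero. *)
pose s := Num.sqrt (Num.sqrt r).
have s0 : 0 <= s by rewrite sqrtr_ge0.
have s4 : s ^+ 4 = r by rewrite (exprM _ 2 2) /s !sqr_sqrtr ?sqrtr_ge0.
have s1 : s < 1.
  by rewrite ltNge; apply/negP => h; have := exprn_ege1 4 h; rewrite s4 leNgt r1.
have ss : 0 <= s < 1 by rewrite s0.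
pose K := (1 - s)^-2.
have K0 : 0 <= K by rewrite invr_ge0 exprn_ge0 // subr_ge0 ltW.
have hK M : M%:R * s ^+ M <= K.
  apply: le_trans (arith_geom_sum M.+1 ss); rewrite big_ord_recr /= ler_wpDl //.
    by apply: sumr_ge0 => i _; rewrite mulr_ge0 ?exprn_ge0.
  by apply: ler_wpM2r; rewrite ?exprn_ge0 // ler_nat.
pose L := A%:R * K ^+ 2 + B%:R + 1.
have L0 : 0 < L by rewrite ltr_wpDl // addr_ge0 ?mulr_ge0 ?exprn_ge0.
have [M0 h] := expr_to0 ss (divr_gt0 e0 L0); exists M0 => M /h hM.
rewrite natrD natrM natrX -s4 -exprM mulnC exprM.
have -> : (A%:R * M%:R ^+ 2 + B%:R) * (s ^+ M) ^+ 4 =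
   (A%:R * (M%:R * s ^+ M) ^+ 2 + B%:R * (s ^+ M) ^+ 2) * (s ^+ M) ^+ 2 by ring.
have sM0 : 0 <= s ^+ M by rewrite exprn_ge0.
have sM1 : s ^+ M <= 1 by rewrite exprn_ile1 // ltW.
have s20 : 0 <= (s ^+ M) ^+ 2 by rewrite exprn_ge0.
have s21 : (s ^+ M) ^+ 2 <= 1 by rewrite exprn_ile1.
apply: (@le_trans _ _ (L * s ^+ M)); last by rewrite mulrC -ler_pdivlMr.
apply: ler_pM => //; first by rewrite addr_ge0 ?mulr_ge0 ?exprn_ge0.
  rewrite /L -[leLHS]addr0; apply: lerD => //; apply: lerD.
    by apply: ler_wpM2l => //; apply: lerXn2r; rewrite ?nnegrE ?mulr_ge0.
  by rewrite ler_piMr.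
by rewrite expr2 ler_piMl.
Qed.

Lemma tends_absurd (d : R) : 0 <= d -> (forall e, 0 < e -> d <= e) -> d = 0.
Proof.
move=> d0 h; apply/eqP; rewrite eq_le d0 andbT; apply/negPn/negP; rewrite -ltNge => dp.
by have := h _ (divr_gt0 dp (ltr0n R 2)); apply/negP; rewrite -ltNge ltr_pdivrMr ?ltr0n // ltr_pMr // ltr1n.
Qed.
End Estimates.

Section Tends.
Context (C : fieldType) (R : realType) (nrm : C -> R).
Hypothesis av : absval nrm.
Definition tends (f : nat -> C) (l : C) :=
  forall e, 0 < e -> exists M0, forall M, (M0 <= M)%N -> nrm (f M - l) <= e.

Lemma tendsC l : tends (fun=> l) l.
Proof. by move=> e e0; exists 0%N => M _; rewrite subrr (av0 av) ltW. Qed.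
Lemma tendsD f g l l' : tends f l -> tends g l' -> tends (fun M => f M + g M) (l + l').
Proof.
move=> hf hg e e0; have e2 : 0 < e / 2%:R by rewrite divr_gt0.
have [M1 h1] := hf _ e2; have [M2 h2] := hg _ e2; exists (maxn M1 M2) => M.
rewrite geq_max => /andP[/h1 k1 /h2 k2]; rewrite opprD addrACA; apply: le_trans (avD av _ _) _.
by apply: le_trans (lerD k1 k2) _; lra.
Qed.
Lemma tendsZ c f l : tends f l -> tends (fun M => c * f M) (c * l).
Proof.
move=> hf e e0; have c0 : 0 < nrm c + 1 by rewrite ltr_wpDl // (av_ge0 av).
have [M1 h1] := hf _ (divr_gt0 e0 c0); exists M1 => M /h1; rewrite ler_pdivlMr // mulrC => h.
by rewrite -mulrBr (avM av); apply: le_trans h; apply: ler_wpM2r; rewrite ?(av_ge0 av) // lerDl.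
Qed.
Lemma tendsN f l : tends f l -> tends (fun M => - f M) (- l).
Proof. by move=> h e /h[M0 hM]; exists M0 => M /hM; rewrite -opprD (avN av). Qed.
Lemma tendsB f g l l' : tends f l -> tends g l' -> tends (fun M => f M - g M) (l - l').
Proof. by move=> hf hg; apply: tendsD => //; exact: tendsN. Qed.
Lemma tends_ext f g l : f =1 g -> tends f l -> tends g l.
Proof. by move=> h; rewrite (funext h). Qed.
Lemma tends_le f l (B : R) M0 l' : tends f l -> (forall M, (M0 <= M)%N -> nrm (f M - l') <= B) -> nrm (l - l') <= B.
Proof.
move=> hf hB; rewrite leNgt; apply/negP => hlt.
have p : 0 < (nrm (l - l') - B) / 2%:R by rewrite divr_gt0 // subr_gt0.
have [M1 h] := hf _ p.
set M := maxn M0 M1; have := h M (leq_maxr _ _); have := hB M (leq_maxl _ _).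
have : nrm (l - l') <= nrm (f M - l') + nrm (f M - l).
  rewrite (avBC av (f M) l) addrC; apply: le_trans (avD av _ _).
  by rewrite (_ : f M - l' + (l - f M) = - l' + l) //; ring.
by move: hlt; lra.
Qed.
Lemma tends_unique f l l' : tends f l -> tends f l' -> l = l'.
Proof.
move=> h h'; apply/eqP; rewrite -subr_eq0 -(av_eq0 av); apply/eqP; apply: tends_absurd; first exact: (av_ge0 av).
by move=> e e0; have [M0 hM] := h' _ e0; apply: tends_le h hM.
Qed.
Lemma tends_bound (f : nat -> C) l r (A B : nat) M1 : 0 <= r < 1 ->
  (forall M, (M1 <= M)%N -> nrm (f M - l) <= (A * M ^ 2 + B)%:R * r ^+ M) -> tends f l.
Proof.
move=> hr h e e0; have [M0 hM] := quad_geom_to0 A B hr e0; exists (maxn M0 M1) => M.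
by rewrite geq_max => /andP[/hM h1 /h]; move=> h2; exact: le_trans h1.
Qed.

Lemma nrm_small (y1 y2 : C) t M k h : nrm y1 <= t -> t <= 1 -> nrm y2 <= 1 -> small y1 y2 M k h ->
  nrm h <= k%:R * t ^+ M.
Proof.
move=> h1 t1 h2 [s [sM sk ->]].
have t0 : 0 <= t by apply: le_trans h1; exact: (av_ge0 av).
apply: le_trans (av_sum av _ _ _) _.
apply: (@le_trans _ _ (\sum_(i <- s) t ^+ M)).
  rewrite !big_seq; apply: ler_sum => i his; rewrite !(avM av) !(avX av) (avN av) (av1 av) expr1n mul1r.
  rewrite -[leRHS]mulr1; apply: ler_pM; rewrite ?exprn_ge0 ?(av_ge0 av) ?exprn_ile1 ?(av_ge0 av) //.
  apply: (@le_trans _ _ (t ^+ i.1.2)); first by apply: lerXn2r; rewrite ?nnegrE ?(av_ge0 av).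
  by apply: ler_wiXn2l => //; move/allP: sM => /(_ _ his).
rewrite big_const_seq count_predT iter_addr addr0 -[leLHS]mulr_natl.
by apply: ler_pM; rewrite ?exprn_ge0 // ler_nat.
Qed.

Lemma nrm_row a c D (y1 y2 : C) t n : nrm y1 <= t -> nrm y2 <= 1 ->
  nrm (trow a c D y1 y2 n) <= n%:R * t ^+ n.
Proof.
move=> h1 h2; have t0 : 0 <= t by apply: le_trans h1; exact: (av_ge0 av).
apply: le_trans (av_sum av _ _ _) _.
apply: (@le_trans _ _ (\sum_(m < n | below a c D n m) t ^+ n)).
  apply: ler_sum => m _; rewrite /term (avM av) !(avX av) -[leRHS]mulr1.
  apply: ler_pM; rewrite ?exprn_ge0 ?(av_ge0 av) ?exprn_ile1 ?(av_ge0 av) //.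
  by apply: lerXn2r; rewrite ?nnegrE ?(av_ge0 av).
rewrite big_const iter_addr addr0 -[leLHS]mulr_natl; apply: ler_pM; rewrite ?exprn_ge0 //.
rewrite ler_nat; by apply: leq_trans (max_card _) _; rewrite card_ord.
Qed.

Lemma tau_tail a c D (acD : ((a - c) ^ 2 < D)%N) (y1 y2 : C) rho E M M' : (0 < E)%N -> 0 <= rho < 1 ->
  nrm y1 <= rho ^+ E -> nrm y2 <= 1 -> (M <= M')%N ->
  nrm (tau a c D M' y1 y2 - tau a c D M y1 y2) <= M.+1%:R * (1 - rho)^-2 * rho ^+ (M * E).
Proof.
move=> E0 /andP[r0 r1] h1 h2 hM; rewrite (tau_sub acD) //; apply: le_trans (av_sum av _ _ _) _.
rewrite mulnC exprM; apply: le_trans (geom_tail M M' (_ : 0 <= rho ^+ E <= rho) r1).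
  by apply: ler_sum => n _; exact: nrm_row.
rewrite exprn_ge0 //=; case: (E) E0 => // E' _; rewrite exprS ler_piMr // exprn_ile1 // ltW //.
Qed.
End Tends.

(** * Growth of the Pell solutions along a strip *)

Section PellReal.
Context (R : realType) (m : nat) (D X Z : 'I_m -> nat).
Hypothesis Pell : forall l, (X l ^ 2 = D l * Z l ^ 2 + 1)%N.
Hypothesis Z0 : forall l, (0 < Z l)%N.
Hypothesis D0 : forall l, (0 < D l)%N.
Definition rt l : R := Num.sqrt (D l)%:R.
Definition eps l : R := (X l)%:R + (Z l)%:R * rt l.
Definition wt l : R := ln (eps l).
Local Notation px k l := (pellx (D l) (X l) (Z l) k).
Local Notation py k l := (pelly (D l) (X l) (Z l) k).

Lemma rt_sq l : rt l ^+ 2 = (D l)%:R. Proof. by rewrite sqr_sqrtr. Qed.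
Lemma rt_ge1 l : 1 <= rt l.
Proof. by rewrite -[leLHS]sqrtr1 ler_wsqrtr // ler1n. Qed.
Lemma eps_gt1 l : 1 < eps l.
Proof.
have X0 : (0 < X l)%N by move: (Pell l); case: (X l) => // h; rewrite exp0n // addn1 in h.
rewrite /eps -[ltLHS]addr0; apply: ler_ltD; first by rewrite ler1n.
by rewrite mulr_gt0 ?ltr0n // (lt_le_trans _ (rt_ge1 l)).
Qed.
Lemma wt_gt0 l : 0 < wt l. Proof. exact: ln_gt0 (eps_gt1 l). Qed.
Lemma eps_pow l k : eps l ^+ k = (px k l)%:R + (py k l)%:R * rt l.
Proof. exact: pell_exp (rt_sq l) k. Qed.
Lemma pelly_geq l k : (k <= py k l)%N.
Proof.
elim: k => // k IH; have [_] := pellD (D l) (X l) (Z l) k 1; rewrite addn1 => ->.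
have -> : px 1 l = X l by rewrite /pellx /=; lia.
have -> : py 1 l = Z l by rewrite /pelly /=; lia.
have X0 : (0 < X l)%N by move: (Pell l); case: (X l) => // h; rewrite exp0n // addn1 in h.
have := pellx_gt0 (Pell l) k; have := Z0 l; clear -IH X0; nia.
Qed.
Lemma pelly_leq l k : (py k l <= px k l)%N.
Proof. by have := pell_norm (Pell l) k; have := D0 l; clear; nia. Qed.
Lemma pellx_leq l k : (0 < k)%N -> (px k l <= (D l + 1) * py k l)%N.
Proof. by move=> k0; have := pell_norm (Pell l) k; have := D0 l; have := leq_trans k0 (pelly_geq l k); clear; nia. Qed.

(** In a strip of width 1 the powers of the units agree up to a factor [exp 1], and each is
    comparable with both of its Pell coordinates. *)
Lemma strip_comparable : exists C : nat, (0 < C)%N /\ forall k, strip wt 1 k -> (forall l, (0 < k l)%N) ->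
  forall l l', (px (k l) l <= C * py (k l') l')%N.
Proof.
pose C0 := Num.truncn (expR 1 : R); exists (C0.+1 * (\sum_l (2 * D l + 1)).+1)%N; split=> // k hs k0 l l'.
have e1 : expR 1 <= C0.+1%:R :> R by rewrite ltW // truncnS_gt.
have h1 : eps l ^+ k l <= C0.+1%:R * eps l' ^+ k l'.
  have ex j : eps j ^+ k j = expR ((k j)%:R * wt j).
    by rewrite expRM_natl lnK // posrE (lt_trans ltr01) // eps_gt1.
  rewrite !ex; apply: (@le_trans _ _ (expR 1 * expR ((k l')%:R * wt l'))); last first.
    by apply: ler_wpM2r e1; exact: expR_ge0.
  by rewrite -expRD ler_expR; have := hs l l'; rewrite ltr_norml => /andP[_]; lra.
have h2 : eps l' ^+ k l' <= (2 * D l' + 1)%:R * (py (k l') l')%:R.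
  have rD : rt l' <= (D l')%:R.
    by rewrite -[leRHS]rt_sq expr2 ler_peMl ?rt_ge1 // (le_trans _ (rt_ge1 l')).
  have := pellx_leq l' (k0 l'); rewrite eps_pow -(ler_nat R) natrM => h.
  apply: le_trans (lerD h (ler_wpM2l (ler0n _ _) rD)) _.
  have -> : (2 * D l' + 1)%:R = 2%:R * (D l')%:R + 1 :> R by rewrite natrD natrM.
  by rewrite natrD; have := ler0n R (py (k l') l'); have := ler0n R (D l'); nra.
have h3 : (px (k l) l)%:R <= eps l ^+ k l.
  by rewrite eps_pow lerDl mulr_ge0 // (le_trans _ (rt_ge1 l)).
have h4 : (2 * D l' + 1 <= (\sum_l (2 * D l + 1)).+1)%N.
  by apply: leqW; rewrite (bigD1 l') //= leq_addr.
rewrite -(ler_nat R) !natrM; apply: le_trans h3 _; apply: le_trans h1 _.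
rewrite -mulrA; apply: ler_wpM2l => //; apply: le_trans h2 _.
by apply: ler_wpM2r => //; rewrite ler_nat.
Qed.
End PellReal.

(** * Heights of families *)

Section Heights.
Context (K : fieldType) (g0 : K) (f : {poly int}).
Hypothesis f_root : (map_poly intr f).[g0] = 0.
Hypothesis f_gen : forall y : K, exists (d : int) (P : {poly int}), d != 0 /\ d%:~R * y = (map_poly intr P).[g0].
Hypothesis f_min : forall P : {poly int}, (map_poly intr P).[g0] = 0 -> exists (c : int) g, c != 0 /\ c *: P = g * f.
Hypothesis f_size : (1 < size f)%N.
Context (I : Type) (E : I -> nat) (E0 : forall k, (0 < E k)%N).
Local Notation d := (size f).-1.

(** Height at most exponential in [E k]. As [E k] is positive, constant factors are absorbed into
    [G]. *)
Definition hgt (F : I -> K) := exists2 G : nat, (0 < G)%N &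
  forall k, exists b, [/\ (0 < b)%N, (b <= G ^ E k)%N & sz g0 f b (G ^ E k) (F k)].

Lemma d_gt0 : (0 < d)%N. Proof. by case: (size f) f_size => [|[]]. Qed.
Lemma leq_expE G k : (G <= G ^ E k)%N.
Proof. by case: G => // G; rewrite -{1}[G.+1]expn1 leq_pexp2l. Qed.

Lemma hgt_const y : hgt (fun=> y).
Proof.
have [b [H [b0 H0 h]]] := sz_exists f_root f_gen f_size y.
exists (b * H)%N; first by rewrite muln_gt0 b0.
move=> k; exists b; split=> //; first by apply: leq_trans (leq_expE _ k); exact: leq_pmulr.
by apply: sz_leq h; apply: leq_trans (leq_expE _ k); exact: leq_pmull.
Qed.

Lemma hgtM F1 F2 : hgt F1 -> hgt F2 -> hgt (fun k => F1 k * F2 k).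
Proof.
move=> [G1 g1 h1] [G2 g2 h2]; exists (d * (G1 * G2))%N; first by rewrite !muln_gt0 d_gt0 g1.
move=> k; have [b1 [b10 b1G s1]] := h1 k; have [b2 [b20 b2G s2]] := h2 k.
exists (b1 * b2)%N; split; first by rewrite muln_gt0 b10.
  rewrite !expnMn; apply: leq_trans (leq_mul b1G b2G) _; apply: leq_pmull; by rewrite expn_gt0 d_gt0.
apply: sz_leq (szM f_size s1 s2); rewrite !expnMn leq_mul2r leq_expE orbT //.
Qed.

Lemma hgtD F1 F2 : hgt F1 -> hgt F2 -> hgt (fun k => F1 k + F2 k).
Proof.
move=> [G1 g1 h1] [G2 g2 h2]; exists (2 * (G1 * G2))%N; first by rewrite !muln_gt0 g1.
move=> k; have [b1 [b10 b1G s1]] := h1 k; have [b2 [b20 b2G s2]] := h2 k.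
exists (b1 * b2)%N; split; first by rewrite muln_gt0 b10.
  rewrite !expnMn; apply: leq_trans (leq_mul b1G b2G) _; apply: leq_pmull; by rewrite expn_gt0.
have s1' := sz_scale b2 s1; rewrite mulnC in s1'.
apply: sz_leq (szD s1' (sz_scale b1 s2)); rewrite !expnMn.
apply: (@leq_trans (2 * (G1 ^ E k * G2 ^ E k))%N); last by rewrite leq_mul2r leq_expE orbT.
rewrite mul2n -addnn; apply: leq_add; last by rewrite leq_mul2r b1G orbT.
by rewrite mulnC leq_mul2l b2G orbT.
Qed.

Lemma hgtB F1 F2 : hgt F1 -> hgt F2 -> hgt (fun k => F1 k - F2 k).
Proof.
move=> h1 h2; have := hgtD h1 (hgtM (hgt_const (-1)) h2).
by rewrite (_ : (fun k => _ + _) = fun k => F1 k - F2 k) //; apply/funext => k; rewrite mulN1r.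
Qed.

Lemma hgtV F : hgt F -> (forall k, F k != 0) -> hgt (fun k => (F k)^-1).
Proof.
move=> [G g h] F0; exists (d`! * (d.-1`! * G ^ d.+1))%N; first by rewrite !muln_gt0 !fact_gt0 expn_gt0 g.
move=> k; have [b [b0 bG s]] := h k; have [b' [b'0 b'G s']] := sz_inv f_root f_gen f_min f_size b0 s (F0 k).
have Gk : (0 < G ^ E k)%N by rewrite expn_gt0 g.
exists b'; split=> //.
  apply: leq_trans b'G _; rewrite !expnMn; apply: leq_mul; first exact: leq_expE.
  apply: leq_trans (leq_pmull _ _); last by rewrite expn_gt0 fact_gt0.
  by rewrite -!expnM mulnC leq_pexp2l // leq_mul2r leqnSn orbT.
apply: sz_leq s'; rewrite !expnMn; apply: leq_trans (leq_pmull _ _); last by rewrite expn_gt0 fact_gt0.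
rewrite mulnCA; apply: leq_mul; first exact: leq_expE.
apply: leq_trans (leq_mul bG (leqnn _)) _; rewrite -expnS -expnM -expnM mulnC leq_pexp2l //.
by rewrite leq_mul2r; case: d d_gt0 => //= d' _; rewrite (leq_trans _ (leqnSn _)) ?orbT.
Qed.

Lemma hgt_pow y (e : I -> nat) (c : nat) : (forall k, e k <= c * E k)%N -> hgt (fun k => y ^+ e k).
Proof.
have [b [H [b0 H0 h]]] := sz_exists f_root f_gen f_size y => he.
have p : (0 < b * (d * H))%N by rewrite !muln_gt0 b0 d_gt0.
exists ((b * (d * H)) ^ c)%N; first by rewrite expn_gt0 p.
move=> k; exists (b ^ e k)%N; split; first by rewrite expn_gt0 b0.
  rewrite -expnM expnMn; apply: leq_trans (leq_pmulr _ _); first by rewrite leq_pexp2l.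
  by rewrite expn_gt0 muln_gt0 d_gt0 H0.
apply: sz_leq (szX f_size (e k) h); rewrite -expnM [X in (_ <= X)%N]expnMn.
apply: leq_trans (leq_pmull _ _); last by rewrite expn_gt0 b0.
by rewrite leq_pexp2l // muln_gt0 d_gt0.
Qed.

(** The sum has as many terms as [E k] up to a constant, which is harmless because [c * E k] is at
    most [2 ^ (c * E k)]. *)
Lemma hgt_sum_pow y (M : I -> nat) (e : I -> nat -> nat) (c : nat) : (forall k, M k <= c * E k)%N ->
  (forall k j, (j < M k)%N -> (e k j <= c * E k)%N) -> hgt (fun k => \sum_(j < M k) y ^+ e k j).
Proof.
have [b [H [b0 H0 h]]] := sz_exists f_root f_gen f_size y => hM he.
have p : (0 < b * (d * H))%N by rewrite !muln_gt0 b0 d_gt0.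
have p2 : (0 < 2 * (b * (d * H)))%N by rewrite muln_gt0.
exists ((2 * (b * (d * H))) ^ c)%N; first by rewrite expn_gt0 p2.
move=> k; exists (b ^ (c * E k))%N; split; first by rewrite expn_gt0 b0.
  by rewrite -expnM 2!expnMn mulnCA leq_pmulr // muln_gt0 !expn_gt0 muln_gt0 d_gt0 H0.
have -> : (((2 * (b * (d * H))) ^ c) ^ E k = 2 ^ (c * E k) * (b * (d * H)) ^ (c * E k))%N.
  by rewrite -expnM expnMn.
have : sz g0 f (b ^ (c * E k)) (size (index_enum 'I_(M k)) * (b * (d * H)) ^ (c * E k)) (\sum_(j < M k) y ^+ e k j).
  apply: sz_sum => j _.
  have hj := he k j (ltn_ord j).
  have := sz_scale (b ^ (c * E k - e k j)) (szX f_size (e k j) h); rewrite -expnD subnK //.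
  apply: sz_leq; rewrite [X in (_ <= X)%N]expnMn; apply: leq_mul; rewrite leq_pexp2l ?leq_subr //.
  by rewrite muln_gt0 d_gt0.
apply: sz_leq; rewrite leq_mul2r; apply/orP; right.
rewrite -sum1_size sum_nat_const card_ord muln1.
by apply: leq_trans (hM k) _; apply: ltnW; apply: ltn_expl.
Qed.
End Heights.

(** * The theorem over a number field *)

Section Morph.
Context (U W : comNzRingType) (phi : {rmorphism U -> W}).
Lemma tau_rmorph a c D M y1 y2 : phi (tau a c D M y1 y2) = tau a c D M (phi y1) (phi y2).
Proof.
rewrite /tau rmorph_sum /=; apply: eq_bigr => n _; rewrite rmorph_sum /=; apply: eq_bigr => m _.
by rewrite /term rmorphM !rmorphXn.
Qed.
Lemma cone_num_rmorph a c D x z y1 y2 : phi (cone_num a c D x z y1 y2) = cone_num a c D x z (phi y1) (phi y2).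
Proof. by rewrite /cone_num rmorph_sum /=; apply: eq_bigr => m _; rewrite /term rmorphM !rmorphXn. Qed.
Lemma cone_den_rmorph a D x z y1 y2 : phi (cone_den a D x z y1 y2) = cone_den a D x z (phi y1) (phi y2).
Proof. by rewrite /cone_den rmorphM !rmorphB rmorph1 !rmorphM !rmorphXn. Qed.
Lemma small_rmorph (y1 y2 : U) M k h : small y1 y2 M k h -> small (phi y1) (phi y2) M k (phi h).
Proof.
move=> [s [h1 h2 ->]]; exists s; split=> //; rewrite rmorph_sum /=; apply: eq_bigr => t _.
by rewrite rmorphMsign rmorphM !rmorphXn.
Qed.
End Morph.

Section Core.
Context (K : fieldType) (g0 : K) (f u v : {poly int}) (e0 : int).
Hypothesis charK : forall k : int, k%:~R = 0 :> K -> k = 0.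
Hypothesis f_root : (map_poly intr f).[g0] = 0.
Hypothesis f_gen : forall y : K, exists (d : int) (P : {poly int}), d != 0 /\ d%:~R * y = (map_poly intr P).[g0].
Hypothesis f_min : forall P : {poly int}, (map_poly intr P).[g0] = 0 -> exists (c : int) g, c != 0 /\ c *: P = g * f.
Hypothesis f_sep : u * f + v * f^`() = e0%:P.
Hypothesis e00 : e0 != 0.
Hypothesis f_size : (1 < size f)%N.
Context (C : fieldType) (R : realType) (nrm : C -> R) (iota : {rmorphism K -> C}).
Hypothesis av : absval nrm.
Hypothesis nrm_int : forall k : int, nrm k%:~R = (`|k|%N)%:R.
Context (m s n : nat) (D X Z : 'I_m -> nat).
Hypothesis Pell : forall l, (X l ^ 2 = D l * Z l ^ 2 + 1)%N.
Hypothesis Z0 : forall l, (0 < Z l)%N.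
Hypothesis D0 : forall l, (0 < D l)%N.
Context (be : 'I_s -> K) (dl : 'I_m -> K).
Hypothesis be_gt0 : forall j, 0 < nrm (iota (be j)).
Hypothesis be_lt1 : forall j, nrm (iota (be j)) < 1.
Hypothesis be_indep : forall a b : 'I_s -> nat, \prod_j be j ^+ a j = \prod_j be j ^+ b j -> a =1 b.
Hypothesis dl_sq : forall l, dl l ^+ 2 = (D l)%:R.
Hypothesis eps_indep : forall a b : 'I_m -> nat,
  \prod_l ((X l)%:R + (Z l)%:R * dl l) ^+ a l = \prod_l ((X l)%:R + (Z l)%:R * dl l) ^+ b l -> a =1 b.
(* The variables are indexed by a field, an element of the multiplicative basis and a sort. *)
Context (vb : 'I_n -> 'I_m) (vj : 'I_n -> 'I_s) (vx : 'I_n -> bool) (idx : 'I_m -> 'I_s -> bool -> 'I_n).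
Hypothesis vb_idx : forall l j t, vb (idx l j t) = l.
Hypothesis vj_idx : forall l j t, vj (idx l j t) = j.
Hypothesis vx_idx : forall l j t, vx (idx l j t) = t.
Hypothesis idxK : forall i, idx (vb i) (vj i) (vx i) = i.

Local Notation px l k := (pellx (D l) (X l) (Z l) k).
Local Notation py l k := (pelly (D l) (X l) (Z l) k).
Local Notation St := (strip (@wt R m D X Z)).
Definition zK (k : 'I_m -> nat) (i : 'I_n) : K := be (vj i) ^+ zexp vb vx D X Z k i.

Lemma be_neq0 j : be j != 0.
Proof. by apply/eqP => h; have := be_gt0 j; rewrite h rmorph0 (av0 av) ltxx. Qed.
Lemma dl_neq0 l : dl l != 0.
Proof.
apply/eqP => h; have := dl_sq l; rewrite h expr0n /= => /esym; rewrite -[_%:R]/((D l)%:Z%:~R) => /charK [].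
by move=> h'; have := D0 l; rewrite h'.
Qed.

(** Transport to the p-adic integers by an odd place at which the coefficients of [p], the [be j],
    the [dl l] and the inverses of the latter two are integral; both independence hypotheses survive
    because the place is injective. *)
Lemma density p : vanish St (fun k => meval (zK k) p) -> p = 0.
Proof.
move=> [B [B0 [k0 hv]]].
pose s0 := [seq mcoeff e p | e <- msupp p] ++ codom be ++ codom (fun j => (be j)^-1) ++ codom dl ++ codom (fun l => (dl l)^-1).
have [pp [p_pr [phi [p2 hs]]]] := exists_place charK f_root f_gen f_min f_sep e00 s0 2.
have /choice[b hb] j : exists t, phi (be j) = tofrac t.
  by apply: hs; rewrite !mem_cat codom_f ?orbT.
have /choice[b' hb'] j : exists t, phi (be j)^-1 = tofrac t.
  by apply: hs; rewrite !mem_cat (codom_f (fun j => (be j)^-1)) ?orbT.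
have /choice[dz hd] l : exists t, phi (dl l) = tofrac t.
  by apply: hs; rewrite !mem_cat codom_f ?orbT.
have /choice[dz' hd'] l : exists t, phi (dl l)^-1 = tofrac t.
  by apply: hs; rewrite !mem_cat (codom_f (fun l => (dl l)^-1)) ?orbT.
have /choice[t ht] (e : multinom n) : exists t, phi (mcoeff e p) = tofrac t.
  have [he|he] := boolP (e \in msupp p); first by apply: hs; rewrite mem_cat (map_f (fun e => mcoeff e p)).

  by exists 0; rewrite memN_msupp_eq0 // rmorph0 tofrac0.
have tinj := @tofrac_eq (padic p_pr).
pose pZ : mpoly n (padic p_pr) := \sum_(e <- msupp p) t e *: mpolyX _ e.
have ev k : tofrac (meval (zval vb vj vx D X Z b k) pZ) = phi (meval (zK k) p).
  rewrite [in RHS]mevalE /pZ (raddf_sum (meval _)) rmorph_sum rmorph_sum /=; apply: eq_bigr => e _.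
  rewrite mevalZ mevalX rmorphM /= rmorphM /= -ht rmorph_prod rmorph_prod /=; congr (_ * _).
  by apply: eq_bigr => i _; rewrite !rmorphXn /= hb.
suff pZ0 : pZ = 0.
  apply/mpolyP => e; rewrite mcoeff0; apply/eqP; rewrite mcoeff_eq0; apply/negP => he.
  have : mcoeff e pZ = t e.
    rewrite /pZ raddf_sum /= (bigD1_seq e) ?msupp_uniq //= mcoeffZ mcoeffX eqxx mulr1 big1 ?addr0 // => e' ne.
    by rewrite mcoeffZ mcoeffX (negbTE ne) mulr0.
  rewrite pZ0 mcoeff0 => te; have := ht e; rewrite -te tofrac0 => /eqP; rewrite fmorph_eq0 mcoeff_eq0.
  by rewrite he.
apply: (@zval_dense _ _ p2 R m s n _ (@wt_gt0 R m D X Z Pell Z0 D0) vb vj vx _ D X Z Pell b b' dz dz').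
- by move=> i i' h1 h2 h3; rewrite -(idxK i) h1 h2 h3 idxK.
- by move=> j; apply/eqP; rewrite -tinj tofracM -hb -hb' -rmorphM divff ?be_neq0 // rmorph1 tofrac1.
- by move=> l; apply/eqP; rewrite -tinj tofracXn -hd -rmorphXn dl_sq !rmorph_nat.
- by move=> l; apply/eqP; rewrite -tinj tofracM -hd -hd' -rmorphM mulVf ?dl_neq0 // rmorph1 tofrac1.
- move=> a c h; apply: be_indep; apply: (fmorph_inj phi); rewrite !rmorph_prod.
  have /eqP := h; rewrite -tinj !rmorph_prod => /eqP {}h.
  by transitivity (\prod_j tofrac (b j ^+ a j)); [|rewrite h]; apply: eq_bigr => j _; rewrite !rmorphXn /= hb.
- move=> a c h; apply: eps_indep; apply: (fmorph_inj phi); rewrite !rmorph_prod.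
  have /eqP := h; rewrite -tinj !rmorph_prod => /eqP {}h.
  have e l d : phi (((X l)%:R + (Z l)%:R * dl l) ^+ d) = tofrac (((X l)%:R + (Z l)%:R * dz l) ^+ d).
    by rewrite !rmorphXn /= !rmorphD !rmorphM !rmorph_nat /= hd.
  by transitivity (\prod_j tofrac (((X j)%:R + (Z j)%:R * dz j) ^+ a j)); [|rewrite h]; apply: eq_bigr => j _; rewrite e.
- exists B; split=> //; exists k0 => k hk kl; apply/eqP; rewrite -tinj ev hv // rmorph0 tofrac0 //.
Qed.

Definition other i := idx (vb i) (vj i) (~~ vx i).
Lemma otherK : involutive other.
Proof. by move=> i; rewrite /other vb_idx vj_idx vx_idx negbK idxK. Qed.

(* [te P] and [theta P] substitute the action of the units of times [P], so that evaluating
   [theta P p] at time [k] evaluates [p] at time [k + P]. *)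
Definition cross (P : 'I_m -> nat) i := ((if vx i then 1 else D (vb i)) * py (vb i) (P (vb i)))%N.
Definition te (P : 'I_m -> nat) (e : multinom n) : multinom n :=
  Multinom [tuple px (vb i) (P (vb i)) * e i + cross P i * e (other i) | i < n]%N.

Lemma teE P e i : te P e i = (px (vb i) (P (vb i)) * e i + cross P i * e (other i))%N.
Proof. by rewrite mnmE. Qed.

Lemma prod_te (U : comNzRingType) (w : 'I_n -> U) P e :
  \prod_i w i ^+ te P e i = \prod_i (w i ^+ px (vb i) (P (vb i)) * w (other i) ^+ cross P (other i)) ^+ e i.
Proof.
under eq_bigr do rewrite teE exprD.
rewrite big_split /= [X in _ * X](reindex_inj (inv_inj otherK)) -big_split /=; apply: eq_bigr => i _.
by rewrite otherK exprMn -!exprM.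
Qed.

Lemma zK_shift k P i : zK (tadd k P) i = zK k i ^+ px (vb i) (P (vb i)) * zK k (other i) ^+ cross P (other i).
Proof.
rewrite /zK vj_idx -!exprM -exprD /zexp /cross vb_idx vx_idx /tadd.
have [h1 h2] := pellD (D (vb i)) (X (vb i)) (Z (vb i)) (k (vb i)) (P (vb i)).
by case: (vx i) => /=; rewrite ?h1 ?h2; congr (_ ^+ _); clear; ring.
Qed.

Definition theta P : mpoly n K -> mpoly n K := mmap (mpolyC n (R:=K)) (fun i => mpolyX K (te P (mnm1 i))).

Lemma mpolyX_te P e : mpolyX K (te P e) = \prod_i mpolyX K (te P (mnm1 i)) ^+ e i.
Proof.
have h e' : mpolyX K (te P e') = \prod_i (mpolyX K (mnm1 i) ^+ px (vb i) (P (vb i)) *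
    mpolyX K (mnm1 (other i)) ^+ cross P (other i)) ^+ e' i.
  by rewrite -(prod_te (fun i => mpolyX K (mnm1 i))) -mpolyXE_id.
rewrite h; apply: eq_bigr => i _; rewrite h (bigD1 i) //= mnm1E eqxx expr1 big1 ?mulr1 // => j ji.
by rewrite mnm1E eq_sym (negbTE ji).
Qed.

Lemma thetaE P p : theta P p = \sum_(e <- msupp p) mcoeff e p *: mpolyX K (te P e).
Proof.
rewrite /theta /mmap; apply: eq_bigr => e _; rewrite mul_mpolyC /mmap1 mpolyX_te //.
Qed.

Lemma meval_theta k P p : meval (zK k) (theta P p) = meval (zK (tadd k P)) p.
Proof.
rewrite /theta meval_mmap; congr meval; apply/funext => i; rewrite mevalX prod_te.
rewrite (bigD1 i) //= mnm1E eqxx expr1 -zK_shift big1 ?mulr1 // => j ji.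
by rewrite mnm1E eq_sym (negbTE ji).
Qed.

Context (r : nat) (lb : 'I_r -> 'I_m) (a c : 'I_r -> nat).
Hypothesis aD : forall i, (D (lb i) < a i ^ 2)%N.
Hypothesis acD : forall i, ((a i - c i) ^ 2 < D (lb i))%N.
Hypothesis c0 : forall i, (0 < c i)%N.
Hypothesis cZ : forall i, (c i %| Z (lb i))%N.
Context (N : nat) (zt : 'I_r -> K) (cc : 'I_r -> 'I_s -> nat).
Hypothesis N0 : (0 < N)%N.
Hypothesis ztN : forall i, zt i ^+ N = 1.
Hypothesis unitN : forall l, unit_mod (D l) (X l) (Z l) N 1.
Hypothesis cc_pos : forall i, exists j, (0 < cc i j)%N.
Definition base_value i := zt i * \prod_j be j ^+ cc i j.

(** The unit is congruent to 1 modulo the order of the root of unity, and so are its powers: the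
    roots of unity stay fixed along the orbit and need no variables. *)
Lemma zt_px i k : zt i ^+ px (lb i) k = zt i.
Proof.
have [A [B []]] := unit_mod_mul k (unitN (lb i)); rewrite muln1 => -> _.
by rewrite exprD expr1 exprM ztN expr1n mulr1.
Qed.
Lemma zt_py i k : zt i ^+ py (lb i) k = 1.
Proof.
have [A [B []]] := unit_mod_mul k (unitN (lb i)); rewrite muln1 => _ ->.
by rewrite exprM ztN expr1n.
Qed.

Definition em i t : multinom n :=
  Multinom [tuple if (vb p == lb i) && (vx p == t) then cc i (vj p) else 0%N | p < n].
(** The root of unity enters [y1] only, since the exponents [pelly] carried by [y2] are divisible by
    [N]. *)
Definition y1 i : mpoly n K := zt i *: mpolyX K (em i true).
Definition y2 i : mpoly n K := mpolyX K (em i false).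

Lemma meval_em k i t : meval (zK k) (mpolyX K (em i t)) =
  (\prod_j be j ^+ cc i j) ^+ (if t then px (lb i) (k (lb i)) else py (lb i) (k (lb i))).
Proof.
rewrite mevalX (bigID (fun p => (vb p == lb i) && (vx p == t))) /= [X in _ * X]big1 ?mulr1; last first.
  by move=> p /negbTE h; rewrite mnmE h expr0.
rewrite (reindex_onto (fun j => idx (lb i) j t) vj) /=; last first.
  by move=> p /andP[/eqP <- /eqP <-]; rewrite idxK.
rewrite -prodrXl; apply: eq_big => [j|j _]; first by rewrite vb_idx vx_idx vj_idx !eqxx.
by rewrite mnmE vb_idx vx_idx !eqxx /= /zK vj_idx /zexp vb_idx vx_idx -!exprM mulnC; case: t.
Qed.
Lemma meval_y1 k i : meval (zK k) (y1 i) = base_value i ^+ px (lb i) (k (lb i)).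
Proof. by rewrite /y1 mevalZ meval_em /base_value exprMn zt_px. Qed.
Lemma meval_y2 k i : meval (zK k) (y2 i) = base_value i ^+ py (lb i) (k (lb i)).
Proof. by rewrite /y2 meval_em /base_value exprMn zt_py mul1r. Qed.

Lemma exists_rho : exists rho : R, 0 < rho < 1 /\ forall j, nrm (iota (be j)) <= rho.
Proof.
exists (\big[Order.max/2%:R^-1]_j nrm (iota (be j))); split; last by move=> j; exact: le_bigmax.
apply/andP; split; first by apply: lt_le_trans (bigmax_ge_id _ _ _ _); rewrite invr_gt0.
by rewrite bigmax_lt // invf_lt1 ?ltr1n.
Qed.

Lemma nrm_zt i : nrm (iota (zt i)) = 1.
Proof.
have h : nrm (iota (zt i)) ^+ N = 1 by rewrite -(avX av) -rmorphXn ztN rmorph1 (av1 av).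
by apply/eqP; move/eqP: h; rewrite pexpr_eq1 // (av_ge0 av).
Qed.

Lemma nrm_al rho i : 0 <= rho <= 1 -> (forall j, nrm (iota (be j)) <= rho) -> nrm (iota (base_value i)) <= rho.
Proof.
move=> /andP[r0 r1] h; have [j hj] := cc_pos i; rewrite /base_value rmorphM (avM av) nrm_zt mul1r rmorph_prod (av_prod av).
rewrite (bigD1 j) //= -[leRHS]mulr1; apply: ler_pM; rewrite ?(av_ge0 av) //.
- by apply: prodr_ge0 => k _; rewrite (av_ge0 av).
- rewrite rmorphXn (avX av); case: (cc i j) hj => // q _; rewrite exprS -[leRHS]mulr1.
  by apply: ler_pM; rewrite ?exprn_ge0 ?(av_ge0 av) ?exprn_ile1 ?(av_ge0 av) // ltW.
- apply: prodr_ile1 => k _; rewrite (av_ge0 av) rmorphXn (avX av) exprn_ile1 ?(av_ge0 av) //.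
  exact: le_trans (h k) r1.
Qed.

Lemma al_lt1 i : nrm (iota (base_value i)) < 1.
Proof.
have [rho [/andP[r0 r1] h]] := exists_rho; apply: le_lt_trans (nrm_al i _ h) (r1).
by rewrite (ltW r0) (ltW r1).
Qed.

Lemma al_exp_neq1 i e : (0 < e)%N -> 1 - base_value i ^+ e != 0.
Proof.
move=> e1; rewrite subr_eq0; apply/eqP => h; have := al_lt1 i.
have : nrm (iota (base_value i)) ^+ e < 1 by rewrite exprn_ilt1 ?(av_ge0 av) ?al_lt1 // -lt0n.
by rewrite -(avX av) -rmorphXn -h rmorph1 (av1 av) ltxx.
Qed.

Lemma cone_den_neq0 i x z p q : (0 < p)%N -> (0 < x)%N ->
  cone_den (a i) (D (lb i)) x z (base_value i ^+ p) (base_value i ^+ q) != 0.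
Proof.
move=> p0 x0; rewrite /cone_den -!exprM -!exprD mulf_neq0 // al_exp_neq1 // addn_gt0 ?p0 //.
by rewrite muln_gt0 p0 addn_gt0 x0.
Qed.

(* The difference between the limits of [tauP] at the times [0] and [k]. *)
Definition orbit_value (k : 'I_m -> nat) i : K := let x := px (lb i) (k (lb i)) in let z := py (lb i) (k (lb i)) in
  (* Then this component of the time is zero, the unit acts trivially and the cone is empty. *)
  if z == 0%N then 0 else
    cone_num (a i) (c i) (D (lb i)) x z (base_value i) 1 / cone_den (a i) (D (lb i)) x z (base_value i) 1.

Context (xi : 'I_r -> C).
Hypothesis xi_lim : forall i, tends nrm (fun M => iota (tau (a i) (c i) (D (lb i)) M (base_value i) 1)) (xi i).

Definition tauP M i : mpoly n K := tau (a i) (c i) (D (lb i)) M (y1 i) (y2 i).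
Lemma meval_tauP k M i : meval (zK k) (tauP M i) = tau (a i) (c i) (D (lb i)) M
  (base_value i ^+ px (lb i) (k (lb i))) (base_value i ^+ py (lb i) (k (lb i))).
Proof. by rewrite /tauP (tau_rmorph (meval (zK k))) /= meval_y1 meval_y2. Qed.

Lemma py_dvd l k : (Z l %| py l k)%N.
Proof.
elim: k => // k IH; have [_] := pellD (D l) (X l) (Z l) k 1; rewrite addn1 => ->.
have -> : py l 1 = Z l by rewrite /pelly /=; lia.
by apply: dvdn_add; [exact: dvdn_mull | exact: dvdn_mulr].
Qed.

Lemma py_gt0 l k : (py l k == 0)%N = (k == 0)%N.
Proof.
apply/idP/idP => [/eqP h|/eqP -> //]; have := pelly_geq Pell Z0 l k.
by rewrite h leqn0.
Qed.

(** The truncated [cone_identity] at a point of the orbit, with the truncation sent to infinity: the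
    error has quadratically many terms of exponential decay. *)
Lemma cone_limit i x z p q (t t' : nat -> K) l l' :
  (x ^ 2 = D (lb i) * z ^ 2 + 1)%N -> (0 < z)%N -> (c i %| z)%N -> (0 < p)%N ->
  (forall M, t M = tau (a i) (c i) (D (lb i)) M (base_value i ^+ p) (base_value i ^+ q)) ->
  (forall M, t' M = tau (a i) (c i) (D (lb i)) M ((base_value i ^+ p) ^+ x * (base_value i ^+ q) ^+ (D (lb i) * z)) ((base_value i ^+ p) ^+ z * (base_value i ^+ q) ^+ x)) ->
  tends nrm (fun M => iota (t M)) l -> tends nrm (fun M => iota (t' M)) l' ->
  iota (cone_den (a i) (D (lb i)) x z (base_value i ^+ p) (base_value i ^+ q)) * (l - l') =
  iota (cone_num (a i) (c i) (D (lb i)) x z (base_value i ^+ p) (base_value i ^+ q)).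
Proof.
move=> Pxz z0 cz p0 ht ht' hl hl'; set dd := cone_den _ _ _ _ _ _; set nn := cone_num _ _ _ _ _ _ _.
have h1 := tendsZ av (iota dd) (tendsB av hl hl').
apply: (tends_unique av h1).
have al0 := al_lt1 i.
apply: (tends_bound (r := nrm (iota (base_value i))) (A := 8) (B := coneM (a i) (c i) (D (lb i)) z) (M1 := 1)).
  by rewrite (av_ge0 av).
move=> M M0; have sm := cone_identity (D0 (lb i)) (aD i) (acD i) Pxz z0 (c0 i) cz (base_value i ^+ p) (base_value i ^+ q) M0.
have := small_rmorph iota sm; rewrite -ht -ht' -/dd -/nn rmorphB rmorphM rmorphB => sm'.
apply: (nrm_small av _ _ _ sm'); rewrite ?(ltW al0) //.
  rewrite rmorphXn (avX av); case: (p) p0 => // p' _; rewrite exprS -[leRHS]mulr1.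
  by apply: ler_pM; rewrite ?exprn_ge0 ?(av_ge0 av) ?exprn_ile1 ?(av_ge0 av) // ltW.
by rewrite rmorphXn (avX av) exprn_ile1 ?(av_ge0 av) // ltW.
Qed.

Lemma py_pos l k : (0 < k)%N -> (0 < py l k)%N.
Proof. by rewrite !lt0n py_gt0. Qed.

Lemma lim_tauP k i : tends nrm (fun M => iota (meval (zK k) (tauP M i))) (xi i - iota (orbit_value k i)).
Proof.
rewrite /orbit_value py_gt0; case: eqP => [k0|/eqP k0].
  rewrite rmorph0 subr0; apply: tends_ext (@xi_lim i) => M.
  by rewrite meval_tauP k0 /= expr1 expr0.
set x := px _ _; set z := py _ _.
set dd := cone_den _ _ _ _ _ _; set nn := cone_num _ _ _ _ _ _ _.
have x0 : (0 < x)%N by exact: pellx_gt0 (Pell (lb i)) _.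
have z0 : (0 < z)%N by rewrite lt0n py_gt0.
have cz : (c i %| z)%N by apply: dvdn_trans (cZ i) (py_dvd _ _).
have Pxz : (x ^ 2 = D (lb i) * z ^ 2 + 1)%N by exact: pell_norm.
have dd0 : dd != 0 by have := @cone_den_neq0 i x z 1 0 isT x0; rewrite expr1 expr0.
have al0 := al_lt1 i.
pose t M := tau (a i) (c i) (D (lb i)) M (base_value i) 1.
pose t' M := meval (zK k) (tauP M i).
have h0 : tends nrm (fun M => iota (dd * (t M - t' M))) (iota nn).
  apply: (tends_bound (r := nrm (iota (base_value i))) (A := 8) (B := coneM (a i) (c i) (D (lb i)) z) (M1 := 1)).
    by rewrite (av_ge0 av).
  move=> M M0; have sm := cone_identity (D0 (lb i)) (aD i) (acD i) Pxz z0 (c0 i) cz (base_value i) 1 M0.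
  have := small_rmorph iota sm; rewrite !expr1n !mulr1 -/(t M) /t' meval_tauP -/x -/z -/dd -/nn rmorphB => sm'.
  by apply: (nrm_small av _ _ _ sm'); rewrite ?(ltW al0) // rmorph1 (av1 av).
have := tendsB av (@xi_lim i) (tendsZ av (iota dd^-1) h0).
rewrite -rmorphM [_^-1 * _]mulrC; apply: tends_ext => M.
by rewrite -rmorphM mulKf // -rmorphB /t opprB addrC subrK.
Qed.

Definition DP P i : mpoly n K := let l := lb i in cone_den (a i) (D l) (px l (P l)) (py l (P l)) (y1 i) (y2 i).
Definition NP P i : mpoly n K := let l := lb i in cone_num (a i) (c i) (D l) (px l (P l)) (py l (P l)) (y1 i) (y2 i).

Lemma DP_neq0 P k i : meval (zK k) (DP P i) != 0.
Proof.
rewrite /DP (cone_den_rmorph (meval (zK k))) /= meval_y1 meval_y2; apply: cone_den_neq0; exact: pellx_gt0 (Pell (lb i)) _.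
Qed.

Lemma A_shift P k i : (0 < P (lb i))%N ->
  meval (zK k) (DP P i) * (orbit_value (tadd k P) i - orbit_value k i) = meval (zK k) (NP P i).
Proof.
move=> P0; set l := lb i; set x := px l (P l); set z := py l (P l).
set p := px l (k l); set q := py l (k l).
have [e1 e2] := pellD (D l) (X l) (Z l) (k l) (P l).
have := @cone_limit i x z p q (fun M => meval (zK k) (tauP M i)) (fun M => meval (zK (tadd k P)) (tauP M i)) _ _
  (pell_norm (Pell l) (P l)) (py_pos l P0) (dvdn_trans (cZ i) (py_dvd _ _)) (pellx_gt0 (Pell l) (k l))
  _ _ (lim_tauP k i) (lim_tauP (tadd k P) i).
rewrite /DP /NP (cone_den_rmorph (meval (zK k))) (cone_num_rmorph (meval (zK k))) /= meval_y1 meval_y2 -/l -/p -/q -/x -/z => h.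
apply: (fmorph_inj iota); rewrite -h.
- by rewrite rmorphM; congr (_ * _); rewrite rmorphB; ring.
- by move=> M; exact: meval_tauP.
- move=> M; rewrite meval_tauP -/l /tadd e1 e2 -/p -/q -/x -/z -!exprM -!exprD.
  by congr (tau _ _ _ _ (_ ^+ _) (_ ^+ _)); clear; ring.
Qed.

Lemma A_shift0 P k i : P (lb i) = 0%N -> orbit_value (tadd k P) i = orbit_value k i.
Proof. by move=> P0; rewrite /orbit_value /tadd P0 addn0. Qed.

Definition Zc (F : ('I_m -> nat) -> K) := exists p : mpoly n K, forall k, F k = meval (zK k) p.
Lemma Zc_const y : Zc (fun=> y). Proof. by exists (mpolyC n y) => k; rewrite mevalC. Qed.
Lemma Zc_add F G : Zc F -> Zc G -> Zc (fun k => F k + G k).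
Proof. by move=> [p hp] [q hq]; exists (p + q) => k; rewrite hp hq (raddfD (meval _)). Qed.
Lemma Zc_mul F G : Zc F -> Zc G -> Zc (fun k => F k * G k).
Proof. by move=> [p hp] [q hq]; exists (p * q) => k; rewrite hp hq (rmorphM (meval _)). Qed.
Lemma Zc_shift P F : Zc F -> Zc (fun k => F (tadd k P)).
Proof. by move=> [p hp]; exists (theta P p) => k; rewrite hp meval_theta. Qed.
Lemma Zc_vanish F : Zc F -> vanish St F -> forall k, F k = 0.
Proof.
move=> [p hp]; rewrite (funext hp) => /density -> k; exact: (raddf0 (meval _)).
Qed.

Lemma A_rational P i : exists NN DD, [/\ Zc NN, Zc DD, forall k, DD k != 0 &
  forall k, DD k * (orbit_value (tadd k P) i - orbit_value k i) = NN k].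
Proof.
have [P0|P0] := posnP (P (lb i)).
  exists (fun=> 0), (fun=> 1); split; [exact: Zc_const|exact: Zc_const|by move=> k; rewrite oner_neq0|].
  by move=> k; rewrite A_shift0 // subrr mulr0.
exists (fun k => meval (zK k) (NP P i)), (fun k => meval (zK k) (DP P i)); split.
- by exists (NP P i).
- by exists (DP P i).
- by move=> k; exact: DP_neq0.
- by move=> k; exact: A_shift.
Qed.

Context (i0 : 'I_r).
Definition Idx := {k : 'I_m -> nat | strip (@wt R m D X Z) 1 k /\ forall l, (0 < k l)%N}.
(** The smallest exponent of a [be j] at the orbit point. By [E_comparable] it also bounds the
    largest one up to a constant, hence governs the heights as well. *)
Definition min_exp (k : Idx) : nat :=
  let l := [arg min_(l < lb i0) py l (sval k l)] in py l (sval k l).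

Lemma E_leq k l : (min_exp k <= py l (sval k l))%N.
Proof. by rewrite /min_exp; case: arg_minnP => // j _; exact. Qed.
Lemma E_attained k : exists l, min_exp k = py l (sval k l).
Proof. by rewrite /min_exp; eexists. Qed.
Lemma E_gt0 k : (0 < min_exp k)%N.
Proof. by have [l ->] := E_attained k; apply: py_pos; case: k => k []. Qed.
Lemma E_leqx k l : (min_exp k <= px l (sval k l))%N.
Proof. by apply: leq_trans (E_leq k l) _; exact: pelly_leq Pell D0 l _. Qed.

Lemma E_comparable : exists c1 : nat, (0 < c1)%N /\
  forall k l, (px l (sval k l) <= c1 * min_exp k)%N /\ (py l (sval k l) <= c1 * min_exp k)%N.
Proof.
have [c1 [c10 h]] := @strip_comparable R m D X Z Pell Z0 D0; exists c1; split=> // -[k [k1 k2]] l.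
have [l' ->] := E_attained (exist _ k (conj k1 k2)); have := h k k1 k2 l l' => /= hx; split=> //.
by apply: leq_trans hx; exact: pelly_leq Pell D0 l _.
Qed.

Local Notation zI := (fun k : Idx => zK (sval k)).
Local Notation AI := (fun k : Idx => orbit_value (sval k)).
Local Notation hg := (hgt g0 f min_exp).

Lemma hgt_z i : hg (fun k => zI k i).
Proof.
have [c1 [_ h]] := E_comparable.
apply: (hgt_pow f_root f_gen f_size (be (vj i)) (c := c1)) => k; have [h1 h2] := h k (vb i).
by rewrite /zexp; case: (vx i).
Qed.

Lemma hgt_A i : hg (fun k => AI k i).
Proof.
have [c1 [c10 h]] := E_comparable; set l := lb i.
pose x (k : Idx) := px l (sval k l); pose z (k : Idx) := py l (sval k l).
have z0 k : (0 < z k)%N by apply: leq_trans (E_gt0 k) _; exact: E_leq.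
have x0 k : (0 < x k)%N by apply: leq_trans (E_gt0 k) _; exact: E_leqx.
have cN k : (coneN (a i) (x k) (z k) <= c1 * (1 + a i + a i ^ 2) * min_exp k)%N.
  by have [h1 h2] := h k l; rewrite /coneN -/(x k) -/(z k) in h1 h2 *; clear -h1 h2; nia.
have cM k : (coneM (a i) (c i) (D l) (z k) <= c1 * (1 + a i + a i ^ 2) * min_exp k)%N.
  have [_ h2] := h k l; rewrite -/(z k) in h2.
  apply: (@leq_trans (z k * a i ^ 2)%N).
    by rewrite /coneM leq_mul ?leq_subr // leq_div.
  by clear -h2; nia.
rewrite (_ : (fun k => _) = fun k => (\sum_(j < coneM (a i) (c i) (D l) (z k)) base_value i ^+ ceil (a i) (c i) (D l) (x k) (z k) j.+1) *
    ((1 - base_value i) * (1 - base_value i ^+ coneN (a i) (x k) (z k)))^-1); last first.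
  apply/funext => k; rewrite /orbit_value -/l -/(x k) -/(z k) eqn0Ngt z0 /=; congr (_ * _^-1).
    by apply: eq_bigr => j _; rewrite /term expr1n mulr1.
  by rewrite /cone_den !expr1n !mulr1.
apply: (hgtM f_size E_gt0); last first.
  apply: (hgtV f_root f_gen f_min f_size E_gt0); last first.
    move=> k; rewrite mulf_neq0 ?al_exp_neq1 //; last by rewrite addn_gt0 x0.
    by have := @al_exp_neq1 i 1 isT; rewrite expr1.
  apply: (hgtM f_size E_gt0 (F1 := fun=> 1 - base_value i)); first exact: (hgt_const f_root f_gen f_size E_gt0).
  apply: (hgtB f_root f_gen f_size E_gt0 (F1 := fun=> 1)); first exact: (hgt_const f_root f_gen f_size E_gt0).
  exact: (hgt_pow f_root f_gen f_size (base_value i) cN).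
apply: (hgt_sum_pow f_root f_gen f_size (base_value i) (e := fun k j => ceil (a i) (c i) (D l) (x k) (z k) j.+1) cM) => k j jM.
apply: leq_trans (cN k).
rewrite (leq_ceil (D0 l) (aD i) (acD i) (pell_norm (Pell l) _) (z0 k) (c0 i) (dvdn_trans (cZ i) (py_dvd _ _))).
by rewrite mulnC leq_mul2l jM orbT.
Qed.

Lemma hgt_uniform T (F : Idx -> 'I_T -> K) : (forall i, hg (fun k => F k i)) -> exists G0 : nat, forall G, (G0 <= G)%N ->
  forall k i, exists b, [/\ (0 < b)%N, (b <= G ^ min_exp k)%N & sz g0 f b (G ^ min_exp k) (F k i)].
Proof.
move=> hF; have /choice[g hg'] i : exists g, (0 < g)%N /\ forall k, exists b, [/\ (0 < b)%N, (b <= g ^ min_exp k)%N & sz g0 f b (g ^ min_exp k) (F k i)].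
  by have [g] := hF i; exists g.
exists (\sum_i g i)%N => G hG k i; have [_ /(_ k)[b [b0 bg s']]] := hg' i.
have gG : (g i ^ min_exp k <= G ^ min_exp k)%N by rewrite leq_exp2r ?E_gt0 // (leq_trans _ hG) // (bigD1 i) //= leq_addr.
by exists b; split=> //; [exact: leq_trans gG|exact: sz_leq gG s'].
Qed.

Lemma liouville_rate : exists2 kap : R, 0 < kap & forall d (w : mpoly n (mpoly r K)), boxed d w ->
  exists2 ct : R, 0 < ct & forall k, evalZY zI AI k w = 0 \/ ct * kap ^+ (d * min_exp k) <= nrm (iota (evalZY zI AI k w)).
Proof.
have [G1 h1] := hgt_uniform hgt_z; have [G2 h2] := hgt_uniform hgt_A.
have l1 : (G1 <= (G1 + G2).+1)%N by lia.
have l2 : (G2 <= (G1 + G2).+1)%N by lia.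
exact: (exists_liouville_rate f_root f_gen f_min f_size av iota nrm_int (ltn0Sn _) (ltn0Sn _) (h1 _ l1) (h2 _ l2)).
Qed.

Lemma low_y1 i : low 1 (y1 i).
Proof.
have [j hj] := cc_pos i; apply: lowZX; rewrite mdegE (bigD1 (idx (lb i) j true)) //= addn_gt0.
by rewrite mnmE vb_idx vx_idx vj_idx !eqxx /= hj.
Qed.

Section Rho.
Context (rho : R).
Hypothesis rho01 : 0 < rho < 1.
Hypothesis be_rho : forall j, nrm (iota (be j)) <= rho.

Lemma rho_le1 : 0 <= rho <= 1. Proof. by case/andP: rho01 => h1 h2; rewrite !ltW. Qed.

Lemma nrm_zI k i : nrm (iota (zI k i)) <= rho ^+ min_exp k.
Proof.
have /andP[r0 r1] := rho_le1.
rewrite /zK rmorphXn (avX av); apply: (@le_trans _ _ (nrm (iota (be (vj i))) ^+ min_exp k)).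
  apply: ler_wiXn2l; rewrite ?(av_ge0 av) ?(ltW (be_lt1 _)) // /zexp.
  by case: (vx i); [exact: E_leqx | exact: E_leq].
by apply: lerXn2r; rewrite ?nnegrE ?(av_ge0 av).
Qed.

Lemma tauP_tail M : exists ct : R, 0 <= ct /\ forall k i,
  nrm (xi i - iota (AI k i) - iota (meval (zI k) (tauP M i))) <= ct * rho ^+ (M * min_exp k).
Proof.
have /andP[r0 r1] := rho_le1; have /andP[r0' r1'] := rho01.
exists (M.+1%:R * (1 - rho)^-2); split; first by rewrite mulr_ge0 // invr_ge0 exprn_ge0 // subr_ge0.
move=> k i; apply: (tends_le av (M0 := M) (@lim_tauP (sval k) i)) => M' hM.
rewrite !meval_tauP !tau_rmorph; apply: (tau_tail av (acD i)) => //; first exact: E_gt0.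
- by rewrite r0.
- have ha := nrm_al i rho_le1 be_rho.
  rewrite rmorphXn (avX av); apply: (@le_trans _ _ (nrm (iota (base_value i)) ^+ min_exp k)).
    apply: ler_wiXn2l; rewrite ?(av_ge0 av) ?(ltW (al_lt1 _)) //; exact: E_leqx.
  by apply: lerXn2r; rewrite ?nnegrE ?(av_ge0 av).
- by rewrite rmorphXn (avX av) exprn_ile1 ?(av_ge0 av) // ltW // al_lt1.
Qed.

Lemma vanishing_relation P : P != 0 -> meval xi (map_mpoly iota P) = 0 ->
  exists w : mpoly n (mpoly r K), w != 0 /\ exists E1, forall k, (E1 <= min_exp k)%N -> evalZY zI AI k w = 0.
Proof.
move=> P0 Px; apply: (exists_vanishing_polynomial av rho01 nrm_zI (tau := tauP) _ _ liouville_rate P0 Px).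
- by move=> M i; apply: (low_tau (acD i) _ M (low_y1 i)); rewrite mdeg0.
- by move=> M; have [ct [_ h]] := tauP_tail M; exists ct => k i _; exact: h.
Qed.

End Rho.

(** The order of the variables is exchanged: [w] is regarded as a polynomial in [Y] whose
    coefficients are polynomials in the orbit point, as the descent to linear relations requires. *)
Definition coefw (w : mpoly n (mpoly r K)) (mu : multinom r) : mpoly n K :=
  \sum_(e <- msupp w) mcoeff mu (mcoeff e w) *: mpolyX K e.
Definition evalw (w : mpoly n (mpoly r K)) k : mpoly r K := meval (fun i => mpolyC r (zK k i)) w.

Lemma mcoeff_evalw w k mu : mcoeff mu (evalw w k) = meval (zK k) (coefw w mu).
Proof.
rewrite /evalw mevalE raddf_sum /coefw (raddf_sum (meval _)) /=; apply: eq_bigr => e _.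
rewrite mevalZ mevalX mulrC; under eq_bigr do rewrite -rmorphXn.
by rewrite -(rmorph_prod (mpolyC r (R:=K))) mul_mpolyC mcoeffZ mulrC.
Qed.

Lemma meval_evalw w k : meval (orbit_value k) (evalw w k) = evalZY zK orbit_value k w.
Proof.
rewrite /evalw (meval_rmorph (meval (orbit_value k))) /evalZY; congr meval.
by apply/funext => i; exact: mevalC.
Qed.

Lemma coefw_neq0 w : w != 0 -> exists mu, coefw w mu != 0.
Proof.
move=> w0; have [e he] : exists e, mcoeff e w != 0.
  by exists (mlead w); rewrite mleadc_eq0.
pose mu := mlead (mcoeff e w); have hmu : mcoeff mu (mcoeff e w) != 0 by rewrite mleadc_eq0.
have he' : e \in msupp w by move: he; rewrite mcoeff_eq0 negbK.
exists mu; apply: contra_neq hmu => h.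
have := congr1 (mcoeff e) h; rewrite mcoeff0 /coefw raddf_sum /= (bigD1_seq e) ?msupp_uniq //=.
rewrite mcoeffZ mcoeffX eqxx mulr1 big1 ?addr0 // => e' ne.
by rewrite mcoeffZ mcoeffX (negbTE ne) mulr0.
Qed.

Lemma size_evalw w : exists d, forall k, (mmeasure mdeg (evalw w k) <= d)%N.
Proof.
exists (\max_(e <- msupp w) mmeasure mdeg (mcoeff e w)) => k.
rewrite leqNgt; apply/negP => h.
have p0 : evalw w k != 0 by apply/eqP => h0; move: h; rewrite h0 mmeasure0.
have : mcoeff (mlead (evalw w k)) (evalw w k) != 0 by rewrite mleadc_eq0.
rewrite mcoeff_evalw /coefw big_seq big1 ?(raddf0 (meval _)) ?eqxx // => e he.
have : (mmeasure mdeg (mcoeff e w) <= mdeg (mlead (evalw w k)))%N.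
  rewrite -ltnS mlead_deg //; apply: leq_ltn_trans h.
  exact: (@leq_bigmax_seq _ (msupp w) xpredT (fun e => mmeasure mdeg (mcoeff e w))).
by move/msize_mdeg_ge; rewrite -mcoeff_eq0 => /eqP ->; rewrite scale0r.
Qed.

Lemma linear_relation P : P != 0 -> meval xi (map_mpoly iota P) = 0 ->
  exists ci : 'I_r -> K, (exists i, ci i != 0) /\ exists q p : mpoly n K, q != 0 /\
  exists B : R, 0 < B /\ exists k0, forall k, St B k -> later k0 k ->
    meval (zK k) q * \sum_i ci i * orbit_value k i = meval (zK k) p.
Proof.
move=> P0 Px; have [rho [rho01 hrho]] := exists_rho.
have [w [w0 [E1 hw]]] := vanishing_relation rho01 hrho P0 Px.
have [d hd] := size_evalw w.
have charN j : j.+1%:R != 0 :> K.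
  by apply/eqP; rewrite -[_%:R]/((j.+1)%:Z%:~R) => /charK.
have hF : exists k, evalw w k != 0.
  have [mu hmu] := coefw_neq0 w0; apply: contrapT => h; move/eqP: hmu; apply.
  apply: density; exists 1; split=> //; exists (fun=> 0%N) => k _ _; rewrite -mcoeff_evalw.
  have [->|h'] := eqVneq (evalw w k) 0; first by rewrite mcoeff0.
  by exfalso; apply: h; exists k.
have hv : vanish St (fun k => meval (orbit_value k) (evalw w k)).
  exists 1; split=> //; exists (fun=> E1.+1) => k hk kl; rewrite meval_evalw.
  have kpos l : (0 < k l)%N by apply: leq_trans (kl l).
  apply: (hw (exist _ k (conj hk kpos))); have [l ->] := E_attained (exist _ k (conj hk kpos)).
  by apply: leq_trans (pelly_geq Pell Z0 l _); apply: leq_trans (kl l); exact: leqnSn.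
have hc : coefZ Zc (evalw w) by move=> mu; exists (coefw w mu) => k; exact: mcoeff_evalw.
have [ci [ci0 [q [p [[qq hq] [pp hp] [k1 qk1] [B [B0 [k0 h]]]]]]]] :=
  linear_relation_of_algebraic charN (@strip_mono R m _)
    (fun B k0 P h1 h2 => strip_sub h1 h2) (@strip_add R m _) Zc_const Zc_add Zc_mul Zc_shift Zc_vanish A_rational hc hd hF hv.
exists ci; split=> //; exists qq, pp; split.
  by apply: contra_neq qk1; rewrite hq => ->; exact: (raddf0 (meval _)).
by exists B; split=> //; exists k0 => k h1 h2; rewrite -hq -hp; exact: h.
Qed.

Lemma meval_inj p q : (forall k, meval (zK k) p = meval (zK k) q) -> p = q.
Proof.
move=> h; apply/eqP; rewrite -subr_eq0; apply/eqP; apply: density; exists 1; split=> //.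
by exists (fun=> 0%N) => k _ _; rewrite (raddfB (meval _)) /= h subrr.
Qed.

Lemma thetaB P p q : theta P (p - q) = theta P p - theta P q.
Proof. by rewrite /theta (raddfB (mmap _ _)). Qed.
Lemma thetaZ P t p : theta P (t *: p) = t *: theta P p.
Proof. by rewrite /theta mmapZ mul_mpolyC. Qed.

Section Proportional.
Context (ci : 'I_r -> K) (q p : mpoly n K) (B : R) (k0 : 'I_m -> nat) (P : 'I_m -> nat).
Hypothesis q0 : q != 0.
Hypothesis B0 : 0 < B.
Hypothesis rel : forall k, St B k -> later k0 k -> meval (zK k) q * \sum_i ci i * orbit_value k i = meval (zK k) p.
Hypothesis StP : St (B / 2%:R) P.
Hypothesis P0 : forall l, (0 < P l)%N.

Definition Sm M := \sum_i ci i *: tauP M i.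
(** Along the orbit [orbit_value k i] is [xi i] minus the limit of [tauP M i]. The relation
    therefore says that the constant [\sum_i ci i * xi i] times [q] equals [p] plus [q] times the
    combined series; [Vm] is the truncation of the latter. *)
Definition Vm M := p + q * Sm M.
Definition Ri i := \prod_(j | j != i) DP P j.

Lemma prod_DP i : \prod_j DP P j = Ri i * DP P i.
Proof. by rewrite (bigD1 i) //= mulrC. Qed.

(** The relations at [k] and [k + P] are cross-multiplied and subtracted. The increments of the
    orbit values are rational in the orbit point, so density turns the outcome into an identity of
    polynomials. *)
Lemma relation_identity : \prod_j DP P j * (q * theta P p - theta P q * p) =
  q * theta P q * \sum_i ci i *: (Ri i * NP P i).
Proof.
apply/eqP; rewrite -subr_eq0; apply/eqP; apply: density; exists (B / 2%:R); split; first exact: divr_gt0.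
exists k0 => k hk kl; pose ev : mpoly n K -> K := meval (zK k).
have hkP : St B (tadd k P).
  by have := strip_add hk StP; apply: strip_mono; lra.
have hk' : St B k by apply: strip_mono hk; rewrite ler_pdivrMr ?ltr0n // ler_pMr // ler1n.
have klP : later k0 (tadd k P) by move=> l; apply: leq_trans (kl l) (leq_addr _ _).
have r1 := rel hk' kl; have r2 := rel hkP klP.
rewrite (raddfB (meval _)) /= !(rmorphM (meval _)) (raddfB (meval _)) /= !(rmorphM (meval _)) /= !meval_theta -r1 -r2.
rewrite (raddf_sum (meval _)) /=.
set qk := meval _ q; set qkP := meval _ q.
have -> : \sum_i meval (zK k) (ci i *: (Ri i * NP P i)) =
   meval (zK k) (\prod_j DP P j) * \sum_i ci i * (orbit_value (tadd k P) i - orbit_value k i).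
  rewrite mulr_sumr; apply: eq_bigr => i _.
  have e1 : meval (zK k) (Ri i * NP P i) = meval (zK k) (Ri i) * (meval (zK k) (DP P i) * (orbit_value (tadd k P) i - orbit_value k i)).
    by rewrite A_shift // (rmorphM (meval _)).
  have e2 : meval (zK k) (\prod_j DP P j) = meval (zK k) (Ri i) * meval (zK k) (DP P i).
    by rewrite (prod_DP i) (rmorphM (meval _)).
  rewrite mevalZ e1 e2; ring.
have -> : \sum_i ci i * (orbit_value (tadd k P) i - orbit_value k i) = \sum_i ci i * orbit_value (tadd k P) i - \sum_i ci i * orbit_value k i.
  by rewrite -sumrB; apply: eq_bigr => i _; rewrite mulrBr.
ring.
Qed.

Lemma theta_tauP M i : theta P (tauP M i) = let l := lb i in let x := px l (P l) in let z := py l (P l) in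
  tau (a i) (c i) (D l) M (y1 i ^+ x * y2 i ^+ (D l * z)) (y1 i ^+ z * y2 i ^+ x).
Proof.
apply: meval_inj => k; rewrite meval_theta meval_tauP /= (tau_rmorph (meval (zK k))) /= !(rmorphM (meval _)) /= !rmorphXn /=.
rewrite meval_y1 meval_y2 -!exprM -!exprD /tadd.
have [-> ->] := pellD (D (lb i)) (X (lb i)) (Z (lb i)) (k (lb i)) (P (lb i)).
by congr (tau _ _ _ _ (_ ^+ _) (_ ^+ _)); clear; ring.
Qed.

Definition hm M i := DP P i * (tauP M i - theta P (tauP M i)) - NP P i.
Lemma low_hm M i : (0 < M)%N -> low M (hm M i).
Proof.
move=> M0; rewrite /hm theta_tauP.
have := cone_identity (D0 (lb i)) (aD i) (acD i) (pell_norm (Pell (lb i)) (P (lb i))) (py_pos (lb i) (P0 _)) (c0 i)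
  (dvdn_trans (cZ i) (py_dvd _ _)) (y1 i) (y2 i) M0.
by move=> h; exact: (low_small (low_y1 i) h).
Qed.

(** The quotient of the series by [q] is formally invariant under [theta P]: the defect of [p],
    given by [relation_identity], cancels the defect of the series, given by [cone_identity]. The
    product of the denominators has constant term 1 and can be divided out. *)
Lemma low_Vm M e : (mdeg e < M)%N -> mcoeff e (q * theta P (Vm M) - theta P q * Vm M) = 0.
Proof.
move=> eM; have M0 : (0 < M)%N by apply: leq_ltn_trans eM.
have E1 : \prod_j DP P j * (q * theta P (Vm M) - theta P q * Vm M) =
    - (q * theta P q * \sum_i ci i *: (Ri i * hm M i)).
  have -> : theta P (Vm M) = theta P p + theta P q * theta P (Sm M).
    by rewrite /Vm /theta (raddfD (mmap _ _)) /= (rmorphM (mmap _ _)).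
  have -> : theta P (Sm M) = \sum_i ci i *: theta P (tauP M i).
    rewrite /Sm /theta (raddf_sum (mmap _ _)) /=; apply: eq_bigr => i _; exact: thetaZ.
  rewrite /Vm /Sm.
  set S1 := \sum_i ci i *: tauP M i; set S2 := \sum_i ci i *: theta P (tauP M i).
  have -> : q * (theta P p + theta P q * S2) - theta P q * (p + q * S1) =
    (q * theta P p - theta P q * p) + q * theta P q * (S2 - S1) by ring.
  rewrite mulrDr relation_identity mulrCA -mulrDr -mulrN; congr (_ * _).
  rewrite /S1 /S2 -sumrB mulr_sumr -big_split /= -sumrN; apply: eq_bigr => i _.
  rewrite (prod_DP i) -scalerBr -scalerAr -scalerDr -scalerN; congr (_ *: _).
  rewrite /hm; ring.
have c1 : mcoeff mnm0 (\prod_j DP P j) != 0.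
  rewrite -meval0_mcoeff (rmorph_prod (meval _)) /=; apply/prodf_neq0 => i _.
  rewrite /DP (cone_den_rmorph (meval _)) /= meval0_mcoeff (low_y1 i) ?mdeg0 // /cone_den mul0r subr0 mul1r.
  by rewrite expr0n eqn0Ngt /coneN addn_gt0 (pellx_gt0 (Pell _)) /= mul0r subr0 oner_neq0.
apply: (low_coeff_factor c1 _ eM) => e' he'; rewrite E1.
apply: (lowN _ he'); apply: lowMr; apply: low_sum => i _.
by rewrite -mul_mpolyC; apply: lowMr; apply: lowMr; exact: low_hm.
Qed.

Lemma low_Vm_sub M M' : (M <= M')%N -> low M (Vm M' - Vm M).
Proof.
move=> hM; have -> : Vm M' - Vm M = q * \sum_i ci i *: (tauP M' i - tauP M i).
  rewrite /Vm /Sm; under [X in _ = _ * X]eq_bigr do rewrite scalerBr; rewrite sumrB; ring.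
apply: lowMr; apply: low_sum => i _; rewrite -mul_mpolyC; apply: lowMr.
by apply: (low_tau_sub (acD i)) => //; exact: low_y1.
Qed.

(** If [D l] were a square, the Pell equation would give two positive squares that differ by 1. *)
Lemma D_nonsquare l (x y : nat) : (x ^ 2 * D l = y ^ 2)%N -> x = 0%N.
Proof.
move=> h; apply/eqP; rewrite -leqn0 leqNgt; apply/negP => x0.
have /dvdnP[t ty] : (x %| y)%N by rewrite -(@dvdn_pexp2r x y 2) // -h dvdn_mulr.
have Dt : D l = (t ^ 2)%N.
  by apply/eqP; rewrite -(@eqn_pmul2l (x ^ 2)) ?expn_gt0 ?x0 // h ty expnMn mulnC.
have s0 : (0 < t * Z l)%N by rewrite muln_gt0 Z0 andbT; have := D0 l; rewrite Dt; case: (t).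
have e1 : (X l ^ 2 = (t * Z l) ^ 2 + 1)%N by rewrite (Pell l) Dt expnMn.
have : (t * Z l < X l)%N by rewrite -ltn_sqr e1 addn1.
move: s0 e1; move: (t * Z l)%N (X l) => s' x'; clear; nia.
Qed.

(** The eigenforms of [te P] on exponents: [te P] multiplies the two sorts like a unit, so this form
    is multiplied by a power of [eps]. Irrationality of the root makes the forms separate
    exponents. *)
Definition rr (t : 'I_m * 'I_s) (e : multinom n) : R :=
  (e (idx t.1 t.2 true))%:R * @rt R m D t.1 + (e (idx t.1 t.2 false))%:R.

Lemma rt_inj l (x y x' y' : nat) : x%:R * @rt R m D l + y%:R = x'%:R * @rt R m D l + y'%:R -> x = x' /\ y = y'.
Proof.
move=> h; suff xx : x = x' by split=> //; move: h; rewrite xx => /addrI /eqP; rewrite eqr_nat => /eqP.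
have h2 : (x%:R - x'%:R) * @rt R m D l = y'%:R - y%:R :> R by move: h; lra.
have h3 : (x%:R - x'%:R) ^+ 2 * (D l)%:R = (y'%:R - y%:R) ^+ 2 :> R by rewrite -h2 exprMn rt_sq.
wlog le : x x' y y' {h h2} h3 / (x' <= x)%N.
  by move=> W; case: (leqP x' x) => [|/ltnW] le; [exact: (W x x' y y') | apply/esym; apply: (W x' x y' y) => //; rewrite -sqrrN opprB h3 -sqrrN opprB].
have h4 : ((x - x') ^ 2 * D l = (`|y'%:Z - y%:Z|%N) ^ 2)%N.
  apply/eqP; rewrite -(eqr_nat R) natrM !natrX natrB // h3 natr_absz.
  by rewrite -rmorphXn /= -normrX ger0_norm ?sqr_ge0 // rmorphXn rmorphB.
have := D_nonsquare h4; move: le; clear; lia.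
Qed.

Lemma mem_In (T : eqType) (t : T) (ts : seq T) : t \in ts -> List.In t ts.
Proof. by elim: ts => // t' ts IH; rewrite inE => /orP[/eqP ->|/IH]; [left | right]. Qed.

Lemma rr_inj (e f' : multinom n) : (forall t, rr t e = rr t f') -> e = f'.
Proof.
move=> h; apply/mnmP => i; have [h1 h2] := rt_inj (h (vb i, vj i)).
by rewrite -(idxK i); case: (vx i).
Qed.

(** The values below a given one involve finitely many pairs of exponents only, because both
    coefficients of the form are at least 1. *)
Lemma rr_min t (S : multinom n -> Prop) : (exists e, S e) -> exists e, S e /\ forall f', S f' -> rr t e <= rr t f'.
Proof.
move=> [e1 Se1]; pose b := (Num.truncn (rr t e1)).+1.
have bound f' : rr t f' <= rr t e1 -> (f' (idx t.1 t.2 true) < b)%N /\ (f' (idx t.1 t.2 false) < b)%N.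
  move=> h; have hb : rr t e1 < b%:R by rewrite truncnS_gt.
  have r1 := @rt_ge1 R m D D0 t.1.
  have n1 := ler0n R (f' (idx t.1 t.2 true)); have n2 := ler0n R (f' (idx t.1 t.2 false)).
  by split; rewrite -(ltr_nat R); apply: le_lt_trans hb; apply: le_trans h; rewrite /rr; nra.
have [b1 b2] := bound e1 (lexx _).
pose Q (x : 'I_b * 'I_b) := `[< exists e, [/\ S e, e (idx t.1 t.2 true) = x.1 & e (idx t.1 t.2 false) = x.2] >].
have Q1 : Q (Ordinal b1, Ordinal b2) by apply/asboolP; exists e1.
case: (@arg_minP _ R _ (Ordinal b1, Ordinal b2) Q (fun x => x.1%:R * @rt R m D t.1 + x.2%:R) Q1).
move=> [x1 x2] /asboolP[e [Se ex1 ex2]] hmin; exists e; split=> // f' Sf'.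
have [h|/ltW h] := leP (rr t f') (rr t e1).
  have [c1 c2] := bound f' h; have := hmin (Ordinal c1, Ordinal c2).
  by rewrite /rr ex1 ex2 /=; apply; apply/asboolP; exists f'.
by apply: le_trans h; have := hmin _ Q1; rewrite /rr ex1 ex2.
Qed.

Lemma rr_te t e : rr t (te P e) = @eps R m D X Z t.1 ^+ P t.1 * rr t e.
Proof.
rewrite eps_pow /rr !teE /other /cross !(vb_idx, vx_idx, vj_idx) /= mul1n.
rewrite !natrD !natrM -[(D t.1)%:R](@rt_sq R m D); ring.
Qed.

Lemma te_inj : injective (te P).
Proof.
move=> e f' h; apply: rr_inj => t.
have ep : 0 < @eps R m D X Z t.1 ^+ P t.1 by rewrite exprn_gt0 // (lt_trans ltr01) // eps_gt1.
have /mulfI := lt0r_neq0 ep; apply; by rewrite -!rr_te h.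
Qed.

Lemma Vm_proportional : exists L, forall M, low M (Vm M - L *: q).
Proof.
pose v' (e : multinom n) := mcoeff e (Vm (mdeg e).+1).
have hV M e : (mdeg e < M)%N -> mcoeff e (Vm M) = v' e.
  move=> h; have := @low_Vm_sub (mdeg e).+1 M h e (ltnSn _); rewrite mcoeffB => /eqP; rewrite subr_eq0 => /eqP //.
have [L hL] : exists L, forall e, v' e = L * mcoeff e q.
  apply: (@proportional K R n _ (enum {: 'I_m * 'I_s}) rr (fun t => @eps R m D X Z t.1 ^+ P t.1) (te P)
    _ rr_te _ rr_min _ _ (theta P) _ _ q v' Vm q0 hV low_Vm (thetaB P) (thetaZ P)).
  - by move=> t e f'; rewrite /rr !mnmDE !natrD; ring.
  - by move=> t; rewrite exprn_egt1 ?eps_gt1 // -lt0n.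
  - by move=> e f' h; apply: rr_inj => t; apply: h; apply: mem_In; rewrite mem_enum.
  - move=> e; rewrite !mdegE; apply: leq_sum => i _; rewrite teE.
    by apply: leq_trans (leq_addr _ _); apply: leq_pmull; exact: pellx_gt0 (Pell _) _.
  - move=> p' e; rewrite thetaE raddf_sum /=.
    have [he|he] := boolP (e \in msupp p').
      rewrite (bigD1_seq e) ?msupp_uniq //= mcoeffZ mcoeffX eqxx mulr1 big1 ?addr0 // => e' ne.
      by rewrite mcoeffZ mcoeffX (inj_eq te_inj) (negbTE ne) mulr0.
    rewrite (memN_msupp_eq0 he) big_seq big1 // => e' he'; rewrite mcoeffZ mcoeffX (inj_eq te_inj).
    by case: eqP he he' => [-> /negP|]; rewrite ?mulr0.
  - move=> p' g; rewrite thetaE raddf_sum /= => h; apply: contrapT => hn; move/eqP: h; apply.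
    apply: big1 => e _; rewrite mcoeffZ mcoeffX; case: eqP => [eg|_]; last by rewrite mulr0.
    by exfalso; apply: hn; exists e.
by exists L => M e he; rewrite mcoeffB mcoeffZ hV // hL subrr.
Qed.

(** The product of [q (z k)] and the difference of the two sides is a sum of tails of the series and
    of the value of [Vm M - L *: q], both at most a constant times [rho ^+ (M * min_exp k)]. The
    Liouville inequality bounds [q (z k)] from below at a smaller rate once [M] is large, so the
    difference is zero. *)
Lemma value_of_combination : exists L, \sum_i iota (ci i) * xi i = iota L.
Proof.
have [L hL] := Vm_proportional; exists L.
have [rho [rho01 hrho]] := exists_rho; have /andP[r0 r1] := rho01.
have [kap kap0 hliou] := liouville_rate.
pose w : mpoly n (mpoly r K) := map_mpoly (@mpolyC r K) q.
have ev k : evalZY zI AI k w = meval (zI k) q.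
  rewrite /evalZY; congr meval; by apply/mpolyP => e; rewrite /w !mcoeff_map_mpoly /= mevalC.
have bw : boxed (msize q).+1 w.
  move=> e mu; rewrite mcoeff_map_mpoly mcoeffC; have [->|_] := eqVneq mu mnm0; last by rewrite mulr0 eqxx.
  rewrite mulr1 => he; split=> i; last by rewrite mnm0E.
  have : (mdeg e < msize q)%N by apply: msize_mdeg_lt; move: he; rewrite mcoeff_eq0 negbK.
  by move=> h; apply: ltnW; rewrite ltnS; apply: leq_trans h; rewrite ltnS mdegE (bigD1 i) //= leq_addr.
have [d [ct ct0 hct]] : exists d, exists2 ct : R, 0 < ct & forall k, meval (zI k) q = 0 \/ ct * kap ^+ (d * min_exp k) <= nrm (iota (meval (zI k) q)).
  by exists (msize q).+1; have [ct ct0 h] := hliou _ _ bw; exists ct => // k; have := h k; rewrite ev.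
have kd0 : 0 < kap ^+ d / 2%:R by rewrite divr_gt0 // exprn_gt0.
have [M hM] : exists M, rho ^+ M <= kap ^+ d / 2%:R.
  have r01 : 0 <= rho < 1 by rewrite (ltW r0).
  by have [M h] := expr_to0 r01 kd0; exists M; apply: h.
have [cT [cT0 hT]] := tauP_tail rho01 hrho M.
pose S := \sum_i iota (ci i) * xi i; pose Del := nrm (S - iota L).
pose C1 := L1 nrm (map_mpoly iota q) * \sum_i nrm (iota (ci i)) * cT + L1 nrm (map_mpoly iota (Vm M - L *: q)).
have C10 : 0 <= C1.
  rewrite addr_ge0 ?mulr_ge0 ?L1_ge0 //.
  by apply: sumr_ge0 => i _; rewrite mulr_ge0 // (av_ge0 av).
have upper k : St B (sval k) -> later k0 (sval k) -> nrm (iota (meval (zI k) q)) * Del <= C1 * (rho ^+ M) ^+ min_exp k.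
  move=> hk kl; have hr := rel hk kl.
  have rE : 0 <= rho ^+ min_exp k <= 1 by rewrite exprn_ge0 ?(ltW r0) ?exprn_ile1 ?(ltW r0) ?(ltW r1).
  have zb i : nrm (iota (zI k i)) <= rho ^+ min_exp k by exact: nrm_zI.
  rewrite /Del -(avM av).
  have -> : iota (meval (zI k) q) * (S - iota L) =
     iota (meval (zI k) q) * (\sum_i iota (ci i) * (xi i - iota (AI k i) - iota (meval (zI k) (tauP M i)))) +
     iota (meval (zI k) (Vm M - L *: q)).
    rewrite (raddfB (meval _)) /= /Vm (raddfD (meval _)) /= (rmorphM (meval _)) /= mevalZ -hr.
    rewrite /Sm (raddf_sum (meval _)) /=.
    have -> : \sum_i meval (zI k) (ci i *: tauP M i) = \sum_i ci i * meval (zI k) (tauP M i).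
      by apply: eq_bigr => i _; rewrite mevalZ.
    rewrite !(rmorphB, rmorphD, rmorphM) !rmorph_sum /=.
    have -> : \sum_i iota (ci i) * (xi i - iota (AI k i) - iota (meval (zI k) (tauP M i))) =
      S - \sum_i iota (ci i * AI k i) - \sum_i iota (ci i * meval (zI k) (tauP M i)).
      by rewrite /S -!sumrB; apply: eq_bigr => i _; rewrite !rmorphM; ring.
    ring.
  rewrite -exprM; apply: le_trans (avD av _ _) _; rewrite /C1 mulrDl; apply: lerD.
    rewrite (avM av) -mulrA; apply: ler_pM; rewrite ?(av_ge0 av) //.
      rewrite meval_rmorph; apply: le_trans (meval_small av (t := 1) (M := 0) _ _ _) _; rewrite ?lexx ?ler01 //.
        by move=> i; apply: le_trans (zb i) _; case/andP: rE.
      by rewrite expr1n mulr1.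
    apply: le_trans (av_sum av _ _ _) _; rewrite mulr_suml; apply: ler_sum => i _; rewrite (avM av) -mulrA.
    by apply: ler_wpM2l; rewrite ?(av_ge0 av).
  rewrite meval_rmorph mulnC exprM; apply: (meval_small av rE zb) => mu hmu.
  by rewrite mcoeff_map_mpoly /= (hL M mu hmu) rmorph0.
have [D0'|Dn0] := eqVneq Del 0.
  by apply/eqP; rewrite -subr_eq0 -(av_eq0 av); apply/eqP.
have Dp : 0 < Del by rewrite lt_neqAle eq_sym Dn0 (av_ge0 av).
exfalso.
pose E1 := (Num.truncn (C1 / (ct * Del))).+1.
(* Density supplies arbitrarily late times in the strip at which [q] does not vanish. *)
have [k [hk1 hkB hkl hk0 hkq]] : exists k, [/\ St 1 k, St B k, later k0 k, forall l, (E1.+1 <= k l)%N & meval (zK k) q != 0].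
  apply: contrapT => hn; move/eqP: q0; apply; apply: density; exists (Num.min 1 B); split; first by rewrite lt_min ltr01.
  exists (fun l => k0 l + E1.+1)%N => k hk kl; apply/eqP/negPn/negP => hq; apply: hn; exists k; split=> //.
  - by apply: strip_mono hk; rewrite ge_min lexx.
  - by apply: strip_mono hk; rewrite ge_min lexx orbT.
  - by move=> l; apply: leq_trans (kl l); exact: leq_addr.
  - by move=> l; apply: leq_trans (kl l); exact: leq_addl.
have kpos l : (0 < k l)%N by apply: leq_trans (hk0 l).
pose kk : Idx := exist _ k (conj hk1 kpos).
have Ek : (E1 <= min_exp kk)%N.
  have [l ->] := E_attained kk; apply: leq_trans (pelly_geq Pell Z0 l _).
  by apply: leq_trans (hk0 l); exact: leqnSn.
have := upper kk hkB hkl; rewrite /= => up.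
have [h0|low'] := hct kk; first by move: hkq; rewrite h0 eqxx.
have h4 : ct * Del * (kap ^+ d) ^+ min_exp kk <= C1 * (kap ^+ d / 2%:R) ^+ min_exp kk.
  apply: (@le_trans _ _ (C1 * (rho ^+ M) ^+ min_exp kk)); last first.
    apply: ler_wpM2l => //; apply: lerXn2r; rewrite ?nnegrE ?exprn_ge0 ?(ltW r0) ?(ltW kd0) //.
  apply: le_trans up; rewrite mulrAC -exprM; apply: ler_wpM2r => //; exact: ltW.
have h5 : 2%:R ^+ min_exp kk <= C1 / (ct * Del).
  have p1 : 0 < (kap ^+ d) ^+ min_exp kk by rewrite !exprn_gt0.
  rewrite ler_pdivlMr ?mulr_gt0 // mulrC -(ler_pM2r p1) mulrAC.
  have p2 : 0 < 2%:R ^+ min_exp kk :> R by rewrite exprn_gt0.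
  by move: h4; rewrite expr_div_n mulrA ler_pdivlMr.
have h6 : (min_exp kk)%:R <= C1 / (ct * Del).
  by apply: le_trans h5; rewrite -natrX ler_nat; apply: ltnW; exact: ltn_expl.
have := truncnS_gt (C1 / (ct * Del)); rewrite ltNge => /negP; apply.
by apply: le_trans h6; rewrite ler_nat.
Qed.
End Proportional.

Theorem core P : P != 0 -> meval xi (map_mpoly iota P) = 0 ->
  exists (ci : 'I_r -> K) (L : K), (exists i, ci i != 0) /\ \sum_i iota (ci i) * xi i = iota L.
Proof.
move=> P0 Px; have [ci [ci0 [q [p [q0 [B [B0 [k0 h]]]]]]]] := linear_relation P0 Px.
have [T [hT T0]] := strip_far (@wt_gt0 R m D X Z Pell Z0 D0) 1 (divr_gt0 B0 (ltr0n R 2)).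
have [L hL] := value_of_combination q0 B0 h hT T0.
by exists ci, L.
Qed.
End Core.

(** * Existence of solutions of the Pell equation *)

Definition nonsquare (d : nat) := forall x y : nat, (x ^ 2 * d = y ^ 2)%N -> x = 0%N.

Section Pell.
Context (R : realType) (D : nat).
Hypothesis D_ns : nonsquare D.
Local Notation w := (Num.sqrt D%:R : R).

Lemma ns_gt0 : (0 < D)%N.
Proof. by rewrite lt0n; apply/eqP => h; have := @D_ns 1 0; rewrite h => /(_ erefl). Qed.
Lemma w_ge1 : 1 <= w. Proof. by rewrite -[leLHS]sqrtr1 ler_wsqrtr // ler1n ns_gt0. Qed.
Lemma w_sq : w ^+ 2 = D%:R. Proof. by rewrite sqr_sqrtr. Qed.

Lemma dirichlet Q : (0 < Q)%N -> exists x y : nat, (0 < y)%N /\ (y <= Q)%N /\ `|x%:R - y%:R * w| < Q%:R^-1.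
Proof.
move=> Q0; have Qr : 0 < Q%:R :> R by rewrite ltr0n.
pose fl (j : nat) := Num.truncn (j%:R * w).
pose fr (j : nat) : R := j%:R * w - (fl j)%:R.
have w0 : 0 <= w by rewrite sqrtr_ge0.
have fr0 j : 0 <= fr j by rewrite subr_ge0 truncn_le // mulr_ge0.
have fr1 j : fr j < 1 by rewrite ltrBlDr nat1r; exact: truncnS_gt.
have hb (j : 'I_Q.+1) : (Num.truncn (Q%:R * fr j) < Q)%N.
  rewrite truncn_lt_nat ?mulr_ge0 //. rewrite -[ltRHS]mulr1 ltr_pM2l //.
have [j [j' [jj' e]]] : exists j j' : 'I_Q.+1, (j < j')%N /\ Ordinal (hb j) = Ordinal (hb j').
  apply: contrapT => hn.
  have inj : injective (fun j => Ordinal (hb j)).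
    move=> j j' e; apply/val_inj => /=; case: (ltngtP j j') => // h; exfalso; apply: hn; first by exists j, j'.
    by exists j', j.
  by have := leq_card _ inj; rewrite !card_ord ltnn.
have fle : (fl j <= fl j')%N.
  by apply: le_truncn; apply: ler_wpM2r => //; rewrite ler_nat ltnW.
exists (fl j' - fl j)%N, (j' - j)%N; rewrite subn_gt0; split=> //; split.
  by have := ltn_ord j'; rewrite ltnS => h; apply: leq_trans (leq_subr _ _) h.
have {}e : Num.truncn (Q%:R * fr j) = Num.truncn (Q%:R * fr j') by case: e.
have h1 := truncnS_gt (Q%:R * fr j); have h2 := truncnS_gt (Q%:R * fr j').
have h3 : (Num.truncn (Q%:R * fr j))%:R <= Q%:R * fr j by rewrite truncn_le ?mulr_ge0.
have h4 : (Num.truncn (Q%:R * fr j'))%:R <= Q%:R * fr j' by rewrite truncn_le ?mulr_ge0.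
rewrite -[ltRHS]mul1r ltr_pdivlMr // mulrC -[X in X * _](ger0_norm (ltW Qr)) -normrM.
have -> : (fl j' - fl j)%:R - (j' - j)%:R * w = fr j - fr j'.
  by rewrite /fr !natrB ?(ltnW jj') //; ring.
rewrite mulrBr ltr_norml; move: h1 h2 h3 h4; rewrite e -natr1; move: (Q%:R * _) (Q%:R * _) => u v; lra.
Qed.

Lemma dvdz_of_mod (k : int) (x y : nat) : (x %% `|k| = y %% `|k|)%N -> (k %| x%:Z - y%:Z)%Z.
Proof. by move=> h; rewrite -eqz_mod_dvd -(modz_abs x) -(modz_abs y) !modz_nat h. Qed.

(** The quotient of two elements of norm [k] that are congruent modulo [k] is integral of norm 1;
    [X] and [Z] are its coordinates, with the division by [k] carried out through [s] and [t]. If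
    [Z] were zero, the two elements would coincide. *)
Lemma pell_of_congruent (x1 y1 x2 y2 : int) (k : int) : k != 0 ->
  x1 ^+ 2 - D%:Z * y1 ^+ 2 = k -> x2 ^+ 2 - D%:Z * y2 ^+ 2 = k ->
  (k %| x1 - x2)%Z -> (k %| y1 - y2)%Z -> 0 < y1 -> 0 < y2 -> 0 <= x1 -> 0 <= x2 -> (x1, y1) != (x2, y2) ->
  exists X Z : nat, (X ^ 2 = D * Z ^ 2 + 1)%N /\ (0 < Z)%N.
Proof.
move=> k0 e1 e2 /dvdzP[s hs] /dvdzP[t ht] y10 y20 x10 x20 ne.
have X1 : x1 = x2 + s * k by rewrite -hs; ring.
have Y1 : y1 = y2 + t * k by rewrite -ht; ring.
pose X := 1 + s * x2 - D%:Z * t * y2; pose Z := s * y2 - t * x2.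
have hX : x1 * x2 - D%:Z * y1 * y2 = k * X.
  transitivity ((x2 ^+ 2 - D%:Z * y2 ^+ 2) + k * (s * x2 - D%:Z * t * y2)); first by rewrite X1 Y1; ring.
  by rewrite e2 /X; ring.
have hZ : x1 * y2 - x2 * y1 = k * Z by rewrite /Z X1 Y1; ring.
have h : X ^+ 2 = D%:Z * Z ^+ 2 + 1.
  have k20 : k ^+ 2 != 0 by rewrite expf_neq0.
  apply: (mulfI k20).
  have -> : k ^+ 2 * X ^+ 2 = (k * X) ^+ 2 by ring.
  have -> : k ^+ 2 * (D%:Z * Z ^+ 2 + 1) = D%:Z * (k * Z) ^+ 2 + k ^+ 2 by ring.
  rewrite -hX -hZ.
  have -> : k ^+ 2 = (x1 ^+ 2 - D%:Z * y1 ^+ 2) * (x2 ^+ 2 - D%:Z * y2 ^+ 2) by rewrite e1 e2.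
  ring.
exists `|X|%N, `|Z|%N; split.
  rewrite -!abszX h; apply/eqP.
  by rewrite -eqz_nat PoszD PoszM !gez0_abs ?sqr_ge0 // addr_ge0 // mulr_ge0 // sqr_ge0.
rewrite lt0n absz_eq0; apply/eqP => Z0; move/eqP: ne; apply.
move/eqP: hZ; rewrite Z0 mulr0 subr_eq0 => /eqP hc.
have yy : y1 ^+ 2 = y2 ^+ 2.
  apply: (mulfI k0); rewrite -{1}e2 -e1.
  have -> : (x2 ^+ 2 - D%:Z * y2 ^+ 2) * y1 ^+ 2 = (x2 * y1) ^+ 2 - D%:Z * y2 ^+ 2 * y1 ^+ 2 by ring.
  rewrite -hc; ring.
have y12 : y1 = y2 by apply/eqP; rewrite -(@eqrXn2 _ 2) ?yy // ltW.
congr pair => //; apply/eqP; rewrite -(@eqrXn2 _ 2) //; apply/eqP.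
by move: e1; rewrite -e2 yy => /addIr.
Qed.

(** Dirichlet's approximations have bounded norm, hence finitely many classes of norm and residues.
    Two different pairs in one class give a solution; otherwise finitely many pairs occur, and their
    approximation errors could not become arbitrarily small. *)
Lemma exists_pell : exists X Z : nat, (X ^ 2 = D * Z ^ 2 + 1)%N /\ (0 < Z)%N.
Proof.
have /choice[xf hx] (Q : nat) : exists p : nat * nat, [/\ (0 < p.2)%N, (p.2 <= Q.+1)%N & `|p.1%:R - p.2%:R * w| < Q.+1%:R^-1].
  by have [x [y [h1 [h2 h3]]]] := dirichlet (ltn0Sn Q); exists (x, y).
pose nm (p : nat * nat) : int := (p.1%:Z) ^+ 2 - D%:Z * (p.2%:Z) ^+ 2.
pose del (p : nat * nat) : R := `|p.1%:R - p.2%:R * w|.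
have nmE p : (nm p)%:~R = (p.1%:R - p.2%:R * w) * (p.1%:R + p.2%:R * w) :> R.
  rewrite /nm !(rmorphXn, rmorphM, rmorphB) /= -!pmulrn.
  by have := w_sq; move: (Num.sqrt D%:R) => W <-; ring.
have nm0 p : (0 < p.2)%N -> nm p != 0.
  move=> p0; rewrite subr_eq0; apply/eqP => h.
  have : (p.2 ^ 2 * D = p.1 ^ 2)%N.
    by have := congr1 absz h; rewrite abszM !abszX !absz_nat => ->; rewrite mulnC.
  by move/D_ns => h'; rewrite h' in p0.
have del0 p : (0 < p.2)%N -> 0 < del p.
  move=> /nm0 h; rewrite normr_gt0; apply: contraNneq h => h.
  by rewrite -(intr_eq0 R) nmE h mul0r.
pose B := (Num.truncn (2%:R * w + 1)).+1.
have nmB Q : (`|nm (xf Q)| < B)%N.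
  have [h1 h2 h3] := hx Q; rewrite -(ltr_nat R) natr_absz intr_norm nmE normrM.
  have Qr : 0 < Q.+1%:R :> R by rewrite ltr0n.
  have w1 := w_ge1; set p := xf Q in h1 h2 h3 *.
  have h4 : `|p.1%:R + p.2%:R * w| <= 2%:R * p.2%:R * w + 1.
    have -> : p.1%:R + p.2%:R * w = (p.1%:R - p.2%:R * w) + 2%:R * p.2%:R * w by ring.
    apply: le_trans (ler_normD _ _) _; rewrite addrC; apply: lerD.
      by rewrite ger0_norm // !mulr_ge0 // sqrtr_ge0.
    by apply: le_trans (ltW h3) _; rewrite invf_le1 // ler1n.
  apply: (@le_lt_trans _ _ (2%:R * w + 1)); last exact: truncnS_gt.
  apply: (@le_trans _ _ (Q.+1%:R^-1 * (Q.+1%:R * (2%:R * w + 1)))); last by rewrite mulKf ?gt_eqF.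
  apply: ler_pM => //; first exact: ltW.
  apply: le_trans h4 _.
  have : p.2%:R <= Q.+1%:R :> R by rewrite ler_nat.
  have : 1 <= Q.+1%:R :> R by rewrite ler1n.
  by nra.
pose cl (Q : nat) : 'I_B * bool * 'I_B * 'I_B := (inord `|nm (xf Q)|, 0 <= nm (xf Q),
   inord ((xf Q).1 %% `|nm (xf Q)|), inord ((xf Q).2 %% `|nm (xf Q)|)).
have [[Q [Q' [ee ne]]]|hn] := pselect (exists Q Q', cl Q = cl Q' /\ xf Q <> xf Q').
  have [h1 _ _] := hx Q; have [h1' _ _] := hx Q'.
  have n0 := nm0 _ h1; have n0' := nm0 _ h1'.
  have modB Q0 x : (0 < (xf Q0).2)%N -> (x %% `|nm (xf Q0)| < B)%N.
    by move=> h; apply: ltn_trans (nmB Q0); rewrite ltn_mod absz_gt0 nm0.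
  case: ee => /(congr1 val) e1 e2 /(congr1 val) e3 /(congr1 val) e4.
  move: e1 e3 e4; rewrite /= !inordK ?nmB ?modB // => e1 e3 e4.
  have nn : nm (xf Q) = nm (xf Q').
    move: e1 e2; case: (leP 0 (nm (xf Q))) => h; case: (leP 0 (nm (xf Q'))) => h' //; move: h h'; clear; lia.
  apply: (@pell_of_congruent (xf Q).1 (xf Q).2 (xf Q').1 (xf Q').2 (nm (xf Q))) => //.
  - by apply: dvdz_of_mod; rewrite e3 nn.
  - by apply: dvdz_of_mod; rewrite e4 nn.
  - by apply/eqP => -[a b]; apply: ne; rewrite [xf Q]surjective_pairing a b -surjective_pairing.
have hcl (t : 'I_B * bool * 'I_B * 'I_B) : exists d : R, 0 < d /\ forall Q, cl Q = t -> d <= del (xf Q).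
  have [[Q0 h0]|h] := pselect (exists Q, cl Q = t); last by exists 1; split=> // Q e; exfalso; apply: h; exists Q.
  exists (del (xf Q0)); split; first by apply: del0; case: (hx Q0).
  move=> Q e; rewrite (_ : xf Q = xf Q0) //; apply: contrapT => ne; apply: hn; exists Q, Q0.
  by rewrite e h0.
have [d hd] := choice hcl.
pose d0 := \big[Order.min/1]_t d t.
have d00 : 0 < d0 by rewrite lt_bigmin // => t _; case: (hd t).
have [Q hQ] : exists Q : nat, Q.+1%:R^-1 <= d0.
  exists (Num.truncn d0^-1); rewrite -[leRHS]invrK lef_pV2 ?posrE ?invr_gt0 ?ltr0n //.
  by rewrite ltW // truncnS_gt.
have [_ _ h3] := hx Q; have [_ h4] := hd (cl Q).
have := lt_le_trans h3 hQ; rewrite ltNge => /negP []; apply: le_trans (h4 Q erefl).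
exact: bigmin_le.
Qed.

Theorem exists_pell_mod M0 : (0 < M0)%N -> exists X Z : nat,
  [/\ (X ^ 2 = D * Z ^ 2 + 1)%N, (0 < Z)%N, (M0 %| Z)%N & exists t, X = (1 + M0 * t)%N].
Proof.
move=> M00; have [X [Z [Pell Z0]]] := exists_pell.
have [K K0 [a [c [hx hy]]]] := pell_period Pell M00.
exists (pellx D X Z K), (pelly D X Z K); split; first exact: pell_norm.
- have : forall k, (k <= pelly D X Z k)%N.
    elim=> // k IH; have [_] := pellD D X Z k 1; rewrite addn1 => ->.
    have [-> ->] := pell1 D X Z.
    have X0 : (0 < X)%N by move: Pell; case: (X) => // h; rewrite exp0n // addn1 in h.
    by have := pellx_gt0 Pell k; clear -IH X0 Z0; nia.
  by move=> h; apply: leq_trans (h K).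
- by rewrite hy dvdn_mulr.
- by exists a.
Qed.
End Pell.

(** * Independence of units of distinct real quadratic fields *)

Section Graph.
Context (R : realType).
Implicit Types G : R -> R -> Prop.

(* The graph of an injective homomorphism from a subring of [R] to [R]. *)
Definition hom_graph G := [/\ G 1 1, forall a a' b b', G a a' -> G b b' -> G (a - b) (a' - b'),
  forall a a' b b', G a a' -> G b b' -> G (a * b) (a' * b') & forall a a', G a a' -> a = 0 <-> a' = 0].

Definition adjoin G (r r' : R) x x' := exists a a' b b',
  [/\ G a a', G b b', x = a + b * r & x' = a' + b' * r'].

Section Fix.
Context (G : R -> R -> Prop) (hG : hom_graph G).
Lemma hom_graph0 : G 0 0. Proof. by case: hG => h1 hB _ _; have := hB _ _ _ _ h1 h1; rewrite !subrr. Qed.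
Lemma hom_graphN a a' : G a a' -> G (- a) (- a').
Proof. by case: hG => _ hB _ _ /(hB _ _ _ _ hom_graph0); rewrite !sub0r. Qed.
Lemma hom_graphD a a' b b' : G a a' -> G b b' -> G (a + b) (a' + b').
Proof. by case: hG => _ hB _ _ h /hom_graphN k; have := hB _ _ _ _ h k; rewrite !opprK. Qed.
Lemma hom_graph_nat n : G n%:R n%:R.
Proof.
elim: n => [|n IH]; first exact: hom_graph0.
by rewrite -!natr1; apply: hom_graphD => //; case: hG.
Qed.
Lemma hom_graphX a a' n : G a a' -> G (a ^+ n) (a' ^+ n).
Proof.
move=> h; elim: n => [|n IH]; first by rewrite !expr0; case: hG.
by rewrite !exprS; case: hG => _ _ hM _; exact: hM.
Qed.
Lemma hom_graph_prod (I : Type) (s : seq I) (F F' : I -> R) : (forall i, G (F i) (F' i)) ->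
  G (\prod_(i <- s) F i) (\prod_(i <- s) F' i).
Proof.
move=> h; elim: s => [|i s IH]; first by rewrite !big_nil; case: hG.
by rewrite !big_cons; case: hG => _ _ hM _; exact: hM.
Qed.

Context (D : nat) (r : R).
Hypothesis rD : r ^+ 2 = D%:R.

Lemma adjoin_graph r' : r' ^+ 2 = D%:R ->
  (forall a a' b b', G a a' -> G b b' -> a + b * r = 0 <-> a' + b' * r' = 0) -> hom_graph (adjoin G r r').
Proof.
move=> r'D hz; case: (hG) => h1 hB hM _; split.
- by exists 1, 1, 0, 0; split=> //; rewrite ?mul0r ?addr0 //; exact: hom_graph0.
- move=> _ _ _ _ [a [a' [b [b' [ha hb -> ->]]]]] [c [c' [d [d' [hc hd -> ->]]]]].
  by exists (a - c), (a' - c'), (b - d), (b' - d'); split; [exact: hB | exact: hB | ring | ring].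
- move=> _ _ _ _ [a [a' [b [b' [ha hb -> ->]]]]] [c [c' [d [d' [hc hd -> ->]]]]].
  exists (a * c + D%:R * (b * d)), (a' * c' + D%:R * (b' * d')), (a * d + b * c), (a' * d' + b' * c'); split.
  + by apply: hom_graphD; [exact: hM | apply: (hM); [exact: hom_graph_nat | exact: hM]].
  + by apply: hom_graphD; exact: hM.
  + by rewrite -rD; ring.
  + by rewrite -r'D; ring.
- by move=> _ _ [a [a' [b [b' [ha hb -> ->]]]]]; exact: hz.
Qed.

Lemma adjoin_self r' : adjoin G r r' r r'.
Proof.
exists 0, 0, 1, 1; case: (hG) => h1 _ _ _; split=> //; rewrite ?mul1r ?add0r //; exact: hom_graph0.
Qed.
Lemma adjoin_sub r' a a' : G a a' -> adjoin G r r' a a'.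
Proof. by move=> h; exists a, a', 0, 0; rewrite !mul0r !addr0; split=> //; exact: hom_graph0. Qed.

Lemma adjoin_free r' : r' = r \/ r' = - r -> (forall a a' b b', G a a' -> G b b' -> a + b * r = 0 -> b = 0) ->
  hom_graph (adjoin G r r').
Proof.
move=> hr hf; case: (hG) => h1 hB hM hz.
have r'D : r' ^+ 2 = D%:R by case: hr => ->; rewrite ?sqrrN.
apply: adjoin_graph => // a a' b b' ha hb; split=> h.
  have b0 := hf _ _ _ _ ha hb h; have b'0 := (hz _ _ hb).1 b0.
  by rewrite b'0 mul0r addr0; apply: (hz _ _ ha).1; move: h; rewrite b0 mul0r addr0.
have h2 : G (a ^+ 2 - b ^+ 2 * D%:R) (a' ^+ 2 - b' ^+ 2 * D%:R).
  by apply: hB; [exact: hom_graphX | apply: (hM); [exact: hom_graphX | exact: hom_graph_nat]].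
have e : a ^+ 2 - b ^+ 2 * D%:R = 0.
  apply: (hz _ _ h2).2; rewrite -r'D; have -> : a' ^+ 2 - b' ^+ 2 * r' ^+ 2 = (a' + b' * r') * (a' - b' * r') by ring.
  by rewrite h mul0r.
have b0 : b = 0.
  move: e; rewrite -rD; have -> : a ^+ 2 - b ^+ 2 * r ^+ 2 = (a + b * r) * (- a + b * r) * -1 by ring.
  move=> /eqP; rewrite mulf_eq0 oppr_eq0 oner_eq0 orbF mulf_eq0 => /orP[] /eqP; first exact: hf ha hb.
  exact: hf (hom_graphN ha) hb.
have b'0 := (hz _ _ hb).1 b0.
by rewrite b0 mul0r addr0; apply: (hz _ _ ha).2; move: h; rewrite b'0 mul0r addr0.
Qed.

(** If [r] satisfies no linear equation over the domain of [G], its image may be chosen freely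
    between [r] and [- r]. Otherwise the image is forced by the transported equation, and taking
    norms shows that it is again one of the two. *)
Lemma adjoin_exists : exists r', (r' = r \/ r' = - r) /\ hom_graph (adjoin G r r').
Proof.
case: (hG) => h1 hB hM hz.
have [hf|hn] := pselect (forall a a' b b', G a a' -> G b b' -> a + b * r = 0 -> b = 0).
  by exists r; split; [left | apply: adjoin_free => //; left].
have [a [a' [b [b' [ha hb e b0]]]]] : exists a a' b b', [/\ G a a', G b b', a + b * r = 0 & b <> 0].
  apply: contrapT => h; apply: hn => a a' b b' ha hb e; apply: contrapT => b0; apply: h.
  by exists a, a', b, b'.
have b'0 : b' <> 0 by move=> h; apply: b0; exact: (hz _ _ hb).2.
have h2 : G (a ^+ 2 - b ^+ 2 * D%:R) (a' ^+ 2 - b' ^+ 2 * D%:R).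
  by apply: hB; [exact: hom_graphX | apply: (hM); [exact: hom_graphX | exact: hom_graph_nat]].
have e' : a' ^+ 2 - b' ^+ 2 * D%:R = 0.
  apply: (hz _ _ h2).1; rewrite -rD; have -> : a ^+ 2 - b ^+ 2 * r ^+ 2 = (a + b * r) * (a - b * r) by ring.
  by rewrite e mul0r.
have [r' [hr er']] : exists r', (r' = r \/ r' = - r) /\ a' + b' * r' = 0.
  move: e'; rewrite -rD; have -> : a' ^+ 2 - b' ^+ 2 * r ^+ 2 = (a' + b' * r) * (a' - b' * r) by ring.
  move=> /eqP; rewrite mulf_eq0 => /orP[] /eqP h; first by exists r; split; [left|].
  by exists (- r); split; [right | rewrite mulrN].
exists r'; split=> //; apply: adjoin_graph; first by case: hr => ->; rewrite ?sqrrN.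
move=> c c' d d' hc hd.
have h3 : G (c * b - d * a) (c' * b' - d' * a') by apply: hB; exact: hM.
have E1 : b * (c + d * r) = c * b - d * a.
  have -> : a = - (b * r) by apply/eqP; rewrite -addr_eq0 e.
  ring.
have E2 : b' * (c' + d' * r') = c' * b' - d' * a'.
  have -> : a' = - (b' * r') by apply/eqP; rewrite -addr_eq0 er'.
  ring.
split=> h.
  have : b' * (c' + d' * r') = 0 by rewrite E2; apply: (hz _ _ h3).1; rewrite -E1 h mulr0.
  by move/eqP; rewrite mulf_eq0 => /orP[] /eqP.
have : b * (c + d * r) = 0 by rewrite E1; apply: (hz _ _ h3).2; rewrite -E2 h mulr0.
by move/eqP; rewrite mulf_eq0 => /orP[] /eqP.
Qed.
End Fix.

Definition int_graph (x x' : R) := exists k : int, x = k%:~R /\ x' = k%:~R.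
Lemma int_graph_hom : hom_graph int_graph.
Proof.
split.
- by exists 1.
- by move=> _ _ _ _ [k [-> ->]] [l [-> ->]]; exists (k - l); rewrite intrB.
- by move=> _ _ _ _ [k [-> ->]] [l [-> ->]]; exists (k * l); rewrite intrM.
- by move=> _ _ [k [-> ->]].
Qed.

Lemma extend_graph (m : nat) (D : 'I_m -> nat) G : hom_graph G -> exists t : 'I_m -> bool, exists G', hom_graph G' /\
  (forall a a', G a a' -> G' a a') /\ forall l, G' (Num.sqrt (D l)%:R) ((-1) ^+ t l * Num.sqrt (D l)%:R).
Proof.
move=> hG; pose W l : R := Num.sqrt (D l)%:R.
suff : forall s : seq 'I_m, exists t : 'I_m -> bool, exists G', hom_graph G' /\
  (forall a a', G a a' -> G' a a') /\ forall l, l \in s -> G' (W l) ((-1) ^+ t l * W l).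
  move=> /(_ (enum 'I_m))[t [G' [h1 [h2 h3]]]]; exists t, G'; split=> //; split=> // l.
  by apply: h3; rewrite mem_enum.
elim=> [|l s [t [G' [h1 [h2 h3]]]]]; first by exists (fun=> false), G.
have rD : W l ^+ 2 = (D l)%:R by rewrite sqr_sqrtr.
have [r' [hr hG']] := adjoin_exists h1 rD.
have [ls|ls] := boolP (l \in s).
  by exists t, G'; split=> //; split=> // l'; rewrite inE => /orP[/eqP ->|]; exact: h3.
exists (fun l' => if l' == l then r' != W l else t l'), (adjoin G' (W l) r'); split=> //; split.
  by move=> a a' /h2; exact: adjoin_sub.
move=> l'; rewrite inE; case: eqP => [-> _|_ /= /h3]; last exact: adjoin_sub.
have -> : (-1) ^+ (r' != W l) * W l = r'.
  by case: eqVneq hr => [->|ne [e|->]]; rewrite ?expr0 ?mul1r ?expr1 ?mulN1r //; rewrite e eqxx in ne.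
exact: adjoin_self.
Qed.
End Graph.

(** * Sign vectors and orthogonality *)

Section Units.
Context (R : realType) (m : nat) (D X Z : 'I_m -> nat).
Hypothesis D_ns : forall l, nonsquare (D l).
Hypothesis D_ind : forall l l', l != l' -> nonsquare (D l * D l').
Hypothesis Pell : forall l, (X l ^ 2 = D l * Z l ^ 2 + 1)%N.
Hypothesis Z0 : forall l, (0 < Z l)%N.
Local Notation W l := (Num.sqrt (D l)%:R : R).

Lemma W_sq l : W l ^+ 2 = (D l)%:R. Proof. by rewrite sqr_sqrtr. Qed.

Lemma ns_int (d : nat) (x y : int) : nonsquare d -> x ^+ 2 * d%:Z = y ^+ 2 -> x = 0.
Proof.
move=> h /(congr1 absz); rewrite abszM !abszX absz_nat => /h /eqP; rewrite absz_eq0 => /eqP //.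
Qed.

(** Multiplication by the conjugate of [B] makes the coefficient of the second root the rational
    norm [N]. Separating rational and irrational parts after another conjugation shows that [N]
    vanishes, because neither [D l'] nor the product of the two is a square; an element of norm zero
    is zero. *)
Lemma irrational_pair l l' : l != l' -> forall a b c d : int,
  (a%:~R + b%:~R * W l) + (c%:~R + d%:~R * W l) * W l' = 0 :> R -> c%:~R + d%:~R * W l = 0 :> R.
Proof.
move=> ne a b c d; set A := _ + _ * W l; set B := c%:~R + _ => h.
have free (x y : int) j : x%:~R + y%:~R * W j = 0 :> R -> y = 0 /\ x = 0.
  move=> e; suff y0 : y = 0.
    by split=> //; move: e; rewrite y0 mul0r addr0 => /eqP; rewrite intr_eq0 => /eqP.
  apply: (ns_int (@D_ns j) (y := x)); apply/eqP; rewrite -(eqr_int R) rmorphM !rmorphXn /= -pmulrn -W_sq -exprMn.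
  by apply/eqP; move/eqP: e; rewrite addr_eq0 => /eqP ->; rewrite sqrrN.
pose w : R := W l; pose w' : R := W l'; have {}h : A + B * w' = 0 by [].
have wD : w * w = (D l)%:R by rewrite -expr2; exact: W_sq.
have wD' : w' * w' = (D l')%:R by rewrite -expr2; exact: W_sq.
have [p pE] : exists p : int, p = a * c - b * d * (D l)%:Z by eexists.
have [q qE] : exists q : int, q = b * c - a * d by eexists.
have [N NE] : exists N : int, N = c * c - d * d * (D l)%:Z by eexists.
have e1 : p%:~R + q%:~R * w + N%:~R * w' = 0.
  have pR : p%:~R = a%:~R * c%:~R - b%:~R * d%:~R * (w * w) :> R by rewrite pE wD intrB !intrM.
  have qR : q%:~R = b%:~R * c%:~R - a%:~R * d%:~R :> R by rewrite qE intrB !intrM.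
  have NR : N%:~R = c%:~R * c%:~R - d%:~R * d%:~R * (w * w) :> R by rewrite NE wD intrB !intrM.
  transitivity ((c%:~R - d%:~R * w) * (A + B * w')); last by rewrite h mulr0.
  by rewrite pR qR NR /A /B -/w; ring.
have [e2 e3] : 2%:Z * p * q = 0 /\ p * p + q * q * (D l)%:Z - N * N * (D l')%:Z = 0.
  apply: (@free _ _ l); rewrite intrB intrD !intrM -/w.
  transitivity ((p%:~R + q%:~R * w + N%:~R * w') * (p%:~R + q%:~R * w - N%:~R * w')); last by rewrite e1 mul0r.
  have -> : ((D l)%:Z)%:~R = w * w by rewrite wD.
  have -> : ((D l')%:Z)%:~R = w' * w' by rewrite wD'.
  have -> : (2%:Z)%:~R = 2%:R :> R by [].
  by ring.
have N0 : N = 0.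
  move/eqP: e2; rewrite !mulf_eq0 /= => /orP[] /eqP h0; move: e3; rewrite h0 ?mul0r ?add0r ?addr0 => /eqP; rewrite subr_eq0 => /eqP e.
    apply: (ns_int (@D_ind _ _ ne) (y := q * (D l)%:Z)); rewrite PoszM.
    transitivity ((D l)%:Z * (N * N * (D l')%:Z)); first by ring.
    by rewrite -e; ring.
  by apply: (ns_int (@D_ns l') (y := p)); rewrite !expr2 -e.
have d0 : d = 0.
  apply: (ns_int (@D_ns l) (y := c)); apply/eqP; rewrite eq_sym -subr_eq0; apply/eqP.
  by rewrite -N0 NE !expr2.
move: N0; rewrite NE d0 !mul0r subr0 => /eqP; rewrite mulf_eq0 orbb => /eqP c0.
by rewrite /B c0 d0 mul0r addr0.
Qed.

Definition admissible (t : {ffun 'I_m -> bool}) := `[< exists G, hom_graph G /\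
  forall l, G (W l) ((-1) ^+ t l * W l) >].

Lemma admissible_add t1 t2 : admissible t1 -> admissible t2 -> admissible [ffun l => t1 l (+) t2 l].
Proof.
move=> /asboolP[G1 [h1 k1]] /asboolP[G2 [h2 k2]]; apply/asboolP.
exists (fun x z => exists y, G1 x y /\ G2 y z); split.
  case: (h1) (h2) => a1 a2 a3 a4 [b1 b2 b3 b4]; split.
  - by exists 1.
  - by move=> x x' y y' [u [u1 u2]] [v [v1 v2]]; exists (u - v); split; [exact: a2 | exact: b2].
  - by move=> x x' y y' [u [u1 u2]] [v [v1 v2]]; exists (u * v); split; [exact: a3 | exact: b3].
  - by move=> x x' [u [/a4 u1 /b4 u2]]; rewrite u1.
move=> l; exists ((-1) ^+ t1 l * W l); split=> //; rewrite ffunE signr_addb -mulrA mulrCA.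
have h := k2 l; case: (t1 l); rewrite ?expr0 ?expr1 ?mul1r ?mulN1r ?mulrN //.
exact: hom_graphN h.
Qed.

Lemma W_neq0 l : W l != 0.
Proof. by rewrite gt_eqF // (lt_le_trans ltr01) // (w_ge1 R (@D_ns l)). Qed.

Lemma hom_graph_unique (G : R -> R -> Prop) x y z : hom_graph G -> G x y -> G x z -> y = z.
Proof.
move=> [_ hB _ hz] h1 h2; apply/eqP; rewrite -subr_eq0; apply/eqP; apply: (hz _ _ (hB _ _ _ _ h1 h2)).1.
by rewrite subrr.
Qed.

(** Fix the root of [D l0] and change the sign of that of [D l], which [irrational_pair] permits;
    then extend to the remaining roots. *)
Lemma admissible_separates l l0 : l != l0 -> exists t, admissible t /\ t l (+) t l0.
Proof.
move=> ne; have hG0 := @int_graph_hom R.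
have hG1 : hom_graph (adjoin (@int_graph R) (W l0) (W l0)).
  apply: (adjoin_free hG0 (W_sq l0)); first by left.
  move=> _ _ _ _ [x [-> _]] [y [-> _]] e.
  suff -> : y = 0 by [].
  apply: (ns_int (@D_ns l0) (y := x)); apply/eqP; rewrite -(eqr_int R) rmorphM !rmorphXn /= -pmulrn -W_sq -exprMn.
  by move/eqP: e; rewrite addr_eq0 => /eqP ->; rewrite sqrrN.
have hG2 : hom_graph (adjoin (adjoin (@int_graph R) (W l0) (W l0)) (W l) (- W l)).
  apply: (adjoin_free hG1 (W_sq l)); first by right.
  move=> _ _ _ _ [_ [_ [_ [_ [[a [-> _]] [b [-> _]] -> _]]]]] [_ [_ [_ [_ [[c [-> _]] [d [-> _]] -> _]]]]].
  by apply: irrational_pair; rewrite eq_sym.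
have [t [G' [hG' [hs ht]]]] := extend_graph D hG2.
exists [ffun l => t l]; split; first by apply/asboolP; exists G'; split=> // l1; rewrite ffunE.
have e1 := hom_graph_unique hG' (ht l) (hs _ _ (adjoin_self hG1 _ _)).
have a2 : adjoin (adjoin (@int_graph R) (W l0) (W l0)) (W l) (- W l) (W l0) (W l0).
  by apply: (adjoin_sub hG1); exact: adjoin_self.
have e2 := hom_graph_unique hG' (ht l0) (hs _ _ a2).
rewrite !ffunE; move: e1 e2; have := W_neq0 l; have := W_neq0 l0; move: (W l) (W l0) => x y.
case: (t l); case: (t l0) => //=; rewrite ?expr0 ?expr1 ?mul1r ?mulN1r => y0 x0 e1 e2.
- by case/eqP: y0; lra.
- by case/eqP: x0; lra.
Qed.

Definition unit_eps l : R := (X l)%:R + (Z l)%:R * W l.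
Lemma unit_eps_gt1 l : 1 < unit_eps l.
Proof.
have X0 : (0 < X l)%N by move: (Pell l); case: (X l) => // h; rewrite exp0n // addn1 in h.
rewrite /unit_eps -[ltLHS]addr0; apply: ler_ltD; first by rewrite ler1n.
by rewrite mulr_gt0 ?ltr0n // (lt_le_trans ltr01) // (w_ge1 R (@D_ns l)).
Qed.

Lemma ln_signed (t : bool) l : 0 < (X l)%:R + (Z l)%:R * ((-1) ^+ t * W l) /\
  ln ((X l)%:R + (Z l)%:R * ((-1) ^+ t * W l)) = (-1) ^+ t * ln (unit_eps l).
Proof.
have e0 : 0 < unit_eps l by rewrite (lt_trans ltr01) // unit_eps_gt1.
case: t; rewrite ?expr0 ?expr1 ?mul1r // !mulN1r.
have e : unit_eps l * ((X l)%:R + (Z l)%:R * - W l) = 1.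
  by rewrite mulrN; exact: (pell_inv (Pell l) (W_sq l)).
have -> : (X l)%:R + (Z l)%:R * - W l = (unit_eps l)^-1.
  by apply: (mulfI (lt0r_neq0 e0)); rewrite e mulfV // gt_eqF.
by rewrite invr_gt0 lnV.
Qed.

Lemma ln_prod_pow (F : 'I_m -> R) (a : 'I_m -> nat) : (forall l, 0 < F l) ->
  ln (\prod_l F l ^+ a l) = \sum_l (a l)%:R * ln (F l).
Proof.
move=> F0; suff [] : 0 < \prod_l F l ^+ a l /\ ln (\prod_l F l ^+ a l) = \sum_l (a l)%:R * ln (F l) by [].
apply: (big_ind2 (fun x y => 0 < x /\ ln x = y)); first by rewrite ln1.
  by move=> x1 x2 y1 y2 [h1 <-] [h2 <-]; rewrite mulr_gt0 // lnM.
by move=> l _; rewrite exprn_gt0 // lnXn // mulr_natl.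
Qed.

(* Every admissible sign vector gives a linear relation between the logarithms of the units;
   the sign vectors form a group, so that the relations are orthogonal. *)
Theorem units_independent (a b : 'I_m -> nat) :
  \prod_l unit_eps l ^+ a l = \prod_l unit_eps l ^+ b l -> a =1 b.
Proof.
move=> h; pose H l := ((a l)%:R - (b l)%:R) * ln (unit_eps l).
have rel t : admissible t -> \sum_l (-1) ^+ t l * H l = 0.
  move=> /asboolP[G [hG ht]].
  pose F l : R := (X l)%:R + (Z l)%:R * ((-1) ^+ t l * W l).
  have hF l : G (unit_eps l) (F l).
    apply: hom_graphD; [exact: hG|exact: hom_graph_nat|].
    by case: (hG) => _ _ hM _; apply: (hM); [exact: hom_graph_nat | exact: ht].
  have eF : \prod_l F l ^+ a l = \prod_l F l ^+ b l.
    apply: (hom_graph_unique hG (x := \prod_l unit_eps l ^+ a l)).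
      by apply: hom_graph_prod => // l; exact: hom_graphX.
    by rewrite h; apply: hom_graph_prod => // l; exact: hom_graphX.
  have F0 l : 0 < F l by case: (ln_signed (t l) l).
  have := congr1 (@ln R) eF; rewrite !ln_prod_pow // => /eqP; rewrite -subr_eq0 -sumrB => /eqP e.
  rewrite -[RHS]e; apply: eq_bigr => l _; case: (ln_signed (t l) l) => _; rewrite -/(F l) /H => ->; ring.
move=> l0; pose S := [set t | admissible t].
have adm0 : [ffun=> false] \in S.
  rewrite inE; apply/asboolP; exists (fun x y => x = y); split; last by move=> l; rewrite ffunE expr0 mul1r.
  by split=> //; [move=> ? ? ? ? -> -> | move=> ? ? ? ? -> -> | move=> ? ? ->].
have E : \sum_(t in S) (-1) ^+ t l0 * \sum_l (-1) ^+ t l * H l = 0.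
  by apply: big1 => t; rewrite inE => /rel ->; rewrite mulr0.
have E2 : \sum_(t in S) (-1) ^+ t l0 * \sum_l (-1) ^+ t l * H l = #|S|%:R * H l0.
  under eq_bigr do rewrite mulr_sumr.
  rewrite exchange_big (bigD1 l0) //= [X in _ + X]big1 ?addr0.
    under eq_bigr do rewrite mulrA -signr_addb addbb expr0 mul1r.
    by rewrite sumr_const mulr_natl.
  move=> l ne; under eq_bigr do rewrite mulrA; rewrite -mulr_suml.
  have [t0 [ht0 st0]] := admissible_separates ne.
  (* Translation by [t0] permutes the admissible vectors and changes the sign of every summand, so
     the sum is its own opposite. *)
  pose add (t : {ffun 'I_m -> bool}) : {ffun 'I_m -> bool} := [ffun l => t0 l (+) t l].
  have addK : involutive add by move=> t; apply/ffunP => j; rewrite !ffunE addKb.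
  have addS t : (add t \in S) = (t \in S).
    have S1 t' : t' \in S -> add t' \in S by rewrite !finset.in_set => h'; exact: admissible_add.
    by apply/idP/idP => [/S1|/S1 //]; rewrite addK.
  set Y := \sum_(t in S) _; suff Y0 : Y = - Y.
    by move/eqP: Y0; rewrite -addr_eq0 -mulr2n mulrn_eq0 /= => /eqP ->; rewrite mul0r.
  rewrite {1}/Y (reindex_inj (inv_inj addK)) (eq_bigl _ _ addS) /= -sumrN; apply: eq_bigr => t _.
  rewrite !ffunE -!signr_addb; move: st0; case: (t0 l); case: (t0 l0) => //= _; case: (t l); case: (t l0) => /=;
    by rewrite ?expr0 ?expr1 ?opprK.
have S0 : (0 < #|S|)%N by apply/card_gt0P; exists [ffun=> false].
move: E; rewrite E2 => /eqP; rewrite mulf_eq0 pnatr_eq0 (gtn_eqF S0) /= /H mulf_eq0.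
have /lt0r_neq0/negbTE -> : 0 < ln (unit_eps l0) by exact: ln_gt0 (unit_eps_gt1 l0).
by rewrite orbF subr_eq0 eqr_nat => /eqP.
Qed.
End Units.

(** * Normal forms of quadratic irrationals *)

Section NormalForm.
Context (R : realType).
Local Notation W d := (Num.sqrt d%:R : R).

Lemma irrational_intP (x : R) : irrational x -> forall k d : int, d != 0 -> d%:~R * x <> k%:~R.
Proof.
move=> ix k d d0 h; apply: ix; exists (k%:Q / d%:Q) => //.
by rewrite rmorphM fmorphV /= !ratr_int -h mulrC mulKf // intr_eq0.
Qed.

Lemma quadratic_int (x : R) : quadratic_irrational x -> exists a b c : int,
  a != 0 /\ a%:~R * x ^+ 2 + b%:~R * x + c%:~R = 0.
Proof.
move=> [_ [p sp]]; have [q [d d0 pE]] := rat_poly_scale p.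
have sq : size q = 3%N.
  have d0' : (d%:~R : rat)^-1 != 0 by rewrite invr_eq0 intr_eq0.
  by move: sp; rewrite pE size_scale // size_map_inj_poly //; exact: intr_inj.
move=> /eqP px; exists q`_2, q`_1, q`_0; split.
  by have : lead_coef q != 0 by [rewrite lead_coef_eq0 -size_poly_eq0 sq]; rewrite lead_coefE sq.
have : (map_poly intr q).[x] = 0 :> R.
  have dR : d%:~R != 0 :> R by rewrite intr_eq0.
  apply: (mulfI (invr_neq0 dR)); rewrite mulr0 -[RHS]px pE map_polyZ hornerZ /= fmorphV rmorph_int.
  congr (_ * _); rewrite -map_poly_comp; congr (_.[x]); apply: eq_map_poly => k /=; by rewrite ratr_int.
by rewrite horner_coef size_map_inj_poly ?sq //; [rewrite !big_ord_recl big_ord0 /= !coef_map /= expr0 expr1; move=> <-; ring | exact: intr_inj].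
Qed.

Lemma sqrt_form (x : R) : quadratic_irrational x -> exists (s : bool) (b : int) (d c : nat),
  [/\ (0 < c)%N, nonsquare d & (-1) ^+ s * x = (b%:~R - W d) / c%:R].
Proof.
move=> qx; have [a [b [c [a0 e]]]] := quadratic_int qx; have [ix _] := qx.
pose Dt : int := b * b - 4%:Z * a * c.
have sqE : (2%:R * a%:~R * x + b%:~R) ^+ 2 = Dt%:~R :> R.
  rewrite /Dt intrB !intrM.
  have -> : (2%:R * a%:~R * x + b%:~R) ^+ 2 = 4%:R * a%:~R * (a%:~R * x ^+ 2 + b%:~R * x + c%:~R) + (b%:~R * b%:~R - 4%:R * a%:~R * c%:~R) :> R by ring.
  by rewrite e mulr0 add0r.
have Dt0 : 0 <= Dt by rewrite -(ler0z R) -sqE sqr_ge0.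
have [d dE] : exists d : nat, Dt = d%:Z by exists `|Dt|%N; rewrite gez0_abs.
have aR : a%:~R != 0 :> R by rewrite intr_eq0.
have Wsq : W d ^+ 2 = Dt%:~R by rewrite sqr_sqrtr // dE -pmulrn.
have ns : nonsquare d.
  move=> u y uy; apply/eqP/negPn/negP => u0.
  have : (u%:R * W d) ^+ 2 = y%:R ^+ 2 by rewrite exprMn Wsq dE -pmulrn -!natrX -natrM uy.
  move=> /eqP; rewrite eqf_sqr => hy.
  have [k hk] : exists k : int, u%:R * (2%:R * a%:~R * x + b%:~R) = k%:~R :> R.
    have : (u%:R * (2%:R * a%:~R * x + b%:~R)) ^+ 2 = y%:R ^+ 2 by rewrite exprMn sqE dE -pmulrn -!natrX -natrM uy.
    move=> /eqP; rewrite eqf_sqr => /orP[] /eqP ->; first by exists y%:Z.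
    by exists (- y%:Z); rewrite intrN.
  apply: (irrational_intP ix (k := k - u%:Z * b) (d := u%:Z * 2%:Z * a)); first by rewrite !mulf_neq0.
  by rewrite intrB !intrM -hk -!pmulrn; ring.
pose t := 2%:R * a%:~R * x + b%:~R : R.
have ht : t = W d \/ t = - W d.
  by have /eqP : t ^+ 2 = W d ^+ 2 by [rewrite sqE Wsq]; rewrite eqf_sqr => /orP[] /eqP; [left | right].
(* The sign is the one that puts a minus in front of the square root once the denominator has been
   made positive. *)
pose s : bool := (t == W d) (+) (a < 0).
exists s, ((-1) ^+ (t != W d) * b), d, (2 * absz a)%N; split=> //; first by rewrite muln_gt0 /= absz_gt0.
have W0 : 0 < W d by rewrite (lt_le_trans ltr01) // (@w_ge1 R d ns).
have c0 : (2 * absz a)%:R != 0 :> R by rewrite pnatr_eq0 muln_eq0 /= absz_eq0.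
have cE : (2 * absz a)%:R = 2%:R * ((-1) ^+ (a < 0)%R * a%:~R) :> R.
  rewrite natrM natr_absz intr_norm; congr (_ * _).
  by case: ltP => h; [rewrite ltr0_norm ?ltrz0 // expr1 mulN1r | rewrite ger0_norm ?ler0z // expr0 mul1r].
apply: (mulIf c0); rewrite divfK // cE.
have xE : 2%:R * a%:~R * x = t - b%:~R by rewrite /t addrK.
rewrite /s signr_addb.
have -> : (-1) ^+ (t == W d) * (-1) ^+ (a < 0)%R * x * (2%:R * ((-1) ^+ (a < 0)%R * a%:~R)) =
   (-1) ^+ (t == W d) * ((-1) ^+ (a < 0)%R * (-1) ^+ (a < 0)%R) * (2%:R * a%:~R * x) :> R by ring.
rewrite -signr_addb addbb expr0 mulr1 xE.
case: eqVneq => [tW|ne]; first by rewrite /= expr0 expr1 mul1r tW; ring.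
case: ht => [h|->]; first by rewrite h eqxx in ne.
by rewrite /= expr0 expr1 mulN1r intrN; ring.
Qed.

(* The conditions on [a] and [c] say that [s * x + k] lies in [(0, 1)]. *)
Definition normal_form (x : R) (s : bool) (k : int) (a c d : nat) :=
  [/\ (0 < c)%N, (d < a ^ 2)%N, ((a - c) ^ 2 < d)%N & (-1) ^+ s * x + k%:~R = (a%:R - W d) / c%:R].

Lemma exists_normal_form (x : R) : quadratic_irrational x -> exists s k a c d, nonsquare d /\ normal_form x s k a c d.
Proof.
move=> /sqrt_form[s [b [d [c [c0 ns e]]]]].
have cR : 0 < c%:R :> R by rewrite ltr0n.
have W0 : 0 < W d by rewrite (lt_le_trans ltr01) // (@w_ge1 R d ns).
pose k := - Num.floor ((-1) ^+ s * x).
have f1 : ((-1) ^+ s * x + k%:~R) * c%:R = (b + k * c%:Z)%:~R - W d.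
  by rewrite e /k mulrDl divfK ?gt_eqF // intrD intrM -pmulrn; ring.
have f0 : 0 <= (-1) ^+ s * x + k%:~R by rewrite /k intrN subr_ge0 floor_le_tmp.
have flt : (-1) ^+ s * x + k%:~R < 1 by rewrite /k intrN ltrBlDr addrC; have := floorD1_gt ((-1) ^+ s * x); rewrite intrD.
have a0 : W d <= (b + k * c%:Z)%:~R by rewrite -subr_ge0 -f1 mulr_ge0 // ltW.
have [a aE] : exists a : nat, b + k * c%:Z = a%:Z.
  exists (absz (b + k * c%:Z)); rewrite gez0_abs // -(ler0z R); exact: le_trans (ltW W0) a0.
rewrite aE -pmulrn in f1 a0.
have Wsq : W d ^+ 2 = d%:R by rewrite sqr_sqrtr.
have ne (y : nat) : (d == y ^ 2)%N = false.
  by apply/negP => /eqP h; have := ns 1%N y; rewrite exp1n mul1n => /(_ h).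
exists s, k, a, c, d; split=> //; split=> //.
- by rewrite ltn_neqAle ne /= -(ler_nat R) natrX -Wsq; apply: lerXn2r; rewrite ?nnegrE // ltW.
- case: (leqP a c) => ac; first by rewrite (eqP (ac : (a - c == 0)%N)) (ns_gt0 ns).
  rewrite -(ltr_nat R) natrX -Wsq ltrXn2r // ?nnegrE ?(ltW W0) // natrB ?(ltnW ac) //.
  by rewrite ltrBlDr -ltrBlDl -f1 gtr_pMl.
- by apply: (mulIf (lt0r_neq0 cR)); rewrite f1 divfK // gt_eqF.
Qed.

Lemma normal_form_scale x s k a c d q e : (0 < q)%N -> (0 < e)%N -> (q ^ 2 * d = e)%N -> normal_form x s k a c d ->
  normal_form x s k (q * a) (q * c) e.
Proof.
move=> q0 e0 qe [c0 h1 h2 h3]; split.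
- by rewrite muln_gt0 q0.
- by rewrite -qe expnMn ltn_pmul2l // expn_gt0 q0.
- by rewrite -qe -mulnBr expnMn ltn_pmul2l // expn_gt0 q0.
have qR : q%:R != 0 :> R by rewrite pnatr_eq0 -lt0n.
have cR : c%:R != 0 :> R by rewrite pnatr_eq0 -lt0n.
have -> : W e = q%:R * W d by rewrite -qe natrM natrX sqrtrM ?sqr_ge0 // sqrtr_sqr ger0_norm.
rewrite h3 !natrM.
by field; rewrite cR qR.
Qed.

Definition square_class (d e : nat) := `[< exists y : nat, (d * e = y ^ 2)%N >].

Lemma square_class_trans d e f : (0 < e)%N -> square_class d e -> square_class e f -> square_class d f.
Proof.
move=> e0 /asboolP[y hy] /asboolP[z hz]; apply/asboolP.
have /dvdnP[t ht] : (e %| y * z)%N.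
  rewrite -(@dvdn_pexp2r e _ 2) // expnMn -hy -hz; apply/dvdnP; exists (d * f)%N; ring.
exists t; apply/eqP; rewrite -(@eqn_pmul2l (e ^ 2)) ?expn_gt0 ?e0 //; apply/eqP.
transitivity ((y * z) ^ 2)%N; last by rewrite ht expnMn mulnC.
by rewrite expnMn -hy -hz; ring.
Qed.
Lemma square_class_sym d e : square_class d e = square_class e d.
Proof. by rewrite /square_class mulnC. Qed.
Lemma square_class_refl d : square_class d d.
Proof. by apply/asboolP; exists d; rewrite mulnn. Qed.

(** Fields correspond to discriminants modulo squares. In each class a representative is chosen, and
    the common factor [Q] makes all numbers of the class use the same [D]. *)
Theorem normal_forms r (x : 'I_r -> R) : (forall i, quadratic_irrational (x i)) ->
  exists (m : nat) (D : 'I_m -> nat) (lb : 'I_r -> 'I_m) (s : 'I_r -> bool) (k : 'I_r -> int) (a c : 'I_r -> nat),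
  [/\ forall l, nonsquare (D l), forall l l', l != l' -> nonsquare (D l * D l') &
      forall i, normal_form (x i) (s i) (k i) (a i) (c i) (D (lb i))].
Proof.
move=> qx.
have /choice[p hp] i : exists p : (bool * int * nat * nat * nat), nonsquare p.2 /\ normal_form (x i) p.1.1.1.1 p.1.1.1.2 p.1.1.2 p.1.2 p.2.
  by have [s [k [a [c [d [h1 h2]]]]]] := exists_normal_form (qx i); exists (s, k, a, c, d).
pose d i := (p i).2.
have dns i : nonsquare (d i) by case: (hp i).
have d0 i : (0 < d i)%N by exact: ns_gt0.
pose rep i := odflt i [pick j | square_class (d i) (d j)].
have repP i : square_class (d i) (d (rep i)).
  by rewrite /rep; case: pickP => [j //|/(_ i)]; rewrite square_class_refl.
have rep_eq i j : square_class (d i) (d j) -> rep i = rep j.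
  move=> h; rewrite /rep.
  have e : [pick j0 | square_class (d i) (d j0)] = [pick j0 | square_class (d j) (d j0)].
    apply: eq_pick => j0 /=; apply/idP/idP => h'; last exact: square_class_trans h h'.
    by apply: square_class_trans h'; rewrite // square_class_sym.
  rewrite e; case: pickP => //= /(_ j); by rewrite square_class_refl.
have /choice[q hq] i : exists q : nat, (d i * d (rep i) = q ^ 2)%N by exact/asboolP/repP.
have q0 i : (0 < q i)%N.
  have : (0 < q i ^ 2)%N by rewrite -hq muln_gt0 !d0.
  by rewrite expn_gt0 orbF.
pose Q := (\prod_i q i)%N.
have Q0 : (0 < Q)%N by apply: prodn_gt0.
have qQ i : (q i %| Q)%N by rewrite /Q (bigD1 i) //= dvdn_mulr.
pose reps := [seq i <- enum 'I_r | rep i == i].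
have rin i : rep i \in reps by rewrite mem_filter mem_enum andbT; apply/eqP/esym/rep_eq.
pose m := size reps.
have lt_ix i : (index (rep i) reps < m)%N by rewrite index_mem.
pose lb i : 'I_m := Ordinal (lt_ix i).
pose rp (l : 'I_m) : 'I_r := tnth (in_tuple reps) l.
have rp_lb i : rp (lb i) = rep i by rewrite /rp (tnth_nth (rep i)) /= nth_index.
have rp_in l : rep (rp l) = rp l.
  by have : rp l \in reps by [rewrite mem_tnth]; rewrite mem_filter => /andP[/eqP].
have rp_inj : injective rp.
  by move=> l l' /tuple_uniqP; apply; rewrite filter_uniq // enum_uniq.
(* The scaling factor of the form [i] is [Q / q i * d (rep i)]: its square times [d i] is
   [Q ^ 2 * d (rep i)], since the square of [q i] is [d i * d (rep i)]. *)
exists m, (fun l => Q ^ 2 * d (rp l))%N, lb, (fun i => (p i).1.1.1.1), (fun i => (p i).1.1.1.2),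
  (fun i => (Q %/ q i * (d (rep i) * (p i).1.1.2))%N), (fun i => (Q %/ q i * (d (rep i) * (p i).1.2))%N).
have scale t e : (0 < t)%N -> nonsquare e -> nonsquare (t ^ 2 * e).
  move=> t0 he u y uy; have := he (u * t)%N y; rewrite expnMn -mulnA => /(_ uy) /eqP.
  by rewrite muln_eq0 (gtn_eqF t0) orbF => /eqP.
split.
- by move=> l; apply: scale => //.
- move=> l l' ne.
  have -> : (Q ^ 2 * d (rp l) * (Q ^ 2 * d (rp l')) = (Q * Q) ^ 2 * (d (rp l) * d (rp l')))%N by ring.
  apply: scale; first by rewrite muln_gt0 Q0.
  move=> u y uy; apply/eqP/negPn/negP => u0; move/eqP: ne; apply; apply: rp_inj.
  rewrite -(rp_in l) -(rp_in l'); apply: rep_eq; apply/asboolP.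
  have /dvdnP[t ht] : (u %| y)%N by rewrite -(@dvdn_pexp2r u y 2) // -uy dvdn_mulr.
  exists t; apply/eqP; rewrite -(@eqn_pmul2l (u ^ 2)) ?expn_gt0 ?lt0n ?u0 //; apply/eqP.
  by rewrite uy ht expnMn mulnC.
- move=> i; have [_ nf] := hp i.
  rewrite rp_lb !mulnA.
  apply: (normal_form_scale _ _ _ nf).
  + by rewrite muln_gt0 divn_gt0 // d0 dvdn_leq.
  + by rewrite muln_gt0 expn_gt0 Q0 d0.
  have -> : ((Q %/ q i * d (rep i)) ^ 2 * (p i).2 = (Q %/ q i) ^ 2 * (d i * d (rep i)) * d (rep i))%N by rewrite /d; ring.
  by rewrite hq -expnMn divnK.
Qed.
End NormalForm.

(** * The theorem over an algebraic closure *)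

Section NField.
Context (C : numFieldType) (A : min_int_poly C).
Local Notation K := (nfield A).
Definition nfincl : {rmorphism K -> C} := \val.
Local Notation alg := (algebraicOver (ratr : rat -> C)).

Lemma alg_int (k : int) : alg k%:~R.
Proof. by rewrite -(ratr_int C k); exact: algebraic_id. Qed.

Lemma nfincl_eval P : nfincl (map_poly intr P).[nfield_gen A] = (map_poly intr P).[mroot A].
Proof.
rewrite -horner_map (_ : map_poly (nfincl) (map_poly intr P) = map_poly intr P) //.
by apply/polyP => i; rewrite coef_map coef_map coef_map; exact: (rmorph_int nfincl).
Qed.

Lemma nfield_root : (map_poly intr (mpol A)).[nfield_gen A] = 0 :> K.
Proof. by apply: (fmorph_inj nfincl); rewrite nfincl_eval mpol_root rmorph0. Qed.

Lemma nfield_elt (y : K) : exists (d : int) (P : {poly int}), d != 0 /\ d%:~R * y = (map_poly intr P).[nfield_gen A].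
Proof.
have /nfpredP[d [P [d0 e]]] : nfincl y \in nfpred A by case: y.
by exists d, P; split=> //; apply: (fmorph_inj nfincl); rewrite nfincl_eval rmorphM rmorph_int.
Qed.

Lemma nfield_min (P : {poly int}) : (map_poly intr P).[nfield_gen A] = 0 :> K ->
  exists (c : int) g, c != 0 /\ c *: P = g * mpol A.
Proof. by move=> h; apply: mpol_dvd; rewrite -nfincl_eval h rmorph0. Qed.

Lemma nfield_char (k : int) : k%:~R = 0 :> K -> k = 0.
Proof. by move/(congr1 nfincl); rewrite rmorph_int rmorph0; exact: intrC_eq0. Qed.

Lemma nfield_alg (y : K) : alg (nfincl y).
Proof.
have ag : alg (mroot A).
  exists (map_poly intr (mpol A)).
    by rewrite map_poly_eq0_id0 ?mpol_neq0 // intr_eq0 lead_coef_eq0 mpol_neq0.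
  rewrite /root -map_poly_comp; rewrite (_ : map_poly _ _ = map_poly intr (mpol A)) ?mpol_root //.
  by apply: eq_map_poly => k /=; rewrite ratr_int.
have /nfpredP[d [P [d0 e]]] : nfincl y \in nfpred A by case: y.
have aP : alg (map_poly intr P).[mroot A].
  elim/poly_ind: P {e} => [|P c IH]; first by rewrite map_poly0 horner0; exact: alg_int 0.
  rewrite rmorphD rmorphM /= map_polyX map_polyC hornerD hornerM hornerX hornerC.
  by apply: algebraic_add; [exact: algebraic_mul | exact: alg_int].
have -> : nfincl y = d%:~R^-1 * (map_poly intr P).[mroot A] by rewrite -e mulKf // intr_eq0.
by apply: algebraic_mul => //; apply: algebraic_inv; exact: alg_int.
Qed.
End NField.

Section Affine.
Context (K C : fieldType) (iota : {rmorphism K -> C}) (r : nat).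
(** The values of the Hecke-Mahler series are affine functions of the limits [xi i], with algebraic
    coefficients; this substitution carries a relation between the former to one between the
    latter. *)
Definition affine (s h : 'I_r -> K) : mpoly r K -> mpoly r K :=
  mmap (mpolyC r (R:=K)) (fun i => mpolyC r (s i) * mpolyX K (mnm1 i) + mpolyC r (h i)).

Lemma affineD s h p q : affine s h (p + q) = affine s h p + affine s h q.
Proof. by rewrite /affine (raddfD (mmap _ _)). Qed.
Lemma affineM s h p q : affine s h (p * q) = affine s h p * affine s h q.
Proof. by rewrite /affine (rmorphM (mmap _ _)). Qed.
Lemma affineC s h c : affine s h (mpolyC r c) = mpolyC r c.
Proof. by rewrite /affine mmapC. Qed.
Lemma affineX s h i : affine s h (mpolyX K (mnm1 i)) = mpolyC r (s i) * mpolyX K (mnm1 i) + mpolyC r (h i).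
Proof. by rewrite /affine mmapX mmap1U. Qed.

Lemma meval_affine s h (x : 'I_r -> C) p : meval x (map_mpoly iota (affine s h p)) =
  meval (fun i => iota (s i) * x i + iota (h i)) (map_mpoly iota p).
Proof.
elim/mpoly_ring_ind: p => [c|i|p q IHp IHq|p q IHp IHq].
- by rewrite affineC !map_mpolyC !mevalC.
- rewrite affineX (rmorphD (map_mpoly iota)) (rmorphM (map_mpoly iota)) /= !map_mpolyC !map_mpolyX.
  by rewrite (raddfD (meval x)) /= (rmorphM (meval x)) /= !mevalC !mevalXU.
- by rewrite affineD !(rmorphD (map_mpoly iota)) !(raddfD (meval _)) /= IHp IHq.
- by rewrite affineM !(rmorphM (map_mpoly iota)) /= !(rmorphM (meval _)) /= IHp IHq.
Qed.

Lemma affine_neq0 s h p : (forall i, s i != 0) -> p != 0 -> affine s h p != 0.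
Proof.
move=> s0; apply: contra_neq => e.
have K1 q : affine (fun i => (s i)^-1) (fun i => - ((s i)^-1 * h i)) (affine s h q) = q.
  elim/mpoly_ring_ind: q => [c|i|q q' IHq IHq'|q q' IHq IHq'].
  - by rewrite !affineC.
  - rewrite affineX affineD affineM !affineC affineX mulrDr mulrA -mpolyCM mulfV // mpolyC1 mul1r.
    by rewrite -mpolyCM mulrN mulrA mulfV // mul1r -addrA -mpolyCD addNr mpolyC0 addr0.
  - by rewrite !affineD IHq IHq'.
  - by rewrite !affineM IHq IHq'.
by rewrite -(K1 p) e -(mpolyC0 r) affineC.
Qed.
End Affine.

Section Algebraic.
Context (C : numFieldType) (R : realType) (nrm : C -> R).
Hypothesis av : absval nrm.
Hypothesis nrm_int : forall k : int, nrm k%:~R = (`|k|%N)%:R.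
Hypothesis roots : forall (x : C) n, (0 < n)%N -> exists y, y ^+ n = x.
Local Notation alg := (algebraicOver (ratr : rat -> C)).

Lemma alg_root (x : C) n : (0 < n)%N -> alg (x ^+ n) -> alg x.
Proof.
move=> n0 [p p0 px]; exists (p \Po 'X^n).
  by rewrite comp_poly_eq0 // size_polyXn.
by rewrite /root map_comp_poly map_polyXn horner_comp hornerXn.
Qed.

Context (r m : nat) (D : 'I_m -> nat) (dl : 'I_m -> C).
Hypothesis D_ns : forall l, nonsquare (D l).
Hypothesis dl_sq : forall l, dl l ^+ 2 = (D l)%:R.
Hypothesis units_indep : forall X Z : 'I_m -> nat, (forall l, (X l ^ 2 = D l * Z l ^ 2 + 1)%N) -> (forall l, (0 < Z l)%N) ->
  forall a b : 'I_m -> nat, \prod_l ((X l)%:R + (Z l)%:R * dl l) ^+ a l = \prod_l ((X l)%:R + (Z l)%:R * dl l) ^+ b l -> a =1 b.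
Context (lb : 'I_r -> 'I_m) (a c : 'I_r -> nat).
Hypothesis aD : forall i, (D (lb i) < a i ^ 2)%N.
Hypothesis acD : forall i, ((a i - c i) ^ 2 < D (lb i))%N.
Hypothesis c0 : forall i, (0 < c i)%N.
Context (al xi sg h : 'I_r -> C).
Hypothesis al_good : forall i, good nrm alg (al i).
Hypothesis xi_lim : forall i, tends nrm (fun M => tau (a i) (c i) (D (lb i)) M (al i) 1) (xi i).
Hypothesis sg_alg : forall i, alg (sg i).
Hypothesis sg0 : forall i, sg i != 0.
Hypothesis h_alg : forall i, alg (h i).

Theorem core_algebraic (P : mpoly r C) : (forall e, alg (mcoeff e P)) -> P != 0 ->
  meval (fun i => sg i * xi i + h i) P = 0 ->
  exists (ci : 'I_r -> C) (L : C), [/\ forall i, alg (ci i), alg L, exists i, ci i != 0 &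
    \sum_i ci i * (sg i * xi i + h i) = L].
Proof.
move=> P_alg P0 Px.
(* Without any index the polynomial is a constant, and a nonzero constant does not vanish. *)
have [i0|/(_ _) no] := pselect (exists i : 'I_r, True); last first.
  exfalso; move/eqP: P0; apply; apply/mpolyP => e; rewrite mcoeff0.
  have u (e' : multinom r) : e' = e by apply/mnmP => i; exfalso; apply: no; exists i.
  have -> : P = mpolyC r (mcoeff e P).
    by apply/mpolyP => e'; rewrite mcoeffC (u e') (u mnm0) eqxx mulr1.
  by rewrite -Px mcoeffC (u mnm0) eqxx mulr1 {2}(_ : P = mpolyC r (mcoeff e P)) ?mevalC //;
     apply/mpolyP => e'; rewrite mcoeffC (u e') (u mnm0) eqxx mulr1.
have {i0}[i0 _] := i0.
have [s [g [g_good [N [zt [cc [N0 sp]]]] g_ind]]] := multiplicative_basis av roots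
  (fun x y h1 h2 => algebraic_mul h1 h2) (fun x h1 => algebraic_inv h1) alg_root al_good.
have zt_alg i : alg (zt i).
  by apply: (alg_root N0); case: (sp i) => -> _; exact: alg_int 1.
have nzt i : nrm (zt i) = 1.
  have e : nrm (zt i) ^+ N = 1 by rewrite -(avX av); case: (sp i) => -> _; rewrite (av1 av).
  by apply/eqP; move/eqP: e; rewrite pexpr_eq1 // (av_ge0 av).
have cc_pos i : exists j, (0 < cc i j)%N.
  apply: contrapT => hn; have [_ _] := al_good i; case: (sp i) => _ ->; rewrite (avM av) nzt mul1r big1 ?(av1 av) ?ltxx //.
  by move=> j _; case: (posnP (cc i j)) => [->|hj]; rewrite ?expr0 //; exfalso; apply: hn; exists j.
have cP : (0 < N * \prod_i c i)%N by rewrite muln_gt0 N0 prodn_gt0.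
(* The unit is congruent to 1 modulo [N] so that it fixes the roots of unity, and [Z] is divisible
   by all [c i] so that it acts on the lattice points. *)
have /choice[X hX] l : exists p : nat * nat, [/\ (p.1 ^ 2 = D l * p.2 ^ 2 + 1)%N, (0 < p.2)%N, (N * \prod_i c i %| p.2)%N & exists t, p.1 = (1 + N * \prod_i c i * t)%N].
  by have [X [Z [h1 h2 h3 h4]]] := exists_pell_mod R (@D_ns l) cP; exists (X, Z).
have dl_alg l : alg (dl l).
  by apply: (@alg_root _ 2); rewrite // dl_sq -[_%:R]/((D l)%:Z%:~R); exact: alg_int.
pose els := codom g ++ codom dl ++ codom zt ++ codom sg ++ codom h ++ [seq mcoeff e P | e <- msupp P].
have [A hA] : exists A : min_int_poly C, forall x, x \in els -> exists y : nfield A, nfincl A y = x.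
  apply: exists_nfield => x; rewrite !mem_cat => /orP[/codomP[j ->]|]; first by case: (g_good j).
  move=> /orP[/codomP[j ->]|]; first exact: dl_alg.
  move=> /orP[/codomP[j ->]|]; first exact: zt_alg.
  move=> /orP[/codomP[j ->]|]; first exact: sg_alg.
  move=> /orP[/codomP[j ->]|]; first exact: h_alg.
  by move=> /mapP[e _ ->].
have nalg := @nfield_alg C A; move: (nfincl A) hA nalg => iota hA nalg.
pose K := nfield A.
have /choice[be hbe] j : exists y, iota y = g j by apply: hA; rewrite mem_cat codom_f.
have /choice[dK hdK] j : exists y, iota y = dl j by apply: hA; rewrite !mem_cat codom_f ?orbT.
have /choice[zK hzK] j : exists y, iota y = zt j by apply: hA; rewrite !mem_cat codom_f ?orbT.
have /choice[sK hsK] j : exists y, iota y = sg j by apply: hA; rewrite !mem_cat codom_f ?orbT.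
have /choice[hK hhK] j : exists y, iota y = h j by apply: hA; rewrite !mem_cat codom_f ?orbT.
have /choice[t ht] (e : multinom r) : exists y, iota y = mcoeff e P.
  have [he|he] := boolP (e \in msupp P); first by apply: hA; rewrite !mem_cat (map_f (fun e => mcoeff e P)) ?orbT.
  by exists 0; rewrite rmorph0 memN_msupp_eq0.
pose PK : mpoly r K := \sum_(e <- msupp P) t e *: mpolyX K e.
have PKE : map_mpoly iota PK = P.
  apply/mpolyP => e; rewrite mcoeff_map_mpoly /PK raddf_sum /=.
  have [he|he] := boolP (e \in msupp P).
    rewrite (bigD1_seq e) ?msupp_uniq //= mcoeffZ mcoeffX eqxx mulr1 big1 ?addr0 ?ht // => e' ne.
    by rewrite mcoeffZ mcoeffX (negbTE ne) mulr0.
  rewrite (memN_msupp_eq0 he) big_seq big1 ?rmorph0 // => e' he'; rewrite mcoeffZ mcoeffX.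
  by case: eqP he he' => [-> /negP|]; rewrite ?mulr0.
have PK0 : PK != 0 by apply: contraNneq P0 => e; rewrite -PKE e raddf0.
have iinj := fmorph_inj iota.
have [u [v [e0 [e00 sep]]]] := mpol_sep A.
have sK0 i : sK i != 0 by apply: contraNneq (sg0 i) => e; rewrite -hsK e rmorph0.
pose idx (l : 'I_m) (j : 'I_s) (b : bool) : 'I_#|{: 'I_m * 'I_s * bool}| := enum_rank (l, j, b).
have [ci [L [ci0 hL]]] : exists (ci : 'I_r -> K) (L : K), (exists i, ci i != 0) /\ \sum_i iota (ci i) * xi i = iota L.
  apply: (@core K (nfield_gen A) (mpol A) u v e0 (@nfield_char C A) (nfield_root A) (@nfield_elt C A) (@nfield_min C A)
    sep e00 (mpol_size A) C R nrm iota av nrm_int m s _ D (fun l => (X l).1) (fun l => (X l).2) _ _ _ be dK _ _ _ _ _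
    (fun i => (enum_val i).1.1) (fun i => (enum_val i).1.2) (fun i => (enum_val i).2) idx _ _ _ _
    r lb a c aD acD c0 _ N zK cc N0 _ _ cc_pos xi _ i0 (affine sK hK PK)).
  - by move=> l; case: (hX l).
  - by move=> l; case: (hX l).
  - by move=> l; exact: ns_gt0.
  - by move=> j; rewrite hbe; case: (g_good j).
  - by move=> j; rewrite hbe; case: (g_good j).
  - move=> a' b' e; apply: g_ind; have := congr1 iota e; rewrite !rmorph_prod /=.
    by move=> e'; transitivity (\prod_j iota (be j ^+ a' j)); [|rewrite e']; apply: eq_bigr => j _; rewrite rmorphXn hbe.
  - by move=> l; apply: iinj; rewrite rmorphXn /= hdK dl_sq rmorph_nat.
  - move=> a' b' e; have := congr1 iota e; rewrite !rmorph_prod /= => e'.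
    apply: (units_indep (X := fun l => (X l).1) (Z := fun l => (X l).2)).
    + by move=> l; case: (hX l).
    + by move=> l; case: (hX l).
    have E j k : iota (((X j).1%:R + (X j).2%:R * dK j) ^+ k) = ((X j).1%:R + (X j).2%:R * dl j) ^+ k.
      by rewrite rmorphXn rmorphD rmorphM !rmorph_nat /= hdK.
    by transitivity (\prod_j iota (((X j).1%:R + (X j).2%:R * dK j) ^+ a' j)); [|rewrite e']; apply: eq_bigr => j _; rewrite E.
  - by move=> l j b; rewrite /idx enum_rankK.
  - by move=> l j b; rewrite /idx enum_rankK.
  - by move=> l j b; rewrite /idx enum_rankK.
  - by move=> i; rewrite /idx; case E : (enum_val i) => [[l j] b]; rewrite -E enum_valK.
  - move=> i; case: (hX (lb i)) => _ _ d _; apply: dvdn_trans d.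
    by rewrite (bigD1 i) //= dvdn_mull // dvdn_mulr.
  - by move=> i; apply: iinj; rewrite rmorphXn /= hzK rmorph1; case: (sp i).
  - move=> l; case: (hX l) => _ _ /dvdnP[q hq] [t' ht']; exists (\prod_i c i * t')%N, (q * \prod_i c i)%N.
    have [-> ->] := pell1 (D l) (X l).1 (X l).2; rewrite ht' hq; split; ring.
  - move=> i; apply: tends_ext (@xi_lim i) => M; rewrite tau_rmorph rmorph1.
    congr tau; rewrite /base_value rmorphM rmorph_prod hzK; case: (sp i) => _ ->; congr (_ * _).
    by apply: eq_bigr => j _; rewrite rmorphXn /= hbe.
  - exact: affine_neq0.
  rewrite meval_affine PKE -[RHS]Px; congr meval; apply/funext => i; by rewrite hsK hhK.
exists (fun i => iota (ci i / sK i)), (iota (L + \sum_i ci i / sK i * hK i)); split.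
- by move=> i; exact: nalg.
- exact: nalg.
- by have [i hi] := ci0; exists i; rewrite fmorph_eq0 mulf_neq0 // invr_neq0.
rewrite rmorphD -hL rmorph_sum -big_split /=; apply: eq_bigr => i _.
by rewrite mulrDr -hsK -hhK (rmorphM iota (ci i / sK i) (hK i)) mulrA -rmorphM divfK.
Qed.
End Algebraic.

(** * Hecke-Mahler series *)

Section ComplexNorm.
Context (R : realType).
Local Open Scope complex_scope.
Definition nrm (z : R[i]) : R := Normc.normc z.

Lemma normE (z : R[i]) : `|z| = (nrm z)%:C.
Proof. by case: z => x y; rewrite normc_def. Qed.

Lemma nrm_absval : absval nrm.
Proof.
split.
- by case=> x y; rewrite sqrtr_ge0.
- exact: Normc.normc0.
- exact: Normc.normc1.
- by move=> x y; exact: Normc.normcM.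
- by move=> x y; exact: le_normcD.
Qed.

Lemma nrm_int (k : int) : nrm k%:~R = (`|k|%N)%:R.
Proof. by apply: (@complexI R); rewrite -normE -intr_norm natr_absz rmorph_int. Qed.

Lemma roots (x : R[i]) n : (0 < n)%N -> exists y, y ^+ n = x.
Proof. by move=> n0; exists (n.-root x); exact: rootCK. Qed.

Lemma nrm_Re (x y : R) : `|x| <= nrm (x +i* y).
Proof. by rewrite -sqrtr_sqr ler_wsqrtr // lerDl sqr_ge0. Qed.
Lemma nrm_Im (x y : R) : `|y| <= nrm (x +i* y).
Proof. by rewrite -sqrtr_sqr ler_wsqrtr // lerDr sqr_ge0. Qed.
Lemma nrm_le (x y : R) : nrm (x +i* y) <= `|x| + `|y|.
Proof.
rewrite /nrm /Normc.normc -[leRHS]ger0_norm ?addr_ge0 // -sqrtr_sqr ler_wsqrtr // sqrrD -!normrX !(ger0_norm (sqr_ge0 _)).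
by rewrite lerD2r lerDl mulrn_wge0 // mulr_ge0.
Qed.

Lemma real_cauchy (u : nat -> R) : (forall e, 0 < e -> exists M0, forall M, (M0 <= M)%N -> `|u M - u M0| <= e) ->
  exists l, forall e, 0 < e -> exists M0, forall M, (M0 <= M)%N -> `|u M - l| <= e.
Proof.
move=> h; have cu : cvg (u @ \oo)%classic.
  apply/cauchy_cvgP/cauchy_exP => e e0; have [M0 hM] := h _ (divr_gt0 e0 (ltr0n R 2)).
  exists (u M0); exists M0 => // M /= hM0; rewrite /ball /= distrC; apply: le_lt_trans (hM M hM0) _.
  by rewrite ltr_pdivrMr // ltr_pMr // ltr1n.
exists (lim (u @ \oo)%classic) => e e0; move/cvgrPdist_le: cu => /(_ e e0)[M0 _ hM].
by exists M0 => M /hM; rewrite distrC.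
Qed.

Lemma complex_cauchy (f : nat -> R[i]) :
  (forall e, 0 < e -> exists M0, forall M, (M0 <= M)%N -> nrm (f M - f M0) <= e) -> exists l, tends nrm f l.
Proof.
move=> h.
have [|x hx] := @real_cauchy (fun M => complex.Re (f M)).
  move=> e /h[M0 hM]; exists M0 => M /hM; apply: le_trans.
  by case: (f M) (f M0) => [a b] [c d]; exact: nrm_Re.
have [|y hy] := @real_cauchy (fun M => complex.Im (f M)).
  move=> e /h[M0 hM]; exists M0 => M /hM; apply: le_trans.
  by case: (f M) (f M0) => [a b] [c d]; exact: nrm_Im.
exists (x +i* y) => e e0; have e2 : 0 < e / 2%:R by rewrite divr_gt0.
have [M1 h1] := hx _ e2; have [M2 h2] := hy _ e2; exists (maxn M1 M2) => M.
rewrite geq_max => /andP[/h1 k1 /h2 k2]; move: k1 k2; case: (f M) => [a b] /= k1 k2.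
by apply: le_trans (nrm_le _ _) _; apply: le_trans (lerD k1 k2) _; lra.
Qed.

Lemma tends_lim (f : nat -> R[i]) l : tends nrm f l -> lim ((f : nat -> R[i]^o) @ \oo)%classic = l.
Proof.
move=> h; apply: cvg_lim; first exact: norm_hausdorff.
apply/cvgrPdist_le => e e0; have eR : e = (complex.Re e)%:C.
  by move: e0; rewrite ltcE /= => /andP[/eqP h0 _]; case: (e) h0 => a b /= ->.
have e1 : 0 < complex.Re e by move: e0; rewrite ltcE => /andP[].
have [M0 hM] := h _ e1; exists M0 => // M /= /hM; rewrite eR normE lecR (avBC nrm_absval) //.
Qed.
End ComplexNorm.

(** * From integer parts to lattice points *)

Section Hecke.
Context (R : realType).
Local Open Scope complex_scope.
Local Notation W d := (Num.sqrt d%:R : R).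
Local Notation av := (nrm_absval R).

Lemma count_below (n a c d : nat) (x : R) : nonsquare d -> normal_form x false 0 a c d ->
  (\sum_(m < n | below a c d n m) 1 = Num.truncn (n%:R * x))%N.
Proof.
move=> ns [c0 h1 h2]; rewrite expr0 mul1r addr0 => xE.
have cR : 0 < c%:R :> R by rewrite ltr0n.
have W0 : 0 < W d by rewrite (lt_le_trans ltr01) // (@w_ge1 R d ns).
have Wsq : W d ^+ 2 = d%:R by rewrite sqr_sqrtr.
have x0 : 0 <= x.
  rewrite xE divr_ge0 // subr_ge0; have : W d ^+ 2 <= a%:R ^+ 2 by rewrite Wsq -natrX ler_nat ltnW.
  by rewrite ler_pXn2r ?nnegrE ?(ltW W0).
set F := Num.truncn _.
have bE m : (m < n)%N -> below a c d n m = (0 < m <= F)%N.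
  move=> mn; rewrite /below; case: (posnP m) => [->|m0] //=.
  have n0 : (0 < n)%N by apply: leq_ltn_trans mn.
  have -> : (m <= F)%N = (m%:R <= n%:R * x) by rewrite /F truncn_ge_nat // mulr_ge0.
  have -> : (m%:R <= n%:R * x) = (n%:R * W d <= (n * a)%:R - (m * c)%:R).
    rewrite xE mulrA ler_pdivlMr // !natrM mulrBr lerBrDr addrC -lerBrDr //.
  have [le|lt] := leqP (m * c) (n * a); last first.
    rewrite (eqP (ltnW lt : (n * a - m * c == 0)%N)) ltn0; apply/esym/negbTE; rewrite -ltNge.
    apply: (@lt_trans _ _ 0); first by rewrite subr_lt0 ltr_nat.
    by rewrite mulr_gt0 // ltr0n.
  rewrite -natrB // -(@ler_pXn2r _ 2) ?nnegrE ?mulr_ge0 // ?(ltW W0) // exprMn Wsq -!natrX -natrM ler_nat mulnC.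
  rewrite ltn_neqAle; case: eqVneq => //= e; have := ns n (n * a - m * c)%N; rewrite e => /(_ erefl) n00.
  by rewrite n00 in n0.
transitivity (\sum_(m < n | (0 < m <= F)%N) 1)%N; first by apply: eq_bigl => m; exact: bE.
have [n0|n0] := posnP n; first by rewrite n0 big_ord0 /F n0 mul0r truncn0.
have Fn : (F < n)%N.
  rewrite /F truncn_lt_nat ?mulr_ge0 // gtr_pMr ?ltr0n // xE ltr_pdivrMr // mul1r ltrBlDr -ltrBlDl.
  case: (leqP a c) => ac; first by apply: le_lt_trans W0; rewrite subr_le0 ler_nat.
  by rewrite -natrB ?(ltnW ac) // -(@ltr_pXn2r _ 2) ?nnegrE ?(ltW W0) // Wsq -natrX ltr_nat.
rewrite -(big_mkord (fun m => (0 < m <= F)%N) (fun=> 1%N)) (big_cat_nat (leq0n F.+1) Fn) /=.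
rewrite [X in (_ + X)%N]big_nat_cond [X in (_ + X)%N]big1 ?addn0; last first.
  by move=> m; rewrite ltnNge; case: (leqP m F) => //; rewrite ?andbF.
rewrite big_ltn_cond //= big_nat_cond (eq_bigl (fun m => (1 <= m < F.+1)%N)) -?big_nat ?sum_nat_const_nat ?muln1 ?subn1 //.
by move=> m; case: (0 < m)%N; rewrite //= ltnS; case: (m <= F)%N.
Qed.

Lemma normal_form_int x s k a c d : normal_form x s k a c d -> normal_form ((-1) ^+ s * x + k%:~R : R) false 0 a c d.
Proof. by move=> [h1 h2 h3 h4]; split=> //; rewrite expr0 mul1r addr0. Qed.

(** The count below the line is the integer part for the normalised number. When the sign was
    reversed, the integer part of the opposite of a non-integer is one less than the opposite of the
    integer part; the non-integrality fails only at [n = 0], hence the last term. *)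
Lemma floor_normal_form (x : R) s k a c d n : irrational x -> nonsquare d -> normal_form x s k a c d ->
  Num.floor (n%:R * x) = (-1) ^+ s * ((\sum_(m < n | below a c d n m) 1)%N%:Z - n%:Z * k) - (s && (0 < n)%N)%:R.
Proof.
move=> ix ns nf; rewrite (count_below _ ns (normal_form_int nf)).
set y := _ + k%:~R.
have y0 : 0 <= n%:R * y.
  rewrite mulr_ge0 // /y; case: nf => [c0 h1 h2 ->].
  have W0 : 0 < W d by rewrite (lt_le_trans ltr01) // (@w_ge1 R d ns).
  have Wsq : W d ^+ 2 = d%:R by rewrite sqr_sqrtr.
  rewrite divr_ge0 // subr_ge0; have : W d ^+ 2 <= a%:R ^+ 2 by rewrite Wsq -natrX ler_nat ltnW.
  by rewrite ler_pXn2r ?nnegrE ?(ltW W0).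
set F := Num.truncn _.
have f1 : F%:R <= n%:R * y by rewrite truncn_le.
have f2 : n%:R * y < F%:R + 1 by rewrite natr1 truncnS_gt.
apply: floor_def.
have cast (b : bool) (j : int) : ((-1) ^+ b * (F%:Z - n%:Z * k) - j)%:~R = (-1) ^+ b * (F%:R - n%:R * k%:~R) - j%:~R :> R.
  by rewrite intrB intrM rmorph_sign intrB intrM.
rewrite intrD cast /=.
clearbody F; clear y0; rewrite /y in f1 f2; clear y.
case: s nf f1 f2 => nf f1 f2 /=; rewrite ?expr0 ?expr1 ?mul1r ?mulN1r in f1 f2 *; last first.
  by rewrite rmorph0 subr0; apply/andP; split; lra.
have [n0|n0] := posnP n; first by move: f1 f2; rewrite n0 !mul0r rmorph0 => f1 f2; apply/andP; split; have := ler0n R F; lra.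
have ne : F%:R != n%:R * (- x + k%:~R).
  apply/eqP => e; apply: (irrational_intP ix (k := n%:Z * k - F%:Z) (d := n%:Z)); first by rewrite -lt0n in n0 *.
  by rewrite intrB intrM -!pmulrn e; ring.
have f1' : F%:R < n%:R * (- x + k%:~R) by rewrite lt_neqAle ne.
by rewrite rmorph1; apply/andP; split; lra.
Qed.

Lemma tends_geometric (al : R[i]) : nrm al < 1 -> al != 1 -> tends (@nrm R) (fun M => \sum_(0 <= n < M) al ^+ n) (1 - al)^-1.
Proof.
move=> a1 ne; have n0 : 1 - al != 0 by rewrite subr_eq0 eq_sym.
have r01 : 0 <= nrm al < 1 by rewrite a1 (av_ge0 av).
have h : tends (@nrm R) (fun M => (1 - al) * \sum_(0 <= n < M) al ^+ n) 1.
  apply: (tends_bound r01 (A := 0) (B := 1) (M1 := 0)) => M _.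
  have -> : (1 - al) * \sum_(0 <= n < M) al ^+ n - 1 = - al ^+ M.
    elim: M => [|M IH]; first by rewrite big_nil mulr0 add0r expr0.
    by rewrite big_nat_recr //= mulrDr addrAC IH exprS; ring.
  by rewrite (avN av) (avX av) mul0n mul1r.
by have := tendsZ av (1 - al)^-1 h; rewrite mulr1; apply: tends_ext => M; rewrite mulKf.
Qed.

Lemma tends_arith_geometric (al : R[i]) : nrm al < 1 -> al != 1 ->
  tends (@nrm R) (fun M => \sum_(0 <= n < M) n%:R * al ^+ n) (al / (1 - al) ^+ 2).
Proof.
move=> a1 ne; have n0 : (1 - al) ^+ 2 != 0 by rewrite expf_neq0 // subr_eq0 eq_sym.
have r01 : 0 <= nrm al < 1 by rewrite a1 (av_ge0 av).
have h : tends (@nrm R) (fun M => (1 - al) ^+ 2 * \sum_(0 <= n < M) n%:R * al ^+ n) al.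
  apply: (tends_bound r01 (A := 2) (B := 1) (M1 := 0)) => M _.
  have -> : (1 - al) ^+ 2 * \sum_(0 <= n < M) n%:R * al ^+ n - al = - (M%:R * al ^+ M) + M%:R * al ^+ M.+1 - al ^+ M.+1.
    elim: M => [|M IH]; first by rewrite big_nil mulr0 !mul0r expr1; ring.
    by rewrite big_nat_recr //= mulrDr addrAC IH !exprS -!natr1; ring.
  have nM : nrm (M%:R : R[i]) = M%:R by have := nrm_int R M%:Z.
  apply: le_trans (avB av _ _) _; apply: le_trans (lerD (avD av _ _) (lexx _)) _.
  rewrite (avN av) !(avM av) !(avX av) nM.
  have p0 : 0 <= nrm al ^+ M by rewrite exprn_ge0 // (av_ge0 av).
  have p1 : nrm al ^+ M.+1 <= nrm al ^+ M by rewrite exprS ler_piMl // ltW.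
  have M2 : (M%:R : R) <= M%:R ^+ 2 by rewrite -natrX ler_nat -mulnn; case: (M) => // M'; exact: leq_pmulr.
  have M0 := ler0n R M.
  rewrite natrD natrM natrX; nra.
by have := tendsZ av ((1 - al) ^+ 2)^-1 h; rewrite [_^-1 * al]mulrC; apply: tends_ext => M; rewrite mulKf.
Qed.

Lemma exists_tau_limit a c d (al : R[i]) : ((a - c) ^ 2 < d)%N -> nrm al < 1 -> exists l, tends (@nrm R) (fun M => tau a c d M al 1) l.
Proof.
move=> acd a1; apply: complex_cauchy => e e0.
have r01 : 0 <= nrm al < 1 by rewrite a1 (av_ge0 av).
have p0 : 0 < (1 - nrm al) ^+ 2 by rewrite exprn_gt0 // subr_gt0.
have [M0 hM] := quad_geom_to0 1 1 r01 (mulr_gt0 e0 p0).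
exists M0 => M hM0; apply: le_trans (tau_tail av acd (E := 1) isT r01 _ _ hM0) _.
- by rewrite expr1.
- by rewrite (av1 av).
rewrite muln1 mulrAC ler_pdivrMr //; apply: le_trans (hM M0 (leqnn _)).
by apply: ler_wpM2r; rewrite ?exprn_ge0 ?(av_ge0 av) // ler_nat mul1n addn1 ltnS -mulnn; case: (M0) => // M1; exact: leq_pmulr.
Qed.

(** The contribution of the terms other than the count: [al / (1 - al) ^+ 2] is the sum of
    [n * al ^+ n], and [(1 - al)^-1 - 1] the geometric series without its term at 0. *)
Definition shift (s : bool) (k : int) (al : R[i]) : R[i] :=
  - ((-1) ^+ s * k%:~R * (al / (1 - al) ^+ 2)) - s%:R * ((1 - al)^-1 - 1).

Lemma hecke_mahler_tau (x : R) s k a c d (al xi : R[i]) : irrational x -> nonsquare d -> normal_form x s k a c d ->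
  nrm al < 1 -> tends (@nrm R) (fun M => tau a c d M al 1) xi ->
  hecke_mahler x al = (-1) ^+ s * xi + shift s k al.
Proof.
move=> ix ns nf a1 hx; have [c0 h1 h2 _] := nf.
have ne : al != 1 by apply: contraTneq a1 => ->; rewrite (av1 av) ltxx.
rewrite /hecke_mahler; apply: tends_lim.
have t1 := tendsZ av ((-1) ^+ s) hx.
have t2 := tendsN av (tendsZ av ((-1) ^+ s * k%:~R) (tends_arith_geometric a1 ne)).
have t3 := tendsZ av s%:R (tendsB av (tends_geometric a1 ne) (tendsC av 1)).
have := tendsD av t1 (tendsB av t2 t3); rewrite -/(shift s k al).
move=> h e /h[M0 hM]; exists (maxn M0 1) => M; rewrite geq_max => /andP[/hM {}hM M1].
suff -> : series (fun n : nat => ((Num.floor (n%:R * x))%:~R * al ^+ n : R[i]^o)) M =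
   (-1) ^+ s * tau a c d M al 1 + (- ((-1) ^+ s * k%:~R * \sum_(0 <= n < M) n%:R * al ^+ n) - s%:R * (\sum_(0 <= n < M) al ^+ n - 1)) by [].
rewrite /series /= (tau_rows h2).
have -> : \sum_(0 <= n < M) al ^+ n - 1 = \sum_(0 <= n < M) (0 < n)%N%:R * al ^+ n.
  rewrite !(big_ltn M1) expr0 ltnn mul0r add0r addrAC subrr add0r !big_nat; apply: eq_bigr => n /andP[n1 _].
  by rewrite n1 mul1r.
rewrite !mulr_sumr -!sumrN -!big_split /=; apply: eq_bigr => n _.
rewrite (floor_normal_form n ix ns nf) /trow.
have -> : \sum_(m < n | below a c d n m) term a c al 1 n m = (\sum_(m < n | below a c d n m) 1)%N%:R * al ^+ n.
  rewrite natr_sum mulr_suml; apply: eq_bigr => m _; by rewrite /term expr1n mulr1 mul1r.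
set F := (\sum_(m < n | _) 1)%N.
rewrite intrB intrM rmorph_sign intrB intrM -!pmulrn.
by case: (s); case: (0 < n)%N; rewrite /= ?rmorph0 ?rmorph1; ring.
Qed.
End Hecke.

Local Open Scope complex_scope.

(** * The two implications *)

Section Final.
Context (R : realType).
Local Notation alg := (algebraicOver (ratr : rat -> R[i])).

Lemma QbarP (z : R[i]) : reflect (alg z) (z \in @Qbar R).
Proof. exact: asboolP. Qed.

Lemma sum_option (V : nmodType) (I : finType) (F : option I -> V) : \sum_k F k = F None + \sum_i F (Some i).
Proof.
rewrite (bigD1 None) //=; congr (_ + _); rewrite (reindex_omap Some id) //=; last by case.
by apply: eq_bigl => i; rewrite eqxx.
Qed.

Lemma mpolyOver_coef r (P : mpoly r R[i]) : P \is a mpolyOver r (@Qbar R) <-> forall e, alg (mcoeff e P).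
Proof.
split=> [/allP h e|h]; last by apply/allP => _ /mapP[e _ ->]; exact/QbarP.
have [he|he] := boolP (e \in msupp P); first by apply/QbarP; apply: h; rewrite (map_f (fun m => mcoeff m P)).
by rewrite memN_msupp_eq0 //; exact: (alg_int _ 0).
Qed.

Lemma algebraically_of_linearly_dependent r (v : 'I_r -> R[i]) :
  Qbar_linearly_dependent (fun k : option 'I_r => if k is Some i then v i else 1) -> Qbar_algebraically_dependent v.
Proof.
move=> [c [cQ [k ck] rel]]; pose P : mpoly r R[i] := mpolyC r (c None) + \sum_i c (Some i) *: mpolyX _ (mnm1 i).
have PE e : mcoeff e P = c None * (e == mnm0)%:R + \sum_i c (Some i) * (mnm1 i == e)%:R.
  rewrite /P mcoeffD mcoeffC raddf_sum /=; congr (_ + _); apply: eq_bigr => i _; by rewrite mcoeffZ mcoeffX.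
exists P; split.
- apply/mpolyOver_coef => e; rewrite PE; apply: algebraic_add.
    by apply: algebraic_mul; [exact/QbarP | rewrite -[_%:R]/((_ : nat)%:Z%:~R); exact: alg_int].
  apply: (big_ind alg) => [||i _]; [exact: (alg_int _ 0) | exact: algebraic_add |].
  by apply: algebraic_mul; [exact/QbarP | rewrite -[_%:R]/((_ : nat)%:Z%:~R); exact: alg_int].
- case: k ck => [i|] ck; apply: contra_neq ck => P0.
    have := PE (mnm1 i); rewrite P0 mcoeff0 => /esym.
    have -> : (mnm1 i == mnm0 :> multinom r) = false.
      by apply/eqP => /(congr1 (fun m : multinom r => m i)); rewrite mnm1E mnm0E eqxx.
    rewrite mulr0 add0r (bigD1 i) //= eqxx mulr1 big1 ?addr0 // => j ji.
    suff -> : (mnm1 j == mnm1 i :> multinom r) = false by rewrite mulr0.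
    apply/eqP => /(congr1 (fun m : multinom r => m i)); rewrite !mnm1E eqxx (negbTE ji) //.
  have := PE mnm0; rewrite P0 mcoeff0 eqxx mulr1 big1 ?addr0 => // i _.
  suff -> : (mnm1 i == mnm0 :> multinom r) = false by rewrite mulr0.
  by apply/eqP => /(congr1 (fun m : multinom r => m i)); rewrite mnm1E mnm0E eqxx.
- rewrite /P (raddfD (meval v)) (raddf_sum (meval v)) /= mevalC -[RHS]rel sum_option mulr1; congr (_ + _).
  by apply: eq_bigr => i _; rewrite mevalZ mevalXU.
Qed.

Lemma linearly_of_algebraically_dependent r (omega : 'I_r -> R) (alpha : 'I_r -> R[i]) :
  (forall i, quadratic_irrational (omega i)) -> (forall i, alpha i \in @Qbar R) -> (forall i, 0 < `|alpha i| < 1) ->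
  Qbar_algebraically_dependent (fun i => hecke_mahler (omega i) (alpha i)) ->
  Qbar_linearly_dependent (fun k : option 'I_r => if k is Some i then hecke_mahler (omega i) (alpha i) else 1).
Proof.
move=> quad aQ a1 [P [PQ P0 Px]].
have [m [D [lb [s [k [a [c [D_ns D_ind nf]]]]]]]] := normal_forms quad.
have na i : 0 < nrm (alpha i) < 1.
  by have := a1 i; rewrite normE -(rmorph0 (real_complex R)) -(rmorph1 (real_complex R)) !ltcR.
have aD i : (D (lb i) < a i ^ 2)%N by case: (nf i).
have acD i : ((a i - c i) ^ 2 < D (lb i))%N by case: (nf i).
have c0 i : (0 < c i)%N by case: (nf i).
have /choice[xi hxi] i : exists l, tends (@nrm R) (fun M => tau (a i) (c i) (D (lb i)) M (alpha i) 1) l.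
  by apply: exists_tau_limit => //; case/andP: (na i).
pose sg i : R[i] := (-1) ^+ s i; pose h i := shift (s i) (k i) (alpha i).
have aa i : alg (alpha i) by exact/QbarP.
have sg_alg i : alg (sg i) by rewrite /sg -(rmorph_sign intr) ; exact: alg_int.
have h_alg i : alg (h i).
  have b1 : alg (1 - alpha i) by apply: algebraic_sub => //; exact: (alg_int _ 1).
  rewrite /h /shift; apply: algebraic_sub; last first.
    apply: algebraic_mul; first by rewrite -[_%:R]/((_ : nat)%:Z%:~R); exact: alg_int.
    by apply: algebraic_sub; [exact: algebraic_inv | exact: (alg_int _ 1)].
  apply: algebraic_opp; apply: algebraic_mul; first by apply: algebraic_mul; [exact: sg_alg | exact: alg_int].
  by apply: algebraic_div => //; rewrite expr2; exact: algebraic_mul.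
have hm i : hecke_mahler (omega i) (alpha i) = sg i * xi i + h i.
  apply: (hecke_mahler_tau (proj1 (quad i)) (@D_ns (lb i)) (nf i)) => //; by case/andP: (na i).
have units X Z : (forall l, (X l ^ 2 = D l * Z l ^ 2 + 1)%N) -> (forall l, (0 < Z l)%N) -> forall u v : 'I_m -> nat,
    \prod_l ((X l)%:R + (Z l)%:R * (Num.sqrt (D l)%:R : R)%:C) ^+ u l =
    \prod_l ((X l)%:R + (Z l)%:R * (Num.sqrt (D l)%:R : R)%:C) ^+ v l -> u =1 v.
  move=> Pell Z0 u v e; apply: (units_independent D_ns D_ind Pell Z0 (R := R)); apply: (@complexI R).
  have E l j : (unit_eps R D X Z l ^+ j)%:C = ((X l)%:R + (Z l)%:R * (Num.sqrt (D l)%:R : R)%:C) ^+ j.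
    by rewrite rmorphXn rmorphD rmorphM !rmorph_nat.
  by rewrite !rmorph_prod /= (eq_bigr _ (fun l _ => E l (u l))) (eq_bigr _ (fun l _ => E l (v l))).
have [|||||ci [L [ci_alg L_alg ci0 hL]]] := @core_algebraic R[i] R (@nrm R) (nrm_absval R) (@nrm_int R) (@roots R) r m D
  (fun l => (Num.sqrt (D l)%:R : R)%:C) D_ns _ units lb a c aD acD c0 alpha xi sg h _ hxi sg_alg _ h_alg P _ P0 _.
- by move=> l; rewrite -rmorphXn sqr_sqrtr // rmorph_nat.
- by move=> i; case/andP: (na i).
- by move=> i; rewrite signr_eq0.
- exact/mpolyOver_coef.
- by rewrite -[RHS]Px; congr meval; apply/funext => i; rewrite hm.
exists (fun k => if k is Some i then ci i else - L); split.
- by case=> [i|]; apply/QbarP => //; exact: algebraic_opp.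
- by have [i hi] := ci0; exists (Some i).
rewrite sum_option mulr1 -hL addrC; apply/eqP; rewrite subr_eq0; apply/eqP.
by apply: eq_bigr => i _; rewrite hm.
Qed.
End Final.

Theorem theorem7p4 (R : realType) (r : nat)
    (omega : 'I_r -> R) (alpha : 'I_r -> R[i])
    (omega_quad : forall i, quadratic_irrational (omega i))
    (alpha_inj : injective alpha)
    (alpha_alg : forall i, alpha i \in @Qbar R)
    (alpha_lt1 : forall i, 0 < `|alpha i| < 1) :
  Qbar_algebraically_dependent
    (fun i : 'I_r => hecke_mahler (omega i) (alpha i))
  <->
  Qbar_linearly_dependent
    (fun k : option 'I_r =>
       if k is Some i then hecke_mahler (omega i) (alpha i) else 1).
Proof.
split; first exact: linearly_of_algebraically_dependent.
exact: algebraically_of_linearly_dependent.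
Qed.
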